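(* Let $d\ge 2$, let $w=(w_1,\dots,w_d)$ be a $d$-tuple of positive real numbers with $\sum_{i=1}^d w_i=1$ and $w_1\ge\cdots\ge w_d$, and let $\Lambda\in\mathcal{L}_{d+1}$. Let $$H=\{g\in \mathrm{SL}_{d+1}(\mathbb{R}):\ a_{-t}\,g\,a_t\to I_{d+1}\ \text{as}\ t\to\infty\}.$$ Then the Hausdorff dimension of $$\operatorname{Sing}(H,\Lambda;a_t)=\{h\in H:\ (a_t h\Lambda)_{t\ge0}\ \text{is divergent}\}$$ is equal to $\dim H-\frac{1}{1+w_1}$.
   Context: $\mathcal{L}_{d+1}$ denotes the space of unimodular (covolume one) lattices in $\mathbb{R}^{d+1}$, identified with $\mathrm{SL}_{d+1}(\mathbb{R})/\mathrm{SL}_{d+1}(\mathbb{Z})$. For $t\in\mathbb{R}$, $a_t=\operatorname{diag}(e^{w_1t},\dots,e^{w_dt},e^{-t})\in \mathrm{SL}_{d+1}(\mathbb{R})$. A trajectory $(y_t)_{t\ge0}$ in $\mathcal{L}_{d+1}$ is divergent if it eventually leaves every compact subset of $\mathcal{L}_{d+1}$. $\dim H$ is the dimension of the Lie group $H$. *)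

(* Defs.v *)
From HB Require Import structures.
From mathcomp Require Import all_boot all_order all_algebra.
From mathcomp Require Import all_classical all_reals all_analysis.

Set Implicit Arguments.
Unset Strict Implicit.
Unset Printing Implicit Defensive.

Import Order.TTheory GRing.Theory Num.Theory.
Import numFieldTopology.Exports numFieldNormedType.Exports.

Local Open Scope classical_set_scope.
Local Open Scope ring_scope.

(** * Hausdorff dimension *)

Section HausdorffDimension.
Variables (R : realType) (V : normedModType R).
Implicit Types (A U : set V) (s delta : R).
Local Open Scope ereal_scope.

(* The diameter of [set0] is -oo. *)
Definition diam U : \bar R :=
  ereal_sup [set `|x - y|%:E | x in U & y in U].

Definition diam_pow s U : \bar R :=
  if U == set0 then 0 else poweR (diam U) s.

Definition hausdorff_premeasure s delta A : \bar R :=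
  ereal_inf [set \sum_(0 <= k <oo) diam_pow s (U k) |
    U in [set U : nat -> set V |
           (forall k, diam (U k) <= delta%:E) /\ A `<=` \bigcup_k U k]].

Definition hausdorff_measure s A : \bar R :=
  ereal_sup [set hausdorff_premeasure s delta A |
    delta in [set delta | (0 < delta)%R]].

Definition hausdorff_dim A : \bar R :=
  ereal_inf [set s%:E |
    s in [set s | (0 <= s)%R /\ hausdorff_measure s A = 0]].

End HausdorffDimension.

(** * Dimension of a closed matrix group *)

Section LieDimension.
Variables (R : realType) (n : nat).
Local Notation M := 'M[R]_n.+1.

Definition expmx (X : M) : M :=
  lim (series (fun k => (k`!%:R)^-1 *: X ^+ k) @ \oo).

(* The Lie algebra of a closed subgroup of GL_(n+1)(R). *)
Definition lie_algebra (G : set M) : set M :=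
  [set X | forall s : R, G (expmx (s *: X))].

(* The dimension of a Lie group is that of its Lie algebra, which is a linear
   subspace when [G] is a closed group; [0] is a default value for other [G]. *)
Definition lie_dim (G : set M) : nat :=
  \dim (xget 0%VS [set E : {vspace M} |
          forall X, X \in E <-> lie_algebra G X]).

End LieDimension.

(** * The space of unimodular lattices *)

Section Lattices.
Variables (R : realType) (n : nat).

(* As a type, [SL] carries the subspace topology. *)
Definition SL : set 'M[R]_n := [set A | \det A = 1].

Lemma det_SL (g : SL) : \det (\val g) = 1.
Proof. by case: g => A /= /set_mem. Qed.

Definition mkSL (A : 'M[R]_n) (detA : \det A = 1) : SL :=
  SigSub (mem_set detA : A \in SL).

Lemma SLmul_subproof (g h : SL) : \det (\val g *m \val h) = 1.
Proof. by rewrite det_mulmx !det_SL mulr1. Qed.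

Definition SLmul (g h : SL) : SL := mkSL (SLmul_subproof g h).

Definition SLone : SL := mkSL (det1 R n).

Lemma SLmulA : associative SLmul.
Proof. by move=> f g h; apply: val_inj; exact: mulmxA. Qed.

(* [g] and [h] lie in the same coset of SL_n(Z), that is, their columns span
   the same lattice. *)
Definition same_lattice (g h : SL) : bool :=
  `[< exists c : 'M[int]_n,
        \det c = 1 /\ \val h = \val g *m map_mx intr c >].

Lemma same_lattice_refl : reflexive same_lattice.
Proof.
by move=> g; apply/asboolP; exists 1%:M; rewrite det1 map_mx1 mulmx1.
Qed.

Lemma same_lattice_trans : transitive same_lattice.
Proof.
move=> h g k /asboolP[c [dc hE]] /asboolP[c' [dc' kE]].
apply/asboolP; exists (c *m c'); split; first by rewrite det_mulmx dc dc' mulr1.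
by rewrite kE hE map_mxM mulmxA.
Qed.

Lemma same_lattice_sym : symmetric same_lattice.
Proof.
suff sub g h : same_lattice g h -> same_lattice h g.
  by move=> g h; apply/idP/idP; exact: sub.
move=> /asboolP[c [dc hE]]; apply/asboolP; exists (\adj c).
have cK : c *m \adj c = 1%:M by rewrite mul_mx_adj dc.
split; first by have := det_mulmx c (\adj c); rewrite cK det1 dc mul1r.
by rewrite hE -mulmxA -map_mxM cK map_mx1 mulmx1.
Qed.

Canonical same_lattice_equiv := EquivRel same_lattice
  same_lattice_refl same_lattice_sym same_lattice_trans.

Local Open Scope quotient_scope.

(* SL_n(R)/SL_n(Z): the class of [g] is the lattice g Z^n. *)
Definition lattice_space : topologicalType :=
  quotient_topology {eq_quot same_lattice_equiv}.

Definition lattice_of (g : SL) : lattice_space :=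
  \pi_(quotient_topology {eq_quot same_lattice_equiv}) g.

Definition lattice_act (g : SL) (L : lattice_space) : lattice_space :=
  lattice_of (SLmul g
    (repr (L : quotient_topology {eq_quot same_lattice_equiv}))).

Lemma lattice_ofP (g h : SL) : lattice_of g = lattice_of h <-> same_lattice g h.
Proof. by split=> [/eqmodP|/eqmodP]. Qed.

Lemma lattice_act_of (g h : SL) :
  lattice_act g (lattice_of h) = lattice_of (SLmul g h).
Proof.
apply/lattice_ofP.
have /lattice_ofP/asboolP[c [dc hE]] : lattice_of
    (repr (lattice_of h : quotient_topology {eq_quot same_lattice_equiv}))
    = lattice_of h by rewrite /lattice_of reprK.
by apply/asboolP; exists c; split=> //=; rewrite hE mulmxA.
Qed.

Definition divergent (y : R -> lattice_space) : Prop :=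
  forall K : set lattice_space, compact K -> \forall t \near +oo, ~ K (y t).

End Lattices.

Arguments SL : clear implicits.
Arguments SLone : clear implicits.

(** * Weighted diagonal flow *)

Section Flow.
Variables (R : realType) (d : nat) (w : 'I_d -> R).
Hypothesis w_sum1 : \sum_(i < d) w i = 1.

(* diag(e^(w_1 t), ..., e^(w_d t), e^(-t)); the index [ord_max] is the last one
   and [unlift ord_max] identifies the others with ['I_d]. *)
Definition flow_mx (t : R) : 'M[R]_d.+1 :=
  diag_mx (\row_i expR (oapp w (-1) (unlift ord_max i) * t)).

Lemma det_flow_mx t : \det (flow_mx t) = 1.
Proof.
rewrite det_diag big_ord_recr /= mxE unlift_none /=.
under eq_bigr => i _.
  have -> : widen_ord (leqnSn d) i = lift ord_max i.
    by apply: val_inj; rewrite /= /bump leqNgt ltn_ord.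
  rewrite mxE liftK /=; over.
by rewrite -expR_sum -mulr_suml w_sum1 -expRD mul1r mulN1r subrr expR0.
Qed.

Definition flow (t : R) : SL R d.+1 := mkSL (det_flow_mx t).

Definition horospherical : set (SL R d.+1) :=
  [set g : SL R d.+1 |
     SLmul (SLmul (flow (- t)) g) (flow t) @[t --> +oo] --> SLone R d.+1].

(* [Sing] is measured through its image in the normed space 'M_(d+1): the metric
   induced on SL is locally bi-Lipschitz to any Riemannian metric, so it gives
   the same Hausdorff dimension. *)
Definition Sing (H : set (SL R d.+1)) (L : lattice_space R d.+1) :
    set (SL R d.+1) :=
  [set h | H h /\ divergent (fun t => lattice_act (SLmul (flow t) h) L)].

End Flow.

(* Main.v *)
(* H is the group of unipotent matrices whose (i, j) entries with i <> j vanish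
   unless lam_i > lam_j, where lam = (w_1, ..., w_d, -1), and a trajectory is
   divergent iff the shortest vectors of its lattices tend to 0 (Mahler).

   Upper bound. The height f(g) = sum |g z|^-b over the nonzero integer z with
   |g z| <= 1, b slightly larger than d, satisfies
     sum_k f(a_t k g) <= C e^(-(1 - eps) t) * #{k} * f(g)
   up to constants when k ranges over a grid of representatives of a_-t B a_t in a
   box B of H, as long as the lattice has a short vector. Iterating, the orbits that
   stay in the cusp from some time on are covered, at time t, by e^((h - 1 + eps) t)
   cells with h the total expansion; cut into cubes of side e^(-(1 + w_1) t) these
   give dimension at most dim H - 1 / (1 + w_1).

   Lower bound. Fix all entries of h but its last column x in R^d. The orbit of x is
   kept in the cusp by a short vector b of the dual lattice lying in the hyperplane
   orthogonal to the last axis. For a time step T the points x with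
   |b . x| <= eps e^-T keep b short. Non-divergence of the flow on the rank d
   quotient of the dual lattice by b yields e^((d - o(1)) T) well separated such x at
   whose end another short dual vector b' replaces b. Iterating gives a tree of
   divergent points; counting its nodes in balls, where the slabs |b . x| <= eps e^-T
   are transverse to the most expanded axis, bounds the Hausdorff content of the
   fibre from below in every dimension less than d - 1 / (1 + w_1). Integrating over
   the other entries (Lebesgue measure, one coordinate at a time) adds dim H - d. *)
Require Import Defs.
From HB Require Import structures.
From mathcomp Require Import all_boot all_order all_algebra.
From mathcomp Require Import all_classical all_reals all_analysis.
From mathcomp Require Import measurable_realfun.
From mathcomp Require Import fingroup perm ring lra zify.

Set Implicit Arguments.
Unset Strict Implicit.
Unset Printing Implicit Defensive.

Import Order.TTheory GRing.Theory Num.Theory.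
Import numFieldTopology.Exports numFieldNormedType.Exports.

Local Open Scope classical_set_scope.
Local Open Scope ring_scope.

(** * Lattice reduction *)

(** A plain sum over vectors suffices as height, with no reference to sublattices of higher rank,
    because contraction is only needed where a short vector exists. By reduction theory a unimodular
    lattice of rank [n.+1] with small shortest length [l] has at most [C / l ^+ n] vectors of
    bounded norm, and for an exponent above n these are outweighed by the single term of the
    shortest vector. In the lower bound the same height, on a quotient of rank d and with exponent
    strictly between d - 1 and d, finds generic free coordinates. The obstacle is that the new dual
    vector has to be primitive, to have all its first coordinates of one prescribed size, and to
    have last coordinate exactly 0 at the child. The sizes come from rounding a target to a lattice
    point, primitivity from a congruence modulo a factorial, and the vanishing from solving for one
    coordinate of x. The quality of the lattice after a step must moreover not depend on its quality
    before the step, or constants would degrade along the tree; only the length of the step may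
    depend on it. *)

Section SupNorm.
Variable R : realType.

(** Also makes sense in size 0, where the induction of [lattice_reduction] starts; [normE]
    identifies it with the ambient norm in positive sizes. *)
Definition mnorm m n (A : 'M[R]_(m, n)) : R :=
  \big[Num.max/0]_(p : 'I_m * 'I_n) `|A p.1 p.2|.

Lemma mnorm_ge0 m n (A : 'M[R]_(m, n)) : 0 <= mnorm A.
Proof. exact: bigmax_ge_id. Qed.

Lemma mnorm_entry m n (A : 'M[R]_(m, n)) i j : `|A i j| <= mnorm A.
Proof. exact: (le_bigmax 0 (fun p : 'I_m * 'I_n => `|A p.1 p.2|) (i, j)). Qed.

Lemma mnorm_le m n (A : 'M[R]_(m, n)) c :
  0 <= c -> (forall i j, `|A i j| <= c) -> mnorm A <= c.
Proof. by move=> c0 Ac; apply: bigmax_le => // -[i j] _ /=. Qed.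

Lemma mnorm0 m n : mnorm (0 : 'M[R]_(m, n)) = 0.
Proof.
apply/eqP; rewrite eq_le mnorm_ge0 andbT mnorm_le // => i j.
by rewrite mxE normr0.
Qed.

Lemma mnorm_eq0 m n (A : 'M[R]_(m, n)) : (mnorm A == 0) = (A == 0).
Proof.
apply/eqP/eqP => [A0|->]; last exact: mnorm0.
apply/matrixP => i j; rewrite mxE; apply/normr0_eq0/eqP.
by rewrite eq_le normr_ge0 andbT -A0 mnorm_entry.
Qed.

Lemma mnorm_gt0 m n (A : 'M[R]_(m, n)) : A != 0 -> 0 < mnorm A.
Proof. by move=> A0; rewrite lt_def mnorm_eq0 A0 mnorm_ge0. Qed.

Lemma mnormZ m n a (A : 'M[R]_(m, n)) : mnorm (a *: A) = `|a| * mnorm A.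
Proof.
have sub b (B : 'M[R]_(m, n)) : mnorm (b *: B) <= `|b| * mnorm B.
  apply: mnorm_le => [|i j]; first by rewrite mulr_ge0 ?mnorm_ge0.
  by rewrite mxE normrM ler_wpM2l // mnorm_entry.
have [->|a0] := eqVneq a 0; first by rewrite scale0r normr0 mul0r mnorm0.
apply/eqP; rewrite eq_le sub /=.
have := sub a^-1 (a *: A).
rewrite scalerA mulVf // scale1r normfV => h.
by rewrite -ler_pdivlMl ?normr_gt0.
Qed.

Lemma mnormN m n (A : 'M[R]_(m, n)) : mnorm (- A) = mnorm A.
Proof. by rewrite -scaleN1r mnormZ normrN1 mul1r. Qed.

Lemma mnormD m n (A B : 'M[R]_(m, n)) : mnorm (A + B) <= mnorm A + mnorm B.
Proof.
apply: mnorm_le => [|i j]; first by rewrite addr_ge0 ?mnorm_ge0.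
by rewrite mxE (le_trans (ler_normD _ _)) // lerD // mnorm_entry.
Qed.

Lemma mnormM m n p (A : 'M[R]_(m, n)) (B : 'M[R]_(n, p)) :
  mnorm (A *m B) <= n%:R * (mnorm A * mnorm B).
Proof.
apply: mnorm_le => [|i j]; first by rewrite !mulr_ge0 ?mnorm_ge0.
rewrite mxE (le_trans (ler_norm_sum _ _ _)) //.
rewrite -[n in n%:R]card_ord -sumr_const mulr_suml ler_sum // => k _.
by rewrite mul1r normrM ler_pM // mnorm_entry.
Qed.

Lemma mnorm_attained m n (A : 'M[R]_(m, n)) : A != 0 ->
  exists i j, mnorm A = `|A i j|.
Proof.
move=> A0; have [i0 [j0 Aij]] : exists i j, A i j != 0.
  apply: contrapT => h; move/eqP: A0; apply; apply/matrixP => i j.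
  by rewrite mxE; apply: contrapT => /eqP Aij; apply: h; exists i, j.
have [[i j] _ H] := arg_maxP (fun p : 'I_m * 'I_n => `|A p.1 p.2|) (isT : predT (i0, j0)).
exists i, j; apply/eqP; rewrite eq_le mnorm_entry andbT.
by apply: mnorm_le => // i' j'; apply: (H (i', j')).
Qed.

End SupNorm.

Notation intmx := (map_mx intr).

Section IntegerVectors.
Variable R : realType.

Lemma intmx0 m n : intmx (0 : 'M[int]_(m, n)) = 0 :> 'M[R]_(m, n).
Proof. by apply/matrixP => i j; rewrite !mxE. Qed.

Lemma intmx_eq0 m n (A : 'M[int]_(m, n)) : (intmx A == 0 :> 'M[R]_(m, n)) = (A == 0).
Proof.
apply/eqP/eqP => [/matrixP A0|->]; last exact: intmx0.
by apply/matrixP => i j; have := A0 i j; rewrite !mxE => /eqP; rewrite intr_eq0 => /eqP.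
Qed.

Lemma unit_intmx n (A : 'M[int]_n) : A \in unitmx ->
  `|\det (intmx A)| = 1 :> R /\ intmx A \in @unitmx R n.
Proof.
move=> Au; have d1 : `|\det (intmx A)| = 1 :> R.
  have /orP[/eqP dA|/eqP dA] : (\det A == 1) || (\det A == -1) by exact: Au.
    by rewrite det_map_mx dA normr1.
  by rewrite det_map_mx dA normrN1.
by split=> //; rewrite unitmxE unitfE -normr_eq0 d1 oner_eq0.
Qed.

Lemma intr_norm_ge1 (k : int) : k != 0 -> 1 <= `|k%:~R| :> R.
Proof. by move=> k0; rewrite -intr_norm ler1z; lia. Qed.

(** Coding bounded integer vectors by a finite type yields finiteness, minima and cardinals of sets
    of short vectors at once. *)
Definition ivec n N (m : {ffun 'I_n -> 'I_N.*2.+1}) : 'cV[int]_n :=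
  \col_i ((m i)%:Z - N%:Z).

Lemma ivecP n N (z : 'cV[int]_n) : (forall i, `|z i 0%R| <= N%:Z) ->
  exists m, ivec (N := N) m = z.
Proof.
move=> zN; exists [ffun i => inord `|(z i 0 + N%:Z)%R|%N].
apply/matrixP => i j; rewrite !mxE !ffunE (ord1 j).
have := zN i; move: (z i 0) => k kN.
rewrite inordK; lia.
Qed.

Lemma lattice_bound n (g : 'M[R]_n) (z : 'cV[int]_n) : g \in unitmx ->
  mnorm (intmx z : 'cV[R]_n) <= n%:R * mnorm (invmx g) * mnorm (g *m intmx z).
Proof.
move=> gu; rewrite -mulrA -{1}[intmx z](mulKmx gu); exact: mnormM.
Qed.

Lemma lattice_finite n (g : 'M[R]_n) (r : R) : g \in unitmx ->
  exists N, forall z : 'cV[int]_n, mnorm (g *m intmx z) <= r ->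
    exists m, ivec (N := N) m = z.
Proof.
move=> gu; set c := n%:R * mnorm (invmx g).
have c0 : 0 <= c by rewrite mulr_ge0 ?mnorm_ge0.
exists (Num.trunc (c * r)) => z zr; apply: ivecP => i.
have zc : `|(z i 0)%:~R| <= c * r :> R.
  have := mnorm_entry (intmx z : 'cV[R]_n) i 0; rewrite mxE => /le_trans; apply.
  by rewrite (le_trans (lattice_bound _ gu)) // ler_wpM2l.
move: zc; rewrite -intr_norm; have [k ->] : exists k : nat, `|z i 0| = k%:Z.
  by exists `|(z i 0)%R|%N; lia.
by rewrite -pmulrn => kc; rewrite lez_nat truncn_ge_nat // (le_trans _ kc).
Qed.

Lemma shortest_vector n (g : 'M[R]_n.+1) : g \in unitmx ->
  exists2 z : 'cV[int]_n.+1, z != 0 &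
    forall z' : 'cV[int]_n.+1, z' != 0 -> mnorm (g *m intmx z) <= mnorm (g *m intmx z').
Proof.
move=> gu; pose e : 'cV[int]_n.+1 := delta_mx 0 0.
have e0 : e != 0.
  by apply/eqP => /matrixP/(_ 0 0); rewrite !mxE eqxx.
have [N HN] := lattice_finite (mnorm (g *m intmx e)) gu.
have [m0 m0E] := HN e (lexx _).
have P0 : ivec m0 != 0 by rewrite m0E.
have [m m1 mmin] := @arg_minP _ _ _ m0 (fun m => ivec m != 0)
  (fun m => mnorm (g *m intmx (ivec (N := N) m))) P0.
exists (ivec m) => // z' z'0.
have [le|/ltW le] := leP (mnorm (g *m intmx z')) (mnorm (g *m intmx e)).
  by have [m' m'E] := HN _ le; rewrite -m'E; apply: mmin; rewrite m'E.
by rewrite (le_trans (mmin _ P0)) // m0E.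
Qed.

End IntegerVectors.

(** In the Smith form of a single column the only invariant factor divides [z], so primitivity makes
    it a unit, which can be moved into the left transformation [L]. *)
Lemma unimodular_completion n (z : 'cV[int]_n.+1) :
  (forall k (z' : 'cV[int]_n.+1), z = k *: z' -> k \is a GRing.unit) ->
  exists2 c : 'M[int]_n.+1, c \in unitmx & col 0 c = z.
Proof.
move=> zprim; have [L Lu [S _ [s _ zE]]] := int_Smith_normal_form z.
pose k := s`_0 * S 0 0.
have zk : z = k *: col 0 L.
  apply/matrixP => i j; rewrite (ord1 j) {1}zE !mxE big_ord1 !mxE.
  rewrite (bigD1 0) //= !mxE eqxx mulr1n big1 ?addr0; first by rewrite /k; ring.
  by move=> l l0; rewrite !mxE (_ : (l == 0 :> nat) = false) ?mulr0n ?mulr0 //; apply/negbTE.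
have ku := zprim _ _ zk.
exists (k *: L); last by rewrite [RHS]zk; apply/matrixP => i j; rewrite !mxE.
by rewrite unitmxE detZ unitrM unitrX // -unitmxE.
Qed.

Section Reduction.
Variable R : realType.

Lemma mnorm_row_perm m n (s : 'S_m) (A : 'M[R]_(m, n)) :
  mnorm (row_perm s A) = mnorm A.
Proof.
have sub (t : 'S_m) (B : 'M[R]_(m, n)) : mnorm (row_perm t B) <= mnorm B.
  by apply: mnorm_le => [|i j]; rewrite ?mnorm_ge0 // mxE mnorm_entry.
apply/eqP; rewrite eq_le sub /=.
have -> : mnorm A = mnorm (row_perm (s^-1)%g (row_perm s A)).
  by rewrite -row_permM mulVg row_perm1.
exact: sub.
Qed.

Lemma det_le_colnorm n (A : 'M[R]_n) :
  `|\det A| <= (n`!)%:R * \prod_j mnorm (col j A).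
Proof.
rewrite -det_tr /determinant (le_trans (ler_norm_sum _ _ _)) //.
rewrite -card_Sn -sumr_const mulr_suml ler_sum // => s _.
rewrite mul1r normrM normrX normrN1 expr1n mul1r normr_prod.
rewrite ler_prod // => i _; rewrite normr_ge0 /= mxE.
by have := mnorm_entry (col i A) (s i) 0; rewrite mxE.
Qed.

Lemma round_int (x a : R) : a != 0 -> exists r : int, `|x + a * r%:~R| <= `|a| / 2.
Proof.
move=> a0; exists (- Num.floor (x / a + 2^-1)).
have /andP[] := @floor_itv R (x / a + 2^-1).
move: (Num.floor _) => k; rewrite intrD => h1 h2.
have -> : x + a * (- k)%:~R = a * (x / a - k%:~R).
  by rewrite mulrBr mulrCA divff // mulr1 intrN mulrN.
rewrite normrM ler_wpM2l // ler_norml; lra.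
Qed.

Lemma mnorm_col_mx m1 m2 n (A : 'M[R]_(m1, n)) (B : 'M[R]_(m2, n)) c :
  mnorm A <= c -> mnorm B <= c -> mnorm (col_mx A B) <= c.
Proof.
move=> Ac Bc; apply: mnorm_le; first by rewrite (le_trans _ Ac) ?mnorm_ge0.
move=> i j; rewrite mxE; case: splitP => k _.
  by rewrite (le_trans (mnorm_entry _ _ _)).
by rewrite (le_trans (mnorm_entry _ _ _)).
Qed.

Lemma col_block_mxr m1 m2 n1 n2 (A : 'M[R]_(m1, n1)) (B : 'M[R]_(m1, n2))
    (C : 'M[R]_(m2, n1)) (D : 'M[R]_(m2, n2)) j :
  col (rshift n1 j) (block_mx A B C D) = col_mx (col j B) (col j D).
Proof.
apply/matrixP => i k; rewrite block_mxEv !mxE.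
by case: splitP => l _; rewrite row_mxEr mxE.
Qed.

(** The converse of [det_le_colnorm]: a nearly orthogonal basis. The exponent leaves room for one
    factor 2 per new column at each rank, since n + n^2 <= (n + 1)^2. *)
Definition reducible n (g : 'M[R]_n) := exists2 c : 'M[int]_n, c \in unitmx &
  \prod_j mnorm (col j (g *m intmx c)) <= 2 ^+ (n * n) * `|\det g|.

Lemma reducible_row_perm n (s : 'S_n) (g : 'M[R]_n) :
  reducible (row_perm s g) -> reducible g.
Proof.
move=> [c cu h]; exists c => //; move: h.
rewrite row_permE det_mulmx det_perm normrM normrX normrN1 expr1n mul1r.
suff E : \prod_j mnorm (col j (perm_mx s *m g *m intmx c)) =
         \prod_j mnorm (col j (g *m intmx c)) by rewrite E.
apply: eq_bigr => j _; rewrite -mulmxA -row_permE.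
rewrite -[RHS](mnorm_row_perm s).
by congr mnorm; apply/matrixP => k l; rewrite !mxE.
Qed.

(** Block elimination with the shortest vector as pivot column. A reduced basis of the Schur
    complement [D'] is lifted, and its top row [t] is reduced modulo the pivot by the integers
    [r]. *)
Lemma reducible_step n (g : 'M[R]_(1 + n)) (z : 'cV[int]_(1 + n)) :
  (forall h : 'M[R]_n, h \in unitmx -> reducible h) ->
  g \in unitmx -> z != 0 ->
  (forall z' : 'cV[int]_(1 + n), z' != 0 -> mnorm (g *m intmx z) <= mnorm (g *m intmx z')) ->
  mnorm (g *m intmx z) = `|(g *m intmx z) 0 0| -> reducible g.
Proof.
move=> IH gu z0 zmin zpiv.
have gz0 (z' : 'cV[int]_(1 + n)) : z' != 0 -> g *m intmx z' != 0.
  move=> z'0; apply: contra z'0 => /eqP gz'; rewrite -(intmx_eq0 R) -(mulKmx gu (intmx z')).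
  by rewrite gz' mulmx0.
have v0 : (g *m intmx z) 0 0 != 0.
  by rewrite -normr_eq0 -zpiv mnorm_eq0 gz0.
have zprim k (z' : 'cV[int]_(1 + n)) : z = k *: z' -> k \is a GRing.unit.
  move=> zE; have z'0 : z' != 0.
    by apply: contra z0 => /eqP z'0; rewrite zE z'0 scaler0.
  have := zmin _ z'0.
  rewrite zE (_ : intmx (k *: z') = k%:~R *: intmx z' :> 'cV[R]_(1 + n)); last first.
    by apply/matrixP => i j; rewrite !mxE intrM.
  rewrite -scalemxAr mnormZ -[leRHS]mul1r ler_pM2r ?mnorm_gt0 ?gz0 //.
  rewrite -intr_norm -[1]/(1%:~R) ler_int => k1.
  have k0 : k != 0 by apply: contra z0 => /eqP k0; rewrite zE k0 scale0r.
  by rewrite (_ : k \is a GRing.unit = (k == 1) || (k == -1)) //; lia.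
have [c1 c1u c1E] : exists2 c : 'M[int]_(1 + n), c \in unitmx & col 0 c = z
  := unimodular_completion zprim.
set A := g *m intmx c1.
have Acol : col 0 A = g *m intmx z.
  by rewrite /A -c1E !colE -mulmxA map_mxM map_delta_mx.
set a := A 0 0.
have aE : a = (g *m intmx z) 0 0 by rewrite -Acol mxE.
have a0 : a != 0 by rewrite aE.
pose b := ursubmx (A : 'M[R]_(1 + n, 1 + n)); pose c := dlsubmx (A : 'M[R]_(1 + n, 1 + n)).
pose D := drsubmx (A : 'M[R]_(1 + n, 1 + n)).
have ulA : ulsubmx (A : 'M[R]_(1 + n, 1 + n)) = a%:M.
  apply/matrixP => i j; rewrite !ord1 [RHS]mxE eqxx mulr1n /a /ulsubmx [LHS]mxE [LHS]mxE.
  by rewrite (_ : lshift n 0 = 0) //; apply/val_inj.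
have AE : A = block_mx a%:M b c D by rewrite -ulA submxK.
pose D' := D - a^-1 *: (c *m b).
have [detA c1det] : \det A = a * \det D' /\ `|\det A| = `|\det g|.
  split; last by rewrite /A det_mulmx normrM (proj1 (unit_intmx R c1u)) mulr1.
  have := det_mulmx (block_mx 1%:M 0 (- a^-1 *: c) 1%:M) A.
  rewrite det_lblock !det1 !mul1r {1}AE mulmx_block !mul1mx !mul0mx !addr0.
  rewrite -scalemxAl mul_mx_scalar scalerA mulNr mulVf // scaleN1r addNr.
  by rewrite det_ublock det_scalar1 -scalemxAl scaleNr addrC.
have [c2 c2u c2le] : reducible D'.
  apply: IH; rewrite unitmxE unitfE; move: gu; rewrite unitmxE unitfE -normr_eq0 -c1det detA.
  by rewrite normrM mulf_eq0 negb_or !normr_eq0 => /andP[].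
have [r rE] : exists r : 'rV[int]_n, forall j, `|(b *m intmx c2) 0 j + a * (r 0 j)%:~R| <= `|a| / 2.
  have /choice[f fP] := fun j => round_int ((b *m intmx c2) 0 j) a0.
  by exists (\row_j f j) => j; rewrite mxE.
pose c3 : 'M[int]_(1 + n) := block_mx 1%:M r 0 c2.
have c3u : c3 \in unitmx by rewrite unitmxE det_ublock det1 mul1r -unitmxE.
exists (c1 *m c3); first by rewrite unitmx_mul c1u.
pose t := a%:M *m intmx r + b *m intmx c2.
have BE : g *m intmx (c1 *m c3) = block_mx a%:M t c (D' *m intmx c2 + a^-1 *: (c *m t)).
  have c3E : map_mx (ssrint_intmul__canonical__GRing_RMorphism R) c3 =
      block_mx 1%:M (intmx r) 0 (intmx c2) :> 'M[R]_(1 + n).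
    by rewrite /c3 map_block_mx map_mx1 map_mx0.
  rewrite map_mxM mulmxA -/A {1}AE c3E mulmx_block.
  rewrite !mulmx1 !mulmx0 !addr0; congr block_mx.
  have -> : a^-1 *: (c *m t) = c *m intmx r + a^-1 *: (c *m b *m intmx c2).
    by rewrite /t mul_scalar_mx mulmxDr -scalemxAr scalerDr scalerA mulVf // scale1r mulmxA.
  by rewrite mulmxBl -scalemxAl addrCA subrK.
set B := g *m _ in BE *.
have Bcol j : col j B = g *m intmx (col j (c1 *m c3)).
  by rewrite /B !colE [in RHS]map_mxM map_delta_mx mulmxA.
have c13u : (c1 *m c3) \in unitmx by rewrite unitmx_mul c1u.
have cj0 j : col j (c1 *m c3) != 0.
  apply/eqP => c0; have := congr1 (mulmx (invmx (c1 *m c3))) c0.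
  rewrite colE mulKmx // mulmx0 => /matrixP/(_ j 0).
  by rewrite !mxE !eqxx.
have tE j : t 0 j = (b *m intmx c2) 0 j + a * (r 0 j)%:~R.
  by rewrite /t mul_scalar_mx [LHS]mxE addrC; congr (_ + _); rewrite !mxE.
have B0 : mnorm (col 0 B) = `|a|.
  rewrite Bcol; have -> : col 0 (c1 *m c3) = z; last by rewrite zpiv aE.
  rewrite -c1E !colE -mulmxA; congr (_ *m _); rewrite -colE.
  apply/matrixP => i j; rewrite !mxE; case: splitP => k ik; rewrite !mxE.
    case: splitP => l /= l0; last by move: l0; rewrite /= add1n.
    by rewrite !mxE !ord1 eqxx (_ : i == 0) //; apply/eqP/val_inj; rewrite /= ik ord1.
  case: splitP => l /= l0; last by move: l0; rewrite /= add1n.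
  by rewrite !mxE (_ : i == 0 = false) //; apply/eqP => i0; move: ik; rewrite i0.
(* The pivot is the largest entry of its column, so lifting adds at most |a| / 2 to the norm: u <= x
   + |a| / 2. Minimality of the pivot gives |a| <= u, and together u <= 2 x. *)
have Bj j : mnorm (col (rshift 1 j) B) <= 2 * mnorm (col j (D' *m intmx c2)).
  set u := mnorm _; set x := mnorm _.
  have au : `|a| <= u.
    by rewrite /u Bcol aE -zpiv; exact: zmin.
  have ta : mnorm (col j t) <= `|a| / 2.
    apply: mnorm_le => [|i k]; first by rewrite divr_ge0.
    by rewrite mxE ord1 tE rE.
  have ux : u <= x + `|a| / 2.
    rewrite /u BE col_block_mxr [X in col_mx _ X]linearD /=; apply: mnorm_col_mx.
      by rewrite (le_trans ta) // lerDr mnorm_ge0.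
    rewrite (le_trans (mnormD _ _)) // lerD2l.
    apply: mnorm_le => [|i k]; first by rewrite divr_ge0.
    rewrite 3!mxE big_ord1 !normrM.
    have cia : `|c i 0| <= `|a|.
      have e0 : lshift n (0 : 'I_1) = 0 :> 'I_(1 + n) by exact/val_inj.
      have <- : B (rshift 1 i) (lshift n 0) = c i 0 by rewrite BE block_mxEdl.
      by rewrite -B0 e0; have := mnorm_entry (col 0 B) (rshift 1 i) 0; rewrite mxE.
    have tj : `|t 0 j| <= `|a| / 2.
      by have := mnorm_entry (col j t) 0 0; rewrite mxE => /le_trans; apply.
    rewrite normfV mulrA (le_trans (ler_piMl (normr_ge0 _) _)) // ?tj //.
    by rewrite mulrC ler_pdivrMr ?normr_gt0 // mul1r.
  move: ux au; rewrite -/u -/x; lra.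
rewrite -c1det detA normrM big_ord_recl B0.
apply: (@le_trans _ _ (`|a| * \prod_(j < n) (2 * mnorm (col j (D' *m intmx c2))))).
  rewrite ler_wpM2l // ler_prod // => j _; rewrite mnorm_ge0 /=.
  by rewrite (_ : lift ord0 j = rshift 1 j) //; exact/val_inj.
rewrite big_split /= prodr_const card_ord.
rewrite [leRHS]mulrCA ler_wpM2l //.
apply: (@le_trans _ _ (2 ^+ n * (2 ^+ (n * n) * `|\det D'|))).
  by rewrite ler_wpM2l // exprn_ge0.
rewrite mulrA ler_wpM2r // -exprD ler_weXn2l ?ler1n //; lia.
Qed.

(* Induction on the rank: after a shortest vector is completed to a basis, the
   projection along it has no vector shorter than half of it. *)
Theorem lattice_reduction n (g : 'M[R]_n) : g \in unitmx -> reducible g.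
Proof.
elim: n g => [|n IH] g gu.
  exists 1%:M; first exact: unitmx1.
  by rewrite big_ord0 expr0 mul1r det_mx00 normr1.
have [z z0 zmin] := shortest_vector gu.
have gz0 : g *m intmx z != 0.
  apply: contra z0 => /eqP gz; rewrite -(intmx_eq0 R) -(mulKmx gu (intmx z)).
  by rewrite gz mulmx0.
have [p [q pq]] := mnorm_attained gz0.
(* Row permutations change neither column norms nor |det|, so the entry attaining the norm of the
   shortest vector may be moved to row 0. *)
apply: (@reducible_row_perm _ (tperm 0 p)).
have gzE (z' : 'cV[int]_n.+1) : row_perm (tperm 0 p) g *m intmx z' =
    row_perm (tperm 0 p) (g *m intmx z') by rewrite !row_permE mulmxA.
apply: (@reducible_step n _ z IH) => //.
- by rewrite row_permE unitmx_mul unitmx_perm.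
- by move=> z' z'0; rewrite !gzE !mnorm_row_perm zmin.
- by rewrite gzE mnorm_row_perm pq !mxE tpermL (ord1 q).
Qed.

End Reduction.

(** * Consequences of reduction: Cramer bounds, transference, counting of lattice points *)

Section ReductionConsequences.
Variable R : realType.

(** Cramer's rule: with column [j] replaced by [A *m m] the determinant becomes [m j 0 * \det A],
    and [det_le_colnorm] bounds it. *)
Lemma cramer_bound n (A : 'M[R]_n) (m : 'cV[R]_n) j :
  `|m j 0| * `|\det A| <=
    (n`!)%:R * (mnorm (A *m m) * \prod_(i | i != j) mnorm (col i A)).
Proof.
pose B : 'M[R]_n := \matrix_(i, k) if k == j then (A *m m) i 0 else A i k.
have detB : \det B = m j 0 * \det A.
  rewrite (expand_det_col B j).
  have -> : m j 0 * \det A = ((\det A)%:M *m m) j 0 by rewrite mul_scalar_mx mxE mulrC.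
  rewrite -mul_adj_mx -mulmxA [in RHS]mxE; apply: eq_bigr => i _.
  rewrite mulrC [B i j]mxE eqxx [\adj A _ _]mxE; congr (_ * _).
  congr (_ * \det _); apply/matrixP => k l; rewrite !mxE.
  by rewrite eq_sym (negbTE (neq_lift _ _)).
rewrite -normrM -detB (le_trans (det_le_colnorm _)) // ler_wpM2l //.
rewrite (bigD1 j) //= ler_pM ?mnorm_ge0 ?prodr_ge0 //.
- by move=> i _; exact: mnorm_ge0.
- apply: mnorm_le => [|i k]; first exact: mnorm_ge0.
  by rewrite !mxE eqxx; have := mnorm_entry (A *m m) i 0; rewrite mxE.
- apply: ler_prod => i ij; rewrite mnorm_ge0 /=; apply: mnorm_le => [|k l].
    exact: mnorm_ge0.
  by rewrite !mxE (negbTE ij); have := mnorm_entry (col i A) k 0; rewrite mxE.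
Qed.

Lemma prod_min_le n (x : 'I_n.+2 -> R) j : (forall i, 0 <= x i) ->
  exists2 i, i != j & x i ^+ n.+1 <= \prod_(i | i != j) x i.
Proof.
move=> x0; have [i0 i0j] : exists i, i != j.
  by exists (lift j 0); rewrite eq_sym neq_lift.
have [i ij imin] := @arg_minP _ _ _ i0 (fun i => i != j) x i0j.
exists i => //; apply: le_trans (_ : \prod_(k | k != j) x i <= _).
  by rewrite -[n.+1]/(n.+2.-1) -[in x i ^+ _](card_ord n.+2) -(cardC1 j) -prodr_const.
by apply: ler_prod => k kj; rewrite x0 imin.
Qed.

Definition lattice_ge n (g : 'M[R]_n) (r : R) :=
  forall z : 'cV[int]_n, z != 0 -> r <= mnorm (g *m intmx z).

Lemma gz_neq0 n (g : 'M[R]_n) (z : 'cV[int]_n) : g \in unitmx -> z != 0 ->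
  g *m intmx z != 0.
Proof.
move=> gu; apply: contra => /eqP gz.
by rewrite -(intmx_eq0 R) -(mulKmx gu (intmx z)) gz mulmx0.
Qed.

Lemma unit_col_neq0 n (c : 'M[int]_n) j : c \in unitmx -> col j c != 0.
Proof.
move=> cu; apply/eqP => c0; have := congr1 (mulmx (invmx c)) c0.
by rewrite colE mulKmx // mulmx0 => /matrixP/(_ j 0); rewrite !mxE !eqxx.
Qed.

Lemma col_intmx n (g : 'M[R]_n) (c : 'M[int]_n) j :
  col j (g *m intmx c) = g *m intmx (col j c).
Proof. by rewrite !colE [in RHS]map_mxM map_delta_mx mulmxA. Qed.

(** In the product bound of a reduced basis the other [n] columns have norm at least [r], so they
    can be divided out. *)
Lemma bounded_basis n (g : 'M[R]_n.+1) r : g \in unitmx -> 0 < r ->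
  lattice_ge g r ->
  exists2 c : 'M[int]_n.+1, c \in unitmx &
    forall j, mnorm (col j (g *m intmx c)) <=
      2 ^+ (n.+1 * n.+1) * `|\det g| / r ^+ n.
Proof.
move=> gu r0 gr; have [c cu cle] := lattice_reduction gu.
exists c => // j; rewrite ler_pdivlMr ?exprn_gt0 //; apply: le_trans cle.
rewrite [leRHS](bigD1 j) //= ler_wpM2l ?mnorm_ge0 //.
rewrite -[n]/(n.+1.-1) -[in r ^+ _](card_ord n.+1) -(cardC1 j) -prodr_const.
by apply: ler_prod => i ij; rewrite ltW // col_intmx gr // unit_col_neq0.
Qed.

(** Transference: some reduced basis vector pairs with [c] to a nonzero integer, so it is long; the
    product bound then makes the product of the other [n.+1] lengths small, and one of them is
    short. *)
Lemma dual_short_vector n (g : 'M[R]_n.+2) (c : 'rV[int]_n.+2) e :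
  g \in unitmx -> c != 0 -> mnorm (intmx c *m invmx g) <= e ->
  exists2 z : 'cV[int]_n.+2, z != 0 &
    mnorm (g *m intmx z) ^+ n.+1 <=
      2 ^+ (n.+2 * n.+2) * `|\det g| * (n.+2%:R * e).
Proof.
move=> gu c0 ce; have [a au ale] := lattice_reduction gu.
have ca0 : c *m a != 0.
  by apply: contra c0 => /eqP ca; rewrite -(mulmxK au c) ca mul0mx.
have [j caj] : exists j, (c *m a) 0 j != 0.
  apply: contrapT => h; move/eqP: ca0; apply; apply/matrixP => i j.
  by rewrite (ord1 i) [RHS]mxE; apply: contrapT => /eqP k; apply: h; exists j.
pose y j := mnorm (col j (g *m intmx a)).
have y0 i : 0 <= y i by exact: mnorm_ge0.
have yj : 1 <= n.+2%:R * e * y j.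
  apply: le_trans (intr_norm_ge1 R caj) _.
  have -> : ((c *m a) 0 j)%:~R = ((intmx c *m invmx g) *m col j (g *m intmx a)) 0 0 :> R.
    rewrite colE -!mulmxA (mulmxA g) (mulmxA (invmx g)) (mulmxA (invmx g)) mulVmx // mul1mx.
    by rewrite mulmxA -map_mxM -colE !mxE.
  apply: le_trans (mnorm_entry _ _ _) _; apply: le_trans (mnormM _ _) _.
  by rewrite -mulrA ler_wpM2l // ler_wpM2r // mnorm_ge0.
have [i ij ile] := prod_min_le j y0.
exists (col i a); first exact: unit_col_neq0.
rewrite -col_intmx; apply: le_trans ile _.
have e0 : 0 <= e by rewrite (le_trans _ ce) ?mnorm_ge0.
apply: le_trans (_ : (\prod_(i | i != j) y i) * (n.+2%:R * e * y j) <= _).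
  by rewrite ler_peMr // prodr_ge0.
rewrite mulrCA mulrC ler_wpM2r ?mulr_ge0 //.
by rewrite mulrC; apply: le_trans ale; rewrite [leRHS](bigD1 j).
Qed.

End ReductionConsequences.

Section Packing.
Variable R : realType.

(** Only [n] of the [n.+1] coefficients are free. As the determinant is 1 and one reduced basis
    vector has length O(l), another is longer than [Y]; by Cramer its coefficient vanishes on
    vectors of norm at most [r], and every other coefficient is at most [Y / l]. *)
Lemma packing n (r : R) : 1 <= r -> exists C l0 : R, [/\ 0 < C, 0 < l0 &
  forall (g : 'M[R]_n.+1) l, `|\det g| = 1 -> 0 < l <= l0 -> lattice_ge g l ->
  (exists2 z : 'cV[int]_n.+1, z != 0 & mnorm (g *m intmx z) <= l) ->
  exists2 s : seq 'cV[int]_n.+1, (size s)%:R <= C / l ^+ n &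
    forall z : 'cV[int]_n.+1, mnorm (g *m intmx z) <= r -> z \in s].
Proof.
move=> r1; pose K : R := 2 ^+ (n.+1 * n.+1); pose F : R := (n.+1`!)%:R.
have K0 : 0 < K by rewrite exprn_gt0.
have F0 : 0 < F by rewrite ltr0n fact_gt0.
have F1 : 1 <= F by rewrite ler1n fact_gt0.
have K1 : 1 <= K by rewrite exprn_ege1 ?ler1n.
have FK0 : 0 <= F * K by rewrite mulr_ge0 ?ltW.
pose Y := F * K * r.
have Y0 : 0 < Y by rewrite !mulr_gt0 // (lt_le_trans _ r1).
exists ((3 * Y) ^+ n), (Num.min 1 (2 * F * F * K * Y ^+ n)^-1); split.
- by rewrite exprn_gt0 // mulr_gt0.
- by rewrite lt_min ltr01 invr_gt0 !mulr_gt0 // exprn_gt0.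
move=> g l detg /andP[l0]; rewrite le_min => /andP[l1 lsmall] gl [z0 z00 z0l].
have gu : g \in unitmx by rewrite unitmxE unitfE -normr_eq0 detg oner_eq0.
have [c cu cle] := lattice_reduction gu.
rewrite detg mulr1 -/K in cle.
set A := g *m intmx c in cle.
have detA : `|\det A| = 1 by rewrite det_mulmx normrM detg (proj1 (unit_intmx R cu)) mulr1.
pose y j := mnorm (col j A).
have yl j : l <= y j by rewrite /y col_intmx gl // unit_col_neq0.
have y0 j : 0 < y j by rewrite (lt_le_trans l0).
have coef (z : 'cV[int]_n.+1) j :
    `|((invmx c *m z) j 0)%:~R| * y j <= F * K * mnorm (g *m intmx z).
  have zE : g *m intmx z = A *m intmx (invmx c *m z).
    by rewrite /A -mulmxA -map_mxM mulKVmx.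
  have := cramer_bound A (intmx (invmx c *m z)) j; rewrite detA mulr1 -zE mxE => h.
  apply: le_trans (ler_wpM2r (ltW (y0 j)) h) _.
  have yP : y j * \prod_(i | i != j) mnorm (col i A) <= K.
    by apply: le_trans cle; rewrite [leRHS](bigD1 j).
  have -> : F * K * mnorm (g *m intmx z) = F * mnorm (g *m intmx z) * K by ring.
  apply: le_trans (ler_wpM2l _ yP); last by rewrite mulr_ge0 ?mnorm_ge0 ?ltW.
  by rewrite -/F le_eqVlt; apply/orP; left; apply/eqP; ring.
have [j0 yj0] : exists j, y j <= F * K * l.
  have m0 : invmx c *m z0 != 0.
    by apply: contra z00 => /eqP h; rewrite -(mulKVmx cu z0) h mulmx0.
  have [j mj] : exists j, (invmx c *m z0) j 0 != 0.
    apply: contrapT => h; move/eqP: m0; apply; apply/matrixP => i j.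
    by rewrite (ord1 j) [RHS]mxE; apply: contrapT => /eqP k; apply: h; exists i.
  exists j; apply: le_trans (_ : F * K * mnorm (g *m intmx z0) <= _).
    by apply: le_trans (coef z0 j); rewrite ler_peMl ?(ltW (y0 j)) ?intr_norm_ge1.
  by rewrite ler_wpM2l ?mulr_ge0 ?(ltW F0) ?(ltW K0).
(* The value of [l0] is made for this contradiction: if all columns were at most [Y], the
   determinant would be at most 1/2. *)
have [i0 yi0] : exists i, Y < y i.
  apply: contrapT => h.
  have yY i : y i <= Y by rewrite leNgt; apply/negP => k; apply: h; exists i.
  have := det_le_colnorm A; rewrite detA -/F (bigD1 j0) //= -/y => h1.
  have h2 : 1 <= F * (F * K * l * Y ^+ n).
    apply: le_trans h1 _; rewrite ler_wpM2l ?(ltW F0) //.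
    rewrite ler_pM ?mnorm_ge0 ?prodr_ge0 //; first by move=> *; exact: mnorm_ge0.
    rewrite -[n]/(n.+1.-1) -[in Y ^+ _](card_ord n.+1) -(cardC1 j0) -prodr_const.
    by apply: ler_prod => i _; rewrite mnorm_ge0 yY.
  have P0 : 0 < 2 * F * F * K * Y ^+ n by rewrite !mulr_gt0 // exprn_gt0.
  move: lsmall; rewrite -[_^-1]mul1r ler_pdivlMr // => lsmall.
  have : F * (F * K * l * Y ^+ n) * 2 <= 1 by apply: le_trans lsmall; rewrite le_eqVlt; apply/orP; left; apply/eqP; ring.
  lra.
pose N := Num.trunc (Y / l).
have YN : N%:R <= Y / l by rewrite truncn_le // divr_ge0 ?ltW.
pose f (m : {ffun 'I_n -> 'I_N.*2.+1}) : 'cV[int]_n.+1 :=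
  c *m \col_i (if unlift i0 i is Some j then ivec m j 0 else 0).
exists [seq f m | m : {ffun 'I_n -> 'I_N.*2.+1}].
  rewrite size_map -cardE card_ffun !card_ord natrX -expr_div_n.
  have Y30 : 0 <= 3 * Y by rewrite pmulr_rge0 // ltW.
  rewrite lerXn2r ?nnegrE ?(divr_ge0 Y30 (ltW l0)) //.
  have : 1 <= Y / l.
    rewrite ler_pdivlMr // mul1r (le_trans l1) // /Y.
    by rewrite !mulr_ege1 // ?(le_trans _ r1).
  have -> : (N.*2.+1)%:R = 2 * N%:R + 1 :> R by rewrite -muln2 -addn1 natrD natrM; ring.
  move: YN; rewrite -(mulrA 3) mulrAC; lra.
move=> z zr; pose m := invmx c *m z.
have mi0 : m i0 0 = 0.
  apply: contrapT => /eqP mi; have := coef z i0.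
  have := intr_norm_ge1 R mi; rewrite -/m => h1 h2.
  have : y i0 <= F * K * mnorm (g *m intmx z).
    by apply: le_trans h2; rewrite ler_peMl ?(ltW (y0 i0)).
  have : F * K * mnorm (g *m intmx z) <= Y by rewrite ler_wpM2l.
  lra.
have mN i : `|m i 0| <= N%:Z.
  have [k kE] : exists k : nat, `|m i 0| = k%:Z by exists `|(m i 0)%R|%N; rewrite abszE.
  rewrite kE lez_nat truncn_ge_nat ?divr_ge0 ?(ltW Y0) ?(ltW l0) //.
  rewrite ler_pdivlMr // pmulrn -kE intr_norm.
  apply: le_trans (_ : `|(m i 0)%:~R| * y i <= _); first by rewrite ler_wpM2l.
  by apply: le_trans (coef z i) _; rewrite ler_wpM2l.
have [q qE] : exists q, ivec (N := N) q = \col_j m (lift i0 j) 0.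
  by apply: ivecP => i; rewrite mxE.
apply/mapP; exists q; rewrite ?mem_enum //.
rewrite /f qE -{1}(mulKVmx cu z) -/m; congr (_ *m _).
apply/matrixP => i k; rewrite (ord1 k) [RHS]mxE.
case: (unliftP i0 i) => [j|] ->.
  by rewrite [RHS]mxE.
by rewrite mi0.
Qed.

End Packing.

(** * Contraction of the height function *)

Section DiscreteSums.
Variable R : realType.

Definition gap (x : R) : R := Num.max 1 `|x|.

Lemma gap_ge1 x : 1 <= gap x. Proof. by rewrite /gap le_max lexx. Qed.
Lemma gap_gt0 x : 0 < gap x. Proof. by rewrite (lt_le_trans ltr01) ?gap_ge1. Qed.
Lemma gap_le x y : `|x| <= `|y| -> gap x <= gap y.
Proof. by move=> xy; rewrite /gap ge_max !le_max lexx xy /= orbT. Qed.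

Lemma powRN_le (b x y : R) : 0 <= b -> 0 < x -> x <= y -> y `^ (- b) <= x `^ (- b).
Proof.
move=> b0 x0 xy; have y0 := lt_le_trans x0 xy.
rewrite !powRN lef_pV2 ?posrE ?powR_gt0 //.
by rewrite ge0_ler_powR // nnegrE ltW.
Qed.

(* k^-e - (k+1)^-e >= e (k+1)^-(1+e), so the sum telescopes. *)
Lemma sum_powRN_le (e : R) N : 0 < e ->
  \sum_(0 <= k < N) gap k%:R `^ (- (1 + e)) <= 2 + e^-1.
Proof.
move=> e0; have le2 : forall N, \sum_(0 <= k < N) gap k.+2%:R `^ (- (1 + e)) <= e^-1 * (1 - N.+1%:R `^ (- e)).
  elim=> [|k IH]; first by rewrite big_geq // powR1 subrr mulr0.
  rewrite big_nat_recr //=; apply: le_trans (lerD IH (lexx _)) _.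
  have k0 : 0 < k.+1%:R :> R by rewrite ltr0n.
  have k20 : 0 < k.+2%:R :> R by rewrite ltr0n.
  have gk : gap k.+2%:R = k.+2%:R.
    by rewrite /gap ger0_norm ?ler0n // max_r // ler1n.
  have lnk : k.+2%:R^-1 <= ln k.+2%:R - ln (k.+1%:R : R).
    have h : 1 - k.+2%:R^-1 = k.+1%:R / k.+2%:R :> R.
      apply: (mulIf (lt0r_neq0 k20)); rewrite mulrBl mul1r mulVf ?gt_eqF // divfK ?gt_eqF //.
      by rewrite -[k.+2%:R]natr1 addrK.
    have hl : ln (1 - k.+2%:R^-1) <= - k.+2%:R^-1 :> R.
      apply: le_ln1Dx; rewrite ltrN2 invf_lt1 ?ltr1n //.
    by move: hl; rewrite h ln_div ?posrE // lerNr opprB.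
  have key : e / k.+2%:R <= (k.+1%:R / k.+2%:R) `^ (- e) - 1.
    have q0 : (k.+1%:R / k.+2%:R : R) != 0 by rewrite gt_eqF // divr_gt0.
    rewrite /powR (negbTE q0) ln_div ?posrE //.
    have := expR_ge1Dx (- e * (ln k.+1%:R - ln (k.+2%:R : R))).
    have : e * k.+2%:R^-1 <= e * (ln k.+2%:R - ln (k.+1%:R : R)) by rewrite ler_pM2l.
    rewrite -[ln k.+1%:R - _]opprB mulrNN => h1 h2.
    by rewrite lerBrDl (le_trans _ h2) // lerD2l.
  have dE : k.+1%:R `^ (- e) = k.+2%:R `^ (- e) * (k.+1%:R / k.+2%:R) `^ (- e) :> R.
    rewrite -powRM ?(ltW k20) ?divr_ge0 ?ltW //; congr (_ `^ _).
    by rewrite mulrC divfK // gt_eqF.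
  have p0 : 0 < k.+2%:R `^ (- e) :> R by rewrite powR_gt0.
  have gE : gap k.+2%:R `^ (- (1 + e)) = k.+2%:R `^ (- e) / k.+2%:R.
    rewrite gk opprD addrC powRD; last by rewrite (gt_eqF k20) implybT.
    by rewrite powR_inv1 // ltW.
  have : e * (k.+2%:R `^ (- e) / k.+2%:R) <= k.+1%:R `^ (- e) - k.+2%:R `^ (- e).
    by rewrite dE mulrCA -[X in _ - X]mulr1 -mulrBr ler_wpM2l // ltW.
  rewrite gE => h; have ei0 : 0 < e^-1 by rewrite invr_gt0.
  have := ler_wpM2l (ltW ei0) h; rewrite mulKf ?gt_eqF //.
  by move=> h'; apply: le_trans (lerD (lexx _) h') _; rewrite -mulrDr addrA subrK.
have h1 : \sum_(0 <= k < N) gap k%:R `^ (- (1 + e)) <=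
    \sum_(0 <= k < N.+2) gap k%:R `^ (- (1 + e)).
  rewrite [leRHS](big_cat_nat (n := N)) //=; last by lia.
  by rewrite lerDl sumr_ge0 // => i _; exact: powR_ge0.
apply: le_trans h1 _; rewrite big_nat_recl // big_nat_recl //=.
have g0 : gap 0 = 1 :> R by rewrite /gap normr0 max_l.
have g1 : gap 1 = 1 :> R by rewrite /gap normr1 maxxx.
rewrite g0 g1 powR1 addrA lerD //; apply: le_trans (le2 N) _.
rewrite ler_piMr ?invr_ge0 ?(ltW e0) // lerBlDr lerDl; exact: powR_ge0.
Qed.

(** The terms before the sign change of k + x, read backwards, and those after it are both dominated
    by the unshifted series, whence the factor 2. *)
Lemma sum_shift_powRN_le (e x : R) N : 0 < e ->
  \sum_(k < N) gap (k%:R + x) `^ (- (1 + e)) <= 2 * (2 + e^-1).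
Proof.
move=> e0; have e1 : 0 <= 1 + e by rewrite addr_ge0 // ltW.
have S0 : 0 <= 2 + e^-1 by rewrite addr_ge0 // invr_ge0 ltW.
pose F k := gap (k%:R + x) `^ (- (1 + e)).
have F0 k : 0 <= F k by exact: powR_ge0.
rewrite -(big_mkord xpredT F).
have [x0|x0] := leP 0 x.
  apply: le_trans (_ : \sum_(0 <= k < N) gap k%:R `^ (- (1 + e)) <= _).
    apply: ler_sum => k _; rewrite powRN_le ?gap_gt0 // gap_le // !ger0_norm ?addr_ge0 //.
    by rewrite lerDl.
  by apply: le_trans (sum_powRN_le _ e0) _; lra.
pose q := Num.trunc (- x).
have /andP[q1 q2] : q%:R <= - x < q.+1%:R by rewrite truncn_itv // oppr_ge0 ltW.
have h1 : \sum_(0 <= k < N) F k <= \sum_(0 <= k < q.+1 + N) F k.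
  rewrite [leRHS](big_cat_nat (n := N)) //=; last by lia.
  by rewrite lerDl sumr_ge0.
apply: le_trans h1 _; rewrite (big_cat_nat (n := q.+1)) //=; last by lia.
have -> : 2 * (2 + e^-1) = (2 + e^-1) + (2 + e^-1) by ring.
apply: lerD.
  apply: le_trans (sum_powRN_le q.+1 e0); rewrite big_nat_rev /= !big_nat.
  apply: ler_sum => k /andP[_ kq]; rewrite powRN_le ?gap_gt0 // gap_le //.
  have -> : (0 + q.+1 - k.+1 = q - k)%N by lia.
  rewrite natrB ?(ltnSE kq) // ger0_norm //.
  have kr : (0 : R) <= k%:R by [].
  rewrite ler0_norm; lra.
rewrite -{1}[q.+1]add0n big_addn addKn.
apply: le_trans (sum_powRN_le N e0); apply: ler_sum => k _.
rewrite powRN_le ?gap_gt0 // gap_le // natrD.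
have kr : (0 : R) <= k%:R by [].
by rewrite !ger0_norm //; lra.
Qed.

(** Splits the exponent [b] among the rows in [S]. In use [c] exceeds 1, so the sum over the digits
    of each single row converges. *)
Lemma prod_gap_le (I : finType) (S : pred I) (G : I -> R) (y b c : R) :
  1 <= y -> 0 <= c -> c * #|S|%:R <= b -> (forall i, S i -> 0 < G i <= y) ->
  y `^ (- b) <= \prod_(i | S i) G i `^ (- c).
Proof.
move=> y1 c0 cb Gy; have y0 := lt_le_trans ltr01 y1.
apply: le_trans (_ : y `^ (- (c * #|S|%:R)) <= _).
  by rewrite ler_powR // lerN2.
rewrite -mulNr powRrM powR_mulrn ?powR_ge0 // -prodr_const.
apply: ler_prod => i Si; rewrite powR_ge0 /=.
by have /andP[G0 Gi] := Gy i Si; rewrite powRN_le.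
Qed.

Lemma family_sum_le (T : finType) M (Q : T -> pred 'I_M.+1) (S : pred T)
    (Phi : {ffun T -> 'I_M.+1} -> R)
    (g : T -> {ffun T -> 'I_M.+1} -> 'I_M.+1 -> R) (s : R) :
  (forall p m x, 0 <= g p m x) -> 0 <= s ->
  (forall p (m m' : {ffun T -> 'I_M.+1}), S p -> (forall q, ~~ S q -> m q = m' q) -> g p m =1 g p m') ->
  (forall p m, S p -> \sum_(x in Q p) g p m x <= s) ->
  (forall m, m \in family Q -> Phi m <= \prod_(p | S p) g p m (m p)) ->
  \sum_(m in family Q) Phi m <= s ^+ #|S| * \prod_(p | ~~ S p) #|Q p|%:R.
Proof.
move=> g0 s0 gind gs Phig.
pose mask (m : {ffun T -> 'I_M.+1}) := [ffun p => if S p then ord0 else m p].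
pose Q0 p : pred 'I_M.+1 := if S p then pred_of_simpl (pred1 ord0) else Q p.
have maskQ m : m \in family Q -> mask m \in family Q0.
  move=> /familyP mQ; apply/familyP => p; rewrite ffunE /Q0.
  by case: ifP => // _; rewrite inE.
rewrite (partition_big mask (fun m => m \in family Q0)) //=.
have inner m0 : m0 \in family Q0 ->
    \sum_(m in family Q | mask m == m0) Phi m <= s ^+ #|S|.
  move=> m0Q; pose Q1 p : pred 'I_M.+1 := if S p then Q p else pred_of_simpl (pred1 (m0 p)).
  pose h p x := if S p then g p m0 x else 1.
  have h0 p x : 0 <= h p x by rewrite /h; case: ifP.
  apply: le_trans (_ : \sum_(m in family Q1) \prod_p h p (m p) <= _).
    rewrite [leRHS](bigID (fun m => (m \in family Q) && (mask m == m0))) /=.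
    rewrite -[leLHS]addr0 lerD ?sumr_ge0 //; last by move=> m _; apply: prodr_ge0.
    rewrite [leRHS](eq_bigl (fun m => (m \in family Q) && (mask m == m0))); last first.
      move=> m; rewrite andb_idl // => /andP[/familyP mQ /eqP mm0].
      apply/familyP => p; rewrite /Q1; case: ifP => Sp; first exact: mQ.
      by rewrite inE -mm0 ffunE Sp.
    apply: ler_sum => m /andP[mQ /eqP mm0]; apply: le_trans (Phig m mQ) _.
    rewrite big_mkcond /=; apply: ler_prod => p _; rewrite /h; case: ifP => Sp; last by rewrite ler01 lexx.
    rewrite g0 /= (gind p m m0) // => q Sq; by rewrite -mm0 ffunE (negbTE Sq).
  rewrite -(bigA_distr_big_dep _ h) /=.
  apply: le_trans (_ : \prod_p (if S p then s else 1) <= _); last first.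
    by rewrite -big_mkcond /= prodr_const.
  apply: ler_prod => p _; rewrite sumr_ge0 //= /Q1 /h; case: ifP => Sp; first exact: gs.
  by rewrite big_pred1_eq.
apply: le_trans (ler_sum _ inner) _.
rewrite sumr_const -mulr_natr ler_wpM2l ?exprn_ge0 //.
have -> : #|family Q0|%:R = \prod_p #|Q0 p|%:R :> R.
  transitivity (\sum_(m in family Q0) \prod_(p : T) (1 : R)).
    by rewrite big1_eq sumr_const.
  rewrite -(bigA_distr_big_dep _ (fun _ _ => 1)) /=.
  by apply: eq_bigr => p _; rewrite sumr_const.
rewrite [leLHS](bigID S) /= [X in X * _]big1 ?mul1r.
  by apply: ler_prod => p Sp; rewrite ler0n /= /Q0 (negbTE Sp).
by move=> p Sp; rewrite /Q0 Sp card1.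
Qed.

End DiscreteSums.

(** * Negative powers of the norm summed over grids of unipotent matrices *)

Section GridSums.
Variables (R : realType) (n : nat) (lam : 'I_n -> R) (P : rel 'I_n).

(** The exponents are arbitrary because the estimates serve both the given flow, with [wlam], and
    the quotient flow, with [clam]. *)
Definition dmx (t : R) : 'M[R]_n := diag_mx (\row_i expR (lam i * t)).

Lemma dmxE t m (A : 'M[R]_(n, m)) i j : (dmx t *m A) i j = expR (lam i * t) * A i j.
Proof.
rewrite mxE (bigD1 i) //= !mxE eqxx mulr1n big1 ?addr0 // => k ki.
by rewrite !mxE eq_sym (negbTE ki) mulr0n mul0r.
Qed.

Lemma dmxEr t m (A : 'M[R]_(m, n)) i j : (A *m dmx t) i j = A i j * expR (lam j * t).
Proof.
rewrite mxE (bigD1 j) //= !mxE eqxx mulr1n big1 ?addr0 // => k kj.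
by rewrite !mxE (negbTE kj) mulr0n mulr0.
Qed.

Lemma dmxD s t : dmx (s + t) = dmx s *m dmx t.
Proof.
apply/matrixP => i j; rewrite dmxE !mxE mulrDr expRD.
by case: eqP => _; rewrite ?mulr1n // !mulr0n mulr0.
Qed.

Lemma dmx0 : dmx 0 = 1%:M.
Proof. by apply/matrixP => i j; rewrite !mxE mulr0 expR0. Qed.

Lemma dmxKl t : dmx (- t) *m dmx t = 1%:M.
Proof. by rewrite -dmxD addNr dmx0. Qed.

Lemma dmxKr t : dmx t *m dmx (- t) = 1%:M.
Proof. by rewrite -dmxD subrr dmx0. Qed.

Lemma dmx_unit t : dmx t \in unitmx.
Proof. by have [] := mulmx1_unit (dmxKr t). Qed.

(** Representatives of the time-[t] cells: conjugation by [dmx t] turns the mesh of each entry into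
    1. The offset [o] produces signed entries from natural digits. *)
Definition gridmx (t : R) (o : 'I_n * 'I_n -> R) M (m : {ffun 'I_n * 'I_n -> 'I_M.+1}) : 'M[R]_n :=
  \matrix_(i, j) if i == j then 1 else if P i j then
    ((m (i, j))%:R - o (i, j)) * expR (- ((lam i - lam j) * t)) else 0.

Hypothesis P_lt : forall i j, P i j -> (i < j)%N.

(** Maximizing [|v j 0| * A ^+ j] favours late coordinates: those after the pivot are smaller by a
    factor [A], at the price of [A ^+ n] against the norm. *)
Lemma pivot_exists (A : R) (v : 'cV[R]_n) : 1 <= A -> v != 0 ->
  exists j, [/\ 0 < `|v j 0|, mnorm v <= A ^+ n * `|v j 0| &
     forall l : 'I_n, (j < l)%N -> A * `|v l 0| <= `|v j 0|].
Proof.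
move=> A1 v0; have A0 := lt_le_trans ltr01 A1.
have [i [k vi]] := mnorm_attained v0; rewrite (ord1 k) in vi.
have [j _ jmax] := @arg_maxP _ _ _ i predT (fun j => `|v j 0| * A ^+ j) isT.
have jle l : `|v l 0| * A ^+ l <= `|v j 0| * A ^+ j by exact: jmax.
have le l : `|v l 0| <= A ^+ n * `|v j 0|.
  apply: le_trans (_ : `|v l 0| * A ^+ l <= _); first by rewrite ler_peMr // exprn_ege1.
  apply: le_trans (jle l) _; rewrite mulrC ler_wpM2r // ler_weXn2l // ltnW //.
exists j; split.
- rewrite lt_def normr_ge0 andbT; apply: contraTneq (mnorm_gt0 v0) => vj0.
  by rewrite vi -leNgt (le_trans (le i)) // vj0 mulr0.
- by rewrite vi.
- move=> l jl; rewrite -(ler_pM2r (exprn_gt0 j A0)); apply: le_trans (jle l).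
  rewrite mulrAC -exprS mulrC ler_wpM2l // ler_weXn2l //.
Qed.

(** For the pivot [j], coordinate [j] of the image stays of size [u], and each coordinate [i] with
    [P i j] runs through an arithmetic progression of step [u] as the digit (i, j) varies. Hence the
    power -b of the norm is summable over the digits of column [j], and the other digits are
    counted. The pivot depends on [v], whence the sum over [j]. *)
Lemma grid_sum (b e B : R) : 0 < b -> 0 < e -> 0 <= B ->
  (forall j, (1 + e) * #|[pred i | P i j]|%:R <= b) ->
  exists2 C, 0 < C & forall t o M (Q : 'I_n * 'I_n -> pred 'I_M.+1) (v : 'cV[R]_n),
    v != 0 ->
    (forall m, m \in family Q -> forall i j, P i j -> `|gridmx t o m i j| <= B) ->
    \sum_(m in family Q) mnorm (dmx t *m gridmx t o m *m v) `^ (- b) <=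
    C * mnorm v `^ (- b) * \sum_j (expR (- (b * lam j * t)) *
       \prod_(p | ~~ (P p.1 p.2 && (p.2 == j))) #|Q p|%:R).
Proof.
move=> b0 e0 B0 cardP.
pose A := 4 * n.+1%:R * (B + 1).
have n1 : 1 <= n.+1%:R :> R by rewrite ler1n.
have nA : n%:R * B <= A / 4.
  have -> : A / 4 = n.+1%:R * (B + 1) by rewrite /A; field.
  by rewrite ler_pM ?ler_nat // lerDl.
have A1 : 1 <= A.
  by rewrite /A -mulrA mulr_ege1 ?ler1n // mulr_ege1 // lerDr.
have A0 := lt_le_trans ltr01 A1.
pose S0 := 2 * (2 + e^-1).
have S1 : 1 <= S0.
  have : 0 <= e^-1 by rewrite invr_ge0 ltW.
  by rewrite /S0; lra.
have Ai0 : 0 <= A^-1 by rewrite invr_ge0 ltW.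
have S00 : 0 <= S0 by rewrite (le_trans _ S1).
exists ((2 * A ^+ n) `^ b * S0 ^+ (n * n)).
  by rewrite mulr_gt0 ?powR_gt0 ?mulr_gt0 ?exprn_gt0 // (lt_le_trans ltr01).
move=> t o M Q v v0 QB.
have [j [vj0 vvj vl]] := pivot_exists A1 v0.
pose s := expR (lam j * t) * v j 0; pose u := `|s|.
have uE : u = expR (lam j * t) * `|v j 0| by rewrite /u normrM (ger0_norm (expR_ge0 _)).
have u0 : 0 < u by rewrite uE mulr_gt0 ?expR_gt0.
have s0 : s != 0 by rewrite -normr_eq0 gt_eqF.
pose S : pred ('I_n * 'I_n) := fun p => P p.1 p.2 && (p.2 == j).
pose nm (m : {ffun 'I_n * 'I_n -> 'I_M.+1}) := mnorm (dmx t *m gridmx t o m *m v).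
(* Coordinate p.1 of the image is [s] times (digit + [xi]), where [xi] involves only digits of
   columns other than [j]; this is the independence that [family_sum_le] asks for. *)
pose xi (p : 'I_n * 'I_n) (m : {ffun 'I_n * 'I_n -> 'I_M.+1}) := 
  - o p + expR (lam p.1 * t) * (\sum_(l | l != j) gridmx t o m p.1 l * v l 0) / s.
have low m : m \in family Q -> u / 2 <= nm m.
  move=> mQ; apply: le_trans (mnorm_entry (dmx t *m gridmx t o m *m v) j 0).
  rewrite -mulmxA dmxE normrM (ger0_norm (expR_ge0 _)) uE -mulrA ler_wpM2l ?expR_ge0 //.
  rewrite mxE (bigD1 j) //= [gridmx _ _ _ _ _]mxE eqxx mul1r.
  have h : `|\sum_(i | i != j) gridmx t o m j i * v i 0| <= `|v j 0| / 4.
    apply: le_trans (ler_norm_sum _ _ _) _.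
    apply: le_trans (_ : \sum_(i | i != j) (B * (`|v j 0| / A)) <= _).
      apply: ler_sum => i ij; rewrite normrM.
      have [Pji|Pji] := boolP (P j i).
        apply: ler_pM => //; first exact: QB.
        by rewrite ler_pdivlMr // mulrC vl // P_lt.
      rewrite [gridmx _ _ _ _ _]mxE eq_sym (negbTE ij) (negbTE Pji) normr0 mul0r.
      by rewrite mulr_ge0 // divr_ge0 // ltW.
    rewrite sumr_const; apply: le_trans (_ : (B * (`|v j 0| / A)) *+ n <= _).
      rewrite ler_wpMn2l ?(mulr_ge0 B0 (mulr_ge0 (normr_ge0 _) Ai0)) //.
      by rewrite -[leqRHS]card_ord max_card.
    have -> : (B * (`|v j 0| / A)) *+ n = (n%:R * B) * (`|v j 0| / A) by rewrite -mulr_natl mulrA.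
    apply: le_trans (ler_wpM2r _ nA) _; first exact: mulr_ge0.
    have -> : A / 4 * (`|v j 0| / A) = `|v j 0| / 4 by field; rewrite gt_eqF.
    exact: lexx.
  have := lerB_normD (v j 0) (\sum_(i | i != j) gridmx t o m j i * v i 0).
  move: h; lra.
have grid (m : {ffun 'I_n * 'I_n -> 'I_M.+1}) p : S p -> u * `|(m p)%:R + xi p m| <= nm m.
  case: p => i k /andP[/= Pij /eqP kj]; rewrite kj in Pij *.
  apply: le_trans (mnorm_entry (dmx t *m gridmx t o m *m v) i 0).
  rewrite -mulmxA dmxE mxE (bigD1 j) //= [gridmx _ _ _ i j]mxE.
  have ij : i != j by have := P_lt Pij; apply: contraTneq => ->; rewrite ltnn.
  rewrite (negbTE ij) Pij /xi /=; move: (\sum_(_ < n | _) _) => Sg.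
  have ED : expR (lam i * t) * expR (- ((lam i - lam j) * t)) = expR (lam j * t).
    by rewrite -expRD; congr expR; ring.
  have -> : expR (lam i * t) *
      (((m (i, j))%:R - o (i, j)) * expR (- ((lam i - lam j) * t)) * v j 0 + Sg) =
      s * ((m (i, j))%:R + (- o (i, j) + expR (lam i * t) * Sg / s)).
    have -> : s * ((m (i, j))%:R + (- o (i, j) + expR (lam i * t) * Sg / s)) =
      s * ((m (i, j))%:R - o (i, j)) + expR (lam i * t) * Sg by field.
    by rewrite /s -ED; ring.
  by rewrite normrM.
pose y m := nm m / (u / 2).
have u20 : 0 < u / 2 by rewrite divr_gt0.
have y1 m : m \in family Q -> 1 <= y m by move=> mQ; rewrite ler_pdivlMr // mul1r low.
have Syle m p : m \in family Q -> S p -> 0 < gap ((m p)%:R + xi p m) <= y m.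
  move=> mQ Sp; rewrite gap_gt0 /gap ge_max y1 //= ler_pdivlMr //.
  have h := grid m p Sp; apply: le_trans h.
  rewrite mulrC ler_wpM2r //; lra.
have cardS : (1 + e) * #|S|%:R <= b.
  have -> : #|S| = #|[pred i | P i j]|; last exact: cardP.
  rewrite -[RHS](card_imset _ (f := fun i => (i, j))); last by move=> ? ? [].
  apply: eq_card => -[i k].
  apply/idP/imsetP => [/andP[/= Pij /eqP kj]|[i' Pi' [-> ->]]].
    by exists i; rewrite ?kj // inE -kj.
  by apply/andP; split=> //=; move: Pi'; rewrite inE.
have := @family_sum_le R _ M Q S (fun m => y m `^ (- b))
  (fun p m x => gap (x%:R + xi p m) `^ (- (1 + e))) S0.
move=> /(_ _ S00)-/(_ _) h.
have {}h : \sum_(m in family Q) y m `^ (- b) <= S0 ^+ #|S| * \prod_(p | ~~ S p) #|Q p|%:R.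
  apply: h.
  - by move=> *; exact: powR_ge0.
  - move=> [i k] m m' /andP[/= Pij /eqP kj] mm' x; congr (gap (_ + _) `^ _).
    rewrite /xi; congr (_ + _ * _ / _); apply: eq_bigr => l lj; congr (_ * _).
    rewrite !mxE; case: ifP => // _; case: ifP => // Pil.
    by rewrite mm' // /S /= negb_and lj orbT.
  - move=> p m Sp; apply: le_trans (sum_shift_powRN_le (xi p m) M.+1 e0).
    rewrite [leRHS](bigID (mem (Q p))) /= lerDl sumr_ge0 // => *; exact: powR_ge0.
  - move=> m mQ; apply: prod_gap_le => //; [exact: y1 | by rewrite addr_ge0 // ltW |].
    by move=> p Sp; exact: Syle.
have nmE m : m \in family Q -> nm m `^ (- b) = (u / 2) `^ (- b) * y m `^ (- b).
  move=> mQ; rewrite -powRM ?(ltW u20) // ?(le_trans _ (y1 m mQ)) //.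
  by rewrite /y mulrC divfK // gt_eqF.
rewrite (eq_bigr _ nmE) -mulr_sumr.
have ub : (u / 2) `^ (- b) <= (2 * A ^+ n) `^ b * mnorm v `^ (- b) * expR (- (b * lam j * t)).
  have vA : mnorm v / (A ^+ n) <= `|v j 0| by rewrite ler_pdivrMr ?exprn_gt0 // mulrC.
  have mv0 := mnorm_gt0 v0.
  apply: le_trans (_ : (expR (lam j * t) * (mnorm v / (2 * A ^+ n))) `^ (- b) <= _).
    apply: powRN_le; [exact: ltW| |].
      by rewrite mulr_gt0 ?expR_gt0 ?divr_gt0 // mulr_gt0 // exprn_gt0.
    rewrite uE -mulrA ler_wpM2l ?expR_ge0 // invfM mulrCA mulrC ler_wpM2r //.
  rewrite powRM ?expR_ge0 ?divr_ge0 ?mulr_ge0 ?mnorm_ge0 ?exprn_ge0 ?(ltW A0) //.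
  rewrite powRM ?mnorm_ge0 ?invr_ge0 ?mulr_ge0 ?exprn_ge0 ?(ltW A0) //.
  have W0 : 0 <= 2 * A ^+ n by rewrite mulr_ge0 // exprn_ge0 // ltW.
  have -> : (2 * A ^+ n)^-1 `^ (- b) = (2 * A ^+ n) `^ b.
    by rewrite -powR_inv1 // -powRrM mulN1r opprK.
  rewrite -expRM.
  rewrite (_ : lam j * t * - b = - (b * lam j * t)); last by ring.
  by rewrite le_eqVlt; apply/orP; left; apply/eqP; ring.
apply: le_trans (ler_pM (powR_ge0 _ _) _ ub h) _.
  by apply: sumr_ge0 => *; exact: powR_ge0.
rewrite (bigD1 j) //= mulrDr -[leLHS]addr0; apply: lerD; last first.
  rewrite !mulr_ge0 ?powR_ge0 ?exprn_ge0 //.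
  by apply: sumr_ge0 => k _; rewrite mulr_ge0 ?expR_ge0 // prodr_ge0.
pose Pr : R := \prod_(p | ~~ S p) #|Q p|%:R.
have Pr0 : 0 <= Pr by exact: prodr_ge0.
have SS : S0 ^+ #|S| <= S0 ^+ (n * n).
  by rewrite ler_weXn2l // (leq_trans (max_card _)) // card_prod !card_ord.
have -> : (2 * A ^+ n) `^ b * S0 ^+ (n * n) * mnorm v `^ (- b) * (expR (- (b * lam j * t)) * Pr)
  = ((2 * A ^+ n) `^ b * mnorm v `^ (- b) * expR (- (b * lam j * t))) * (S0 ^+ (n * n) * Pr) by ring.
apply: ler_wpM2l; first by rewrite !mulr_ge0 ?powR_ge0 ?expR_ge0.
by apply: ler_wpM2r.
Qed.

End GridSums.

Lemma sum_subseq_le (R : realType) (T : eqType) (s1 s2 : seq T) (F : T -> R) :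
  uniq s1 -> uniq s2 -> {subset s1 <= s2} -> (forall x, 0 <= F x) ->
  \sum_(x <- s1) F x <= \sum_(x <- s2) F x.
Proof.
move=> u1 u2 s12 F0; rewrite [leRHS](bigID (mem s1)) /=.
have -> : \sum_(x <- s2 | x \in s1) F x = \sum_(x <- s1) F x.
  rewrite -big_filter; apply: perm_big; apply: uniq_perm; rewrite ?filter_uniq // => x.
  by rewrite mem_filter; apply: andb_idr => xs; exact: s12.
by rewrite lerDl sumr_ge0.
Qed.

(** * The height of a lattice *)

Section HeightSum.
Variables (R : realType) (n : nat).
Implicit Types g : 'M[R]_n.

Definition short_set g (r : R) : set 'cV[int]_n :=
  [set z | z != 0 /\ mnorm (g *m intmx z) <= r].

Definition short g r : seq 'cV[int]_n := finmap.enum_fset (fset_set (short_set g r)).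

Lemma short_uniq g r : uniq (short g r).
Proof. exact: finmap.fset_uniq. Qed.

Lemma short_finite g r : g \in unitmx -> finite_set (short_set g r).
Proof.
move=> gu; have [N HN] := lattice_finite r gu.
apply: (@sub_finite_set _ _ [set` codom (ivec (n := n) (N := N))]); last exact: finite_seq.
by move=> z [_ /HN[m <-]] /=; exact: codom_f.
Qed.

Lemma mem_short g r z : g \in unitmx ->
  (z \in short g r) = (z != 0) && (mnorm (g *m intmx z) <= r).
Proof.
move=> gu; rewrite /short in_fset_set; last exact: short_finite.
by apply/idP/andP => [/set_mem|h]; last exact/mem_set.
Qed.

(* The height of the lattice [g Z^n]; it is of size at least one when the lattice
   has a short vector, and the flow contracts its average over unipotent translates. *)
Definition hsum (b : R) g : R := \sum_(z <- short g 1) mnorm (g *m intmx z) `^ (- b).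

Lemma hsum_ge0 b g : 0 <= hsum b g.
Proof. by apply: sumr_ge0 => z _; exact: powR_ge0. Qed.

Lemma hsum_ge b g (z : 'cV[int]_n) : g \in unitmx -> z != 0 ->
  mnorm (g *m intmx z) <= 1 -> mnorm (g *m intmx z) `^ (- b) <= hsum b g.
Proof.
move=> gu z0 z1; rewrite /hsum (big_rem z) /=; last by rewrite mem_short // z0.
by rewrite lerDl sumr_ge0 // => *; exact: powR_ge0.
Qed.

(** Vectors that are short after the step had norm at most [r] before it. Those of norm at most 1
    give the height of [g]; those between 1 and [r] contribute at most [D] each, which explains the
    count. *)
Lemma hsum_step (b D r : R) (I : finType) (S : pred I) (k : I -> 'M[R]_n) g :
  g \in unitmx -> 0 <= b -> 0 <= D -> 1 <= r ->
  (forall i, S i -> k i \in unitmx) ->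
  (forall i (z : 'cV[int]_n), S i -> mnorm (k i *m g *m intmx z) <= 1 -> mnorm (g *m intmx z) <= r) ->
  (forall v : 'cV[R]_n, v != 0 ->
     \sum_(i | S i) mnorm (k i *m v) `^ (- b) <= D * mnorm v `^ (- b)) ->
  \sum_(i | S i) hsum b (k i *m g) <= D * (hsum b g + (size (short g r))%:R).
Proof.
move=> gu b0 D0 r1 ku kr kD.
apply: le_trans (_ : \sum_(i | S i) \sum_(z <- short g r) mnorm (k i *m (g *m intmx z)) `^ (- b) <= _).
  apply: ler_sum => i Si; rewrite /hsum; under eq_bigr do rewrite -mulmxA.
  have kgu : k i *m g \in unitmx by rewrite unitmx_mul ku.
  apply: sum_subseq_le; rewrite ?short_uniq // => z; last exact: powR_ge0.
  by rewrite !mem_short // => /andP[-> /(kr i z Si)].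
rewrite exchange_big /=.
apply: le_trans (_ : \sum_(z <- short g r) D * mnorm (g *m intmx z) `^ (- b) <= _).
  rewrite !big_seq; apply: ler_sum => z; rewrite mem_short // => /andP[z0 _].
  by apply: kD; exact: gz_neq0.
rewrite -mulr_sumr ler_wpM2l // (bigID (fun z => mnorm (g *m intmx z) <= 1)) /=.
apply: lerD.
  rewrite -big_filter; apply: sum_subseq_le; rewrite ?filter_uniq ?short_uniq //.
    by move=> z; rewrite mem_filter !mem_short // => /andP[-> /andP[->]].
  by move=> z; exact: powR_ge0.
apply: le_trans (_ : \sum_(z <- short g r) 1 <= _); last first.
  by rewrite big_const_seq count_predT iter_addr_0.
rewrite [leLHS]big_mkcond /=; apply: ler_sum => z _; case: ifP => //.
rewrite -ltNge => z1; apply: le_trans (powRN_le b0 ltr01 (ltW z1)) _.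
by rewrite powR1.
Qed.

End HeightSum.

Section HeightSumUnimodular.
Variables (R : realType) (n : nat).
Implicit Types g : 'M[R]_n.+1.

Lemma unit_of_det1 m (g : 'M[R]_m) : `|\det g| = 1 -> g \in unitmx.
Proof. by move=> g1; rewrite unitmxE unitfE -normr_eq0 g1 oner_eq0. Qed.

(** With shortest length [t], packing allows [C / t ^+ n] vectors while the shortest one alone
    contributes the power -b of [t] to the height; since b > n the latter wins for [t <= c]. *)
Lemma short_count_le (b r : R) : n%:R < b -> 1 <= r -> exists2 l0 : R, 0 < l0 <= 1 &
  forall g, `|\det g| = 1 ->
    (exists2 z : 'cV[int]_n.+1, z != 0 & mnorm (g *m intmx z) <= l0) ->
    (size (short g r))%:R <= hsum b g.
Proof.
move=> nb r1; have [C [l [C0 l0 pack]]] := packing n r1.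
have bn0 : 0 < b - n%:R by rewrite subr_gt0.
pose c := C `^ (- (b - n%:R)^-1).
have c0 : 0 < c by rewrite powR_gt0.
exists (Num.min 1 (Num.min l c)); first by rewrite !lt_min ltr01 l0 c0 ge_min lexx.
move=> g g1 [z z0]; rewrite !le_min => /and3P[z1 zl zc].
have gu := unit_of_det1 g1.
have [y y0 ymin] := shortest_vector gu.
set t := mnorm (g *m intmx y) in ymin.
have t0 : 0 < t by rewrite mnorm_gt0 // gz_neq0.
have tz := ymin _ z0.
have tl : 0 < t <= l by rewrite t0 (le_trans tz zl).
have ty : exists2 x : 'cV[int]_n.+1, x != 0 & mnorm (g *m intmx x) <= t by exists y.
have [s sC ss] := pack g t g1 tl ymin ty.
apply: le_trans (_ : (size s)%:R <= _).
  rewrite ler_nat; apply: uniq_leq_size; first exact: short_uniq.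
  by move=> x; rewrite mem_short // => /andP[_]; exact: ss.
apply: le_trans sC _.
apply: le_trans (hsum_ge b gu y0 (le_trans tz z1)).
rewrite -/t ler_pdivrMr ?exprn_gt0 // -powR_mulrn ?(ltW t0) // -powRD; last by rewrite (gt_eqF t0) implybT.
have -> : - b + n%:R = - (b - n%:R) by rewrite opprB addrC.
have tc : t <= c := le_trans tz zc.
apply: le_trans (powRN_le (ltW bn0) t0 tc).
by rewrite /c -powRrM mulrNN mulVf ?gt_eqF // powRr1 // ltW.
Qed.

(** Away from the cusp there is a bounded basis, and Cramer bounds the coefficients of all short
    vectors in it. *)
Lemma hsum_bounded (b d : R) : 0 <= b -> 0 < d -> exists2 B : R, 0 < B &
  forall g, `|\det g| = 1 -> lattice_ge g d -> hsum b g <= B.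
Proof.
move=> b0 d0; pose K : R := 2 ^+ (n.+1 * n.+1) * 1 / d ^+ n.
have K0 : 0 < K by rewrite divr_gt0 ?exprn_gt0 // mulr1 exprn_gt0.
pose Y : R := (n.+1`!)%:R * K ^+ n; pose N := Num.trunc Y.
have Y0 : 0 <= Y by rewrite mulr_ge0 // exprn_ge0 // ltW.
exists (((N.*2.+1) ^ n.+1)%N%:R * d `^ (- b)).
  by rewrite mulr_gt0 ?powR_gt0 // ltr0n expn_gt0.
move=> g g1 gd; have gu := unit_of_det1 g1.
have [c cu cK] := bounded_basis gu d0 gd; rewrite g1 -/K in cK.
apply: le_trans (_ : \sum_(z <- short g 1) d `^ (- b) <= _).
  rewrite /hsum !big_seq; apply: ler_sum => z; rewrite mem_short // => /andP[z0 _].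
  by apply: powRN_le => //; exact: gd.
rewrite big_const_seq count_predT iter_addr_0 -[leLHS]mulr_natl ler_wpM2r ?powR_ge0 // ler_nat.
pose s := [seq c *m ivec (N := N) m | m : {ffun 'I_n.+1 -> 'I_N.*2.+1}].
apply: leq_trans (_ : size s <= _)%N; last by rewrite size_map -cardE card_ffun !card_ord.
apply: uniq_leq_size; first exact: short_uniq.
move=> z; rewrite mem_short // => /andP[z0 z1].
have [q qE] : exists q, ivec (N := N) q = invmx c *m z.
  apply: ivecP => i; have [k kE] : exists k : nat, `|(invmx c *m z) i 0| = k%:Z.
    by exists `|((invmx c *m z) i 0)%R|%N; rewrite abszE.
  rewrite kE lez_nat truncn_ge_nat // pmulrn -kE intr_norm.
  have := cramer_bound (g *m intmx c) (intmx (invmx c *m z)) i.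
  rewrite det_mulmx normrM g1 (proj1 (unit_intmx R cu)) !mulr1 -mulmxA -map_mxM mulKVmx // mxE.
  move/le_trans; apply; rewrite ler_wpM2l // -[leRHS]mul1r ler_pM ?mnorm_ge0 ?prodr_ge0 //.
    by move=> *; exact: mnorm_ge0.
  rewrite -[n]/(n.+1.-1) -[in K ^+ _](card_ord n.+1) -(cardC1 i) -prodr_const.
  by apply: ler_prod => j _; rewrite mnorm_ge0 cK.
apply/mapP; exists q; rewrite ?mem_enum // qE mulKVmx //.
Qed.

End HeightSumUnimodular.

(** * The unipotent group and its division into cells *)

Section UnipotentGroup.
Variables (R : realType) (n : nat) (lam : 'I_n -> R).
Hypothesis lam_mono : forall i j : 'I_n, (i <= j)%N -> lam j <= lam i.

Definition expands : rel 'I_n := [rel i j | lam j < lam i].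

Definition unip (h : 'M[R]_n) := forall i j, ~~ expands i j -> h i j = (i == j)%:R.

Definition box (N : R) (h : 'M[R]_n) := unip h /\ forall i j, expands i j -> `|h i j| <= N.

Lemma expands_lt i j : expands i j -> (i < j)%N.
Proof. by rewrite ltnNge => ij; apply: contraL ij => /lam_mono; rewrite /= -leNgt. Qed.

Lemma expands_irr i : expands i i = false. Proof. exact: ltxx. Qed.

Lemma expands_trans i j k : expands i j -> expands j k -> expands i k.
Proof. by move=> /= ij jk; exact: lt_trans jk ij. Qed.

Lemma expands_gap : exists2 r, 0 < r & forall i j, expands i j -> r <= lam i - lam j.
Proof.
exists (\big[Num.min/1]_(p : 'I_n * 'I_n | expands p.1 p.2) (lam p.1 - lam p.2)).
  by apply: lt_bigmin => // p; rewrite subr_gt0.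
by move=> i j ij; apply: (bigmin_le_cond _ (fun p : 'I_n * 'I_n => lam p.1 - lam p.2) (j := (i, j))).
Qed.

Lemma unip_det h : unip h -> \det h = 1.
Proof.
move=> hu; rewrite -det_tr det_trig; last first.
  apply/is_trig_mxP => i j ij; rewrite mxE hu; last first.
    by apply/negP => /expands_lt; rewrite ltnNge ltnW.
  by rewrite (_ : (j == i) = false) //; apply/eqP => e; rewrite e ltnn in ij.
by rewrite big1 // => i _; rewrite mxE hu ?expands_irr // eqxx.
Qed.

Lemma unip_unit h : unip h -> h \in unitmx.
Proof. by move=> hu; rewrite unitmxE unip_det // unitr1. Qed.

Lemma unip_conj h t : unip h -> unip (dmx lam t *m h *m dmx lam (- t)).
Proof.
move=> hu i j ij; rewrite dmxEr dmxE hu //; case: eqP => [->|_]; last by rewrite !mulr0 mul0r.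
by rewrite mulr1 -expRD mulrN subrr expR0.
Qed.

Lemma unip_norm N h i j : 1 <= N -> box N h -> `|h i j| <= N.
Proof.
move=> N1 [hu hN]; have [ij|ij] := boolP (expands i j); first exact: hN.
by rewrite hu // normr_nat; apply: le_trans N1; rewrite lern1; case: (i == j).
Qed.

Lemma unip_inv_bound N : 1 <= N -> exists2 K, 0 < K &
  forall h, box N h -> mnorm (invmx h) <= K.
Proof.
move=> N1; have N0 := lt_le_trans ltr01 N1.
exists ((n.-1`!)%:R * N ^+ n.-1) => [|h hN].
  by rewrite mulr_gt0 ?exprn_gt0 // ltr0n fact_gt0.
have [hu _] := hN; apply: mnorm_le => [|i j]; first by rewrite mulr_ge0 // exprn_ge0 // ltW.
rewrite /invmx unip_unit // unip_det // invr1 scale1r mxE /cofactor normrM normrX normrN1.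
rewrite expr1n mul1r; apply: le_trans (det_le_colnorm _) _; rewrite ler_wpM2l //.
rewrite -[X in N ^+ X]card_ord -prodr_const; apply: ler_prod => k _; rewrite mnorm_ge0 /=.
apply: mnorm_le => [|p q]; first exact: ltW.
by rewrite !mxE unip_norm.
Qed.

(** The total expansion rate, not a dimension: a box meets about e^(hdim t) cells of time t. *)
Definition hdim : R := \sum_(p : 'I_n * 'I_n | expands p.1 p.2) (lam p.1 - lam p.2).

Lemma unip_mid (C K : 'M[R]_n) i j : unip C -> unip K -> expands i j ->
  (C *m K) i j = C i j + K i j + \sum_(l | expands i l && expands l j) C i l * K l j.
Proof.
move=> Cu Ku ij; have ij' : i != j by apply: contraTneq ij => ->; rewrite expands_irr.
rewrite mxE (bigD1 i) //= (bigD1 j) /=; last by rewrite eq_sym.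
rewrite [C i i]Cu ?expands_irr // [K j j]Ku ?expands_irr // !eqxx mul1r mulr1.
rewrite addrCA addrA; congr (_ + _).
rewrite (bigID (fun l => expands i l && expands l j)) /= addrC big1 ?add0r.
  apply: eq_bigl => l; apply: andb_idl => /andP[il lj].
  apply/andP; split; first by apply: contraTneq il => ->; rewrite expands_irr.
  by apply: contraTneq lj => ->; rewrite expands_irr.
move=> l /andP[/andP[li lj]]; rewrite negb_and => /orP[nil|nlj].
  by rewrite Cu // eq_sym (negbTE li) mul0r.
by rewrite Ku // (negbTE lj) mulr0.
Qed.

Lemma unipM C K : unip C -> unip K -> unip (C *m K).
Proof.
move=> Cu Ku i j ij; rewrite mxE (bigD1 i) //= big1.
  rewrite [C i i]Cu ?expands_irr // eqxx mul1r addr0; exact: Ku.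
move=> l li; have [il|il] := boolP (expands i l); last by rewrite Cu // eq_sym (negbTE li) mul0r.
rewrite Ku; last by apply: contra ij => /(expands_trans il).
rewrite (_ : (l == j) = false) ?mulr0 //; apply/eqP => lj.
by move: ij; rewrite -lj il.
Qed.

(* Entries are chosen by induction on [j - i]: the products in entry [(i, j)]
   only involve entries closer to the diagonal. *)
Lemma grid_decomposition N t h : 1 <= N -> box N h -> 0 <= t ->
  (forall i j, expands i j -> n%:R * (expR (- ((lam i - lam j) * t)) * (N + 2)) <= 1) ->
  exists (m : 'I_n -> 'I_n -> int) (C K : 'M[R]_n),
    [/\ h = C *m K, unip C, unip K &
     forall i j, expands i j ->
     [/\ 0 <= C i j <= expR (- ((lam i - lam j) * t)),
         K i j = (m i j)%:~R * expR (- ((lam i - lam j) * t)) & `|K i j| <= N + 2]].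
Proof.
move=> N1 [hu hN] t0 small.
pose E i j := expR (- ((lam i - lam j) * t)).
have E0 i j : 0 < E i j by exact: expR_gt0.
have E1 i j : expands i j -> E i j <= 1.
  by move=> ij; rewrite /E -[1]expR0 ler_expR oppr_le0 mulr_ge0 // subr_ge0 ltW.
have N20 : 0 <= N + 2 by rewrite addr_ge0 // (le_trans _ N1).
pose good L (m : 'I_n -> 'I_n -> int) (c : 'I_n -> 'I_n -> R) :=
  forall i j, expands i j -> (j - i <= L)%N ->
    [/\ 0 <= c i j <= E i j, `|(m i j)%:~R * E i j| <= N + 2 &
      c i j + (m i j)%:~R * E i j +
      \sum_(l | expands i l && expands l j) c i l * ((m l j)%:~R * E l j) = h i j].
have [m [c good_n]] : exists m c, good n m c.
  suff: forall L, exists m c, good L m c by apply.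
  elim=> [|L [m [c mc]]].
    exists (fun _ _ => 0), (fun _ _ => 0) => i j /expands_lt ij.
    by rewrite leqn0 subn_eq0 leqNgt ij.
  pose x i j := h i j - \sum_(l | expands i l && expands l j) c i l * ((m l j)%:~R * E l j).
  (* At distance [L.+1] the remainder [x] is already determined; its integer part in units of [E] is
     the digit, and what is left is the entry of [C]. *)
  pose m' (i j : 'I_n) := if (j - i <= L)%N then m i j else Num.floor (x i j / E i j).
  pose c' (i j : 'I_n) := if (j - i <= L)%N then c i j else x i j - (m' i j)%:~R * E i j.
  have mid (i j : 'I_n) : expands i j -> (j - i <= L.+1)%N ->
      forall l, expands i l && expands l j ->
      [/\ (l - i <= L)%N, (j - l <= L)%N, c' i l = c i l & m' l j = m l j].
    move=> ij ijL l /andP[/expands_lt il /expands_lt lj].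
    have a : (l - i <= L)%N by lia.
    have b : (j - l <= L)%N by lia.
    by split=> //; rewrite /c' /m' ?a ?b.
  have sumE (i j : 'I_n) : expands i j -> (j - i <= L.+1)%N ->
    \sum_(l | expands i l && expands l j) c' i l * ((m' l j)%:~R * E l j) =
    \sum_(l | expands i l && expands l j) c i l * ((m l j)%:~R * E l j).
    by move=> ij ijL; apply: eq_bigr => l /(mid _ _ ij ijL)[_ _ -> ->].
  exists m', c' => i j ij ijL; rewrite sumE //.
  have [ijL'|ijL'] := leqP (j - i) L.
    by rewrite /c' /m' ijL'; exact: mc.
  have nL : (j - i <= L)%N = false by rewrite leqNgt ijL'.
  rewrite /c' nL /m' nL.
  have /andP[f1 f2] := floor_itv (x i j / E i j); set q := Num.floor _ in f1 f2 *.
  have fE1 : q%:~R * E i j <= x i j by rewrite -ler_pdivlMr.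
  have fE2 : x i j < q%:~R * E i j + E i j.
    by move: f2; rewrite intrD ltr_pdivrMr // mulrDl mul1r.
  (* The hypothesis [small] keeps this correction below 1, so the remainder is at most [N + 1] and
     its rounding at most [N + 2]. *)
  have sum1 : `|\sum_(l | expands i l && expands l j) c i l * ((m l j)%:~R * E l j)| <= 1.
    apply: le_trans (ler_norm_sum _ _ _) _.
    apply: le_trans (_ : \sum_(l | expands i l && expands l j) n%:R^-1 <= _).
      apply: ler_sum => l ilj; have [a b _ _] := mid _ _ ij ijL l ilj.
      have /andP[il lj] := ilj.
      have [/andP[c0 cE] _ _] := mc _ _ il a; have [_ mN _] := mc _ _ lj b.
      rewrite normrM (ger0_norm c0).
      have n0 : 0 < n%:R :> R by rewrite ltr0n (leq_ltn_trans _ (ltn_ord i)).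
      apply: le_trans (ler_pM c0 (normr_ge0 _) cE mN) _.
      by rewrite -[leRHS]mul1r ler_pdivlMr // mulrC; exact: small.
    rewrite sumr_const -[leLHS]mulr_natr.
    have n0 : 0 < n%:R :> R by rewrite ltr0n (leq_ltn_trans _ (ltn_ord i)).
    rewrite mulrC ler_pdivrMr // mul1r ler_nat -[X in (_ <= X)%N](card_ord n) max_card //.
  have xN : `|x i j| <= N + 1.
    by rewrite (le_trans (ler_normB _ _)) // lerD // hN.
  split.
  - by apply/andP; split; lra.
  - move: xN (E1 _ _ ij); rewrite !ler_norml => /andP[? ?] ?; apply/andP; split; lra.
  - by rewrite subrK /x subrK.
pose C : 'M[R]_n := \matrix_(i, j) if expands i j then c i j else (i == j)%:R.
pose K : 'M[R]_n := \matrix_(i, j) if expands i j then (m i j)%:~R * E i j else (i == j)%:R.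
have Cu : unip C by move=> i j /negbTE ij; rewrite mxE ij.
have Ku : unip K by move=> i j /negbTE ij; rewrite mxE ij.
have ijn (i j : 'I_n) : (j - i <= n)%N by rewrite (leq_trans (leq_subr _ _)) // ltnW.
exists m, C, K; split=> //.
  apply/matrixP => i j; have [ij|ij] := boolP (expands i j); last first.
    by rewrite hu // (unipM Cu Ku).
  have [_ _ <-] := good_n i j ij (ijn i j).
  rewrite unip_mid // !mxE ij; congr (_ + _); apply: eq_bigr => l /andP[il lj].
  by rewrite !mxE il lj.
move=> i j ij; have [a b _] := good_n i j ij (ijn i j).
by rewrite !mxE ij; split.
Qed.

End UnipotentGroup.

(** * Contraction of the height by the weighted flow, and covers by cells *)

Section WeightedContraction.
Variables (R : realType) (d : nat) (w : 'I_d -> R).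
Hypothesis d0 : (0 < d)%N.
Hypothesis w_gt0 : forall i, 0 < w i.
Hypothesis w_sum1 : \sum_(i < d) w i = 1.
Hypothesis w_noninc : forall i j : 'I_d, (i <= j)%N -> w j <= w i.

Definition wlam (i : 'I_d.+1) : R := oapp w (-1) (unlift ord_max i).

Lemma wlam_max : wlam ord_max = -1. Proof. by rewrite /wlam unlift_none. Qed.
Lemma wlam_lift i : wlam (lift ord_max i) = w i. Proof. by rewrite /wlam liftK. Qed.

Lemma wlam_mono (i j : 'I_d.+1) : (i <= j)%N -> wlam j <= wlam i.
Proof.
case: (unliftP ord_max j) => [j'|] ->; case: (unliftP ord_max i) => [i'|] ->;
  rewrite ?wlam_lift ?wlam_max //.
- by rewrite !lift_max; exact: w_noninc.
- by rewrite lift_max /= => h; have := ltn_ord j'; rewrite ltnNge h.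
- by move=> _; rewrite (le_trans _ (ltW (w_gt0 _))) // oppr_le0.
Qed.

Lemma wlam_ge i : -1 <= wlam i.
Proof.
case: (unliftP ord_max i) => [i'|] ->; rewrite ?wlam_lift ?wlam_max //.
by rewrite (le_trans _ (ltW (w_gt0 _))) // oppr_le0.
Qed.

(** Extending the sum to all the weights [w i] adds only nonpositive terms, and the weights sum to
    1. This is the origin of the gain 1 in the exponent of [grid_contraction]. *)
Lemma drop_ge j :
  1 - d%:R * wlam j <= \sum_(i | expands wlam i j) (wlam i - wlam j).
Proof.
rewrite big_mkcond big_ord_recr /=.
have wl i : wlam (widen_ord (leqnSn d) i) = w i.
  rewrite -wlam_lift; congr wlam; apply: val_inj.
  by rewrite /= /bump leqNgt ltn_ord.
rewrite -[leLHS]addr0; apply: lerD; last first.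
  by case: ifP => // h; rewrite subr_ge0 ltW.
apply: le_trans (_ : \sum_(i < d) (w i - wlam j) <= _).
  by rewrite big_split /= w_sum1 sumr_const card_ord mulNrn -[wlam j *+ _]mulr_natl.
apply: ler_sum => i _; rewrite wl; case: ifP => // /negbT.
by rewrite /expands /= -leNgt wl subr_le0.
Qed.

Lemma card_expands j : (#|[pred i | expands wlam i j]| <= d)%N.
Proof.
apply: leq_trans (_ : #|predC1 j| <= _)%N; last by rewrite cardC1 card_ord.
apply: subset_leq_card; apply/fintype.subsetP => i; rewrite !inE => ij.
by apply: contraTneq ij => ->; rewrite expands_irr.
Qed.

Lemma card_ord_le M a : (a <= M)%N -> #|[pred x : 'I_M.+1 | (x <= a)%N]| = a.+1.
Proof.
move=> aM; rewrite -sum1_card (eq_bigl (fun x : 'I_M.+1 => (x < a.+1)%N)) //.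
by rewrite -(big_ord_widen M.+1 (fun _ => 1%N)) // sum1_card card_ord.
Qed.

(** Recentres the signed digits, whose entries are at most [N + 2] by [grid_decomposition]. The
    common bound [gsize] puts the digits of all entries in one finite type. *)
Definition goff (N t : R) (p : 'I_d.+1 * 'I_d.+1) : nat :=
  (Num.trunc ((N + 2) * expR ((wlam p.1 - wlam p.2) * t))).+1.
Definition gsize (N t : R) : nat := \sum_p (goff N t p).*2.
Definition gdigits (N t : R) (p : 'I_d.+1 * 'I_d.+1) : pred 'I_(gsize N t).+1 :=
  fun x => if expands wlam p.1 p.2 then (x <= (goff N t p).*2)%N else x == ord0.
Arguments gdigits N t p : clear implicits.

Definition gmx (N t : R) (m : {ffun 'I_d.+1 * 'I_d.+1 -> 'I_(gsize N t).+1}) : 'M[R]_d.+1 :=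
  gridmx wlam (expands wlam) t (fun p => (goff N t p)%:R) m.
Arguments gmx N t m : clear implicits.

Lemma goff_le_size N t p : ((goff N t p).*2 <= gsize N t)%N.
Proof. by rewrite /gsize (bigD1 p) //= leq_addr. Qed.

Lemma gmx_unip N t m : unip wlam (gmx N t m).
Proof. by move=> i j /negbTE ij; rewrite mxE ij; case: ifP. Qed.

Lemma card_gdigits N t p : 1 <= N -> 0 <= t ->
  #|gdigits N t p|%:R <= if expands wlam p.1 p.2
     then (2 * N + 7) * expR ((wlam p.1 - wlam p.2) * t) else 1.
Proof.
move=> N1 t0; case: ifP => pe; last first.
  have -> : #|gdigits N t p| = #|pred1 (ord0 : 'I_(gsize N t).+1)|.
    by apply: eq_card => x; rewrite !unfold_in /gdigits pe.
  by rewrite card1.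
rewrite (_ : #|gdigits N t p| = (goff N t p).*2.+1); last first.
  rewrite -(card_ord_le (goff_le_size N t p)); apply: eq_card => x.
  by rewrite !unfold_in /gdigits pe.
set E := expR _.
have E1 : 1 <= E by rewrite /E -[1]expR0 ler_expR mulr_ge0 // subr_ge0 ltW.
have NE0 : 0 <= (N + 2) * E by rewrite mulr_ge0 ?expR_ge0 // addr_ge0 // (le_trans _ N1).
have h : (Num.trunc ((N + 2) * E))%:R <= (N + 2) * E by rewrite truncn_le.
rewrite /goff -/E -addn1 -muln2 natrD natrM -addn1 natrD.
move: h E1; nra.
Qed.

(** With pivot [j] the exponent is [hdim] minus the rate of column [j] minus [b * wlam j]. By
    [drop_ge] this is at most hdim - 1 - (b - d) * wlam j, and [wlam j >= -1]. *)
Lemma grid_contraction (N b : R) : 1 <= N -> d%:R < b -> exists2 C, 0 < C & forall t, 0 <= t ->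
  forall v : 'cV[R]_d.+1, v != 0 ->
  \sum_(m in family (gdigits N t)) mnorm (dmx wlam t *m gmx N t m *m v) `^ (- b) <=
  C * expR ((hdim wlam - 1 + (b - d%:R)) * t) * mnorm v `^ (- b).
Proof.
move=> N1 db; have dr0 : 0 < d%:R :> R by rewrite ltr0n.
have b0 : 0 < b := lt_trans dr0 db.
have e0 : 0 < b / d%:R - 1 by rewrite subr_gt0 ltr_pdivlMr // mul1r.
have cardP j : (1 + (b / d%:R - 1)) * #|[pred i | expands wlam i j]|%:R <= b.
  rewrite addrC subrK; apply: le_trans (_ : b / d%:R * d%:R <= _); last by rewrite divfK // gt_eqF.
  by rewrite ler_wpM2l ?divr_ge0 ?(ltW b0) // ler_nat card_expands.
have N30 : 0 <= N + 3 by rewrite addr_ge0 // (le_trans _ N1).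
have [C C0 HC] := grid_sum wlam (expands_lt wlam_mono) b0 e0 N30 cardP.
pose C1 := 2 * N + 7; have C11 : 1 <= C1 by rewrite /C1; lra.
have C10 := lt_le_trans ltr01 C11.
exists (C * (d.+1%:R * C1 ^+ (d.+1 * d.+1))).
  by rewrite !mulr_gt0 ?exprn_gt0.
move=> t t0 v v0.
apply: le_trans (HC t _ _ (gdigits N t) v v0 _) _.
  move=> m /familyP mQ i j ij; rewrite mxE (negbTE (_ : i != j)); last first.
    by apply: contraTneq ij => ->; rewrite expands_irr.
  rewrite ij; have := mQ (i, j); rewrite unfold_in /gdigits /= ij => mij.
  set E := expR _; have E0 : 0 < E by exact: expR_gt0.
  have EE : expR ((wlam i - wlam j) * t) * E = 1 by rewrite -expRD subrr expR0.
  have E1 : E <= 1 by rewrite /E -[1]expR0 ler_expR oppr_le0 mulr_ge0 // subr_ge0 ltW.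
  have NE0 : 0 <= (N + 2) * expR ((wlam i - wlam j) * t).
    by rewrite mulr_ge0 ?expR_ge0 // addr_ge0 // (le_trans _ N1).
  have oE : (goff N t (i, j))%:R * E <= N + 3.
    rewrite /goff -addn1 natrD mulrDl mul1r /=.
    apply: le_trans (_ : ((N + 2) * expR ((wlam i - wlam j) * t)) * E + 1 <= _).
      by rewrite lerD // ler_wpM2r ?(ltW E0) // truncn_le.
    by rewrite -mulrA EE; lra.
  rewrite normrM (gtr0_norm E0); apply: le_trans oE; rewrite ler_wpM2r ?(ltW E0) //.
  have : (m (i, j))%:R <= 2 * (goff N t (i, j))%:R :> R by rewrite -natrM ler_nat mul2n.
  by have : 0 <= (m (i, j))%:R :> R by []; rewrite ler_norml => *; apply/andP; split; lra.
set mv := mnorm v `^ _.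
have mv0 : 0 <= mv by exact: powR_ge0.
have -> : C * (d.+1%:R * C1 ^+ (d.+1 * d.+1)) * expR ((hdim wlam - 1 + (b - d%:R)) * t) * mv =
  C * mv * \sum_(j < d.+1) (C1 ^+ (d.+1 * d.+1) * expR ((hdim wlam - 1 + (b - d%:R)) * t)).
  by rewrite sumr_const card_ord -mulr_natl; ring.
apply: ler_wpM2l; first by rewrite mulr_ge0 // ltW.
apply: ler_sum => j _; pose S (p : 'I_d.+1 * 'I_d.+1) := expands wlam p.1 p.2 && (p.2 == j).
pose rho (p : 'I_d.+1 * 'I_d.+1) := wlam p.1 - wlam p.2.
pose P (p : 'I_d.+1 * 'I_d.+1) := expands wlam p.1 p.2.
have hS : \sum_(p | S p) rho p = \sum_(i | expands wlam i j) (wlam i - wlam j).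
  rewrite big_mkcond -(pair_bigA _ (fun i k => if S (i, k) then rho (i, k) else 0)) /=.
  rewrite [RHS]big_mkcond; apply: eq_bigr => i _.
  rewrite (bigD1 j) //= /S /= eqxx andbT big1 ?addr0 // => k kj.
  by rewrite (negbTE kj) andbF.
have hE : hdim wlam = \sum_(p | S p) rho p + \sum_(p | ~~ S p && P p) rho p.
  rewrite /hdim (bigID S) /=; congr (_ + _); apply: eq_bigl => p.
    by rewrite andb_idl // => /andP[].
  by rewrite andbC.
apply: le_trans (_ : expR (- (b * wlam j * t)) *
    (C1 ^+ (d.+1 * d.+1) * expR ((\sum_(p | ~~ S p && P p) rho p) * t)) <= _).
  rewrite ler_wpM2l ?expR_ge0 //.
  apply: le_trans (_ : \prod_(p | ~~ S p) (C1 * (if P p then expR (rho p * t) else 1)) <= _).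
    apply: ler_prod => p _; rewrite ler0n /=; apply: le_trans (card_gdigits p N1 t0) _.
    by rewrite -/(P p); case: ifP => // _; rewrite mulr1.
  rewrite big_split /= prodr_const -big_mkcondr /= mulr_suml expR_sum ler_wpM2r ?prodr_ge0 //.
  by rewrite ler_weXn2l // (leq_trans (max_card _)) // card_prod !card_ord.
rewrite mulrCA ler_wpM2l ?exprn_ge0 ?(ltW C10) // -expRD ler_expR -mulNr -mulrDl ler_wpM2r //.
have := drop_ge j; rewrite -hS hE; have := wlam_ge j.
set s := \sum_(p | S p) _; set s' := \sum_(p | _) _.
have : 0 <= (b - d%:R) * (wlam j + 1).
  by rewrite mulr_ge0 ?subr_ge0 ?(ltW db) //; have := wlam_ge j; lra.
move: (wlam j) => x; nra.
Qed.

Definition has_short (g : 'M[R]_d.+1) (r : R) :=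
  exists2 z : 'cV[int]_d.+1, z != 0 & mnorm (g *m intmx z) <= r.

Lemma det_dmx t : \det (dmx wlam t) = 1.
Proof. exact: det_flow_mx. Qed.

(** The factor 2 absorbs the count in [hsum_step]. [C] must not depend on [t], so that a long step
    beats it; the threshold [l] does depend on [t], through the distortion [r] of one step. *)
Lemma hsum_contraction (N b : R) : 1 <= N -> d%:R < b -> exists2 C, 0 < C &
  forall t, 0 <= t -> exists2 l, 0 < l <= 1 & forall g, `|\det g| = 1 -> has_short g l ->
  \sum_(m in family (gdigits N t)) hsum b (dmx wlam t *m gmx N t m *m g) <=
  C * expR ((hdim wlam - 1 + (b - d%:R)) * t) * hsum b g.
Proof.
move=> N1 db; have [C C0 HC] := grid_contraction N1 db.
have b0 : 0 <= b by rewrite (le_trans _ (ltW db)).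
exists (C * 2) => [|t t0]; first by rewrite mulr_gt0.
pose r : R := 1 + \sum_(m in family (gdigits N t)) d.+1%:R * mnorm (invmx (dmx wlam t *m gmx N t m)).
have r1 : 1 <= r by rewrite lerDl sumr_ge0 // => m _; rewrite mulr_ge0 ?mnorm_ge0.
have [l l01 Hl] := short_count_le db r1; exists l => // g g1 gl.
have ku m : dmx wlam t *m gmx N t m \in unitmx.
  have gu : gmx N t m \in unitmx by apply: (@unip_unit R _ wlam wlam_mono); exact: gmx_unip.
  by rewrite unitmx_mul dmx_unit.
set D := expR _; have CD0 : 0 <= C * D by rewrite mulr_ge0 ?expR_ge0 // ltW.
apply: le_trans (@hsum_step _ _ b (C * D) r _ _ _ g (unit_of_det1 g1) b0 CD0 r1 _ _ _) _.
- by move=> m _; exact: ku.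
- move=> m z mQ kz; rewrite -(mulKmx (ku m) (g *m intmx z)) [_ *m (g *m _)]mulmxA.
  apply: le_trans (mnormM _ _) _; rewrite mulrA.
  apply: le_trans (_ : d.+1%:R * mnorm (invmx (dmx wlam t *m gmx N t m)) * 1 <= _).
    by rewrite ler_wpM2l ?mulr_ge0 ?mnorm_ge0.
  rewrite mulr1 /r (bigD1 m) //= addrA addrAC lerDr addr_ge0 // sumr_ge0 // => m' _.
  by rewrite mulr_ge0 ?mnorm_ge0.
- by move=> v v0; exact: HC.
have -> : C * 2 * D * hsum b g = C * D * (hsum b g + hsum b g) by ring.
by rewrite ler_wpM2l // lerD2l Hl.
Qed.

Section Cells.
Variables (N t b D l K : R).
Hypotheses (N1 : 1 <= N) (t0 : 0 <= t) (b0 : 0 <= b) (D0 : 0 <= D) (l01 : 0 < l <= 1).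
Hypothesis K0 : 0 < K.
Hypothesis tlarge : forall i j, expands wlam i j ->
  d.+1%:R * (expR (- ((wlam i - wlam j) * t)) * (N + 2)) <= 1.
Hypothesis contr : forall g : 'M[R]_d.+1, `|\det g| = 1 -> has_short g l ->
  \sum_(m in family (gdigits N t)) hsum b (dmx wlam t *m gmx N t m *m g) <= D * hsum b g.
Hypothesis invK : forall h, box wlam N h -> mnorm (invmx h) <= K.

Let l2 := l / (d.+1%:R * K).

Lemma box_short h g : box wlam N h -> has_short (h *m g) l2 -> has_short g l.
Proof.
move=> hN [z z0 zl]; exists z => //; have [hu _] := hN.
rewrite -(mulKmx (unip_unit wlam_mono hu) (g *m intmx z)).
apply: le_trans (mnormM _ _) _.
apply: le_trans (_ : d.+1%:R * (K * l2) <= _).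
  rewrite ler_wpM2l // ler_pM ?mnorm_ge0 //; first exact: invK.
  by rewrite mulmxA.
by rewrite /l2 mulrA mulrC divfK // mulf_neq0 // gt_eqF.
Qed.

(** The fractional factor [C] of the grid decomposition has entries below the mesh, so conjugation
    by the flow blows it up to an element of the box again. *)
Lemma box_step h : box wlam N h -> exists2 m, m \in family (gdigits N t) &
  exists2 b', box wlam N b' & h = dmx wlam (- t) *m b' *m dmx wlam t *m gmx N t m.
Proof.
move=> hN; have [m [C [k [hE Cu Ku mk]]]] := grid_decomposition wlam_mono N1 hN t0 tlarge.
pose E i j := expR (- ((wlam i - wlam j) * t)).
have E0 i j : 0 < E i j by exact: expR_gt0.
pose m' := [ffun p => if expands wlam p.1 p.2 then inord `|(m p.1 p.2 + (goff N t p)%:Z)%R|%N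
   else ord0 : 'I_(gsize N t).+1].
have mo i j : expands wlam i j ->
    exists2 q : nat, m i j + (goff N t (i, j))%:Z = q%:Z & (q <= (goff N t (i, j)).*2)%N.
  move=> ij; have [_ kE kN] := mk i j ij.
  have mN : `|m i j| <= (goff N t (i, j))%:Z.
    have [q qE] : exists q : nat, `|m i j| = q%:Z by exists `|(m i j)%R|%N; rewrite abszE.
    rewrite qE lez_nat /goff ltnW // ltnS truncn_ge_nat; last first.
      by rewrite mulr_ge0 ?expR_ge0 // addr_ge0 // (le_trans _ N1).
    rewrite pmulrn -qE intr_norm; move: kN; rewrite kE normrM (gtr0_norm (expR_gt0 _)).
    by rewrite expRN ler_pdivrMr // expR_gt0.
  exists `|(m i j + (goff N t (i, j))%:Z)%R|%N; lia.
have m'E i j : expands wlam i j -> (m' (i, j))%:R - (goff N t (i, j))%:R = (m i j)%:~R :> R.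
  move=> ij; have [q qE qle] := mo i j ij; rewrite ffunE /= ij qE absz_nat.
  rewrite inordK; last by rewrite ltnS (leq_trans qle) ?goff_le_size.
  by have -> : m i j = q%:Z - (goff N t (i, j))%:Z; [rewrite -qE addrK | rewrite intrD intrN -!pmulrn].
exists m'.
  apply/familyP => -[i j]; rewrite unfold_in /gdigits /=; case: ifP => ij; last first.
    by rewrite ffunE /= ij.
  have [q qE qle] := mo i j ij; rewrite ffunE /= ij qE absz_nat inordK //.
  by rewrite ltnS (leq_trans qle) ?goff_le_size.
have kE : gmx N t m' = k.
  apply/matrixP => i j; have [ij|ij] := boolP (expands wlam i j); last first.
    by rewrite gmx_unip // Ku.
  have [_ -> _] := mk i j ij; rewrite mxE ij m'E // ifN //.
  by apply: contraTneq ij => ->; rewrite expands_irr.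
exists (dmx wlam t *m C *m dmx wlam (- t)).
  split; first exact: unip_conj.
  move=> i j ij; have [/andP[c0 cE] _ _] := mk i j ij; rewrite dmxEr dmxE.
  rewrite !normrM !ger0_norm ?expR_ge0 //; apply: le_trans N1.
  rewrite mulrAC -expRD; apply: le_trans (ler_wpM2l (expR_ge0 _) cE) _.
  rewrite -expRD le_eqVlt; apply/orP; left; apply/eqP; rewrite -[RHS]expR0; congr expR; ring.
by rewrite !mulmxA dmxKl mul1mx -[_ *m dmx wlam (- t) *m _]mulmxA dmxKl mulmx1 kE.
Qed.

(** After a grid step k, the orbit of [h] over [g] continues as the orbit of a box element over a_t
    k g, so the count obeys the recursion of the height. The induction starts because the height is
    at least 1 once a short vector exists; without one no [h] qualifies and the list is empty. *)
Lemma cell_cover M g : `|\det g| = 1 ->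
  exists2 ws : seq 'M[R]_d.+1, (size ws)%:R <= D ^+ M * hsum b g &
  forall h, box wlam N h ->
    (forall j, (j <= M)%N -> has_short (dmx wlam (j%:R * t) *m h *m g) l2) ->
    exists2 v, v \in ws & exists2 b', box wlam N b' &
      h = dmx wlam (- (M%:R * t)) *m b' *m dmx wlam (M%:R * t) *m v.
Proof.
have /andP[l0 l1] := l01.
elim: M g => [|M IH] g g1.
  have [[h0 h0N h0s]|none] := pselect (exists2 h, box wlam N h & has_short (h *m g) l2).
    exists [:: 1%:M] => [|h hN _].
      rewrite expr0 mul1r; have [z z0 zl] := box_short h0N h0s.
      apply: le_trans (hsum_ge b (unit_of_det1 g1) z0 (le_trans zl l1)).
      have gz0 := mnorm_gt0 (gz_neq0 (unit_of_det1 g1) z0).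
      have -> : (size [:: 1%:M : 'M[R]_d.+1])%:R = 1 `^ (- b) :> R by rewrite powR1.
      by rewrite powRN_le // (le_trans zl l1).
    exists 1%:M; first by rewrite inE.
    by exists h => //; rewrite mul0r oppr0 dmx0 mul1mx !mulmx1.
  exists [::] => [|h hN /(_ 0%N isT)]; first by rewrite expr0 mul1r hsum_ge0.
  by rewrite mul0r dmx0 mul1mx => hs; case: none; exists h.
have [gs|ngs] := pselect (has_short g l); last first.
  exists [::] => [|h hN /(_ 0%N isT)]; first by rewrite mulr_ge0 ?hsum_ge0 ?exprn_ge0.
  by rewrite mul0r dmx0 mul1mx => /(box_short hN).
have k1 m : `|\det (dmx wlam t *m gmx N t m *m g)| = 1.
  by rewrite !det_mulmx det_dmx (unip_det wlam_mono (gmx_unip _)) !mul1r.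
have /choice[ws wsP] := fun m => (let: ex_intro2 s h1 h2 := IH _ (k1 m) in
  ex_intro (fun s : seq 'M[R]_d.+1 => (size s)%:R <= D ^+ M * hsum b (dmx wlam t *m gmx N t m *m g) /\
   forall h, box wlam N h ->
    (forall j, (j <= M)%N -> has_short (dmx wlam (j%:R * t) *m h *m (dmx wlam t *m gmx N t m *m g)) l2) ->
    exists2 v, v \in s & exists2 b', box wlam N b' &
      h = dmx wlam (- (M%:R * t)) *m b' *m dmx wlam (M%:R * t) *m v) s (conj h1 h2)).
exists (flatten [seq [seq dmx wlam (- t) *m v *m dmx wlam t *m gmx N t m | v <- ws m]
                | m <- enum (family (gdigits N t))]).
  rewrite size_flatten /shape -map_comp sumnE big_map natr_sum big_enum /=.
  apply: le_trans (_ : \sum_(m in family (gdigits N t)) D ^+ M * hsum b (dmx wlam t *m gmx N t m *m g) <= _).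
    by apply: ler_sum => m _; rewrite /= size_map; have [] := wsP m.
  by rewrite -mulr_sumr exprSr -mulrA ler_wpM2l ?exprn_ge0 // contr.
move=> h hN hs; have [m mQ [c cN hE]] := box_step hN.
have [_ /(_ c cN)[]] := wsP m.
  move=> j jM; have := hs j.+1 jM; rewrite hE -[j.+1]addn1 natrD mulrDl mul1r dmxD.
  by rewrite !mulmxA -[_ *m dmx wlam t *m dmx wlam (- t)]mulmxA dmxKr mulmx1.
move=> v vm [b' b'N cE].
exists (dmx wlam (- t) *m v *m dmx wlam t *m gmx N t m).
  apply/flattenP; exists [seq dmx wlam (- t) *m v *m dmx wlam t *m gmx N t m | v <- ws m].
    by apply: map_f; rewrite mem_enum.
  by apply/mapP; exists v.
exists b' => //.
have e1 : dmx wlam (- (M.+1%:R * t)) = dmx wlam (- t) *m dmx wlam (- (M%:R * t)).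
  by rewrite -dmxD; congr (dmx wlam _); rewrite -natr1; ring.
have e2 : dmx wlam (M.+1%:R * t) *m dmx wlam (- t) = dmx wlam (M%:R * t).
  by rewrite -dmxD; congr (dmx wlam _); rewrite -natr1; ring.
by rewrite hE cE e1 -e2 !mulmxA.
Qed.

End Cells.

End WeightedContraction.

Arguments gdigits {R d} w N t p.
Arguments gmx {R d} w N t m.

Lemma digit_of_floor (k q : int) : - q < k + 1 -> k < q -> exists2 n : nat, n%:Z = k + q & n%:Z <= 2 * q.
Proof. by move=> h1 h2; exists `|(k + q)%R|%N; lia. Qed.

(** * Upper bound *)

Section NullSets.
Variables (R : realType) (V : normedModType R).
Implicit Types (A U : set V).

Definition sized (c : R) U := forall x y, U x -> U y -> `|x - y| <= c.

Lemma diam_le U c : sized c U -> (diam U <= c%:E)%E.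
Proof.
by move=> Uc; apply: ge_ereal_sup => _ [x Ux [y Uy <-]]; rewrite lee_fin Uc.
Qed.

Lemma diam_ge0 U : U !=set0 -> (0 <= diam U)%E.
Proof.
move=> [x Ux]; apply: ereal_sup_ubound; exists x => //; exists x => //.
by rewrite subrr normr0.
Qed.

Lemma diam_pow_ge0 s U : (0 <= diam_pow s U)%E.
Proof. by rewrite /diam_pow; case: ifP => // _; exact: poweR_ge0. Qed.

Lemma diam_pow_le s c U : 0 <= s -> 0 <= c -> sized c U ->
  (diam_pow s U <= (c `^ s)%:E)%E.
Proof.
move=> s0 c0 Uc; rewrite /diam_pow; case: ifPn => [_|/set0P U0].
  by rewrite lee_fin powR_ge0.
rewrite -poweR_EFin; apply: gt0_ler_poweR => //; rewrite ?in_itv /= ?leey ?andbT.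
- exact: diam_ge0.
- by rewrite lee_fin.
- exact: diam_le.
Qed.

(** Equivalent to Hausdorff measure zero, by [thin_measure0] and [measure0_thin], in a form where
    covers can be combined directly. *)
Definition thin s A := forall delta e : R, 0 < delta -> 0 < e ->
  exists U : nat -> set V, [/\ forall k, (diam (U k) <= delta%:E)%E,
    A `<=` \bigcup_k U k & (\sum_(0 <= k <oo) diam_pow s (U k) <= e%:E)%E].

Lemma thin_measure0 s A : thin s A -> hausdorff_measure s A = 0%E.
Proof.
move=> As; have pre0 delta : (0 <= hausdorff_premeasure s delta A)%E.
  apply: le_ereal_inf_tmp => _ [U _ <-].
  by apply: nneseries_ge0 => k _ _; exact: diam_pow_ge0.
apply/eqP; rewrite eq_le; apply/andP; split; last first.
  apply: le_trans (pre0 1) _; apply: ereal_sup_ubound.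
  by exists 1 => //; rewrite /= ltr01.
apply: ge_ereal_sup => _ [delta /= delta0 <-].
apply/lee_addgt0Pr => e e0; rewrite add0e.
have [U [Ud AU Ue]] := As delta e delta0 e0.
by apply: le_trans Ue; apply: ereal_inf_lbound; exists U.
Qed.

Lemma thin_sub s A B : A `<=` B -> thin s B -> thin s A.
Proof.
move=> AB Bs delta e d0 e0; have [U [Ud BU Ue]] := Bs delta e d0 e0.
by exists U; split=> //; exact: subset_trans AB BU.
Qed.

(** Indices outside the range of [pickle] receive the empty set, of weight 0. The explicit place of
    [U k j] serves in [recurrent_cover] to find arbitrarily late indices. *)
Lemma interleave s (U : nat -> nat -> set V) (delta e : R) : 0 < e ->
  (forall k j, (diam (U k j) <= delta%:E)%E) ->
  (forall k, (\sum_(0 <= j <oo) diam_pow s (U k j) <= (e / (2 ^ k.+1)%:R)%:E)%E) ->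
  exists W : nat -> set V, [/\ forall n, (diam (W n) <= delta%:E)%E,
    forall k j, W (pickle (k, j)) = U k j & (\sum_(0 <= n <oo) diam_pow s (W n) <= e%:E)%E].
Proof.
move=> e0 Ud Ue.
pose W n : set V := if pickle_inv n is Some p then U p.1 p.2 else set0.
exists W; split.
- move=> n; rewrite /W; case: (pickle_inv n) => [[k j]|] //=.
  by apply: diam_le => x y.
- by move=> k j; rewrite /W pickleK_inv.
rewrite nneseries_esumT; last by move=> n; exact: diam_pow_ge0.
rewrite (esumID (range (@pickle (nat * nat)%type))); last by move=> n _; exact: diam_pow_ge0.
rewrite [X in (_ + X)%E]esum1 ?adde0; last first.
  move=> n [_ nr]; rewrite /W; have := @pickle_invK (nat * nat)%type n.
  case: (pickle_inv n) => [p /= pn|_]; last by rewrite /diam_pow eqxx.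
  by exfalso; apply: nr; exists p.
rewrite setTI esum_image; last by move=> p q _ _; exact: (pcan_inj pickleK).
under eq_esum do rewrite /W pickleK_inv.
have -> : [set: nat * nat] = [set: nat] `*`` (fun _ => [set: nat]).
  by apply/seteqP; split.
rewrite -(esum_esum (a := fun k j => diam_pow s (U k j))); last first.
  by move=> k j _ _; exact: diam_pow_ge0.
apply: le_trans (_ : \esum_(k in [set: nat]) (e / (2 ^ k.+1)%:R)%:E <= _)%E.
  by apply: le_esum => k _; rewrite -nneseries_esumT // => n; exact: diam_pow_ge0.
rewrite -nneseries_esumT; last by move=> n; rewrite lee_fin divr_ge0 // ltW.
exact: epsilon_trick0 (ltW e0).
Qed.

Lemma thin_bigcup s (A : nat -> set V) : (forall k, thin s (A k)) ->
  thin s (\bigcup_k A k).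
Proof.
move=> As delta e d0 e0.
have ek k : 0 < e / (2 ^ k.+1)%:R by rewrite divr_gt0 // ltr0n expn_gt0.
have /choice[U UP] := fun k => As k delta _ d0 (ek k).
have [||W [Wd WU We]] := @interleave s U delta e e0.
- by move=> k; have [] := UP k.
- by move=> k; have [] := UP k.
exists W; split=> // x [k _ Ax]; have [_ /(_ x Ax)[j _ Ujx] _] := UP k.
by exists (pickle (k, j)) => //; rewrite WU.
Qed.

Lemma thin_count s A : 0 <= s ->
  (forall delta e : R, 0 < delta -> 0 < e -> exists (us : seq (set V)) (c : R),
    [/\ 0 <= c <= delta, forall U, U \in us -> sized c U,
        forall x, A x -> exists2 U, U \in us & U x & (size us)%:R * c `^ s <= e]) ->
  thin s A.
Proof.
move=> s0 As delta e d0 e0; have [us [c [/andP[c0 cd] usc usA use]]] := As delta e d0 e0.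
have nth_sized k : sized c (nth set0 us k).
  have [ks|ks] := ltnP k (size us); first by apply: usc; exact: mem_nth.
  by rewrite nth_default // => x y [].
exists (fun k => nth set0 us k); split.
- by move=> k; apply: le_trans (diam_le (nth_sized k)) _; rewrite lee_fin.
- move=> x /usA[U Uus Ux]; exists (index U us) => //.
  by rewrite nth_index.
rewrite (nneseries_split 0 (size us)); last by move=> k _; exact: diam_pow_ge0.
rewrite [X in (_ + X)%E]eseries0 ?adde0; last first.
  by move=> k kn _; rewrite nth_default ?add0n // /diam_pow eqxx.
rewrite add0n; apply: le_trans (_ : \sum_(0 <= k < size us) (c `^ s)%:E <= _)%E.
  by apply: lee_sum => k _; exact: diam_pow_le.
rewrite sumEFin lee_fin; apply: le_trans use.
by rewrite big_const_nat iter_addr_0 subn0 mulr_natl.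
Qed.

End NullSets.

Lemma normE (R : realType) m n (A : 'M[R]_(m.+1, n.+1)) : `|A| = mnorm A.
Proof. exact: mx_normrE. Qed.

Section UpperBound.
Variables (R : realType) (d : nat) (w : 'I_d -> R).
Hypothesis d0 : (0 < d)%N.
Hypothesis w_gt0 : forall i, 0 < w i.
Hypothesis w_sum1 : \sum_(i < d) w i = 1.
Hypothesis w_noninc : forall i j : 'I_d, (i <= j)%N -> w j <= w i.
Variables (w1 : R).
Hypothesis w1_max : forall i, w i <= w1.

Local Notation lam := (wlam w).
Local Notation mono := (wlam_mono w_gt0 w_noninc).

(** The dimension of H, by [lie_dim_unip]. *)
Definition npairs := #|[pred p : 'I_d.+1 * 'I_d.+1 | expands lam p.1 p.2]|.

Lemma rate_le i j : lam i - lam j <= 1 + w1.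
Proof.
have w1p : 0 <= w1 by rewrite (le_trans (ltW (w_gt0 (Ordinal d0)))).
have := wlam_ge w_gt0 j; suff : lam i <= w1 by lra.
case: (unliftP ord_max i) => [i'|] ->; rewrite ?wlam_lift ?wlam_max //.
by rewrite (le_trans _ w1p) // oppr_le0.
Qed.

Section CellCovers.
Variables (N t b D l K : R).
Hypotheses (N1 : 1 <= N) (t0 : 0 <= t) (b0 : 0 <= b) (D0 : 0 <= D) (l01 : 0 < l <= 1).
Hypothesis K0 : 0 < K.
Hypothesis tlarge : forall i j, expands lam i j ->
  d.+1%:R * (expR (- ((lam i - lam j) * t)) * (N + 2)) <= 1.
Hypothesis contr : forall g : 'M[R]_d.+1, `|\det g| = 1 -> has_short g l ->
  \sum_(m in family (gdigits w N t)) hsum b (dmx lam t *m gmx w N t m *m g) <= D * hsum b g.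
Hypothesis invK : forall h, box lam N h -> mnorm (invmx h) <= K.
Let l2 := l / (d.+1%:R * K).

(** Nothing is known about the first [m0] steps, so all grid elements are kept there; this
    multiplies the count by a factor independent of [M], harmless for the dimension. *)
Lemma late_cover m0 g : `|\det g| = 1 -> exists2 C, 0 <= C & forall M,
  exists2 ws : seq 'M[R]_d.+1, (size ws)%:R <= C * D ^+ M &
  forall h, box lam N h ->
    (forall j, (m0 <= j)%N -> has_short (dmx lam (j%:R * t) *m h *m g) l2) ->
    exists2 v, v \in ws & exists2 b', box lam N b' &
      h = dmx lam (- ((m0 + M)%:R * t)) *m b' *m dmx lam ((m0 + M)%:R * t) *m v.
Proof.
elim: m0 g => [|m0 IH] g g1.
  exists (hsum b g) => [|M]; first exact: hsum_ge0.
  have [ws wsD wsP] := cell_cover d0 w_gt0 w_sum1 w_noninc N1 t0 b0 D0 l01 K0 tlarge contr invK M g1.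
  exists ws => [|h hN hs]; first by rewrite mulrC.
  by apply: wsP => // j _; exact: hs.
have k1 m : `|\det (dmx lam t *m gmx w N t m *m g)| = 1.
  by rewrite !det_mulmx (det_dmx w_sum1) (unip_det mono (gmx_unip _)) !mul1r.
have /choice[C CP] : forall m, exists C, 0 <= C /\ forall M,
    exists2 ws : seq 'M[R]_d.+1, (size ws)%:R <= C * D ^+ M &
    forall h, box lam N h ->
    (forall j, (m0 <= j)%N -> has_short (dmx lam (j%:R * t) *m h *m (dmx lam t *m gmx w N t m *m g)) l2) ->
    exists2 v, v \in ws & exists2 b', box lam N b' &
      h = dmx lam (- ((m0 + M)%:R * t)) *m b' *m dmx lam ((m0 + M)%:R * t) *m v.
  by move=> m; have [C C0 HC] := IH _ (k1 m); exists C.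
exists (\sum_(m in family (gdigits w N t)) C m) => [|M].
  by apply: sumr_ge0 => m _; have [] := CP m.
have /choice[ws wsP] : forall m, exists ws : seq 'M[R]_d.+1, (size ws)%:R <= C m * D ^+ M /\
    forall h, box lam N h ->
    (forall j, (m0 <= j)%N -> has_short (dmx lam (j%:R * t) *m h *m (dmx lam t *m gmx w N t m *m g)) l2) ->
    exists2 v, v \in ws & exists2 b', box lam N b' &
      h = dmx lam (- ((m0 + M)%:R * t)) *m b' *m dmx lam ((m0 + M)%:R * t) *m v.
  by move=> m; have [_ HC] := CP m; have [ws h1 h2] := HC M; exists ws.
exists (flatten [seq [seq dmx lam (- t) *m v *m dmx lam t *m gmx w N t m | v <- ws m]
                | m <- enum (family (gdigits w N t))]).
  rewrite size_flatten /shape -map_comp sumnE big_map natr_sum big_enum /= mulr_suml.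
  by apply: ler_sum => m _; rewrite /= size_map; have [] := wsP m.
move=> h hN hs; have [m mQ [c cN hE]] := box_step d0 w_gt0 w_noninc N1 t0 b0 D0 l01 K0 tlarge hN.
have [_ /(_ c cN)[]] := wsP m.
  move=> j jM; have := hs j.+1 jM; rewrite hE -[j.+1]addn1 natrD mulrDl mul1r dmxD.
  by rewrite !mulmxA -[_ *m dmx lam t *m dmx lam (- t)]mulmxA dmxKr mulmx1.
move=> v vm [b' b'N cE].
exists (dmx lam (- t) *m v *m dmx lam t *m gmx w N t m).
  apply/flattenP; exists [seq dmx lam (- t) *m v *m dmx lam t *m gmx w N t m | v <- ws m].
    by apply: map_f; rewrite mem_enum.
  by apply/mapP; exists v.
exists b' => //.
have e1 : dmx lam (- ((m0.+1 + M)%:R * t)) = dmx lam (- t) *m dmx lam (- ((m0 + M)%:R * t)).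
  by rewrite -dmxD; congr (dmx lam _); rewrite addSn -natr1; ring.
have e2 : dmx lam ((m0.+1 + M)%:R * t) *m dmx lam (- t) = dmx lam ((m0 + M)%:R * t).
  by rewrite -dmxD; congr (dmx lam _); rewrite addSn -natr1; ring.
by rewrite hE cE e1 -e2 !mulmxA.
Qed.

(* Each cell is a parallelepiped, cut into cubes of its smallest side. *)
Lemma cell_cubes (T : R) (v : 'M[R]_d.+1) : 0 <= T ->
  exists us : seq (set 'M[R]_d.+1),
  [/\ (size us)%:R <= (2 * N + 3) ^+ npairs * expR ((npairs%:R * (1 + w1) - hdim lam) * T),
    forall U, U \in us -> sized (d.+1%:R * (expR (- ((1 + w1) * T)) * (d.+1%:R * (K * N)))) U &
    forall h b', box lam N h -> box lam N b' ->
      h = dmx lam (- T) *m b' *m dmx lam T *m v -> exists2 U, U \in us & U h].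
Proof.
move=> T0; pose r := expR (- ((1 + w1) * T)); have r0 : 0 < r by exact: expR_gt0.
pose P (p : 'I_d.+1 * 'I_d.+1) := expands lam p.1 p.2.
pose rho (p : 'I_d.+1 * 'I_d.+1) := lam p.1 - lam p.2.
(* Ratio of the side of the cell in direction [p] to the smallest side. *)
pose F p : R := expR ((1 + w1 - rho p) * T).
have F1 p : 1 <= F p.
  by rewrite -[leLHS]expR0 ler_expR mulr_ge0 // subr_ge0; exact: rate_le.
have N0 : 0 <= N by rewrite (le_trans _ N1).
pose q p : nat := (Num.trunc (N * F p)).+1.
pose M := (\sum_p (q p).*2)%N.
have qM p : ((q p).*2 <= M)%N by rewrite /M (bigD1 p) //= leq_addr.
pose Q p : pred 'I_M.+1 := fun x => if P p then (x <= (q p).*2)%N else x == ord0.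
pose U (m : {ffun 'I_d.+1 * 'I_d.+1 -> 'I_M.+1}) : set 'M[R]_d.+1 :=
  [set h | box lam N h /\ exists c, [/\ h = c *m v, box lam N c &
     forall i j, expands lam i j ->
     ((m (i, j))%:R - (q (i, j))%:R) * r <= c i j <= ((m (i, j))%:R - (q (i, j))%:R + 1) * r]].
exists [seq U m | m <- enum (family Q)]; split.
- rewrite size_map -cardE card_family.
  have -> : (foldr muln 1%N [seq #|Q p| | p : 'I_d.+1 * 'I_d.+1])%:R = \prod_p #|Q p|%:R :> R.
    by rewrite foldrE big_map big_enum /= natr_prod.
  have QP p : #|Q p|%:R <= if P p then (2 * N + 3) * F p else 1 :> R.
    case: ifP => Pp; last first.
      have -> : #|Q p| = #|pred1 (ord0 : 'I_M.+1)|.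
        by apply: eq_card => x; rewrite !unfold_in /Q Pp.
      by rewrite card1.
    have -> : #|Q p| = (q p).*2.+1.
      by rewrite -(card_ord_le (qM p)); apply: eq_card => x; rewrite !unfold_in /Q Pp.
    have h : (Num.trunc (N * F p))%:R <= N * F p by rewrite truncn_le // mulr_ge0 // expR_ge0.
    rewrite /q -addn1 -muln2 natrD natrM -addn1 natrD.
    by move: h (F1 p); nra.
  apply: le_trans (_ : \prod_p (if P p then (2 * N + 3) * F p else 1) <= _).
    by apply: ler_prod => p _; rewrite ler0n QP.
  rewrite -big_mkcond big_split /= prodr_const; apply: ler_wpM2l.
    by rewrite exprn_ge0 // addr_ge0 // mulr_ge0.
  rewrite -expR_sum ler_expR -mulr_suml ler_wpM2r //.
  by rewrite sumrB sumr_const /hdim mulr_natl.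
- move=> _ /mapP[m _ ->] x x' [xN [c [xE cN cm]]] [_ [c' [x'E c'N c'm]]].
  rewrite normE xE x'E -mulmxBl; apply: le_trans (mnormM _ _) _; rewrite ler_wpM2l //.
  apply: ler_pM; rewrite ?mnorm_ge0 //.
    apply: mnorm_le => [|i j]; first exact: ltW.
    rewrite !mxE; have [ij|ij] := boolP (expands lam i j); last first.
      by rewrite (proj1 cN) // (proj1 c'N) // subrr normr0 ltW.
    have /andP[h1 h2] := cm i j ij; have /andP[h3 h4] := c'm i j ij.
    rewrite -/r ler_norml; move: h2 h4; rewrite !(mulrDl _ 1) mul1r => h2 h4.
    by apply/andP; split; lra.
  (* [v] is [invmx c *m x] with [c] and [x] in the box, so right multiplication by [v] distorts the
     cubes by a bounded factor only. *)
  rewrite -(mulKmx (unip_unit mono (proj1 cN)) v) -xE.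
  apply: le_trans (mnormM _ _) _; rewrite ler_wpM2l // ler_pM ?mnorm_ge0 ?invK //.
  by apply: mnorm_le => [|i j]; [exact: N0 | exact: unip_norm N1 xN].
move=> h b' hN b'N hE; pose c := dmx lam (- T) *m b' *m dmx lam T.
have cu : unip lam c by have := unip_conj (- T) (proj1 b'N); rewrite opprK.
have cle i j : expands lam i j -> `|c i j| <= N * expR (- (rho (i, j) * T)).
  move=> ij; rewrite /c dmxEr dmxE !normrM !(ger0_norm (expR_ge0 _)) mulrAC -expRD mulrC.
  rewrite ler_pM ?expR_ge0 // ?(proj2 b'N) // ler_expR /rho /= le_eqVlt; apply/orP; left.
  by apply/eqP; ring.
have cN : box lam N c.
  split=> // i j ij; apply: le_trans (cle i j ij) _; rewrite ler_piMr //.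
  by rewrite -[leRHS]expR0 ler_expR oppr_le0 mulr_ge0 // /rho subr_ge0 ltW.
have crN i j : expands lam i j -> `|c i j| <= N * F (i, j) * r.
  move=> ij; apply: le_trans (cle i j ij) _; rewrite -mulrA /F /r -expRD ler_wpM2l //.
  by rewrite ler_expR le_eqVlt; apply/orP; left; apply/eqP; ring.
have fl i j : expands lam i j -> exists2 k : nat, (k <= (q (i, j)).*2)%N &
    (k%:R - (q (i, j))%:R) * r <= c i j <= (k%:R - (q (i, j))%:R + 1) * r.
  move=> ij; have /andP[f1 f2] := floor_itv (c i j / r); set k := Num.floor _ in f1 f2.
  have kN : `|c i j / r| <= N * F (i, j).
    by rewrite normrM normfV (gtr0_norm r0) ler_pdivrMr // crN.
  have tq : N * F (i, j) < (q (i, j))%:R.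
    by have /andP[_] := truncn_itv (mulr_ge0 N0 (expR_ge0 ((1 + w1 - rho (i, j)) * T))).
  move: kN; rewrite ler_norml => /andP[k1 k2].
  have kq1 : (- (q (i, j))%:R : R) < k%:~R + 1 by rewrite -intrD1; lra.
  have kq2 : k%:~R < (q (i, j))%:R :> R by lra.
  have kq1' : - (q (i, j))%:Z < k + 1 by rewrite -(@ltr_int R) intrN intrD -pmulrn.
  have kq2' : k < (q (i, j))%:Z by rewrite -(@ltr_int R) -pmulrn.
  have [n nE n2] := digit_of_floor kq1' kq2'.
  exists n; first by rewrite -mul2n -lez_nat PoszM.
  have -> : n%:R = k%:~R + (q (i, j))%:R :> R by rewrite pmulrn nE intrD.
  rewrite addrK -ler_pdivlMr // f1 /= -ler_pdivrMr // ltW //.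
  by rewrite -[1]/(1%:~R) -intrD.
pose m : {ffun 'I_d.+1 * 'I_d.+1 -> 'I_M.+1} := [ffun p =>
  if pselect (expands lam p.1 p.2) is left pe then inord (s2val (cid2 (fl p.1 p.2 pe))) else ord0].
exists (U m).
  apply: map_f; rewrite mem_enum; apply/familyP => -[i j]; rewrite unfold_in /Q /P ffunE /=.
  case: pselect => [pe|/negP/negbTE ->] //; rewrite pe; case: (cid2 _) => k kq _ /=.
  by rewrite inordK // ltnS (leq_trans kq).
split=> //; exists c; split=> // i j ij; rewrite ffunE /=.
case: pselect => // pe; case: (cid2 _) => k kq kc /=.
by rewrite inordK // ltnS (leq_trans kq).
Qed.

End CellCovers.

End UpperBound.

Section UpperThin.
Variable R : realType.

Lemma exp_decay (k c e : R) : 0 < k -> 0 <= c -> 0 < e -> exists2 t0, 0 <= t0 &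
  forall t, t0 <= t -> c * expR (- (k * t)) <= e.
Proof.
move=> k0 c0 e0; exists (c / (e * k)) => [|t tt].
  by rewrite divr_ge0 // mulr_ge0 // ltW.
rewrite expRN ler_pdivrMr ?expR_gt0 //; apply: le_trans (_ : e * (k * t) <= _).
  by move: tt; rewrite ler_pdivrMr ?mulr_gt0 // => /le_trans; apply; rewrite le_eqVlt; apply/orP; left; apply/eqP; ring.
rewrite ler_wpM2l ?(ltW e0) //; apply: le_trans (expR_ge1Dx _).
by rewrite lerDr.
Qed.

Lemma halving_decay (c e : R) : 0 < e -> exists M0 : nat, forall M, (M0 <= M)%N ->
  c * (2^-1) ^+ M <= e.
Proof.
move=> e0; exists (Num.trunc (`|c| / e)).+1 => M hM.
have h2 : 0 < (2 : R) ^+ M by rewrite exprn_gt0.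
rewrite exprVn ler_pdivrMr //; apply: le_trans (ler_norm _) _.
rewrite mulrC -ler_pdivrMr //; apply: le_trans (_ : M%:R <= _).
  apply: le_trans (_ : (Num.trunc (`|c| / e)).+1%:R <= _); last by rewrite ler_nat.
  have /andP[_ /ltW] // := truncn_itv (divr_ge0 (normr_ge0 c) (ltW e0)).
by rewrite -natrX ler_nat ltnW // ltn_expl.
Qed.

Variables (d : nat) (w : 'I_d -> R).
Hypothesis d0 : (0 < d)%N.
Hypothesis w_gt0 : forall i, 0 < w i.
Hypothesis w_sum1 : \sum_(i < d) w i = 1.
Hypothesis w_noninc : forall i j : 'I_d, (i <= j)%N -> w j <= w i.
Variables (w1 : R).
Hypothesis w1_max : forall i, w i <= w1.

Local Notation lam := (wlam w).
Local Notation mono := (wlam_mono w_gt0 w_noninc).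
Local Notation np := ((npairs w)%:R : R).

(** The number of cells, times the cubes per cell, times the power [s] of their diameter, changes in
    each step by at most C e^(- a t / 2), which is at most 1/2 for [t] large. *)
Lemma late_thin (N s : R) : 1 <= N -> 0 <= s -> np - (1 + w1)^-1 < s ->
  exists t l2 : R, [/\ 0 < t, 0 < l2 & forall m0 g, `|\det g| = 1 -> thin s
    [set h : 'M[R]_d.+1 | box lam N h /\
      forall j, (m0 <= j)%N -> has_short (dmx lam (j%:R * t) *m h *m g) l2]].
Proof.
move=> N1 s0 hs.
have w1p : 0 < w1 by rewrite (lt_le_trans (w_gt0 (Ordinal d0))).
have w11 : 0 < 1 + w1 by lra.
(* The excess of [s] over the critical exponent, multiplied by 1 + w1. Half of it is spent on taking
   the height exponent above d. *)
pose a := 1 + (1 + w1) * (s - np); have a0 : 0 < a.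
  have h : (1 + w1) * (np - s) < 1.
    by rewrite -ltr_pdivlMl // mulr1; lra.
  by rewrite /a -opprB mulrN; lra.
have db : (d%:R : R) < d%:R + a / 2 by rewrite ltrDl divr_gt0.
have [C C0 HC] := hsum_contraction d0 w_gt0 w_sum1 w_noninc N1 db.
have [rho rho0 rhoP] := expands_gap lam.
have [K K0 invK] := unip_inv_bound mono N1.
have N20 : 0 <= d.+1%:R * (N + 2) by rewrite mulr_ge0 //; lra.
have half0 : (0 : R) < 2^-1 by lra.
have [ta ta0 Ha] := exp_decay rho0 N20 ltr01.
have a20 : 0 < a / 2 by lra.
have [tb tb0 Hb] := exp_decay a20 (ltW C0) half0.
have [tc tc0 Hc] := exp_decay w11 ler01 half0.
pose t := 1 + ta + tb + tc.
have [tat tbt tct] : [/\ ta <= t, tb <= t & tc <= t] by rewrite /t; split; lra.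
have t00 : 0 < t by rewrite /t; lra.
have t0 := ltW t00; clearbody t.
have [l l01 contr] := HC t t0.
have l20 : 0 < l / (d.+1%:R * K) by case/andP: l01 => l0 _; rewrite divr_gt0 // mulr_gt0.
exists t, (l / (d.+1%:R * K)); split=> // m0 g g1.
set D := C * _ in contr.
have D0 : 0 <= D by rewrite mulr_ge0 ?expR_ge0 // ltW.
have b0 : 0 <= d%:R + a / 2 by rewrite addr_ge0 // ltW.
have tlarge i j : expands lam i j ->
    d.+1%:R * (expR (- ((lam i - lam j) * t)) * (N + 2)) <= 1.
  move=> ij; apply: le_trans (Ha t tat); rewrite mulrA mulrAC ler_wpM2l //.
  by rewrite ler_expR lerN2 ler_wpM2r // rhoP.
have [C' C'0 cover] := late_cover d0 w_gt0 w_sum1 w_noninc N1 t0 b0 D0 l01 K0 tlarge contr invK m0 g1.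
pose X := np * (1 + w1) - hdim lam.
pose c0 := d.+1%:R * (d.+1%:R * (K * N)).
have c00 : 0 <= c0 by rewrite !mulr_ge0 // ?(ltW K0) // (le_trans _ N1).
pose G := C' * (2 * N + 3) ^+ npairs w * expR ((X - (1 + w1) * s) * (m0%:R * t)) * c0 `^ s.
apply: thin_count => // delta e delta0 e0.
have [M1 HM1] := halving_decay c0 delta0.
have [M2 HM2] := halving_decay G e0.
pose M := (M1 + M2)%N; pose T := (m0 + M)%:R * t.
have T0 : 0 <= T by rewrite mulr_ge0.
have [ws wsC wsP] := cover M.
have := fun v => cell_cubes d0 w_gt0 w_noninc w1_max N1 invK v T0.
move=> /choice[us usP].
exists (flatten [seq us v | v <- ws]), (c0 * expR (- ((1 + w1) * T))); split.
- rewrite mulr_ge0 ?expR_ge0 //=; apply: le_trans (HM1 M _); last exact: leq_addr.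
  rewrite ler_wpM2l //.
  have -> : - ((1 + w1) * T) = - ((1 + w1) * (m0%:R * t)) + - ((1 + w1) * (M%:R * t)).
    by rewrite /T natrD; ring.
  rewrite expRD.
  apply: le_trans (_ : 1 * expR (- ((1 + w1) * t)) ^+ M <= _).
    rewrite -expRM_natl; apply: ler_pM; rewrite ?expR_ge0 //.
      by rewrite -[leRHS]expR0 ler_expR oppr_le0 mulr_ge0 ?(ltW w11) // mulr_ge0.
    by rewrite ler_expR le_eqVlt; apply/orP; left; apply/eqP; ring.
  by rewrite mul1r lerXn2r ?nnegrE ?expR_ge0 ?(ltW half0) //; have := Hc t tct; rewrite mul1r.
- move=> U /flattenP[u /mapP[v vws ->] Uu]; have [_ + _] := usP v => /(_ U Uu) h x y Ux Uy.
  by apply: le_trans (h x y Ux Uy) _; rewrite le_eqVlt; apply/orP; left; apply/eqP; rewrite /c0; ring.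
- move=> h [hN hj]; have [v vws [b' b'N hE]] := wsP h hN hj.
  have [_ _ /(_ h b' hN b'N hE)[U Uu Uh]] := usP v; exists U => //.
  by apply/flattenP; exists (us v) => //; exact: map_f.
apply: le_trans (_ : (\sum_(v <- ws) (2 * N + 3) ^+ npairs w * expR (X * T)) * (c0 * expR (- ((1 + w1) * T))) `^ s <= _).
  rewrite ler_wpM2r ?powR_ge0 // size_flatten /shape -map_comp sumnE big_map natr_sum.
  by apply: ler_sum => v _ /=; have [] := usP v.
rewrite big_const_seq count_predT iter_addr_0 -[_ *+ size ws]mulr_natl.
apply: le_trans (HM2 M _); last exact: leq_addl.
rewrite powRM ?expR_ge0 // -expRM.
have N30 : 0 <= (2 * N + 3) ^+ npairs w by rewrite exprn_ge0 //; lra.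
apply: le_trans (_ : C' * D ^+ M * ((2 * N + 3) ^+ npairs w * expR (X * T)) * (c0 `^ s * expR (- ((1 + w1) * T) * s)) <= _).
  by rewrite ler_wpM2r ?mulr_ge0 ?powR_ge0 ?expR_ge0 // ler_wpM2r // mulr_ge0 ?expR_ge0.
have -> : C' * D ^+ M * ((2 * N + 3) ^+ npairs w * expR (X * T)) * (c0 `^ s * expR (- ((1 + w1) * T) * s))
  = (C' * (2 * N + 3) ^+ npairs w * c0 `^ s) * (D ^+ M * (expR (X * T) * expR (- ((1 + w1) * T) * s))) by ring.
have -> : G * 2^-1 ^+ M = (C' * (2 * N + 3) ^+ npairs w * c0 `^ s) * (expR ((X - (1 + w1) * s) * (m0%:R * t)) * 2^-1 ^+ M) by rewrite /G; ring.
apply: ler_wpM2l; first by rewrite !mulr_ge0 ?powR_ge0.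
have -> : D ^+ M * (expR (X * T) * expR (- ((1 + w1) * T) * s)) =
    expR ((X - (1 + w1) * s) * (m0%:R * t)) * (D * expR ((X - (1 + w1) * s) * t)) ^+ M.
  rewrite [(D * _) ^+ M]exprMn -expRM_natl [RHS]mulrCA -!expRD; congr (_ * expR _).
  by rewrite /T natrD; ring.
rewrite ler_wpM2l ?expR_ge0 // lerXn2r ?nnegrE ?(mulr_ge0 D0 (expR_ge0 _)) ?(ltW half0) //.
apply: le_trans (Hb t tbt); rewrite /D -mulrA -expRD ler_wpM2l ?(ltW C0) // ler_expR.
rewrite le_eqVlt; apply/orP; left; apply/eqP; rewrite /X.
have -> : (hdim lam - 1 + (d%:R + a / 2 - d%:R)) * t + (np * (1 + w1) - hdim lam - (1 + w1) * s) * t =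
  (- a + a / 2) * t by rewrite /a; ring.
by field.
Qed.

(* The flow only needs to be sampled along an arithmetic progression. *)
Lemma escaping_thin (s : R) (g : 'M[R]_d.+1) : 0 <= s -> np - (1 + w1)^-1 < s -> `|\det g| = 1 ->
  thin s [set h : 'M[R]_d.+1 | unip lam h /\
    forall r : R, 0 < r -> \forall t \near +oo, has_short (dmx lam t *m h *m g) r].
Proof.
move=> s0 hs g1.
have /choice[t /choice[l tlP]] : forall k : nat, exists t l2 : R, [/\ 0 < t, 0 < l2 & forall m0 g, `|\det g| = 1 -> thin s
    [set h : 'M[R]_d.+1 | box lam k.+1%:R h /\
      forall j, (m0 <= j)%N -> has_short (dmx lam (j%:R * t) *m h *m g) l2]].
  by move=> k; apply: late_thin => //; rewrite ler1n.
pose A k m0 := [set h : 'M[R]_d.+1 | box lam k.+1%:R h /\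
      forall j, (m0 <= j)%N -> has_short (dmx lam (j%:R * t k) *m h *m g) (l k)].
apply: (@thin_sub _ _ _ _ (\bigcup_k \bigcup_m0 A k m0)); last first.
  by apply: thin_bigcup => k; apply: thin_bigcup => m0; have [_ _] := tlP k; apply.
move=> h [hu hr].
pose k := Num.trunc (mnorm h).
have hb : box lam k.+1%:R h.
  split=> // i j _; apply: le_trans (mnorm_entry _ _ _) _.
  by have /andP[_ /ltW] := truncn_itv (mnorm_ge0 h).
exists k => //; have [tk0 lk0 _] := tlP k.
have [T [_ HT]] := hr _ lk0.
exists (Num.trunc (`|T| / t k)).+1 => //; split=> // j hj; apply: HT.
apply: le_lt_trans (ler_norm T) _; rewrite -ltr_pdivrMr //.
have /andP[_ h1] := truncn_itv (divr_ge0 (normr_ge0 T) (ltW tk0)).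
by apply: lt_le_trans h1 _; rewrite ler_nat.
Qed.

End UpperThin.

(** * Non-divergence of expanding columns *)

Section ColumnUnipotent.
Variables (R : realType) (d : nat).
Implicit Types x y : 'cV[R]_d.

Definition ux x : 'M[R]_d.+1 :=
  \matrix_(i, j) if i == j then 1 else if j == ord_max then oapp (fun k => x k 0) 0 (unlift ord_max i) else 0.

Lemma ux_lift_max x k : ux x (lift ord_max k) ord_max = x k 0.
Proof. by rewrite mxE eq_sym (negbTE (neq_lift _ _)) eqxx liftK. Qed.

Lemma ux_max x i : ux x ord_max i = (ord_max == i)%:R.
Proof. by rewrite mxE; case: eqP => // mi; rewrite unlift_none /= if_same. Qed.

Lemma ux_lift_lift x k l : ux x (lift ord_max k) (lift ord_max l) = (k == l)%:R.
Proof.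
rewrite mxE (inj_eq (@lift_inj _ _)); case: eqP => // kl.
by rewrite eq_sym (negbTE (neq_lift _ _)).
Qed.

Lemma mul_ux_max m (A : 'M[R]_(d.+1, m)) x j : (ux x *m A) ord_max j = A ord_max j.
Proof.
rewrite mxE (bigD1_ord ord_max) //= ux_max eqxx mul1r big1 ?addr0 // => k _.
by rewrite ux_max (negbTE (neq_lift _ _)) mul0r.
Qed.

Lemma mul_ux_lift m (A : 'M[R]_(d.+1, m)) x k j :
  (ux x *m A) (lift ord_max k) j = A (lift ord_max k) j + x k 0 * A ord_max j.
Proof.
rewrite mxE (bigD1_ord ord_max) //= ux_lift_max addrC; congr (_ + _).
rewrite (bigD1 k) //= ux_lift_lift eqxx mul1r big1 ?addr0 // => l lk.
by rewrite ux_lift_lift eq_sym (negbTE lk) mul0r.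
Qed.

Lemma ux_mul_lift m (A : 'M[R]_(m, d.+1)) x k j : (A *m ux x) j (lift ord_max k) = A j (lift ord_max k).
Proof.
rewrite mxE (bigD1_ord ord_max) //= ux_max (negbTE (neq_lift _ _)) mulr0 add0r.
rewrite (bigD1 k) //= ux_lift_lift eqxx mulr1 big1 ?addr0 // => l lk.
by rewrite ux_lift_lift (negbTE lk) mulr0.
Qed.

Lemma ux_mul_max m (A : 'M[R]_(m, d.+1)) x j :
  (A *m ux x) j ord_max = A j ord_max + \sum_k A j (lift ord_max k) * x k 0.
Proof.
rewrite mxE (bigD1_ord ord_max) //= ux_max eqxx mulr1; congr (_ + _).
by apply: eq_bigr => k _; rewrite ux_lift_max.
Qed.

Lemma eq_mx_lift m (A B : 'M[R]_(d.+1, m)) : (forall j, A ord_max j = B ord_max j) ->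
  (forall k j, A (lift ord_max k) j = B (lift ord_max k) j) -> A = B.
Proof. by move=> h1 h2; apply/matrixP => i j; case: (unliftP ord_max i) => [k|] ->. Qed.

Lemma uxD x y : ux (x + y) = ux x *m ux y.
Proof.
apply: eq_mx_lift => [j|k j]; rewrite ?mul_ux_max ?mul_ux_lift ?ux_max //.
case: (unliftP ord_max j) => [l|] ->; rewrite ?ux_lift_lift ?ux_lift_max.
  by rewrite (negbTE (neq_lift _ _)) mulr0 addr0.
by rewrite eqxx mulr1 mxE addrC.
Qed.

Lemma ux0 : ux 0 = 1%:M.
Proof.
apply/matrixP => i j; rewrite !mxE; case: eqP => // _; case: eqP => // _.
by case: (unlift _ _) => //= k; rewrite mxE.
Qed.

Lemma uxNl x : ux (- x) *m ux x = 1%:M.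
Proof. by rewrite -uxD addNr ux0. Qed.

Lemma uxNr x : ux x *m ux (- x) = 1%:M.
Proof. by rewrite -uxD subrr ux0. Qed.

Lemma ux_unit x : ux x \in unitmx.
Proof. by have [] := mulmx1_unit (uxNr x). Qed.

Lemma det_ux x : \det (ux x) = 1.
Proof.
rewrite -det_tr det_trig; last first.
  apply/is_trig_mxP => i j ij; rewrite 2!mxE.
  have ji : j != i by apply: contraTneq ij => ->; rewrite ltnn.
  rewrite (negbTE ji); case: eqP => // iM; move: ij; rewrite iM /=.
  by move=> h; have := ltn_ord j; rewrite ltnS leqNgt h.
by rewrite big1 // => i _; rewrite !mxE eqxx.
Qed.

Variable lam : 'I_d.+1 -> R.

Definition stretch (t : R) x : 'cV[R]_d :=
  \col_k (expR ((lam (lift ord_max k) - lam ord_max) * t) * x k 0).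

Lemma stretch0 x : stretch 0 x = x.
Proof. by apply/matrixP => i j; rewrite !mxE mulr0 expR0 mul1r (ord1 j). Qed.

Lemma stretch_stretch s t x : stretch s (stretch t x) = stretch (s + t) x.
Proof. by apply/matrixP => i j; rewrite !mxE mulrA -expRD -mulrDr. Qed.

Lemma dmx_ux t x : dmx lam t *m ux x = ux (stretch t x) *m dmx lam t.
Proof.
apply: eq_mx_lift => [j|k j]; rewrite dmxE ?mul_ux_max ?mul_ux_lift ?ux_max.
  rewrite !mxE; case: eqP => [->|_]; first by rewrite mulr1.
  by rewrite mulr0 mulr0n.
case: (unliftP ord_max j) => [l|] ->; rewrite ?ux_lift_lift ?ux_lift_max !mxE.
  rewrite (inj_eq (@lift_inj _ _)) (negbTE (neq_lift _ _)) mulr0n mulr0 addr0.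
  by case: eqP => _; rewrite ?mulr1 ?mulr1n // mulr0 mulr0n.
rewrite eqxx eq_sym (negbTE (neq_lift _ _)) mulr0n add0r mulr1n mulrAC -expRD.
by congr (expR _ * _); ring.
Qed.

Lemma det_dmx_gen t : \det (dmx lam t) = expR ((\sum_i lam i) * t).
Proof. by rewrite det_diag mulr_suml expR_sum; apply: eq_bigr => i _; rewrite mxE. Qed.

End ColumnUnipotent.

Lemma uniform_gap (R : realType) (I : finType) (F : I -> R) : (forall i, 0 < F i) ->
  exists2 r, 0 < r & forall i, r <= F i.
Proof.
move=> F0; exists (\big[Num.min/1]_i F i); first by apply: lt_bigmin.
by move=> i; apply: bigmin_le.
Qed.

Section ColumnContraction.
Variables (R : realType) (e : nat) (v : 'I_e -> R) (S : R).
Hypothesis e0 : (0 < e)%N.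
Hypothesis v_gt0 : forall i, 0 < v i.
Hypothesis S_gt0 : 0 < S.
Hypothesis v_sum : \sum_i v i = S.

(* Exponents of the flow induced on the rank [e + 1] quotient lattice. *)
Definition clam (i : 'I_e.+1) : R := oapp v (- S) (unlift ord_max i).

Lemma clam_max : clam ord_max = - S. Proof. by rewrite /clam unlift_none. Qed.
Lemma clam_lift i : clam (lift ord_max i) = v i. Proof. by rewrite /clam liftK. Qed.

Lemma clam_sum : \sum_i clam i = 0.
Proof.
rewrite (bigD1_ord ord_max) //= clam_max; under eq_bigr do rewrite clam_lift.
by rewrite v_sum addNr.
Qed.

Lemma det_clam t : \det (dmx clam t) = 1.
Proof. by rewrite det_dmx_gen clam_sum mul0r expR0. Qed.

Definition cpat (i j : 'I_e.+1) := (i != ord_max) && (j == ord_max).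

Lemma cpat_lt i j : cpat i j -> (i < j)%N.
Proof.
move=> /andP[iM /eqP->] /=; case: (unliftP ord_max i) iM => [k|] ->; last by rewrite eqxx.
by rewrite lift_max ltn_ord.
Qed.

Lemma card_cpat j : (#|[pred i | cpat i j]| <= e)%N.
Proof.
apply: leq_trans (_ : #|predC1 (ord_max : 'I_e.+1)| <= _)%N; last by rewrite cardC1 card_ord.
by apply: subset_leq_card; apply/fintype.subsetP => i; rewrite !inE => /andP[].
Qed.

Definition cdig (t : R) (p : 'I_e.+1 * 'I_e.+1) : nat :=
  Num.trunc (expR ((clam p.1 - clam p.2) * t)).
Definition csize t := (\sum_p cdig t p)%N.
Definition cfam t (p : 'I_e.+1 * 'I_e.+1) : pred 'I_(csize t).+1 :=
  fun x => if cpat p.1 p.2 then (x < cdig t p)%N else x == ord0.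
Arguments cfam t p : clear implicits.
Definition cmx t (m : {ffun 'I_e.+1 * 'I_e.+1 -> 'I_(csize t).+1}) : 'M[R]_e.+1 :=
  gridmx clam cpat t (fun=> 0) m.
Definition cvec t (m : {ffun 'I_e.+1 * 'I_e.+1 -> 'I_(csize t).+1}) : 'cV[R]_e :=
  \col_k ((m (lift ord_max k, ord_max))%:R * expR (- ((v k + S) * t))).

Lemma cpat_lift k : cpat (lift ord_max k) ord_max.
Proof. by rewrite /cpat eqxx eq_sym neq_lift. Qed.

Lemma cmxE t m : cmx m = ux (cvec (t := t) m).
Proof.
apply/matrixP => i j; rewrite !mxE; case: eqP => // /eqP ij.
case: (unliftP ord_max j) => [l|] jE; rewrite jE /cpat.
  by rewrite [lift _ _ == _]eq_sym (negbTE (neq_lift _ _)) andbF.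
rewrite eqxx andbT; case: (unliftP ord_max i) => [k|] iE; rewrite iE.
  by rewrite eq_sym neq_lift /= mxE subr0 clam_lift clam_max opprK.
by rewrite eqxx.
Qed.

Lemma rate_gt0 k : 0 < v k + S. Proof. exact: addr_gt0. Qed.

Lemma cdig_gt0 t p : cpat p.1 p.2 -> 0 <= t -> (0 < cdig t p)%N.
Proof.
case: p => i j /= /andP[iM /eqP->] t0; rewrite /cdig truncn_gt0 -expR0 ler_expR mulr_ge0 //.
case: (unliftP ord_max i) iM => [k|] ->; last by rewrite eqxx.
by rewrite /= clam_lift clam_max opprK ltW // rate_gt0.
Qed.

Lemma cdig_card t p : 0 <= t -> #|cfam t p| = if cpat p.1 p.2 then cdig t p else 1%N.
Proof.
move=> t0; case: ifP => pe; last first.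
  have -> : #|cfam t p| = #|pred1 (ord0 : 'I_(csize t).+1)|.
    by apply: eq_card => x; rewrite !unfold_in /cfam pe.
  by rewrite card1.
have c0 := cdig_gt0 pe t0; rewrite -[RHS](prednK c0).
have pl : ((cdig t p).-1 <= csize t)%N.
  by rewrite (leq_trans (leq_pred _)) // /csize (bigD1 p) //= leq_addr.
rewrite -(card_ord_le pl); apply: eq_card => x; rewrite !unfold_in /cfam pe.
by rewrite -[X in (x < X)%N](prednK c0) ltnS.
Qed.

Definition cnum t : nat := #|family (cfam t)|.

Lemma cnumE t : 0 <= t -> cnum t = (\prod_(p | cpat p.1 p.2) cdig t p)%N.
Proof.
move=> t0; rewrite /cnum card_family foldrE big_map big_enum /= [RHS]big_mkcond.
by apply: eq_bigr => p _; rewrite cdig_card.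
Qed.

Lemma big_cpat (F : 'I_e.+1 * 'I_e.+1 -> R) :
  \prod_(p | cpat p.1 p.2) F p = \prod_k F (lift ord_max k, ord_max).
Proof.
rewrite big_mkcond (eq_bigr (fun p => if cpat p.1 p.2 then F (p.1, p.2) else 1)); last by case.
rewrite -(pair_bigA _ (fun i j => if cpat i j then F (i, j) else 1)) /=.
rewrite (bigD1_ord ord_max) //= big1 ?mul1r; last by move=> j _; rewrite /cpat eqxx.
apply: eq_bigr => k _; rewrite (bigD1 ord_max) //= cpat_lift big1 ?mulr1 // => j jM.
by rewrite /cpat (negbTE jM) andbF.
Qed.

Lemma cnum_ge t : 0 <= t -> 2^-1 ^+ e * expR (e.+1%:R * S * t) <= (cnum t)%:R.
Proof.
move=> t0; rewrite cnumE // natr_prod big_cpat.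
have -> : e.+1%:R * S * t = (\sum_k (v k + S)) * t.
  by rewrite big_split /= v_sum sumr_const card_ord -mulr_natl -natr1; ring.
rewrite mulr_suml expR_sum -[in 2^-1 ^+ e](card_ord e) -prodr_const -big_split /=.
apply: ler_prod => k _; rewrite mulr_ge0 ?expR_ge0 ?invr_ge0 //= /cdig /= clam_lift clam_max opprK.
set E := expR _; have E1 : 1 <= E by rewrite /E -[1]expR0 ler_expR mulr_ge0 // ltW // rate_gt0.
have /andP[_] := truncn_itv (le_trans ler01 E1).
have : 1 <= (Num.trunc E)%:R :> R by rewrite ler1n truncn_gt0.
by rewrite -natr1; lra.
Qed.

Lemma cvec_ge0 t m k : 0 <= cvec (t := t) m k 0.
Proof. by rewrite mxE mulr_ge0 ?expR_ge0. Qed.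

(** A whole cell of margin is left below 1, so that nested expansions stay in the unit cube
    ([words_range]). *)
Lemma cvec_lt t m k : 0 <= t -> m \in family (cfam t) ->
  cvec m k 0 <= 1 - expR (- ((v k + S) * t)).
Proof.
move=> t0 /familyP/(_ (lift ord_max k, ord_max)); rewrite unfold_in /cfam /= cpat_lift => mk.
rewrite mxE lerBrDr -[X in _ + X]mul1r -mulrDl natr1 expRN ler_pdivrMr ?expR_gt0 // mul1r.
have -> : (v k + S) * t = (clam (lift ord_max k) - clam ord_max) * t by rewrite clam_lift clam_max opprK.
apply: le_trans (_ : (cdig t (lift ord_max k, ord_max))%:R <= _); first by rewrite ler_nat.
by rewrite truncn_le // expR_ge0.
Qed.

Lemma cvec_sep t m m' : m \in family (cfam t) -> m' \in family (cfam t) -> m != m' ->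
  exists k, expR (- ((v k + S) * t)) <= `|cvec m k 0 - cvec m' k 0|.
Proof.
move=> /familyP mF /familyP m'F mm'.
have [[i j] ijE] : exists p, m p != m' p.
  apply: contrapT => h; move/eqP: mm'; apply; apply/ffunP => p.
  by apply: contrapT => /eqP pE; apply: h; exists p.
have := mF (i, j); have := m'F (i, j); rewrite !unfold_in /cfam /=.
case: ifP => [/andP[iM /eqP jE]|_ /eqP m0 /eqP m'0]; last by rewrite m0 m'0 eqxx in ijE.
case: (unliftP ord_max i) iM => [k|] iE; last by rewrite iE eqxx.
move=> _ _ _; exists k; rewrite !mxE -mulrBl normrM (ger0_norm (expR_ge0 _)) ler_peMl ?expR_ge0 //.
move: ijE; rewrite iE jE; move: (m _) (m' _) => a b ab.
have -> : a%:R - b%:R = (a%:Z - b%:Z)%:~R :> R by rewrite intrB.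
by apply: intr_norm_ge1; rewrite subr_eq0 eqz_nat (inj_eq val_inj).
Qed.

(** A pivot among the first [e] coordinates is expanded and gains e^(- b v_k t). If the pivot is the
    contracted coordinate, the loss e^(b S t) is beaten by the e^((e + 1) S t) digits summed out,
    because b < e + 1. *)
Lemma column_contraction (b : R) : e%:R < b < e.+1%:R -> exists2 t0, 0 <= t0 &
  forall t, t0 <= t -> forall x : 'cV[R]_e.+1, x != 0 ->
  \sum_(m in family (cfam t)) mnorm (dmx clam t *m cmx m *m x) `^ (- b) <=
  (cnum t)%:R / 4 * mnorm x `^ (- b).
Proof.
move=> /andP[db bd]; have dr0 : 0 < e%:R :> R by rewrite ltr0n.
have b0 : 0 < b := lt_trans dr0 db.
have e1 : 0 < b / e%:R - 1 by rewrite subr_gt0 ltr_pdivlMr // mul1r.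
have cardP j : (1 + (b / e%:R - 1)) * #|[pred i | cpat i j]|%:R <= b.
  rewrite addrC subrK; apply: le_trans (_ : b / e%:R * e%:R <= _); last by rewrite divfK // gt_eqF.
  by rewrite ler_wpM2l ?divr_ge0 ?(ltW b0) // ler_nat card_cpat.
have [C C0 HC] := grid_sum clam cpat_lt b0 e1 ler01 cardP.
have [k0 k00 k0P] := uniform_gap (fun i => mulr_gt0 b0 (v_gt0 i)).
pose k1 := (e.+1%:R - b) * S; have k10 : 0 < k1 by rewrite mulr_gt0 // subr_gt0.
pose kk := Num.min k0 k1; have kk0 : 0 < kk by rewrite lt_min k00.
have Ce0 : 0 <= C * (e.+1%:R * 2 ^+ e) by rewrite !mulr_ge0 ?exprn_ge0 // ltW.
have q0 : (0 : R) < 4^-1 by lra.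
have [t0 t00 Ht0] := exp_decay kk0 Ce0 q0.
exists t0 => // t tt x x0; have tge := le_trans t00 tt.
apply: le_trans (HC t _ _ (cfam t) x x0 _) _.
  move=> m mF i j ij; have /andP[iM /eqP jE] := ij; subst j.
  case: (unliftP ord_max i) iM => [k|] iE; last by rewrite iE eqxx.
  rewrite iE => _; have := cmxE m; rewrite /cmx => ->; rewrite ux_lift_max ger0_norm ?cvec_ge0 //.
  by apply: le_trans (cvec_lt _ tge mF) _; rewrite lerBlDr lerDl expR_ge0.
set mv := mnorm x `^ _; have mv0 : 0 <= mv by exact: powR_ge0.
have Qp p : #|cfam t p|%:R = if cpat p.1 p.2 then (cdig t p)%:R else 1 :> R.
  by rewrite cdig_card //; case: ifP.
have h2 : 1 <= 2 ^+ e :> R by rewrite exprn_ege1 // ler1n.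
have E0 := expR_ge0 (- (kk * t)).
have term j : expR (- (b * clam j * t)) * \prod_(p | ~~ (cpat p.1 p.2 && (p.2 == j))) #|cfam t p|%:R
    <= 2 ^+ e * expR (- (kk * t)) * (cnum t)%:R.
  case: (unliftP ord_max j) => [k|] ->.
    rewrite clam_lift; have -> : \prod_(p | ~~ (cpat p.1 p.2 && (p.2 == lift ord_max k))) #|cfam t p|%:R = (cnum t)%:R :> R.
      rewrite cnumE // natr_prod [RHS]big_mkcond; apply: eq_big => [[i l]|p _] /=; last exact: Qp.
      by apply/negP => /andP[/andP[_ /eqP->]]; rewrite (negbTE (neq_lift _ _)).
    rewrite ler_wpM2r // -[leLHS]mul1r ler_pM ?expR_ge0 // ler_expR lerN2 ler_wpM2r //.
    by rewrite (le_trans _ (k0P k)) // ge_min lexx.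
  rewrite clam_max big1 ?mulr1; last first.
    move=> p; rewrite Qp; case: ifP => //= /andP[_ /eqP->]; by rewrite eqxx.
  apply: le_trans (_ : 2 ^+ e * expR (- (kk * t)) * (2^-1 ^+ e * expR (e.+1%:R * S * t)) <= _); last first.
    by rewrite ler_wpM2l ?cnum_ge // mulr_ge0 ?exprn_ge0.
  rewrite mulrACA -exprMn divff // expr1n mul1r -expRD ler_expR.
  have : kk <= k1 by rewrite ge_min lexx orbT.
  by rewrite /k1 => h; have := ler_wpM2r tge h; lra.
apply: le_trans (_ : C * mv * \sum_(j < e.+1) (2 ^+ e * expR (- (kk * t)) * (cnum t)%:R) <= _).
  by rewrite ler_wpM2l ?mulr_ge0 ?(ltW C0) // ler_sum.
rewrite sumr_const card_ord -[X in C * mv * X]mulr_natl.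
have -> : C * mv * (e.+1%:R * (2 ^+ e * expR (- (kk * t)) * (cnum t)%:R)) =
  (C * (e.+1%:R * 2 ^+ e) * expR (- (kk * t))) * ((cnum t)%:R * mv) by ring.
apply: le_trans (_ : 4^-1 * ((cnum t)%:R * mv) <= _).
  by rewrite ler_wpM2r ?mulr_ge0 // Ht0.
by rewrite mulrA [4^-1 * _]mulrC.
Qed.

Lemma det_cmx t m : \det (cmx (t := t) m) = 1.
Proof. by rewrite cmxE det_ux. Qed.

(** If [g] has a vector of norm at most [l], the count of [hsum_step] doubles the factor 1/4.
    Otherwise no translate has a vector shorter than [l / r], and all heights are at most [B]. *)
Lemma hsum_column (b : R) : e%:R < b < e.+1%:R -> exists2 t0, 0 <= t0 &
  forall t, t0 <= t -> exists2 B, 0 <= B & forall g : 'M[R]_e.+1, `|\det g| = 1 ->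
  \sum_(m in family (cfam t)) hsum b (dmx clam t *m cmx m *m g) <=
  (cnum t)%:R * (hsum b g / 2 + B).
Proof.
move=> bb; have /andP[db _] := bb; have [t0 t00 HC] := column_contraction bb.
have b0 : 0 <= b by rewrite (le_trans _ (ltW db)).
exists t0 => // t tt.
pose r : R := 1 + \sum_(m in family (cfam t)) e.+1%:R * mnorm (invmx (dmx clam t *m cmx m)).
have r1 : 1 <= r by rewrite lerDl sumr_ge0 // => m _; rewrite mulr_ge0 ?mnorm_ge0.
have rm m : m \in family (cfam t) -> e.+1%:R * mnorm (invmx (dmx clam t *m cmx m)) <= r.
  move=> mF; rewrite /r (bigD1 m) //= addrA addrAC lerDr addr_ge0 // sumr_ge0 // => m' _.
  by rewrite mulr_ge0 ?mnorm_ge0.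
have [l /andP[l0 l1] Hl] := short_count_le db r1.
have lr0 : 0 < l / r by rewrite divr_gt0 // (lt_le_trans ltr01).
have [B B0 HB] := hsum_bounded e b0 lr0.
exists B => [|g g1]; first exact: ltW.
have ku (m : {ffun 'I_e.+1 * 'I_e.+1 -> 'I_(csize t).+1}) : dmx clam t *m cmx m \in unitmx by rewrite unitmx_mul dmx_unit cmxE ux_unit.
have [gl|ngl] := pselect (exists2 z : 'cV[int]_e.+1, z != 0 & mnorm (g *m intmx z) <= l).
  have D0 : 0 <= (cnum t)%:R / 4 :> R by rewrite divr_ge0.
  apply: le_trans (@hsum_step _ _ b ((cnum t)%:R / 4) r _ _ _ g (unit_of_det1 g1) b0 D0 r1 _ _ _) _.
  - by move=> m _; exact: ku.
  - move=> m z mQ kz; rewrite -(mulKmx (ku m) (g *m intmx z)) [_ *m (g *m _)]mulmxA.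
    apply: le_trans (mnormM _ _) _; rewrite mulrA.
    apply: le_trans (rm m mQ); rewrite -[leRHS]mulr1.
    by rewrite ler_wpM2l ?mulr_ge0 ?mnorm_ge0.
  - by move=> x x0; exact: HC.
  have := Hl g g1 gl; have := hsum_ge0 b g; have : 0 <= (cnum t)%:R :> R by [].
  by move: (hsum b g) (cnum t)%:R (size _)%:R => h c s c0 h0 sh; nra.
apply: le_trans (_ : \sum_(m in family (cfam t)) B <= _); last first.
  by rewrite sumr_const -[X in _ *+ X]/(cnum t) -[B *+ _]mulr_natl ler_wpM2l // lerDr divr_ge0 ?hsum_ge0.
apply: ler_sum => m mF; apply: HB.
  by rewrite !det_mulmx det_clam det_cmx !mul1r.
move=> z z0; rewrite ler_pdivrMr ?(lt_le_trans ltr01) //.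
have h : l <= mnorm (g *m intmx z).
  by rewrite leNgt; apply/negP => zl; apply: ngl; exists z => //; exact: ltW.
apply: le_trans h _; rewrite -(mulKmx (ku m) (g *m intmx z)) [_ *m (g *m _)]mulmxA.
apply: le_trans (mnormM _ _) _; rewrite mulrA [leRHS]mulrC ler_wpM2r ?mnorm_ge0 //.
exact: rm.
Qed.

End ColumnContraction.

Arguments cfam {R e} v S t p.
Arguments cvec {R e} v S {t} m.
Arguments cmx {R e} v S {t} m.

(** Markov's inequality for the counting measure. *)
Lemma markov_filter (R : realType) (T : eqType) (s : seq T) (F : T -> R) a :
  (forall x, 0 <= F x) -> 0 < a -> \sum_(x <- s) F x <= (size s)%:R * a ->
  (size s)%:R / 2 <= (size [seq x <- s | F x <= 2 * a])%:R :> R.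
Proof.
move=> F0 a0 sa; rewrite size_filter.
have : (size s)%:R = (count (fun x => F x <= 2 * a) s)%:R + (count (predC (fun x => F x <= 2 * a)) s)%:R :> R.
  by rewrite -natrD count_predC.
suff : 2 * a * (count (predC (fun x => F x <= 2 * a)) s)%:R <= (size s)%:R * a.
  move: (count _ _)%:R (count _ _)%:R (size s)%:R => p q n h1 h2.
  have : 2 * q <= n by rewrite -(ler_pM2l a0) mulrA [a * 2]mulrC [a * n]mulrC.
  by move=> h3; rewrite ler_pdivrMr //; lra.
apply: le_trans sa; elim: s => [|x s IH]; first by rewrite /= mulr0 big_nil.
rewrite big_cons [count _ _]/=; case: (leP (F x) (2 * a)) => h.
  by rewrite add0n; apply: le_trans IH _; rewrite lerDr.
set c := count _ s in IH *; have -> : (~~ false + c)%:R = c%:R + 1 :> R by rewrite natr1.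
by rewrite [_ * (c%:R + 1)]mulrDr mulr1 addrC lerD // ltW.
Qed.

(** * Words of digits and generic points of the expanding column *)

Section Words.
Variables (R : realType) (e : nat) (v : 'I_e -> R) (S : R).
Hypothesis e0 : (0 < e)%N.
Hypothesis v_gt0 : forall i, 0 < v i.
Hypothesis S_gt0 : 0 < S.
Hypothesis v_sum : \sum_i v i = S.

Local Notation lam := (clam v S).

(* Expansions with [M] digits, each followed by a time-[t] contraction. *)
Fixpoint words (t : R) (M : nat) : seq 'cV[R]_e :=
  if M is M'.+1 then
    [seq cvec v S m + stretch lam (- t) y | m <- enum (family (cfam v S t)), y <- words t M']
  else [:: 0].

Definition wsize (t : R) M k := expR (- ((v k + S) * (M%:R * t))).

Lemma stretchE t x k : stretch lam t x k 0 = expR ((v k + S) * t) * x k 0.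
Proof. by rewrite mxE clam_lift clam_max opprK. Qed.

Lemma size_words t M : size (words t M) = (cnum v S t ^ M)%N.
Proof. by elim: M => [//|M IH]; rewrite /= size_allpairs IH -cardE expnS. Qed.

Lemma wsizeS t M k : wsize t M.+1 k = expR (- ((v k + S) * t)) * wsize t M k.
Proof. by rewrite /wsize -expRD; congr expR; rewrite -natr1; ring. Qed.

Lemma words_range t M y k : 0 <= t -> y \in words t M -> 0 <= y k 0 <= 1 - wsize t M k.
Proof.
move=> t0; elim: M y k => [|M IH] y k.
  by rewrite inE => /eqP ->; rewrite mxE /wsize !mul0r mulr0 oppr0 expR0 subrr lexx.
move=> /allpairsP[[m y'] /= [mF y'W ->]]; rewrite mem_enum in mF.
have /andP[h1 h2] := IH y' k y'W; have h3 := cvec_lt k t0 mF; have h4 := cvec_ge0 m k.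
rewrite mxE stretchE wsizeS mulrN; move: h1 h2 h3 h4 (expR_ge0 (- ((v k + S) * t))).
by move: (expR _) (wsize _ _ _) (y' k 0) (cvec v S m k 0) => a b c z h1 h2 h3 h4 h5; apply/andP; split; nra.
Qed.

Lemma words_step_sep t M m m' (y y' : 'cV[R]_e) : 0 <= t ->
  m \in family (cfam v S t) -> m' \in family (cfam v S t) ->
  y \in words t M -> y' \in words t M ->
  (y != y' -> exists k, wsize t M k <= `|y k 0 - y' k 0|) ->
  (m, y) != (m', y') ->
  exists k, wsize t M.+1 k <= `|(cvec v S m + stretch lam (- t) y) k 0 - (cvec v S m' + stretch lam (- t) y') k 0|.
Proof.
move=> t0 mF m'F yW y'W ysep; rewrite xpair_eqE negb_and.
have [<- /= /ysep[k hk]|mm' _] := eqVneq m m'; last first.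
  have [k hk] := cvec_sep mF m'F mm'; exists k; rewrite wsizeS.
  rewrite [X in `|X - _|]mxE [X in `|_ - X|]mxE !stretchE !mulrN.
  have /andP[h1 h2] := words_range k t0 yW; have /andP[h3 h4] := words_range k t0 y'W.
  have E0 := expR_ge0 (- ((v k + S) * t)).
  move: hk h1 h2 h3 h4 E0; move: (expR _) (wsize _ _ _) (y k 0) (y' k 0) (cvec v S m k 0) (cvec v S m' k 0).
  move=> a b c c' z z' hk h1 h2 h3 h4 a0.
  have h5 : `|a * (c - c')| <= a * (1 - b).
    by rewrite normrM (ger0_norm a0) ler_wpM2l // ler_norml; apply/andP; split; lra.
  have := lerB_normD (z - z') (a * (c - c')).
  have -> : z - z' + a * (c - c') = z + a * c - (z' + a * c') by ring.
  lra.
exists k; rewrite wsizeS [X in `|X - _|]mxE [X in `|_ - X|]mxE !stretchE !mulrN.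
have -> : cvec v S m k 0 + expR (- ((v k + S) * t)) * y k 0 -
   (cvec v S m k 0 + expR (- ((v k + S) * t)) * y' k 0) = expR (- ((v k + S) * t)) * (y k 0 - y' k 0) by ring.
by rewrite normrM (ger0_norm (expR_ge0 _)) ler_wpM2l ?expR_ge0.
Qed.

Lemma words_sep t M y y' : 0 <= t -> y \in words t M -> y' \in words t M -> y != y' ->
  exists k, wsize t M k <= `|y k 0 - y' k 0|.
Proof.
move=> t0; elim: M y y' => [|M IH] y y'; first by rewrite !inE => /eqP-> /eqP->; rewrite eqxx.
move=> /allpairsP[[m z] /= [mF zW ->]] /allpairsP[[m' z'] /= [m'F z'W ->]] yy.
rewrite !mem_enum in mF m'F; apply: words_step_sep => //; first exact: IH.
by apply: contraNneq yy => -[-> ->].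
Qed.

Lemma words_uniq t M : 0 <= t -> uniq (words t M).
Proof.
move=> t0; elim: M => [//|M IH]; apply: allpairs_uniq => //; first exact: enum_uniq.
move=> [m y] [m' y'] /allpairsP[[n z] /= [nF zW [-> ->]]] /allpairsP[[n' z'] /= [n'F z'W [-> ->]]] /= h.
rewrite !mem_enum in nF n'F; apply/eqP; apply: contrapT => /negP ne.
have [k] := words_step_sep t0 nF n'F zW z'W (words_sep t0 zW z'W) ne.
by rewrite h subrr normr0 leNgt expR_gt0.
Qed.

(** Iteration of x -> x / 2 + B: the influence of the initial height dies out, and the additive
    errors sum to less than 2 B. *)
Lemma words_hsum t b B M (g : 'M[R]_e.+1) : 0 <= B ->
  (forall g : 'M[R]_e.+1, `|\det g| = 1 ->
    \sum_(m in family (cfam v S t)) hsum b (dmx lam t *m cmx v S m *m g) <=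
     (cnum v S t)%:R * (hsum b g / 2 + B)) -> `|\det g| = 1 ->
  \sum_(y <- words t M) hsum b (dmx lam (M%:R * t) *m ux y *m g) <=
    (cnum v S t)%:R ^+ M * (2^-1 ^+ M * hsum b g + 2 * (1 - 2^-1 ^+ M) * B).
Proof.
move=> B0 HB; elim: M g => [|M IH] g g1.
  by rewrite big_seq1 mul0r dmx0 mul1mx ux0 mul1mx expr0 !mul1r subrr mulr0 mul0r addr0.
rewrite /= big_allpairs_dep big_enum /=.
apply: le_trans (_ : \sum_(m in family (cfam v S t)) (cnum v S t)%:R ^+ M *
   (2^-1 ^+ M * hsum b (dmx lam t *m cmx v S m *m g) + 2 * (1 - 2^-1 ^+ M) * B) <= _).
  apply: ler_sum => m _; apply: le_trans (IH (dmx lam t *m cmx v S m *m g) _); last first.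
    by rewrite !det_mulmx det_clam // det_cmx !mul1r.
  rewrite le_eqVlt; apply/orP; left; apply/eqP; apply: eq_bigr => y _; congr hsum.
  have e1 : dmx lam t *m ux (stretch lam (- t) y) = ux y *m dmx lam t.
    by rewrite dmx_ux stretch_stretch subrr stretch0.
  rewrite -natr1 mulrDl mul1r dmxD addrC uxD cmxE !mulmxA.
  by rewrite -[_ *m dmx lam t *m ux (stretch _ _ _)]mulmxA e1 !mulmxA.
rewrite -mulr_sumr [(cnum v S t)%:R ^+ M.+1]exprSr -[leRHS]mulrA ler_wpM2l ?exprn_ge0 //.
rewrite big_split /= -mulr_sumr sumr_const -[_ *+ #|_|]/(_ *+ cnum v S t) -[_ *+ cnum v S t]mulr_natl.
have := HB g g1; set N := (cnum v S t)%:R; set q := 2^-1 ^+ M => h.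
have q0 : 0 <= q by rewrite exprn_ge0 // invr_ge0.
apply: le_trans (_ : q * (N * (hsum b g / 2 + B)) + N * (2 * (1 - q) * B) <= _).
  by rewrite lerD2r ler_wpM2l.
by rewrite exprS -/q le_eqVlt; apply/orP; left; apply/eqP; field.
Qed.

Lemma hsum_lattice_ge b C (g : 'M[R]_e.+1) : 0 < b -> 1 <= C -> `|\det g| = 1 -> hsum b g <= C ->
  lattice_ge g (C `^ (- b^-1)).
Proof.
move=> b0 C1 g1 hC z z0; have C0 := lt_le_trans ltr01 C1.
rewrite leNgt; apply/negP => h.
have gz0 := mnorm_gt0 (gz_neq0 (unit_of_det1 g1) z0).
have gz1 : mnorm (g *m intmx z) <= 1.
  by rewrite (le_trans (ltW h)) // powRN invf_le1 ?powR_gt0 // -[1]/((fun=> 1 : R) b^-1) -powR1 ge0_ler_powR ?nnegrE ?invr_ge0 ?(ltW b0) ?(ltW C0).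
have := le_trans (hsum_ge b (unit_of_det1 g1) z0 gz1) hC.
rewrite leNgt => /negP; apply.
rewrite powRN -[C]invrK ltf_pV2 ?posrE ?invr_gt0 ?powR_gt0 //.
have -> : C^-1 = (C `^ (- b^-1)) `^ b by rewrite -powRrM mulNr mulVf ?gt_eqF // powR_inv1 // ltW.
by rewrite gt0_ltr_powR // ?nnegrE ?mnorm_ge0 ?powR_ge0.
Qed.

(** [delta] is independent of [l]: the initial lattice only decides how long to wait until its
    height divided by 2^M is at most 1. The average height is then at most 1 + 2 B, and half of the
    words have height at most twice that. *)
Theorem generic_words (eta : R) : 0 < eta -> exists t delta, [/\ 0 < t, 0 < delta &
  forall l, 0 < l -> exists M0, forall M, (M0 <= M)%N -> forall g : 'M[R]_e.+1, `|\det g| = 1 ->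
    lattice_ge g l -> exists ys : seq 'cV[R]_e,
    [/\ uniq ys, expR ((e.+1%:R * S - eta) * (M%:R * t)) <= (size ys)%:R,
      forall y, y \in ys -> forall k, 0 <= y k 0 <= 1,
      forall y y', y \in ys -> y' \in ys -> y != y' -> exists k, wsize t M k <= `|y k 0 - y' k 0| &
      forall y, y \in ys -> lattice_ge (dmx lam (M%:R * t) *m ux y *m g) delta]].
Proof.
move=> eta0; pose b : R := e%:R + 2^-1.
have bb : e%:R < b < e.+1%:R by rewrite /b -[e.+1%:R]natr1; apply/andP; split; lra.
have b0 : 0 < b by case/andP: bb => h _; apply: le_lt_trans h.
have [t0 t00 Ht0] := hsum_column e0 v_gt0 S_gt0 v_sum bb.
have c0 : 0 <= 2 ^+ e.+1 :> R by exact: exprn_ge0.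
have [t1 t10 Ht1] := exp_decay eta0 c0 ltr01.
pose t := 1 + t0 + t1; have t_gt0 : 0 < t by rewrite /t; lra.
have tt0 : t0 <= t by rewrite /t; lra.
have tt1 : t1 <= t by rewrite /t; lra.
have {}Ht1 := Ht1 t tt1; clearbody t.
have [B B0 HB] := Ht0 t tt0.
pose C := 2 * (1 + 2 * B); have C1 : 1 <= C by rewrite /C; lra.
have C0 := lt_le_trans ltr01 C1.
exists t, (C `^ (- b^-1)); split=> //; first by rewrite powR_gt0.
move=> l l0; have [B' B'0 HB'] := hsum_bounded e (ltW b0) l0.
have [M0 HM0] := halving_decay B' ltr01.
exists M0.+1 => M MM g g1 gl.
pose F (y : 'cV[R]_e) := hsum b (dmx lam (M%:R * t) *m ux y *m g).
exists [seq y <- words t M | F y <= C].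
have h1 : \sum_(y <- words t M) F y <= (size (words t M))%:R * (1 + 2 * B).
  apply: le_trans (words_hsum M B0 HB g1) _.
  rewrite size_words natrX ler_wpM2l ?exprn_ge0 // lerD //.
    by apply: le_trans (HM0 M (ltnW MM)); rewrite mulrC ler_wpM2r ?exprn_ge0 ?invr_ge0 // HB'.
  by rewrite ler_wpM2r // ler_piMr // gerBl exprn_ge0 // invr_ge0.
have a0 : 0 < 1 + 2 * B by lra.
split.
- by rewrite filter_uniq // words_uniq // ltW.
- apply: le_trans (markov_filter (fun y => hsum_ge0 b _) a0 h1).
  rewrite size_words natrX; have M1 : (0 < M)%N by exact: leq_trans MM.
  (* [t] is so long that [eta] absorbs the constant of [cnum_ge] and one more factor 2, which pays
     for the half discarded by Markov's inequality. *)
  have h2 : 2 * expR ((e.+1%:R * S - eta) * t) <= (cnum v S t)%:R.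
    apply: le_trans (cnum_ge v_gt0 S_gt0 v_sum (ltW t_gt0)).
    rewrite mulrBl expRD -(ler_pM2l (_ : 0 < (2 : R) ^+ e)) ?exprn_gt0 // [leRHS]mulrA -exprMn divff // expr1n mul1r.
    have -> : 2 ^+ e * (2 * (expR (e.+1%:R * S * t) * expR (- (eta * t)))) = expR (e.+1%:R * S * t) * (2 ^+ e.+1 * expR (- (eta * t))) by rewrite exprS; ring.
    by rewrite ler_piMr ?expR_ge0.
  have -> : expR ((e.+1%:R * S - eta) * (M%:R * t)) = expR ((e.+1%:R * S - eta) * t) ^+ M.
    by rewrite -expRM_natl; congr expR; ring.
  set x := expR _ in h2 *; have x0 : 0 <= x by exact: expR_ge0.
  rewrite ler_pdivlMr //; apply: le_trans (_ : (2 * x) ^+ M <= _).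
    rewrite exprMn mulrC ler_wpM2r ?exprn_ge0 // -[leLHS]expr1.
    by rewrite ler_weXn2l // ler1n.
  by rewrite lerXn2r ?nnegrE ?mulr_ge0.
- move=> y; rewrite mem_filter => /andP[_ yW] k; have /andP[h2 h3] := words_range k (ltW t_gt0) yW.
  by rewrite h2 (le_trans h3) // gerBl expR_ge0.
- by move=> y y'; rewrite !mem_filter => /andP[_ yW] /andP[_ y'W]; exact: words_sep (ltW t_gt0) yW y'W.
- move=> y; rewrite mem_filter => /andP[yF _]; apply: hsum_lattice_ge => //.
  by rewrite !det_mulmx det_clam // det_ux !mul1r.
Qed.

End Words.

(** * Dual lattices and their quotients *)

Section DualBounds.
Variable R : realType.

Lemma inv_bound n (A : 'M[R]_n) C : `|\det A| = 1 -> 0 <= C -> mnorm A <= C ->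
  mnorm (invmx A) <= (n.-1`!)%:R * C ^+ n.-1.
Proof.
move=> A1 C0 AC.
have Au : A \in unitmx by exact: unit_of_det1.
apply: mnorm_le => [|i j]; first by rewrite mulr_ge0 ?exprn_ge0.
rewrite /invmx Au !mxE normrM normfV A1 invr1 mul1r /cofactor normrM normrX normrN1 expr1n mul1r.
apply: le_trans (det_le_colnorm _) _; rewrite ler_wpM2l //.
rewrite -[in X in _ <= X](card_ord n.-1) -prodr_const; apply: ler_prod => k _.
rewrite mnorm_ge0 /=; apply: mnorm_le => // a b.
by rewrite !mxE (le_trans (mnorm_entry _ _ _)).
Qed.

Definition dual_ge n (G : 'M[R]_n) (delta : R) :=
  forall z : 'rV[int]_n, z != 0 -> delta <= mnorm (intmx z *m G).

Lemma mnorm_tr m n (A : 'M[R]_(m, n)) : mnorm A^T = mnorm A.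
Proof.
have sub p q (B : 'M[R]_(p, q)) : mnorm B^T <= mnorm B.
  by apply: mnorm_le => [|i j]; rewrite ?mnorm_ge0 // mxE mnorm_entry.
by apply/eqP; rewrite eq_le sub -{1}(trmxK A) sub.
Qed.

Lemma intmx_tr m n (A : 'M[int]_(m, n)) : (intmx A)^T = intmx A^T :> 'M[R]_(n, m).
Proof. by apply/matrixP => i j; rewrite !mxE. Qed.

Lemma int_row_ge1 m n (z : 'M[int]_(m, n)) : z != 0 -> 1 <= mnorm (intmx z : 'M[R]_(m, n)).
Proof.
move=> z0; have [i [j zij]] : exists i j, z i j != 0.
  apply: contrapT => h; move/eqP: z0; apply; apply/matrixP => i j.
  by rewrite mxE; apply: contrapT => /eqP zij; apply: h; exists i, j.
by apply: le_trans (mnorm_entry _ i j); rewrite mxE intr_norm_ge1.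
Qed.

Lemma dual_basis n (G : 'M[R]_n.+1) delta : `|\det G| = 1 -> 0 < delta -> dual_ge G delta ->
  exists2 c : 'M[int]_n.+1, c \in unitmx &
    mnorm (intmx c *m G) <= 2 ^+ (n.+1 * n.+1) / delta ^+ n.
Proof.
move=> G1 d0 Gd; have GT1 : `|\det G^T| = 1 by rewrite det_tr.
have [|c cu cb] := bounded_basis (unit_of_det1 GT1) d0.
  move=> z z0; rewrite -mnorm_tr trmx_mul trmxK intmx_tr; apply: Gd.
  by rewrite -(inj_eq (@trmx_inj _ _ _)) trmxK linear0.
exists c^T; first by rewrite unitmx_tr.
rewrite -mnorm_tr trmx_mul intmx_tr trmxK; apply: mnorm_le => [|i j].
  by rewrite divr_ge0 ?exprn_ge0 // ltW.
apply: le_trans (_ : mnorm (col j (G^T *m intmx c)) <= _); last first.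
  by have := cb j; rewrite GT1 mulr1.
by have := mnorm_entry (col j (G^T *m intmx c)) i 0; rewrite [col _ _ _ _]mxE.
Qed.

(** A bounded basis of the row lattice of [G] pairs with [u] to integers that are not all 0, so [u]
    cannot be short. *)
Lemma primal_ge n (delta : R) : 0 < delta -> exists2 c, 0 < c &
  forall (G : 'M[R]_n.+1) (u : 'cV[R]_n.+1) (z : 'cV[int]_n.+1), `|\det G| = 1 -> dual_ge G delta ->
   z != 0 -> G *m u = intmx z -> c <= mnorm u.
Proof.
move=> d0; pose C : R := 2 ^+ (n.+1 * n.+1) / delta ^+ n.
have C0 : 0 < C by rewrite divr_gt0 ?exprn_gt0.
exists (n.+1%:R * C)^-1; first by rewrite invr_gt0 mulr_gt0.
move=> G u z G1 Gd z0 Gu; have [c cu cb] := dual_basis G1 d0 Gd.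
have cz0 : c *m z != 0.
  by apply: contra_neq z0 => cz; rewrite -(mulKmx cu z) cz mulmx0.
have := int_row_ge1 cz0; rewrite map_mxM -Gu mulmxA => h.
rewrite -[_^-1]mulr1 ler_pdivrMl; last exact: (mulr_gt0 (ltr0Sn _ _) C0).
apply: le_trans h _; apply: le_trans (mnormM _ _) _.
by rewrite -mulrA ler_wpM2l // ler_wpM2r ?mnorm_ge0.
Qed.

End DualBounds.

Section Projection.
Variables (R : realType) (e : nat).

(* Among the first [e + 1] coordinates, [ic] is the one of smallest weight: it is
   solved for, while the coordinates [ix k] stay free. *)
Definition ix (k : 'I_e) : 'I_e.+2 := lift ord_max (lift ord_max k).
Definition ic : 'I_e.+2 := lift ord_max ord_max.

Lemma lift_ic_max : lift ic ord_max = ord_max.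
Proof. by apply: val_inj; rewrite /= /bump /=; lia. Qed.

Lemma lift_ic_lift k : lift ic (lift ord_max k) = ix k.
Proof.
apply: val_inj; rewrite /= /bump /= /bump; have := ltn_ord k => h.
by move: h => /=; lia.
Qed.

(** Quotient of row space by the line spanned by the vector with entries [beta k] at [ix k], 1 at
    [ic] and 0 at the end. *)
Definition pmx m (beta : 'I_e -> R) (A : 'M[R]_(m, e.+2)) : 'M[R]_(m, e.+1) :=
  \matrix_(i, j) oapp (fun k => A i (ix k) - beta k * A i ic) (A i ord_max) (unlift ord_max j).

Lemma pmx_lift m beta (A : 'M[R]_(m, e.+2)) i k :
  pmx beta A i (lift ord_max k) = A i (ix k) - beta k * A i ic.
Proof. by rewrite mxE liftK. Qed.

Lemma pmx_max m beta (A : 'M[R]_(m, e.+2)) i : pmx beta A i ord_max = A i ord_max.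
Proof. by rewrite mxE unlift_none. Qed.

Lemma pmxM m p beta (B : 'M[R]_(p, m)) (A : 'M[R]_(m, e.+2)) :
  pmx beta (B *m A) = B *m pmx beta A.
Proof.
apply/matrixP => i j; case: (unliftP ord_max j) => [k|] ->.
  rewrite pmx_lift !mxE mulr_sumr -sumrB; apply: eq_bigr => l _.
  by rewrite pmx_lift mulrBr mulrCA.
by rewrite pmx_max !mxE; apply: eq_bigr => l _; rewrite pmx_max.
Qed.

(** A column operation of determinant 1 that clears a row on this line outside column [ic]; deleting
    that column then gives [pmx], whence the determinant formula [det_proj]. *)
Definition elim_mx (beta : 'I_e -> R) : 'M[R]_e.+2 :=
  \matrix_(i, j) if i == ic then oapp (fun j' => oapp (fun k => - beta k) 1 (unlift ord_max j')) 0 (unlift ord_max j)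
     else (i == j)%:R.

Lemma elim_ic_ix beta k : elim_mx beta ic (ix k) = - beta k.
Proof. by rewrite mxE eqxx /ix liftK /= liftK. Qed.

Lemma elim_ic_ic beta : elim_mx beta ic ic = 1.
Proof. by rewrite mxE eqxx /ic liftK /= unlift_none. Qed.

Lemma elim_ic_max beta : elim_mx beta ic ord_max = 0.
Proof. by rewrite mxE eqxx unlift_none. Qed.

Lemma elim_neq beta i j : i != ic -> elim_mx beta i j = (i == j)%:R.
Proof. by rewrite mxE => /negbTE ->. Qed.

Lemma det_elim beta : \det (elim_mx beta) = 1.
Proof.
rewrite det_trig; last first.
  apply/is_trig_mxP => i j ij; have [iE|iN] := eqVneq i ic; last first.
    by rewrite elim_neq // (_ : i == j = false) //; apply: contraTF ij => /eqP ->; rewrite ltnn.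
  move: ij; rewrite iE; case: (unliftP ord_max j) => [j'|] ->; last by rewrite elim_ic_max.
  case: (unliftP ord_max j') => [k|] ->; last by rewrite ltnn.
  by rewrite /ic !lift_max ltnNge /= (ltnW (ltn_ord k)).
rewrite big1 // => i _; have [->|iN] := eqVneq i ic; first exact: elim_ic_ic.
by rewrite elim_neq // eqxx.
Qed.

Lemma mul_elim m beta (A : 'M[R]_(m, e.+2)) i j :
  (A *m elim_mx beta) i j = A i ic * elim_mx beta ic j + (if j == ic then 0 else A i j).
Proof.
rewrite mxE (bigD1 ic) //=; congr (_ + _); case: eqP => [->|/eqP jc].
  by rewrite big1 // => l lc; rewrite elim_neq // (negbTE lc) mulr0.
rewrite (bigD1 j) //= elim_neq // eqxx mulr1 big1 ?addr0 // => l /andP[lc lj].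
by rewrite elim_neq // (negbTE lj) mulr0.
Qed.

Lemma ix_neq_ic k : ix k != ic.
Proof. by rewrite /ix /ic (inj_eq (@lift_inj _ _)) eq_sym neq_lift. Qed.

Lemma max_neq_ic : ord_max != ic.
Proof. exact: neq_lift. Qed.

Lemma col'_elim m beta (A : 'M[R]_(m, e.+2)) : col' ic (A *m elim_mx beta) = pmx beta A.
Proof.
apply/matrixP => i j; rewrite [LHS]mxE; case: (unliftP ord_max j) => [k|] ->.
  rewrite lift_ic_lift mul_elim elim_ic_ix (negbTE (ix_neq_ic k)) pmx_lift mulrN addrC.
  by rewrite [beta k * _]mulrC.
by rewrite lift_ic_max mul_elim elim_ic_max (negbTE max_neq_ic) mulr0 add0r pmx_max.
Qed.

Lemma row_elim (b : 'rV[R]_e.+2) beta j : b 0 ord_max = 0 -> (forall k, b 0 (ix k) = beta k * b 0 ic) ->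
  j != ic -> (b *m elim_mx beta) 0 j = 0.
Proof.
move=> bn bk jc; rewrite mul_elim (negbTE jc).
case: (unliftP ord_max j) jc => [j'|] ->; last by rewrite elim_ic_max mulr0 add0r bn.
case: (unliftP ord_max j') => [k|] ->; last by rewrite eqxx.
by move=> _; rewrite elim_ic_ix bk mulrN mulrC addNr.
Qed.

Lemma det_proj (G : 'M[R]_e.+2) beta : G 0 ord_max = 0 -> (forall k, G 0 (ix k) = beta k * G 0 ic) ->
  `|\det G| = `|G 0 ic| * `|\det (pmx beta (row' 0 G))|.
Proof.
move=> bn bk; rewrite -[\det G]mulr1 -(det_elim beta) -det_mulmx.
have rE j : j != ic -> (G *m elim_mx beta) 0 j = 0.
  move=> jc; have := @row_elim (row 0 G) beta j; rewrite -row_mul ![row _ _ _ _]mxE; apply=> //.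
  by move=> k; rewrite !mxE.
rewrite (expand_det_row _ 0) (bigD1 ic) //= big1 ?addr0; last by move=> j jc; rewrite rE // mul0r.
rewrite mul_elim elim_ic_ic eqxx addr0 mulr1 normrM /cofactor normrM normrX normrN1 expr1n mul1r.
by rewrite -col'_elim; congr (_ * `|\det _|); apply/matrixP => i j; rewrite !mxE; apply: eq_bigr => l _; rewrite !mxE.
Qed.

End Projection.

Section Bases.
Variable R : realType.

Lemma bounded_pair n (r : R) : 0 < r -> exists2 C, 0 < C &
  forall g : 'M[R]_n.+1, `|\det g| = 1 -> lattice_ge g r ->
  exists2 c : 'M[int]_n.+1, c \in unitmx &
    mnorm (g *m intmx c) <= C /\ mnorm (invmx (g *m intmx c)) <= C.
Proof.
move=> r0; pose C1 : R := 2 ^+ (n.+1 * n.+1) / r ^+ n.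
have C10 : 0 < C1 by rewrite divr_gt0 ?exprn_gt0.
exists (C1 + (n`!)%:R * C1 ^+ n) => [|g g1 gr].
  by rewrite addr_gt0 // mulr_gt0 ?exprn_gt0 // ltr0n fact_gt0.
have [c cu cb] := bounded_basis (unit_of_det1 g1) r0 gr.
have gc1 : mnorm (g *m intmx c) <= C1.
  apply: mnorm_le => [|i j]; first exact: ltW.
  apply: le_trans (_ : mnorm (col j (g *m intmx c)) <= _); last first.
    by have := cb j; rewrite g1 mulr1.
  by have := mnorm_entry (col j (g *m intmx c)) i 0; rewrite [col _ _ _ _]mxE.
have d1 : `|\det (g *m intmx c)| = 1.
  by rewrite det_mulmx normrM g1 mul1r; have [] := unit_intmx R cu.
exists c => //; split.
  by rewrite (le_trans gc1) // lerDl mulr_ge0 ?exprn_ge0 // ltW.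
apply: le_trans (inv_bound d1 (ltW C10) gc1) _.
by rewrite lerDr ltW.
Qed.

(** Rounding of the coordinates of [tau] in the basis [W]. The bound on the coefficients is what
    lets a single factorial be divisible by any nonzero one of them. *)
Lemma near_lattice_point n (W : 'M[R]_n) (C : R) (tau : 'rV[R]_n) : W \in unitmx ->
  mnorm W <= C -> mnorm (invmx W) <= C ->
  exists m : 'rV[int]_n, [/\ forall j, `|(intmx m *m W) 0 j - tau 0 j| <= n%:R * C &
    forall j, `|m 0 j|%:~R <= n%:R * (mnorm tau * C) + 1].
Proof.
move=> Wu WC WC'; pose u := tau *m invmx W.
have C0 : 0 <= C by rewrite (le_trans _ WC) ?mnorm_ge0.
have /choice[m mP] : forall j, exists k : int, `|u 0 j + 1 * k%:~R| <= 1.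
  move=> j; have [k kP] := @round_int R (u 0 j) 1 (oner_neq0 _); exists k.
  by apply: le_trans kP _; rewrite normr1; lra.
have um j : `|(intmx (\row_i (- m i)) : 'rV[R]_n) 0 j - u 0 j| <= 1.
  by rewrite [X in X - _]mxE mxE intrN -opprD normrN addrC -[(m j)%:~R]mul1r.
exists (\row_i (- m i)); split=> j.
  have -> : (intmx (\row_i (- m i)) *m W) 0 j - tau 0 j = ((intmx (\row_i (- m i)) - u) *m W) 0 j.
    by rewrite mulmxBl /u mulmxKV // [RHS]mxE [X in _ = _ + X]mxE.
  apply: le_trans (mnorm_entry _ _ _) _; apply: le_trans (mnormM _ _) _.
  rewrite ler_wpM2l // -[leRHS]mul1r ler_pM ?mnorm_ge0 //.
  apply: mnorm_le => // i k; rewrite (ord1 i); have := um k.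
  by rewrite [(_ - u) 0 k]mxE [(- u) 0 k]mxE.
have uu : `|u 0 j| <= n%:R * (mnorm tau * C).
  apply: le_trans (mnorm_entry _ _ _) _; apply: le_trans (mnormM _ _) _.
  by rewrite ler_wpM2l // ler_wpM2l ?mnorm_ge0.
have := um j; rewrite [(intmx _) 0 j]mxE => h.
rewrite intr_norm -[X in `|X|](subrK (u 0 j)); apply: le_trans (ler_normD _ _) _.
by rewrite addrC lerD.
Qed.

Lemma window_count (a b A1 A2 : R) : a != 0 -> A1 <= A2 ->
  exists js : seq int, [/\ uniq js, (A2 - A1) / `|a| - 1 <= (size js)%:R &
    forall j, j \in js -> A1 <= b + a * j%:~R <= A2].
Proof.
move=> a0 A12; have an : 0 < `|a| by rewrite normr_gt0.
pose k0 := Num.ceil ((A1 - b) / `|a|).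
pose N := Num.trunc ((A2 - A1) / `|a|).
pose sa : int := if 0 < a then 1 else -1.
have sa1 : sa != 0 by rewrite /sa; case: ifP.
have saE : a * sa%:~R = `|a|.
  rewrite /sa; case: ltrP => h; first by rewrite mulr1 gtr0_norm.
  by rewrite ler0_norm // mulrN1.
exists [seq sa * (k0 + i%:Z) | i <- iota 0 N]; split.
- by rewrite map_inj_uniq ?iota_uniq // => i j /(mulfI sa1) /addrI [].
- rewrite size_map size_iota lerBlDr.
  have A0 : 0 <= A2 - A1 by rewrite subr_ge0.
  have /andP[_ /ltW] := truncn_itv (divr_ge0 A0 (ltW an)).
  by rewrite -natr1.
move=> j /mapP[i]; rewrite mem_iota add0n leq0n /= => iN ->.
rewrite intrM mulrA saE intrD -pmulrn.
have h1 : (A1 - b) / `|a| <= k0%:~R by exact: ceil_ge.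
have h2 : k0%:~R < (A1 - b) / `|a| + 1.
  by have /andP[+ _] := ceil_itv ((A1 - b) / `|a|); rewrite intrB ltrBlDr.
have h3 : (i%:R : R) + 1 <= (A2 - A1) / `|a|.
  apply: le_trans (_ : N%:R <= _); first by rewrite natr1 ler_nat.
  by rewrite truncn_le // divr_ge0 ?subr_ge0 // ltW.
have i0 : 0 <= i%:R :> R by [].
apply/andP; split.
  by rewrite -lerBlDl mulrC -ler_pdivrMr // (le_trans h1) // lerDl.
rewrite -lerBrDl mulrC -ler_pdivlMr //.
have -> : (A2 - b) / `|a| = (A1 - b) / `|a| + (A2 - A1) / `|a| by rewrite -mulrDl; congr (_ / _); ring.
lra.
Qed.

Lemma dual_ge_unimod n (G : 'M[R]_n) delta (c : 'M[int]_n) : c \in unitmx ->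
  dual_ge G delta -> dual_ge (intmx c *m G) delta.
Proof.
move=> cu Gd z z0; rewrite mulmxA -map_mxM; apply: Gd.
by apply: contra_neq z0 => zc; rewrite -(mulmxK cu z) zc mul0mx.
Qed.

(* [p] is congruent to 1 modulo a nonzero coefficient of [m], so [(p, m)] is primitive. *)
Lemma primitive_completion n (p : int) (m : 'rV[int]_n.+1) (c : 'M[int]_n.+1) i (q : int) :
  c \in unitmx -> p = 1 + m 0 i * q ->
  exists2 g : 'M[int]_n.+2, g \in unitmx & forall G : 'M[R]_n.+2,
    row 0 (intmx g *m G) = p%:~R *: row 0 G + intmx (m *m c) *m row' 0 G.
Proof.
move=> cu pE; pose z : 'cV[int]_n.+2 := \col_k oapp (fun l => (m *m c) 0 l) p (unlift 0 k).
have [k z' zE|g gu gz] := @unimodular_completion n.+1 z.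
  have pk : p = k * z' 0 0 by have := congr1 (fun u : 'cV_ _ => u 0 0) zE; rewrite !mxE unlift_none.
  have mk : m *m c = k *: \row_l z' (lift 0 l) 0.
    apply/rowP => l; have := congr1 (fun u : 'cV_ _ => u (lift 0 l) 0) zE.
    by rewrite [LHS]mxE liftK /= => ->; rewrite !mxE.
  have mi : m 0 i = k * ((\row_l z' (lift 0 l) 0) *m invmx c) 0 i.
    by rewrite -[m in LHS](mulmxK cu) mk -scalemxAl mxE.
  apply/unitrP; exists (z' 0 0 - ((\row_l z' (lift 0 l) 0) *m invmx c) 0 i * q).
  suff h : k * (z' 0 0 - ((\row_l z' (lift 0 l) 0) *m invmx c) 0 i * q) = 1 by rewrite mulrC h.
  by rewrite mulrBr -pk mulrA -mi pE addrK.
exists g^T => [|G]; first by rewrite unitmx_tr.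
have gE l : g l 0 = z l 0 by have := congr1 (fun u : 'cV_ _ => u l 0) gz; rewrite mxE.
have gL l : (intmx g^T : 'M[R]_n.+2) 0 (lift 0 l) = ((m *m c) 0 l)%:~R.
  by rewrite [LHS]mxE [X in X%:~R]mxE gE [z _ _]mxE liftK.
have g0 : (intmx g^T : 'M[R]_n.+2) 0 0 = p%:~R.
  by rewrite [LHS]mxE [X in X%:~R]mxE gE [z _ _]mxE unlift_none.
apply/rowP => j; rewrite [LHS]mxE [LHS]mxE big_ord_recl g0 [RHS]mxE [in RHS]mxE [row _ _ _ _]mxE; congr (_ + _).
rewrite [RHS]mxE; apply: eq_bigr => l _; rewrite gL [in RHS]mxE; congr (_ * _).
by rewrite [RHS]mxE.
Qed.

End Bases.

Section DualStates.
Variables (R : realType) (e : nat) (w : 'I_e.+1 -> R).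
Hypothesis e0 : (0 < e)%N.
Hypothesis w_gt0 : forall i, 0 < w i.
Hypothesis w_sum1 : \sum_i w i = 1.
Hypothesis w_noninc : forall i j : 'I_e.+1, (i <= j)%N -> w j <= w i.

Local Notation n := e.+2.
Local Notation lam := (wlam w).
Local Notation v := (fun k : 'I_e => w (lift ord_max k)).
Local Notation wd := (w ord_max).
Local Notation S := (\sum_(k < e) w (lift ord_max k)).
Local Notation qlam := (clam v S).

Lemma S_wd : S + wd = 1.
Proof. by rewrite -w_sum1 (bigD1_ord ord_max) //= addrC. Qed.

Lemma S_pos : 0 < S.
Proof.
rewrite (bigD1 (Ordinal e0)) //= ltr_pwDl // sumr_ge0 // => k _; exact: ltW.
Qed.

Lemma wd_le k : wd <= v k.
Proof. by apply: w_noninc; rewrite lift_max ltnW. Qed.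

Lemma w_le1 i : w i <= 1.
Proof. by rewrite -w_sum1 (bigD1 i) //= lerDl sumr_ge0 // => k _; exact: ltW. Qed.

(* Row vectors of the dual lattice move by the inverse of [dmx lam T *m ux x]. *)
Definition dflow (x : 'cV[R]_e.+1) (T : R) : 'M[R]_e.+2 := ux (- x) *m dmx lam (- T).

Lemma dflow_lift m (A : 'M[R]_(m, n)) x T i j :
  (A *m dflow x T) i (lift ord_max j) = A i (lift ord_max j) * expR (- (w j * T)).
Proof. by rewrite mulmxA dmxEr ux_mul_lift wlam_lift mulrN. Qed.

Lemma dflow_max m (A : 'M[R]_(m, n)) x T i :
  (A *m dflow x T) i ord_max = (A i ord_max - \sum_j A i (lift ord_max j) * x j 0) * expR T.
Proof.
rewrite mulmxA dmxEr ux_mul_max wlam_max mulrNN mul1r; congr ((_ + _) * _).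
by rewrite -sumrN; apply: eq_bigr => j _; rewrite mxE mulrN.
Qed.

(* The rows of [G] span the dual lattice. Its row 0 is [(b, 0)] with all [|b_i|] of
   size [eps]: it is contracted until its last coordinate, [- b . x], takes over. *)
Definition state (eps delta : R) (G : 'M[R]_n) :=
  [/\ `|\det G| = 1, G 0 ord_max = 0,
      forall i, eps / 2 <= `|G 0 (lift ord_max i)| <= eps & dual_ge G delta].

Definition slope (G : 'M[R]_n) (k : 'I_e) : R := G 0 (ix k) / G 0 (ic e).

Section FromState.
Variables (eps delta : R) (G : 'M[R]_n).
Hypothesis eps0 : 0 < eps.
Hypothesis GS : state eps delta G.

Lemma state_neq0 i : G 0 (lift ord_max i) != 0.
Proof.
have [_ _ /(_ i)/andP[h _] _] := GS; rewrite -normr_gt0; apply: lt_le_trans h.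
by rewrite divr_gt0.
Qed.

Lemma slopeE k : G 0 (ix k) = slope G k * G 0 (ic e).
Proof. by rewrite /slope divfK // state_neq0. Qed.

Lemma slope_neq0 k : slope G k != 0.
Proof. by rewrite mulf_neq0 ?invr_neq0 ?state_neq0. Qed.

Lemma slope_le2 k : `|slope G k| <= 2.
Proof.
have [_ _ h _] := GS; have /andP[_ h1] := h (lift ord_max k); have /andP[h2 _] := h ord_max.
rewrite normrM normfV ler_pdivrMr ?normr_gt0 ?state_neq0 //.
by apply: le_trans h1 _; rewrite -ler_pdivrMl // mulrC.
Qed.

(* A basis of the dual lattice modulo its row 0. *)
Definition quot : 'M[R]_e.+1 := pmx (slope G) (row' 0 G).

Lemma det_quot : `|G 0 (ic e)| * `|\det quot| = 1.
Proof. by have [<- G0 _ _] := GS; rewrite (@det_proj _ _ G (slope G)) // => k; exact: slopeE. Qed.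

Lemma quot_unit : quot \in unitmx.
Proof.
rewrite unitmxE unitfE; apply/eqP => h; have := det_quot; rewrite h normr0 mulr0 => /eqP.
by rewrite eq_sym oner_eq0.
Qed.

(** Normalizes the dual of the quotient lattice to covolume one, as the height estimates require. *)
Definition qscale : R := `|G 0 (ic e)| `^ (- (e.+1%:R)^-1).

Lemma qscale_gt0 : 0 < qscale.
Proof. by rewrite powR_gt0 // normr_gt0 state_neq0. Qed.

Lemma det_qscale : `|\det (qscale *: invmx quot)| = 1.
Proof.
rewrite detZ normrM det_inv normfV ger0_norm ?exprn_ge0 ?(ltW qscale_gt0) //.
have -> : qscale ^+ e.+1 = `|G 0 (ic e)|^-1.
  rewrite -powR_mulrn ?powR_ge0 // /qscale -powRrM mulNr mulVf ?pnatr_eq0 //.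
  by rewrite powR_inv1.
by rewrite -invfM det_quot invr1.
Qed.

(** Adjoint of [pmx], see [mul_unproj]: it embeds the dual of the quotient as the hyperplane
    orthogonal to row 0 of [G]. *)
Definition unproj (q : 'cV[R]_e.+1) : 'cV[R]_n :=
  \col_i oapp (fun i' => oapp (fun k => q (lift ord_max k) 0) (- \sum_k slope G k * q (lift ord_max k) 0) (unlift ord_max i'))
     (q ord_max 0) (unlift ord_max i).

Lemma unproj_max q : unproj q ord_max 0 = q ord_max 0.
Proof. by rewrite mxE unlift_none. Qed.

Lemma unproj_ic q : unproj q (ic e) 0 = - \sum_k slope G k * q (lift ord_max k) 0.
Proof. by rewrite mxE liftK /= unlift_none. Qed.

Lemma unproj_ix q k : unproj q (ix k) 0 = q (lift ord_max k) 0.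
Proof. by rewrite mxE liftK /= liftK. Qed.

Lemma mul_unproj m (A : 'M[R]_(m, n)) q : A *m unproj q = pmx (slope G) A *m q.
Proof.
apply/matrixP => i j; rewrite (ord1 j) !mxE !(bigD1_ord ord_max) //= unproj_max pmx_max.
congr (_ + _); rewrite -/(ic e) unproj_ic.
rewrite mulrN mulr_sumr -sumrN -big_split /=; apply: eq_bigr => k _.
by rewrite -/(ix k) unproj_ix pmx_lift; ring.
Qed.

Lemma mnorm_unproj q : mnorm (unproj q) <= (2 * e.+1%:R) * mnorm q.
Proof.
have e1 : 1 <= 2 * e.+1%:R :> R by rewrite -natrM ler1n.
have qq i : `|q i 0| <= 2 * e.+1%:R * mnorm q.
  by apply: le_trans (mnorm_entry _ _ _) _; rewrite ler_peMl ?mnorm_ge0.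
apply: mnorm_le => [|i j]; first by rewrite mulr_ge0 ?mnorm_ge0 // (le_trans ler01).
rewrite (ord1 j); case: (unliftP ord_max i) => [i'|] ->; last by rewrite unproj_max.
case: (unliftP ord_max i') => [k|] ->; first by rewrite -/(ix k) unproj_ix.
rewrite -/(ic e) unproj_ic normrN; apply: le_trans (ler_norm_sum _ _ _) _.
apply: le_trans (_ : \sum_(k < e) (2 * mnorm q) <= _).
  by apply: ler_sum => k _; rewrite normrM ler_pM // ?slope_le2 // mnorm_entry.
rewrite sumr_const card_ord -[leLHS]mulr_natl mulrA [_ * 2]mulrC ler_wpM2r ?mnorm_ge0 //.
by rewrite ler_wpM2l // ler_nat.
Qed.

End FromState.

(** The dual of the quotient is the part of the primal lattice orthogonal to row 0 of [G], and
    [primal_ge] bounds its vectors below. *)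
Lemma quot_lattice_ge (eps delta : R) : 0 < eps -> 0 < delta -> exists2 l, 0 < l &
  forall G, state eps delta G -> lattice_ge (qscale G *: invmx (quot G)) l.
Proof.
move=> eps0 d0; have [c c0 Hc] := primal_ge e.+1 d0.
pose s0 := eps `^ (- (e.+1%:R)^-1); have s00 : 0 < s0 by rewrite powR_gt0.
exists (s0 * (c / (2 * e.+1%:R))); first by rewrite mulr_gt0 // divr_gt0 // mulr_gt0.
move=> G GS z z0; have [G1 G0 Gb Gd] := GS; have /andP[Gb1 Gb2] := Gb ord_max.
have bc0 : 0 < `|G 0 (ic e)| by rewrite normr_gt0 (state_neq0 eps0 GS).
rewrite -scalemxAl mnormZ gtr0_norm ?(qscale_gt0 eps0 GS) // ler_pM ?(ltW s00) //.
- by rewrite divr_ge0 ?(ltW c0).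
- rewrite /s0 /qscale !powRN lef_pV2 ?posrE ?powR_gt0 //.
  by rewrite ge0_ler_powR ?nnegrE ?invr_ge0 ?normr_ge0 ?(ltW eps0).
rewrite ler_pdivrMr ?mulr_gt0 // [leRHS]mulrC; apply: le_trans (mnorm_unproj eps0 GS _).
pose z' : 'cV[int]_n := \col_i oapp (fun k => z k 0) 0 (unlift 0 i).
apply: (Hc G _ z') => //.
  apply: contra_neq z0 => h; apply/colP => i; have := congr1 (fun u : 'cV_ _ => u (lift 0 i) 0) h.
  by rewrite [LHS]mxE liftK /= => ->; rewrite !mxE.
apply/colP => i; case: (unliftP 0 i) => [k|] ->.
  have -> : (G *m unproj G (invmx (quot G) *m intmx z)) (lift 0 k) 0 = (row' 0 G *m unproj G (invmx (quot G) *m intmx z)) k 0.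
    by rewrite !mxE; apply: eq_bigr => l _; rewrite !mxE.
  by rewrite mul_unproj mulmxA mulmxV ?(quot_unit eps0 GS) // mul1mx !mxE liftK.
have -> : (G *m unproj G (invmx (quot G) *m intmx z)) 0 0 = (row 0 G *m unproj G (invmx (quot G) *m intmx z)) 0 0.
  by rewrite !mxE; apply: eq_bigr => l _; rewrite !mxE.
rewrite mul_unproj (_ : pmx _ _ = 0) ?mul0mx ?mxE ?unlift_none //.
apply/rowP => j; rewrite [RHS]mxE; case: (unliftP ord_max j) => [k|] ->; last by rewrite pmx_max mxE.
by rewrite pmx_lift !mxE (slopeE eps0 GS) subrr.
Qed.

End DualStates.

(** 29/40 is the midpoint of [7/10, 3/4]. Adding [beta * b] to the target of [F] therefore leaves
    3/4 a in absolute value, up to c / 20 from [b] and a / 20 from [F], well inside [a / 2, a]. The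
    sign is chosen so that [F] itself stays away from 0. *)
Lemma target_bounds (R : realType) (beta a c F b : R) : beta != 0 -> `|beta| <= 2 -> 0 < c -> c <= a ->
  `|F - - (Num.sg beta * (3 / 4 * a + `|beta| * (29 / 40 * c)))| <= a / 20 ->
  7 / 10 * c <= b <= 3 / 4 * c ->
  7 / 10 * a <= `|F| <= 23 / 10 * a /\ a / 2 <= `|F + beta * b| <= a.
Proof.
move=> beta0 beta2 c0 ca + /andP[b1 b2]; have [bp|bn|b0] := ltgtP beta 0; last by rewrite b0 eqxx in beta0.
  rewrite ltr0_sg // (ltr0_norm bp) in beta2 *.
  rewrite ler_norml => /andP[h1 h2].
  have F0 : 0 < F by nra.
  have Fb : 0 < F + beta * b by nra.
  by rewrite !gtr0_norm //; split; apply/andP; split; nra.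
rewrite gtr0_sg // (gtr0_norm bn) in beta2 *.
rewrite ler_norml => /andP[h1 h2].
have F0 : F < 0 by nra.
have Fb : F + beta * b < 0 by nra.
by rewrite !ltr0_norm //; split; apply/andP; split; nra.
Qed.

(** * Successors of a dual state *)

Section Children.
Variables (R : realType) (e : nat) (w : 'I_e.+1 -> R).
Hypothesis e0 : (0 < e)%N.
Hypothesis w_gt0 : forall i, 0 < w i.
Hypothesis w_sum1 : \sum_i w i = 1.
Hypothesis w_noninc : forall i j : 'I_e.+1, (i <= j)%N -> w j <= w i.

Local Notation n := e.+2.
Local Notation lam := (wlam w).
Local Notation v := (fun k : 'I_e => w (lift ord_max k)).
Local Notation wd := (w ord_max).
Local Notation S := (\sum_(k < e) w (lift ord_max k)).
Local Notation qlam := (clam v S).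
Local Notation state := (@state R e).

Section Child.
Variables (eps delta : R) (G : 'M[R]_n).
Hypothesis eps0 : 0 < eps.
Hypothesis GS : state eps delta G.

Lemma pmx_row0 : pmx (slope G) (row 0 G) = 0.
Proof.
have [_ G0 _ _] := GS; apply/rowP => j; rewrite [RHS]mxE; case: (unliftP ord_max j) => [k|] ->.
  by rewrite pmx_lift !mxE (slopeE eps0 GS) subrr.
by rewrite pmx_max mxE.
Qed.

Definition zrest (z : 'rV[int]_n) : 'rV[int]_e.+1 := \row_k z 0 (lift 0 k).

Lemma int_row_split (z : 'rV[int]_n) :
  intmx z *m G = (z 0 0)%:~R *: row 0 G + intmx (zrest z) *m row' 0 G.
Proof.
apply/rowP => j; rewrite [LHS]mxE big_ord_recl [RHS]mxE; congr (_ + _).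
  by rewrite [RHS]mxE [X in X * _]mxE [in RHS]mxE.
rewrite [RHS]mxE; apply: eq_bigr => l _; rewrite [X in X * _]mxE [X in _ = X * _]mxE [X in _ = X%:~R * _]mxE.
by congr (_ * _); rewrite [RHS]mxE.
Qed.

Lemma pmx_int_row (z : 'rV[int]_n) : pmx (slope G) (intmx z *m G) = intmx (zrest z) *m quot G.
Proof.
rewrite pmxM; have -> : pmx (slope G) G = \matrix_(i, j) (pmx (slope G) (row i G)) 0 j.
  by apply/matrixP => i j; rewrite [RHS]mxE; case: (unliftP ord_max j) => [k|] ->; rewrite ?pmx_lift ?pmx_max !mxE.
apply/rowP => j; rewrite [LHS]mxE big_ord_recl [X in _ * X + _]mxE pmx_row0 [X in _ * X + _]mxE mulr0 add0r.
rewrite [RHS]mxE; apply: eq_bigr => l _; rewrite [X in X * _]mxE [X in _ = X * _]mxE [X in _ = X%:~R * _]mxE.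
congr (_ * _); rewrite [LHS]mxE /quot.
by case: (unliftP ord_max j) => [k|] ->; rewrite ?pmx_lift ?pmx_max !mxE.
Qed.

Variables (t sigma psi theta : R) (y : 'cV[R]_e) (x : 'cV[R]_e.+1).
Local Notation T := (t + sigma).
Hypothesis t0 : 0 <= t.
Hypothesis sigma0 : 0 <= sigma.
Hypothesis xE : x ord_max 0 = psi - \sum_k slope G k * x (lift ord_max k) 0.
Hypothesis psi_bd : expR (- T) / 2 <= `|psi| <= expR (- T).
Hypothesis xy : forall k, `|x (lift ord_max k) 0 - y k 0| <= expR (- ((v k + S) * t)).
Hypothesis theta_bd : forall zeta : 'rV[int]_e.+1, zeta != 0 ->
  theta <= mnorm (intmx zeta *m quot G *m ux (- y) *m dmx qlam (- t)).

Lemma dot_formula m (A : 'M[R]_(m, n)) i : \sum_j A i (lift ord_max j) * x j 0 =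
  \sum_k pmx (slope G) A i (lift ord_max k) * x (lift ord_max k) 0 + A i (ic e) * psi.
Proof.
rewrite (bigD1_ord ord_max) //= xE -/(ic e) mulrBr addrAC [RHS]addrC -addrA; congr (_ + _).
rewrite mulr_sumr -sumrN -big_split /=; apply: eq_bigr => k _.
by rewrite -/(ix k) pmx_lift; ring.
Qed.

Lemma child_dot0 : \sum_j G 0 (lift ord_max j) * x j 0 = G 0 (ic e) * psi.
Proof.
rewrite dot_formula big1 ?add0r // => k _.
by rewrite pmx_lift (slopeE eps0 GS) subrr mul0r.
Qed.

(** Multiples of row 0 are bounded below by their last coordinate, through the lower bound on [psi].
    All other vectors have nonzero image in the quotient, where [theta_bd] holds at [y] and time
    [t]; passing to [x] and time [t + sigma] costs a factor of order e^sigma. *)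
Lemma child_dual_ge : 0 < theta ->
  dual_ge (G *m dflow w x T) (Num.min (theta / (3 * e.+1%:R * expR sigma)) (eps / 4)).
Proof.
move=> theta0 z z0; have [_ G0 Gb _] := GS; rewrite mulmxA; set r := intmx z *m G.
set N := mnorm (r *m dflow w x T); have N0 : 0 <= N by exact: mnorm_ge0.
have wdS := S_wd w_sum1.
have [zr|zr] := eqVneq (zrest z) 0.
  have z00 : z 0 0 != 0.
    apply: contra_neq z0 => z00; apply/rowP => j; rewrite [RHS]mxE.
    by case: (unliftP 0 j) => [k|] -> //; have := congr1 (fun u : 'rV_ _ => u 0 k) zr; rewrite !mxE.
  rewrite ge_min; apply/orP; right.
  apply: le_trans (mnorm_entry _ 0 ord_max); rewrite dflow_max dot_formula.
  have -> : pmx (slope G) r = 0 by rewrite pmx_int_row zr intmx0 mul0mx.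
  rewrite big1 ?add0r; last by move=> k _; rewrite mxE mul0r.
  have rE j : r 0 j = (z 0 0)%:~R * G 0 j.
    by rewrite /r int_row_split zr intmx0 mul0mx addr0 [LHS]mxE [X in _ * X]mxE.
  rewrite !rE G0 mulr0 sub0r normrM normrN !normrM (gtr0_norm (expR_gt0 _)).
  have /andP[g1 _] := Gb ord_max; have /andP[p1 _] := psi_bd.
  have zz := intr_norm_ge1 R z00.
  apply: le_trans (_ : 1 * (eps / 2) * (expR (- T) / 2) * expR T <= _).
    have E : expR (- T) * expR T = 1 by rewrite -expRD addNr expR0.
    have -> : 1 * (eps / 2) * (expR (- T) / 2) * expR T = eps / 4 * (expR (- T) * expR T) by field.
    by rewrite E mulr1.
  rewrite ler_wpM2r ?expR_ge0 // ler_pM ?mulr_ge0 ?divr_ge0 ?expR_ge0 ?ler01 ?(ltW eps0) //.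
  by rewrite ler_pM ?ler01 ?divr_ge0 ?(ltW eps0).
rewrite ge_min; apply/orP; left; rewrite ler_pdivrMr ?mulr_gt0 ?expR_gt0 //.
apply: le_trans (theta_bd zr) _; rewrite -pmx_int_row -/r.
have es1 : 1 <= expR sigma by rewrite -expR0 ler_expR.
have rl j : `|r 0 (lift ord_max j)| <= N * expR (w j * T).
  have := mnorm_entry (r *m dflow w x T) 0 (lift ord_max j); rewrite dflow_lift normrM.
  by rewrite (gtr0_norm (expR_gt0 _)) expRN ler_pdivrMr ?expR_gt0.
have rm : `|r 0 ord_max - \sum_j r 0 (lift ord_max j) * x j 0| <= N * expR (- T).
  have := mnorm_entry (r *m dflow w x T) 0 ord_max; rewrite dflow_max normrM.
  by rewrite (gtr0_norm (expR_gt0 _)) expRN ler_pdivlMr ?expR_gt0.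
have T0 : 0 <= T by rewrite addr_ge0.
have rho k : `|pmx (slope G) r 0 (lift ord_max k)| <= 3 * N * expR (v k * T).
  rewrite pmx_lift; apply: le_trans (ler_normB _ _) _.
  have -> : 3 * N * expR (v k * T) = N * expR (v k * T) + 2 * (N * expR (v k * T)) by ring.
  rewrite lerD ?rl // normrM ler_pM // ?(slope_le2 eps0 GS) //.
  apply: le_trans (rl ord_max) _; rewrite ler_wpM2l // ler_expR ler_wpM2r //.
  exact: wd_le.
have e1 : 1 <= e%:R :> R by rewrite ler1n.
apply: mnorm_le => [|i j]; first by rewrite !mulr_ge0 ?expR_ge0.
rewrite (ord1 i) dmxEr; case: (unliftP ord_max j) => [k|] ->.
  rewrite ux_mul_lift clam_lift normrM (gtr0_norm (expR_gt0 _)).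
  apply: le_trans (_ : 3 * N * expR (v k * T) * expR (v k * - t) <= _).
    by rewrite ler_wpM2r ?expR_ge0.
  rewrite -mulrA -expRD (_ : v k * T + v k * - t = v k * sigma); last by ring.
  apply: le_trans (_ : 3 * N * expR sigma <= _).
    by rewrite ler_wpM2l ?mulr_ge0 // ler_expR ler_piMl // w_le1.
  have -> : N * (3 * e.+1%:R * expR sigma) = e.+1%:R * (3 * N * expR sigma) by ring.
  by rewrite ler_peMl ?mulr_ge0 ?expR_ge0 // ler1n.
rewrite ux_mul_max clam_max mulrNN normrM (gtr0_norm (expR_gt0 _)) pmx_max.
have -> : r 0 ord_max + \sum_k pmx (slope G) r 0 (lift ord_max k) * (- y) k 0 =
   (r 0 ord_max - \sum_j r 0 (lift ord_max j) * x j 0) + (r 0 (ic e) * psi +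
   \sum_k pmx (slope G) r 0 (lift ord_max k) * (x (lift ord_max k) 0 - y k 0)).
  have -> : \sum_k pmx (slope G) r 0 (lift ord_max k) * (x (lift ord_max k) 0 - y k 0) =
     \sum_k pmx (slope G) r 0 (lift ord_max k) * x (lift ord_max k) 0 +
     \sum_k pmx (slope G) r 0 (lift ord_max k) * (- y) k 0.
    by rewrite -big_split; apply: eq_bigr => k _; rewrite [(- y) k 0]mxE mulrDr.
  by rewrite dot_formula; ring.
have p1 : `|r 0 (ic e) * psi| <= N * expR (wd * T) * expR (- T).
  by have /andP[_ p2] := psi_bd; rewrite normrM ler_pM ?rl.
have p2 : `|\sum_k pmx (slope G) r 0 (lift ord_max k) * (x (lift ord_max k) 0 - y k 0)| <=
    e%:R * (3 * N * (expR sigma * expR (- (S * t)))).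
  apply: le_trans (ler_norm_sum _ _ _) _.
  apply: le_trans (_ : \sum_(k < e) (3 * N * (expR sigma * expR (- (S * t)))) <= _); last first.
    by rewrite sumr_const card_ord -[leLHS]mulr_natl.
  apply: ler_sum => k _.
  rewrite normrM; apply: le_trans (ler_pM _ _ (rho k) (xy k)) _ => //.
  rewrite -!mulrA -!expRD ler_wpM2l // ler_wpM2l // ler_expR.
  have := ler_wpM2r sigma0 (w_le1 w_gt0 w_sum1 (lift ord_max k)).
  lra.
apply: le_trans (_ : (N * expR (- T) + (N * expR (wd * T) * expR (- T) + e%:R * (3 * N * (expR sigma * expR (- (S * t)))))) * expR (S * t) <= _).
  rewrite ler_wpM2r ?expR_ge0 //; apply: le_trans (ler_normD _ _) _; rewrite lerD //.
  by apply: le_trans (ler_normD _ _) _; rewrite lerD.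
have S0 : 0 < S := S_pos e0 w_gt0.
have E1 : expR (- T) * expR (S * t) <= 1.
  rewrite -expRD -[leRHS]expR0 ler_expR; have := ltW (w_gt0 ord_max) => wd0.
  have : S * t <= 1 * t by rewrite ler_wpM2r // -wdS lerDl.
  by move=> h; rewrite addrC subr_le0 (le_trans h) // mul1r lerDl.
have E2 : expR (wd * T) * expR (- T) * expR (S * t) <= 1.
  rewrite -!expRD -[leRHS]expR0 ler_expR; have : 0 <= S * sigma by rewrite mulr_ge0 // ltW.
  have -> : wd = 1 - S by rewrite -wdS addrAC subrr add0r.
  lra.
have E3 : expR (- (S * t)) * expR (S * t) = 1 by rewrite -expRD addNr expR0.
rewrite -[e.+1%:R]natr1; clear - E1 E2 E3 es1 e1 N0; clearbody N; move: E1 E2 E3 es1 e1 N0.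
move: (expR (- T)) (expR (S * t)) (expR (wd * T)) (expR sigma) (expR (- (S * t))) (e%:R : R) N.
move=> a b c s a' d' M E1 E2 E3 s1 d1 M0.
have -> : (M * a + (M * c * a + d' * (3 * M * (s * a')))) * b = M * (a * b) + M * (c * a * b) + 3 * d' * M * s * (a' * b) by ring.
rewrite E3 mulr1.
have h1 : M * (a * b) <= M by rewrite ler_piMr.
have h2 : M * (c * a * b) <= M by rewrite ler_piMr.
have h3 : M <= M * s by rewrite ler_peMr.
have -> : M * (3 * (d' + 1) * s) = 3 * d' * M * s + 3 * (M * s) by ring.
lra.
Qed.

End Child.

End Children.

Section Numeric.
Variable R : realType.
Implicit Types (ep E Ec ET phi bc : R).

(** [ET], [Ec] and [E] stand for e^(-T), e^(wd T) and e^(- S T); abstracting them leaves polynomial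
    inequalities. *)
Lemma num_psi ep E Ec ET phi bc : 0 < ep -> 0 < Ec -> 0 < ET -> E = ET * Ec ->
  2 / 5 * (ep * E) <= phi <= 3 / 5 * (ep * E) -> 7 / 10 * (ep * Ec) <= bc <= 3 / 4 * (ep * Ec) ->
  ET / 2 <= phi / bc <= ET.
Proof.
move=> ep0 Ec0 ET0 -> /andP[p1 p2] /andP[b1 b2].
have bc0 : 0 < bc by apply: lt_le_trans b1; rewrite !mulr_gt0 //; lra.
have h : 0 < ep * Ec by rewrite mulr_gt0.
have E1 : ep * (ET * Ec) = ET * (ep * Ec) by ring.
rewrite E1 in p1 p2.
rewrite ler_pdivlMr // ler_pdivrMr //; move: (ep * Ec) h p1 p2 b1 b2 => a a0 p1 p2 b1 b2.
by apply/andP; split; nra.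
Qed.

Lemma num_sep ep eps P A E Ec ET phi bc bc' : 0 < ep -> 0 < Ec -> 0 < ET -> 0 < eps -> 0 < A -> E = ET * Ec ->
  3 * A * ep <= P * eps -> 2 / 5 * (ep * E) <= phi ->
  7 / 10 * (ep * Ec) <= bc <= 3 / 4 * (ep * Ec) -> 7 / 10 * (ep * Ec) <= bc' <= 3 / 4 * (ep * Ec) ->
  P * (eps / 2) <= `|bc' - bc| -> A * (ET / Ec) <= `|phi / bc - phi / bc'|.
Proof.
move=> ep0 Ec0 ET0 eps0 A0 EE Pe p1 /andP[b1 b2] /andP[b3 b4] bb.
have a0 : 0 < ep * Ec by rewrite mulr_gt0.
have bc0 : 0 < bc by apply: lt_le_trans b1; rewrite mulr_gt0 //; lra.
have bc'0 : 0 < bc' by apply: lt_le_trans b3; rewrite mulr_gt0 //; lra.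
have -> : phi / bc - phi / bc' = phi * (bc' - bc) / (bc * bc').
  by field; rewrite !gt_eqF.
have phi0 : 0 < phi by apply: lt_le_trans p1; rewrite EE !mulr_gt0 //; lra.
rewrite normrM normfV (gtr0_norm (mulr_gt0 bc0 bc'0)) normrM (gtr0_norm phi0).
rewrite ler_pdivlMr ?mulr_gt0 //.
apply: le_trans (_ : A * (ET / Ec) * ((3 / 4 * (ep * Ec)) * (3 / 4 * (ep * Ec))) <= _).
  by rewrite ler_wpM2l ?mulr_ge0 ?invr_ge0 ?(ltW A0) ?(ltW ET0) ?(ltW Ec0) // ler_pM // ltW.
apply: le_trans (_ : 2 / 5 * (ep * E) * (P * (eps / 2)) <= _); last first.
  rewrite ler_pM //; first by rewrite EE !mulr_ge0 ?(ltW ep0) ?(ltW ET0) ?(ltW Ec0) //; lra.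
  by apply: le_trans (_ : 3 * A * ep / 2 <= _); [rewrite !mulr_ge0 ?(ltW A0) ?(ltW ep0)| lra].
have -> : A * (ET / Ec) * ((3 / 4 * (ep * Ec)) * (3 / 4 * (ep * Ec))) = 9 / 16 * (ep * (ET * Ec)) * (A * ep).
  by field; rewrite gt_eqF.
rewrite -EE; have E0 : 0 <= ep * E by rewrite EE !mulr_ge0 // ltW.
by move: Pe (mulr_gt0 A0 ep0); move: (ep * E) E0 => x x0 h1 h2; nra.
Qed.

Lemma num_adj ep err r0 Es Est Ev Ev' ES Ed F : 0 < ep -> 0 < Est -> 0 < Ev -> 1 <= Ev' ->
  0 < Ed -> Ed <= 10^-1 ->
  err <= ep / 20 * Ev' -> `|r0| <= err * Est -> ES <= Est * Ed * Ev' -> 0 < ES ->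
  7 / 10 * (ep * (Ev * Ev')) <= `|F| -> Es = Est / Ev ->
  `|(r0 - ep / 2 * ES) / F| <= Es / 4.
Proof.
move=> ep0 Est0 Ev0 Ev'1 Ed0 Ed1 he hr hES ES0 hF ->.
have F0 : 0 < `|F| by apply: lt_le_trans hF; rewrite !mulr_gt0 //; lra.
rewrite normrM normfV ler_pdivrMr //.
apply: le_trans (ler_normB _ _) _.
apply: le_trans (_ : Est / Ev / 4 * (7 / 10 * (ep * (Ev * Ev'))) <= _); last first.
  by rewrite ler_wpM2l // !mulr_ge0 ?invr_ge0 // ltW.
have -> : Est / Ev / 4 * (7 / 10 * (ep * (Ev * Ev'))) = 7 / 40 * (ep * (Est * Ev')).
  by field; rewrite gt_eqF.
have x0 : 0 < Est * Ev' by rewrite mulr_gt0 // (lt_le_trans ltr01).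
have h1 : err * Est <= ep / 20 * (Est * Ev').
  by have := ler_wpM2r (ltW Est0) he; rewrite [Est * Ev']mulrC mulrA.
have h2 : ES <= (Est * Ev') / 10.
  apply: le_trans hES _; rewrite mulrAC ler_wpM2l //; first exact: ltW.
rewrite normrM (gtr0_norm ES0) gtr0_norm ?divr_gt0 //.
by move: (Est * Ev') x0 h1 h2 => x x0 h1 h2; nra.
Qed.

Lemma int_dvd_fact (k : int) (N : nat) : k != 0 -> (`|k| <= N)%N -> exists q : int, (N`!)%:Z = k * q.
Proof.
move=> k0 kN; have /dvdnP[q qE] : (`|k| %| N`!)%N by rewrite dvdn_fact // kN andbT absz_gt0.
exists (Num.sg k * q%:Z); by rewrite qE PoszM mulrA [k * _]mulrC -normrEsg abszE mulrC.
Qed.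

End Numeric.

Section QuotientFlow.
Variables (R : realType) (e : nat) (w : 'I_e.+1 -> R).
Hypothesis e0 : (0 < e)%N.
Hypothesis w_gt0 : forall i, 0 < w i.
Hypothesis w_sum1 : \sum_i w i = 1.
Hypothesis w_noninc : forall i j : 'I_e.+1, (i <= j)%N -> w j <= w i.

Local Notation n := e.+2.
Local Notation lam := (wlam w).
Local Notation v := (fun k : 'I_e => w (lift ord_max k)).
Local Notation wd := (w ord_max).
Local Notation S := (\sum_(k < e) w (lift ord_max k)).
Local Notation qlam := (clam v S).
Local Notation state := (@state R e).

(** The bound [4 * e.+1] is what [mkx_le] yields: free coordinates and slopes are at most 2, and the
    last coordinate is solved for. *)
Definition child (eps eps' delta' T : R) (G : 'M[R]_n) (x : 'cV[R]_e.+1) :=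
  [/\ forall i, `|x i 0| <= 4 * e.+1%:R,
      `|\sum_j G 0 (lift ord_max j) * x j 0| <= eps * expR (- T) &
      exists2 c : 'M[int]_n, c \in unitmx & state eps' delta' (intmx c *m G *m dflow w x T)].

Definition sep_at (A T : R) (x x' : 'cV[R]_e.+1) :=
  exists i, A * expR (- ((1 + w i) * T)) <= `|x i 0 - x' i 0|.

Definition qflow (G : 'M[R]_n) (y : 'cV[R]_e) (t : R) : 'M[R]_e.+1 :=
  quot G *m ux (- y) *m dmx qlam (- t).

Lemma det_dflow x T : \det (dflow w x T) = 1.
Proof. by rewrite det_mulmx det_ux mul1r (det_dmx w_sum1). Qed.

(** Up to the scale [qscale], which [eps] controls, the flowed quotient basis is the inverse of the
    flowed primal lattice; a well-conditioned basis of the latter is inverted. *)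
Lemma qflow_basis (eps delta1 : R) : 0 < eps -> 0 < delta1 -> exists2 C, 0 < C &
  forall t delta (G : 'M[R]_n) (y : 'cV[R]_e), state eps delta G ->
  lattice_ge (dmx qlam t *m ux y *m (qscale G *: invmx (quot G))) delta1 ->
  exists2 c : 'M[int]_e.+1, c \in unitmx &
   [/\ intmx c *m qflow G y t \in unitmx, mnorm (intmx c *m qflow G y t) <= C &
     mnorm (invmx (intmx c *m qflow G y t)) <= C].
Proof.
move=> eps0 d10; have [C1 C10 HC1] := bounded_pair e d10.
pose slo := eps `^ (- (e.+1%:R)^-1); pose shi := (eps / 2) `^ (- (e.+1%:R)^-1).
have eps20 : 0 < eps / 2 by rewrite divr_gt0.
have slo0 : 0 < slo by exact: powR_gt0.
have shi0 : 0 < shi by exact: powR_gt0.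
exists (shi * C1 + slo^-1 * C1).
  by rewrite addr_gt0 // mulr_gt0 // invr_gt0.
move=> t delta G y GS lat; have [_ _ Gb _] := GS; have /andP[b1 b2] := Gb ord_max.
have s0 := qscale_gt0 eps0 GS; have bc0 : 0 < `|G 0 (ic e)| by rewrite normr_gt0 (state_neq0 eps0 GS).
have slo_le : slo <= qscale G.
  rewrite /slo /qscale !powRN lef_pV2 ?posrE ?powR_gt0 //.
  by rewrite ge0_ler_powR ?nnegrE ?invr_ge0 ?normr_ge0 ?(ltW eps0).
have shi_ge : qscale G <= shi.
  rewrite /shi /qscale !powRN lef_pV2 ?posrE ?powR_gt0 //.
  by rewrite ge0_ler_powR ?nnegrE ?invr_ge0 ?normr_ge0 ?(ltW eps20).
set g1 := dmx qlam t *m ux y *m _ in lat.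
have d1 : `|\det g1| = 1.
  by rewrite !det_mulmx det_clam // det_ux !mul1r (det_qscale eps0 GS).
have [c cu [gc1 gc2]] := HC1 g1 d1 lat.
have [_ cRu] := unit_intmx R cu.
have Xu : g1 *m intmx c \in unitmx by rewrite unitmx_mul (unit_of_det1 d1) cRu.
exists (invmx c); first by rewrite unitmx_inv.
have WX : intmx (invmx c) *m qflow G y t *m (g1 *m intmx c) = (qscale G)%:M.
  have -> : intmx (invmx c) *m qflow G y t *m (g1 *m intmx c) =
      intmx (invmx c) *m (qflow G y t *m g1) *m intmx c by rewrite !mulmxA.
  have -> : qflow G y t *m g1 = (qscale G)%:M.
    rewrite /qflow /g1 !mulmxA -[_ *m dmx qlam (- t) *m dmx qlam t]mulmxA dmxKl mulmx1.
    rewrite -[_ *m ux (- y) *m ux y]mulmxA uxNl mulmx1 -scalemxAr mulmxV ?(quot_unit eps0 GS) //.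
    by rewrite scalemx1.
  by rewrite mul_mx_scalar -scalemxAl -map_mxM mulVmx // map_mx1 scalemx1.
have WE : intmx (invmx c) *m qflow G y t = qscale G *: invmx (g1 *m intmx c).
  by rewrite -[LHS](mulmxK Xu) WX mul_scalar_mx.
have Wu : intmx (invmx c) *m qflow G y t \in unitmx.
  by rewrite WE unitmxZ ?unitmx_inv // unitfE gt_eqF.
split=> //.
  rewrite WE mnormZ gtr0_norm //; apply: le_trans (_ : shi * C1 <= _).
    by rewrite ler_pM ?mnorm_ge0 // ltW.
  by rewrite lerDl mulr_ge0 ?invr_ge0 // ltW.
rewrite WE invmxZ; last by rewrite -WE.
rewrite invmxK mnormZ normfV gtr0_norm //; apply: le_trans (_ : slo^-1 * C1 <= _).
  by rewrite ler_pM ?mnorm_ge0 ?invr_ge0 ?(ltW s0) // lef_pV2.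
by rewrite lerDr mulr_ge0 // ltW.
Qed.

Lemma qflow_dual_ge (C t : R) (G : 'M[R]_n) (y : 'cV[R]_e) (c : 'M[int]_e.+1) : 0 < C -> c \in unitmx ->
  intmx c *m qflow G y t \in unitmx -> mnorm (invmx (intmx c *m qflow G y t)) <= C ->
  forall zeta : 'rV[int]_e.+1, zeta != 0 ->
  (e.+1%:R * C)^-1 <= mnorm (intmx zeta *m quot G *m ux (- y) *m dmx qlam (- t)).
Proof.
move=> C0 cu Wu WC zeta z0; rewrite -[_^-1]mulr1 ler_pdivrMl; last exact: (mulr_gt0 (ltr0Sn _ _) C0).
have x0 : zeta *m invmx c != 0.
  by apply: contra_neq z0 => zc; rewrite -(mulmxKV cu zeta) zc mul0mx.
apply: le_trans (int_row_ge1 R x0) _; rewrite -(mulmxK Wu (intmx (zeta *m invmx c))).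
apply: le_trans (mnormM _ _) _; rewrite -mulrA ler_wpM2l //.
have -> : intmx (zeta *m invmx c) *m (intmx c *m qflow G y t) =
    intmx zeta *m quot G *m ux (- y) *m dmx qlam (- t).
  by rewrite mulmxA -map_mxM mulmxKV // /qflow !mulmxA.
by rewrite mulrC ler_wpM2r ?mnorm_ge0.
Qed.

End QuotientFlow.

Section WordChildren.
Variables (R : realType) (e : nat) (w : 'I_e.+1 -> R).
Hypothesis e0 : (0 < e)%N.
Hypothesis w_gt0 : forall i, 0 < w i.
Hypothesis w_sum1 : \sum_i w i = 1.
Hypothesis w_noninc : forall i j : 'I_e.+1, (i <= j)%N -> w j <= w i.

Local Notation n := e.+2.
Local Notation lam := (wlam w).
Local Notation v := (fun k : 'I_e => w (lift ord_max k)).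
Local Notation wd := (w ord_max).
Local Notation S := (\sum_(k < e) w (lift ord_max k)).
Local Notation qlam := (clam v S).
Local Notation state := (@state R e).

Section Word.
Variables (eps eps' A err sigma t delta : R) (P L : nat) (G : 'M[R]_n) (y : 'cV[R]_e).
Variables (f : 'rV[R]_n) (js : seq int).
Local Notation T := (t + sigma).
Hypotheses (eps0 : 0 < eps) (eps'0 : 0 < eps') (A0 : 0 < A) (t0 : 0 <= t) (sigma0 : 0 <= sigma).
Hypothesis GS : state eps delta G.
Hypothesis sigmaC : err <= eps' / 20 * expR (wd * sigma).
Hypothesis sigma1 : expR (- (wd * sigma)) <= 10^-1.
Hypothesis y01 : forall k, 0 <= y k 0 <= 1.
Let F k := pmx (slope G) f 0 (lift ord_max k).
Hypothesis Fnear : forall k, `|F k - - (Num.sg (slope G k) * (3 / 4 * (eps' * expR (v k * T)) +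
   `|slope G k| * (29 / 40 * (eps' * expR (wd * T)))))| <= eps' * expR (v k * T) / 20.
Let r0 := f 0 ord_max - \sum_k F k * y k 0.
Hypothesis r0_le : `|r0| <= err * expR (- (S * t)).
Hypothesis PE : 3 * A * eps' <= P%:R * eps.
Hypothesis LE : L%:R * A <= expR (wd * T) / (30 * e%:R).
(** Coordinate [ic] of the new dual vector, [f] plus 1 + P j times row 0 of [G]. The multiplier is 1
    modulo a nonzero coefficient of [f], so the vector is primitive for every [j]. *)
Let bcj (j : int) := f 0 (ic e) + (1 + P%:R * j%:~R) * G 0 (ic e).
Hypothesis jsb : forall j, j \in js ->
  7 / 10 * (eps' * expR (wd * T)) <= bcj j <= 3 / 4 * (eps' * expR (wd * T)).
Hypothesis js0 : (0 < size js)%N.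

Let k0 := Ordinal e0.
(** Moves one free coordinate so that the residual [phi] would be exactly
    [eps' / 2 * expR (- (S * T))]; the digits [zz] then change it by at most a fifth. *)
Let adj := (r0 - eps' / 2 * expR (- (S * T))) / F k0.
Let zz (l : {ffun 'I_e -> 'I_L}) k := A * expR (- ((1 + v k) * T)) * (l k)%:R.
Let xk l k := y k 0 + (if k == k0 then adj else 0) + zz l k.
Let phi l := f 0 ord_max - \sum_k F k * xk l k.
(* The digits [l] move the free coordinates; the last one is solved for so that the
   new short dual vector has vanishing last coordinate at [mkx l j]. *)
Definition mkx (l : {ffun 'I_e -> 'I_L}) (j : int) : 'cV[R]_e.+1 :=
  \col_i oapp (xk l) (phi l / bcj j - \sum_k slope G k * xk l k) (unlift ord_max i).

Let SE : S = 1 - wd. Proof. by rewrite -(S_wd w_sum1) addrK. Qed.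
Let T0 : 0 <= T. Proof. exact: addr_ge0. Qed.

Lemma mkx_lift l j k : mkx l j (lift ord_max k) 0 = xk l k.
Proof. by rewrite mxE liftK. Qed.

Lemma mkx_max l j : mkx l j ord_max 0 = phi l / bcj j - \sum_k slope G k * mkx l j (lift ord_max k) 0.
Proof. by rewrite mxE unlift_none /=; congr (_ - _); apply: eq_bigr => k _; rewrite mkx_lift. Qed.

Let ca k : eps' * expR (wd * T) <= eps' * expR (v k * T).
Proof. by rewrite ler_wpM2l ?(ltW eps'0) // ler_expR ler_wpM2r // wd_le. Qed.

Let c0 : 0 < eps' * expR (wd * T). Proof. by rewrite mulr_gt0 ?expR_gt0. Qed.

Lemma F_bound k : 7 / 10 * (eps' * expR (v k * T)) <= `|F k| <= 23 / 10 * (eps' * expR (v k * T)).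
Proof.
have h : 7 / 10 * (eps' * expR (wd * T)) <= 7 / 10 * (eps' * expR (wd * T)) <= 3 / 4 * (eps' * expR (wd * T)).
  by rewrite lexx /= ler_wpM2r ?(ltW c0) //; lra.
by have [] := target_bounds (slope_neq0 eps0 GS k) (slope_le2 eps0 GS k) c0 (ca k) (Fnear k) h.
Qed.

Lemma b_bound j k : j \in js -> eps' * expR (v k * T) / 2 <= `|F k + slope G k * bcj j| <= eps' * expR (v k * T).
Proof.
move=> /jsb h.
by have [] := target_bounds (slope_neq0 eps0 GS k) (slope_le2 eps0 GS k) c0 (ca k) (Fnear k) h.
Qed.

Lemma adj_le : `|adj| <= expR (- ((v k0 + S) * t)) / 4.
Proof.
have S0 := S_pos e0 w_gt0.
apply: (@num_adj R eps' err r0 _ (expR (- (S * t))) (expR (v k0 * t)) (expR (v k0 * sigma)) _ (expR (- (wd * sigma)))) => //;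
  rewrite ?expR_gt0 //.
- by rewrite -expR0 ler_expR mulr_ge0 // ltW.
- by apply: le_trans sigmaC _; rewrite ler_wpM2l ?divr_ge0 ?(ltW eps'0) // ler_expR ler_wpM2r // wd_le.
- rewrite -!expRD ler_expR.
  have := mulr_ge0 (ltW S0) sigma0; have := ler_wpM2r sigma0 (wd_le w_noninc k0).
  by move: (S * sigma) (wd * sigma) (v k0 * sigma) (mulrDr S t sigma) => a b c -> *; lra.
- by rewrite -expRD -mulrDr; have /andP[] := F_bound k0.
- by rewrite -expRN -expRD; congr expR; ring.
Qed.

Lemma zz_ge0 l k : 0 <= zz l k.
Proof. by rewrite /zz !mulr_ge0 ?expR_ge0 // ltW. Qed.

Let er0 : 0 < e%:R :> R. Proof. by rewrite ltr0n. Qed.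

Lemma zz_le l k : zz l k <= expR (- ((v k + S) * T)) / (30 * e%:R).
Proof.
rewrite /zz; apply: le_trans (_ : L%:R * A * expR (- ((1 + v k) * T)) <= _).
  have -> : A * expR (- ((1 + v k) * T)) * (l k)%:R = (l k)%:R * A * expR (- ((1 + v k) * T)) by ring.
  by rewrite ler_wpM2r ?expR_ge0 // ler_wpM2r ?(ltW A0) // ler_nat ltnW.
apply: le_trans (ler_wpM2r (expR_ge0 _) LE) _.
rewrite mulrAC -expRD ler_wpM2r ?invr_ge0 ?mulr_ge0 // ler_expR SE le_eqVlt; apply/orP; left; apply/eqP; ring.
Qed.

Lemma phi_bounds l : 2 / 5 * (eps' * expR (- (S * T))) <= phi l <= 3 / 5 * (eps' * expR (- (S * T))).
Proof.
have F00 : F k0 != 0.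
  rewrite -normr_gt0; have /andP[h _] := F_bound k0; apply: lt_le_trans h.
  by rewrite !mulr_gt0 ?expR_gt0 //; lra.
have -> : phi l = eps' / 2 * expR (- (S * T)) - \sum_k F k * zz l k.
  rewrite /phi; have -> : \sum_k F k * xk l k = \sum_k F k * y k 0 + (F k0 * adj + \sum_k F k * zz l k).
    rewrite [X in _ = _ + (X + _)](_ : _ = \sum_k F k * (if k == k0 then adj else 0)); last first.
      by rewrite (bigD1 k0) //= ?eqxx big1 ?addr0 // => k /negbTE ->; rewrite mulr0.
    by rewrite -!big_split; apply: eq_bigr => k _; rewrite /xk !mulrDr -addrA.
  rewrite /adj [F k0 * _]mulrC divfK // /r0; ring.
have h : `|\sum_k F k * zz l k| <= 1 / 10 * (eps' * expR (- (S * T))).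
  apply: le_trans (ler_norm_sum _ _ _) _.
  apply: le_trans (_ : \sum_(k < e) (23 / 10 * (eps' * expR (- (S * T))) / (30 * e%:R)) <= _).
    apply: ler_sum => k _; have /andP[_ h1] := F_bound k.
    rewrite normrM (ger0_norm (zz_ge0 l k)); apply: le_trans (ler_pM _ (zz_ge0 l k) h1 (zz_le l k)) _ => //.
    rewrite mulrA ler_wpM2r ?invr_ge0 ?mulr_ge0 // -!mulrA -expRD ler_wpM2l //.
      by rewrite ler_wpM2l ?invr_ge0 // ler_wpM2l ?(ltW eps'0) // ler_expR le_eqVlt; apply/orP; left; apply/eqP; ring.
  rewrite sumr_const card_ord -[leLHS]mulr_natl.
  have -> : e%:R * (23 / 10 * (eps' * expR (- (S * T))) / (30 * e%:R)) = 23 / 300 * (eps' * expR (- (S * T))).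
    by field; rewrite gt_eqF.
  by rewrite ler_wpM2r ?mulr_ge0 ?expR_ge0 ?(ltW eps'0) //; lra.
move: h; have : 0 < eps' * expR (- (S * T)) by rewrite mulr_gt0 ?expR_gt0.
have -> : eps' / 2 * expR (- (S * T)) = (eps' * expR (- (S * T))) / 2 by ring.
move: (eps' * _) (\sum_k F k * zz l k) => a b a0; rewrite ler_norml => /andP[h1 h2].
by apply/andP; split; lra.
Qed.

Let EE : expR (- (S * T)) = expR (- T) * expR (wd * T).
Proof. by rewrite -expRD SE; congr expR; ring. Qed.

Lemma bcj_gt0 j : j \in js -> 0 < bcj j.
Proof. by move=> /jsb/andP[h _]; apply: lt_le_trans h; rewrite mulr_gt0 //; lra. Qed.

Lemma psi_bounds l j : j \in js -> expR (- T) / 2 <= `|phi l / bcj j| <= expR (- T).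
Proof.
move=> jj; have h := num_psi eps'0 (expR_gt0 (wd * T)) (expR_gt0 (- T)) EE (phi_bounds l) (jsb jj).
have /andP[h1 _] := h; rewrite gtr0_norm //; apply: lt_le_trans h1.
by rewrite divr_gt0 ?expR_gt0.
Qed.

Lemma xk_y l k : `|xk l k - y k 0| <= 3 / 8 * expR (- ((v k + S) * t)).
Proof.
have S0 := S_pos e0 w_gt0.
have z1 : zz l k <= expR (- ((v k + S) * t)) / 30.
  apply: le_trans (zz_le l k) _; have e1 : 1 <= e%:R :> R by rewrite ler1n.
  rewrite ler_pM ?expR_ge0 ?invr_ge0 ?mulr_ge0 //.
    by rewrite ler_expR lerN2 ler_wpM2l ?lerDl // addr_ge0 // ltW.
  by rewrite lef_pV2 ?posrE ?mulr_gt0 // ler_peMr.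
have -> : xk l k - y k 0 = (if k == k0 then adj else 0) + zz l k by rewrite /xk; ring.
apply: le_trans (ler_normD _ _) _; rewrite (ger0_norm (zz_ge0 l k)).
have E0 := expR_ge0 (- ((v k + S) * t)).
have a1 : `|if k == k0 then adj else 0| <= expR (- ((v k + S) * t)) / 4.
  by case: eqP => [->|_]; [exact: adj_le | rewrite normr0 divr_ge0].
lra.
Qed.

Lemma mkx_near l j k : `|mkx l j (lift ord_max k) 0 - y k 0| <= 3 / 8 * expR (- ((v k + S) * t)).
Proof. by rewrite mkx_lift xk_y. Qed.

Lemma xk_le2 l k : `|xk l k| <= 2.
Proof.
have := xk_y l k; have /andP[y1 y2] := y01 k.
have : expR (- ((v k + S) * t)) <= 1.
  rewrite -[leRHS]expR0 ler_expR oppr_le0 mulr_ge0 // addr_ge0 // ltW //; exact: S_pos.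
by rewrite !ler_norml => h /andP[h1 h2]; apply/andP; split; lra.
Qed.

Lemma mkx_le l j i : j \in js -> `|mkx l j i 0| <= 4 * e.+1%:R.
Proof.
move=> jj; have e1 : 1 <= e%:R :> R by rewrite ler1n.
case: (unliftP ord_max i) => [k|] ->.
  by rewrite mkx_lift (le_trans (xk_le2 l k)) // -[e.+1%:R]natr1; lra.
rewrite mkx_max; apply: le_trans (ler_normB _ _) _.
have /andP[_ h1] := psi_bounds l jj.
have h2 : expR (- T) <= 1 by rewrite -[leRHS]expR0 ler_expR oppr_le0.
have h3 : `|\sum_k slope G k * mkx l j (lift ord_max k) 0| <= 4 * e%:R.
  apply: le_trans (ler_norm_sum _ _ _) _.
  apply: le_trans (_ : \sum_(k < e) (4 : R) <= _); last by rewrite sumr_const card_ord -[leLHS]mulr_natr.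
  apply: ler_sum => k _; rewrite mkx_lift normrM (_ : 4 = 2 * 2); last by ring.
  by rewrite ler_pM ?xk_le2 ?(slope_le2 eps0 GS).
by rewrite -[e.+1%:R]natr1; lra.
Qed.

(** Different digits move a free coordinate by at least the mesh. With equal digits, different [j]
    change [phi l / bcj j], hence the last coordinate, by enough thanks to the spacing [P]. *)
Lemma mkx_sep l l' j j' : j \in js -> j' \in js -> (l, j) != (l', j') ->
  sep_at w A T (mkx l j) (mkx l' j').
Proof.
move=> jj jj'; rewrite xpair_eqE negb_and; have [<- /= jj1|ll _] := eqVneq l l'.
  exists ord_max; rewrite !mkx_max.
  have -> : phi l / bcj j - \sum_k slope G k * mkx l j (lift ord_max k) 0 -
     (phi l / bcj j' - \sum_k slope G k * mkx l j' (lift ord_max k) 0) = phi l / bcj j - phi l / bcj j'.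
    rewrite [X in _ - X - _](eq_bigr (fun k => slope G k * mkx l j' (lift ord_max k) 0)); last first.
      by move=> k _; rewrite !mkx_lift.
    by ring.
  have /andP[p1 _] := phi_bounds l.
  apply: le_trans (num_sep eps'0 (expR_gt0 (wd * T)) (expR_gt0 (- T)) eps0 A0 EE PE p1 (jsb jj) (jsb jj') _).
    by rewrite ler_wpM2l ?(ltW A0) // -expRN -expRD ler_expR le_eqVlt; apply/orP; left; apply/eqP; ring.
  have -> : bcj j' - bcj j = P%:R * (j' - j)%:~R * G 0 (ic e) by rewrite /bcj intrB; ring.
  have [_ _ Gb _] := GS; have /andP[g1 _] := Gb ord_max.
  rewrite !normrM ger0_norm // -mulrA ler_wpM2l // -[leLHS]mul1r ler_pM ?divr_ge0 ?(ltW eps0) //.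
  by apply: intr_norm_ge1; rewrite subr_eq0 eq_sym.
have [k lk] : exists k, l k != l' k.
  apply: contrapT => h; move/eqP: ll; apply; apply/ffunP => k.
  by apply: contrapT => /eqP kE; apply: h; exists k.
exists (lift ord_max k); rewrite !mkx_lift.
have -> : xk l k - xk l' k = A * expR (- ((1 + v k) * T)) * ((l k)%:R - (l' k)%:R) by rewrite /xk /zz; ring.
have AE : 0 <= A * expR (- ((1 + v k) * T)) by rewrite mulr_ge0 ?expR_ge0 // ltW.
rewrite normrM (ger0_norm AE) ler_peMr //.
have -> : (l k)%:R - (l' k)%:R = ((l k)%:Z - (l' k)%:Z)%:~R :> R by rewrite intrB.
by apply: intr_norm_ge1; rewrite subr_eq0 eqz_nat (inj_eq val_inj).
Qed.

Lemma mkx_dot l j : j \in js -> `|\sum_i G 0 (lift ord_max i) * mkx l j i 0| <= eps * expR (- T).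
Proof.
move=> jj; rewrite (child_dot0 eps0 GS (mkx_max l j)) normrM.
have [_ _ Gb _] := GS; have /andP[_ g2] := Gb ord_max; have /andP[_ p2] := psi_bounds l jj.
by rewrite ler_pM.
Qed.

Variables (theta : R) (m : 'rV[int]_e.+1) (c : 'M[int]_e.+1) (i0 : 'I_e.+1) (q0 : int).
Hypothesis theta0 : 0 < theta.
Hypothesis theta_bd : forall zeta : 'rV[int]_e.+1, zeta != 0 ->
  theta <= mnorm (intmx zeta *m quot G *m ux (- y) *m dmx qlam (- t)).
Hypothesis cu : c \in unitmx.
Hypothesis fE : f = intmx (m *m c) *m row' 0 G.
Hypothesis Pm : P%:Z = m 0 i0 * q0.

(** The new row 0 has vanishing last coordinate because [mkx] solves exactly this equation; its
    other coordinates are the numbers bounded in [b_bound] and [jsb]. *)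
Lemma mkx_state l j : j \in js -> exists2 c : 'M[int]_n, c \in unitmx &
  state eps' (Num.min (theta / (3 * e.+1%:R * expR sigma)) (eps / 4)) (intmx c *m G *m dflow w (mkx l j) T).
Proof.
move=> jj; have pE : 1 + P%:Z * j = 1 + m 0 i0 * (q0 * j) by rewrite Pm mulrA.
have [g gu gr] := primitive_completion R cu pE; exists g => //.
have [G1 G0 Gb Gd] := GS.
have rE : row 0 (intmx g *m G) = (1 + P%:R * j%:~R) *: row 0 G + f.
  by rewrite gr fE intrD intrM -pmulrn.
have rj i : (intmx g *m G) 0 i = (1 + P%:R * j%:~R) * G 0 i + f 0 i.
  have <- : (row 0 (intmx g *m G)) 0 i = (intmx g *m G) 0 i by rewrite [LHS]mxE.
  by rewrite rE !mxE.
have bE : (intmx g *m G) 0 (ic e) = bcj j by rewrite rj addrC.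
have FE k : pmx (slope G) (intmx g *m G) 0 (lift ord_max k) = F k.
  by rewrite pmx_lift !rj /F pmx_lift (slopeE eps0 GS); ring.
split.
- by rewrite det_mulmx (det_dflow w_sum1) mulr1 det_mulmx normrM G1 mulr1; have [] := unit_intmx R gu.
- rewrite dflow_max (dot_formula (mkx_max l j)) bE rj G0 mulr0 add0r.
  have -> : \sum_k pmx (slope G) (intmx g *m G) 0 (lift ord_max k) * mkx l j (lift ord_max k) 0 =
      \sum_k F k * xk l k.
    by apply: eq_bigr => k _; rewrite FE mkx_lift.
  rewrite [bcj j * _]mulrC divfK ?gt_eqF ?bcj_gt0 // /phi; ring.
- move=> i; rewrite dflow_lift normrM (gtr0_norm (expR_gt0 _)) expRN ler_pdivlMr ?expR_gt0 // ler_pdivrMr ?expR_gt0 //.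
  case: (unliftP ord_max i) => [k|] ->.
    have /andP[h1 h2] := b_bound k jj.
    have -> : (intmx g *m G) 0 (lift ord_max (lift ord_max k)) = F k + slope G k * bcj j.
      by rewrite -FE pmx_lift bE subrK.
    by rewrite mulrAC h1.
  rewrite -/(ic e) bE (gtr0_norm (bcj_gt0 jj)); have /andP[h1 h2] := jsb jj.
  by move: c0 h1 h2; move: (expR _) => E c0' h1 h2; apply/andP; split; nra.
rewrite -mulmxA; apply: dual_ge_unimod => //.
apply: (child_dual_ge e0 w_gt0 w_sum1 w_noninc eps0 GS t0 sigma0 (mkx_max l j) (psi_bounds l jj) _ theta_bd theta0).
move=> k; rewrite mkx_lift; apply: le_trans (xk_y l k) _.
by rewrite ler_piMl ?expR_ge0 //; lra.
Qed.

End Word.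

End WordChildren.

Lemma truncn_succ_ge (R : realType) (x : R) : 0 <= x -> x <= (Num.trunc x).+1%:R.
Proof. by move=> /truncn_itv/andP[_ /ltW]. Qed.

Lemma uniq_flatten_map (T U : eqType) (F : T -> seq U) (ys : seq T) : uniq ys ->
  (forall y, y \in ys -> uniq (F y)) ->
  (forall y y' x x', y \in ys -> y' \in ys -> y != y' -> x \in F y -> x' \in F y' -> x != x') ->
  uniq (flatten [seq F y | y <- ys]).
Proof.
elim: ys => [//|y ys IH] /= /andP[yys uys] uF dF.
rewrite cat_uniq uF ?mem_head //= IH //; last 2 first.
- by move=> z zys; apply: uF; rewrite inE zys orbT.
- by move=> z z' x x' zys z'ys; apply: dF; rewrite inE ?zys ?z'ys orbT.
rewrite andbT; apply/hasPn => x /flattenP[_ /mapP[z zys ->] xz]; apply/negP => xy.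
have yz : y != z by apply: contraNneq yys => ->.
have := dF y z x x _ _ yz xy xz; rewrite eqxx mem_head inE zys orbT => h.
by have := h isT isT.
Qed.

Section ChildPoints.
Variables (R : realType) (e : nat) (w : 'I_e.+1 -> R).
Hypothesis e0 : (0 < e)%N.
Hypothesis w_gt0 : forall i, 0 < w i.
Hypothesis w_sum1 : \sum_i w i = 1.
Hypothesis w_noninc : forall i j : 'I_e.+1, (i <= j)%N -> w j <= w i.

Local Notation n := e.+2.
Local Notation v := (fun k : 'I_e => w (lift ord_max k)).
Local Notation wd := (w ord_max).
Local Notation S := (\sum_(k < e) w (lift ord_max k)).
Local Notation qlam := (clam v S).
Local Notation state := (@state R e).

(** The count comes from [e] free digits with about e^(wd t) values each and from about e^(wd t)
    integers [j]. No constant depends on the quality [delta] of the given state. *)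
Lemma word_children (eps eps' delta1 A : R) : 0 < eps -> 0 < eps' -> 0 < delta1 -> 0 < A ->
  exists sigma c delta' t0, [/\ 0 <= sigma, 0 < c, 0 < delta', 0 <= t0 &
  forall t delta (G : 'M[R]_n) (y : 'cV[R]_e), t0 <= t -> state eps delta G ->
    (forall k, 0 <= y k 0 <= 1) ->
    lattice_ge (dmx qlam t *m ux y *m (qscale G *: invmx (quot G))) delta1 ->
  exists xs : seq 'cV[R]_e.+1, [/\ uniq xs, c * expR (e.+1%:R * wd * t) <= (size xs)%:R,
    forall x x', x \in xs -> x' \in xs -> x != x' -> sep_at w A (t + sigma) x x' &
    forall x, x \in xs -> (forall k, `|x (lift ord_max k) 0 - y k 0| <= 3 / 8 * expR (- ((v k + S) * t))) /\
      child w eps eps' delta' (t + sigma) G x]].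
Proof.
move=> eps0 eps'0 d10 A0.
have [C C0 HC] := qflow_basis w eps0 d10.
pose err := e.+1%:R * C; have err0 : 0 < err by rewrite mulr_gt0.
have wd0 : 0 < wd by [].
have e200 : 0 < eps' / 20 by lra.
have [s1 s10 Hs1] := exp_decay wd0 (ltW err0) e200.
have i10 : 0 < 10^-1 :> R by lra.
have [s2 s20 Hs2] := exp_decay wd0 ler01 i10.
(* During the extra time [sigma] the prescribed size of the new vector grows past the rounding error
   [err] of the lattice. *)
pose sigma := s1 + s2; have sigma0 : 0 <= sigma by rewrite addr_ge0.
have sigmaC : err <= eps' / 20 * expR (wd * sigma).
  have := Hs1 sigma; rewrite lerDl s20 => /(_ isT); rewrite expRN ler_pdivrMr ?expR_gt0 //.
have sigma1 : expR (- (wd * sigma)) <= 10^-1.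
  by have := Hs2 sigma; rewrite lerDr s10 mul1r => /(_ isT).
clearbody sigma.
(* Bounds the coefficients of the rounded vector, so its factorial is a multiple of each nonzero
   one. [J] enlarges the modulus until different [j] give separated points. *)
pose N1 := (Num.trunc (e.+1%:R * (3 * (eps' * expR sigma) * C) + 1)).+1.
pose J := (Num.trunc (3 * A * eps' / eps)).+1.
pose P := (N1`! * J)%N.
have P0 : (0 < P)%N by rewrite muln_gt0 fact_gt0.
have PR0 : 0 < P%:R :> R by rewrite ltr0n.
have PE : 3 * A * eps' <= P%:R * eps.
  rewrite -ler_pdivrMr // (le_trans _ (_ : J%:R <= _)) ?ler_nat ?leq_pmull ?fact_gt0 //.
  by rewrite truncn_succ_ge // divr_ge0 ?(ltW eps0) // !mulr_ge0 // ltW.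
have er0 : 0 < e%:R :> R by rewrite ltr0n.
pose k1 : R := 30 * e%:R * A; have k10 : 0 < k1 by rewrite !mulr_gt0.
pose k2 := 40 * P%:R * eps / eps'; have k20 : 0 < k2 by rewrite divr_gt0 // !mulr_gt0.
have [t1 t10 Ht1] := exp_decay wd0 (ltW k10) ltr01.
have [t2 t20 Ht2] := exp_decay wd0 (ltW k20) ltr01.
pose theta := (e.+1%:R * C)^-1; have theta0 : 0 < theta by rewrite invr_gt0.
exists sigma, ((2 * k1)^-1 ^+ e * k2^-1), (Num.min (theta / (3 * e.+1%:R * expR sigma)) (eps / 4)), (t1 + t2).
split=> //.
- by rewrite mulr_gt0 ?invr_gt0 // exprn_gt0 // invr_gt0 mulr_gt0.
- by rewrite lt_min !divr_gt0 ?mulr_gt0 ?expR_gt0.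
- exact: addr_ge0.
move=> t delta G y tt GS y01 lat; have t0 : 0 <= t by rewrite (le_trans _ tt) // addr_ge0.
have {}Ht1 : k1 <= expR (wd * t).
  have := Ht1 t; rewrite (le_trans _ tt) ?lerDl // => /(_ isT).
  by rewrite expRN ler_pdivrMr ?expR_gt0 // mul1r.
have {}Ht2 : k2 <= expR (wd * t).
  have := Ht2 t; rewrite (le_trans _ tt) ?lerDr // => /(_ isT).
  by rewrite expRN ler_pdivrMr ?expR_gt0 // mul1r.
have [ci ciu [Wu WC WC']] := HC t delta G y GS lat.
have theta_bd := qflow_dual_ge C0 ciu Wu WC'.
set T := t + sigma; have T0 : 0 <= T by rewrite addr_ge0.
pose target k := - (Num.sg (slope G k) * (3 / 4 * (eps' * expR (v k * T)) +
   `|slope G k| * (29 / 40 * (eps' * expR (wd * T))))).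
(* The target of [target_bounds] as seen after the quotient flow of time [t]; its last coordinate is
   0 so that the residual at [y] is small. *)
pose tau : 'rV[R]_e.+1 := \row_j oapp (fun k => target k * expR (- (v k * t))) 0 (unlift ord_max j).
have target_le k : `|target k| <= 3 * (eps' * expR (v k * T)).
  have h1 : `|Num.sg (slope G k)| <= 1 by rewrite normr_sg; case: (_ != 0).
  have h2 := slope_le2 eps0 GS k.
  have h3 : expR (wd * T) <= expR (v k * T) by rewrite ler_expR ler_wpM2r // wd_le.
  have h4 := expR_gt0 (wd * T).
  rewrite /target normrN normrM; apply: le_trans (ler_piMl (normr_ge0 _) h1) _.
  rewrite ger0_norm; last by rewrite addr_ge0 // !mulr_ge0 ?expR_ge0 ?(ltW eps'0).
  have h5 : eps' * expR (wd * T) <= eps' * expR (v k * T) by rewrite ler_wpM2l // ltW.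
  have h6 : 0 < eps' * expR (wd * T) by rewrite mulr_gt0.
  move: h2 h5 h6 (normr_ge0 (slope G k)).
  by move: (eps' * expR (wd * T)) (eps' * expR (v k * T)) `|slope G k| => a b s h2 h5 h6 h7; nra.
have tau_le : mnorm tau <= 3 * (eps' * expR sigma).
  apply: mnorm_le => [|i j]; first by rewrite !mulr_ge0 ?expR_ge0 // ltW.
  rewrite mxE; case: (unlift ord_max j) => [k|] /=; last by rewrite normr0 !mulr_ge0 ?expR_ge0 // ltW.
  rewrite normrM (gtr0_norm (expR_gt0 _)).
  apply: le_trans (ler_wpM2r (expR_ge0 _) (target_le k)) _.
  rewrite -!mulrA -expRD ler_wpM2l // ler_wpM2l ?(ltW eps'0) // ler_expR.
  have -> : v k * T + - (v k * t) = v k * sigma by rewrite /T; ring.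
  by rewrite ler_piMl // w_le1.
have [m [ma mb]] := near_lattice_point tau Wu WC WC'.
pose f : 'rV[R]_n := intmx (m *m ci) *m row' 0 G.
pose F k := pmx (slope G) f 0 (lift ord_max k).
have aE : intmx m *m (intmx ci *m qflow w G y t) = pmx (slope G) f *m ux (- y) *m dmx qlam (- t).
  by rewrite mulmxA -map_mxM /qflow !mulmxA /f pmxM.
have Fnear k : `|F k - target k| <= eps' * expR (v k * T) / 20.
  have := ma (lift ord_max k); rewrite aE dmxEr ux_mul_lift clam_lift -/(F k) [tau _ _]mxE liftK /= mulrN.
  rewrite -mulrBl normrM (gtr0_norm (expR_gt0 _)) expRN ler_pdivrMr ?expR_gt0 // => h.
  apply: le_trans h _; rewrite -/err; apply: le_trans (ler_wpM2r (expR_ge0 _) sigmaC) _.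
  have -> : eps' * expR (v k * T) / 20 = eps' / 20 * (expR (v k * sigma) * expR (v k * t)).
    by rewrite -expRD /T mulrDr [v k * t + _]addrC; ring.
  by rewrite -[leLHS]mulrA ler_wpM2l ?(ltW e200) // ler_wpM2r ?expR_ge0 // ler_expR ler_wpM2r // wd_le.
have r0_le : `|f 0 ord_max - \sum_k F k * y k 0| <= err * expR (- (S * t)).
  have := ma ord_max; rewrite aE dmxEr ux_mul_max clam_max mulrNN pmx_max [tau _ _]mxE unlift_none /= subr0.
  have -> : \sum_k pmx (slope G) f 0 (lift ord_max k) * (- y) k 0 = - \sum_k F k * y k 0.
    by rewrite -sumrN; apply: eq_bigr => k _; rewrite [(- y) k 0]mxE mulrN.
  by rewrite normrM (gtr0_norm (expR_gt0 _)) expRN ler_pdivlMr ?expR_gt0.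
(* [m = 0] would give [F = 0], against the lower bound for [F] in [target_bounds]. *)
have [i0 i00] : exists i, m 0 i != 0.
  apply: contrapT => h; have m0 : m = 0.
    by apply/rowP => i; rewrite mxE; apply: contrapT => /eqP mi; apply: h; exists i.
  have := Fnear (Ordinal e0); have -> : F (Ordinal e0) = 0.
    by rewrite /F /f m0 mul0mx intmx0 mul0mx pmx_lift !mxE mulr0 subrr.
  rewrite sub0r normrN /target => h1.
  have c0' : 0 < eps' * expR (wd * T) by rewrite mulr_gt0 ?expR_gt0.
  have ca : eps' * expR (wd * T) <= eps' * expR (v (Ordinal e0) * T).
    by rewrite ler_wpM2l ?(ltW eps'0) // ler_expR ler_wpM2r // wd_le.
  have hb : 7 / 10 * (eps' * expR (wd * T)) <= 7 / 10 * (eps' * expR (wd * T)) <= 3 / 4 * (eps' * expR (wd * T)).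
    by rewrite lexx /= ler_wpM2r ?(ltW c0') //; lra.
  have := @target_bounds R (slope G (Ordinal e0)) _ _ 0 _ (slope_neq0 eps0 GS _) (slope_le2 eps0 GS _) c0' ca _ hb.
  rewrite sub0r normrN => /(_ h1)[]; rewrite normr0 leNgt => /andP[/negP[]].
  by rewrite mulr_gt0 ?(lt_le_trans c0' ca) //; lra.
have [q0' qE] : exists q : int, (N1`!)%:Z = m 0 i0 * q.
  apply: int_dvd_fact => //; rewrite -(ler_nat R) pmulrn abszE.
  apply: le_trans (mb i0) _; apply: le_trans (_ : e.+1%:R * (3 * (eps' * expR sigma) * C) + 1 <= _).
    by rewrite lerD2r ler_wpM2l // ler_wpM2r // ltW.
  by rewrite truncn_succ_ge // addr_ge0 // !mulr_ge0 ?expR_ge0 // ltW.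
have Pm : P%:Z = m 0 i0 * (q0' * J%:Z) by rewrite mulrA -qE -PoszM.
pose bc := G 0 (ic e); have bc0 : bc != 0 by exact: (state_neq0 eps0 GS).
have a0 : P%:R * bc != 0 by rewrite mulf_neq0 // gt_eqF.
pose X := expR (wd * T); have X0 : 0 < X by exact: expR_gt0.
have XY : expR (wd * t) <= X by rewrite ler_expR ler_wpM2l ?(ltW wd0) // lerDl.
have A12 : 7 / 10 * (eps' * X) <= 3 / 4 * (eps' * X).
  by rewrite ler_wpM2r ?mulr_ge0 ?(ltW eps'0) ?(ltW X0) //; lra.
have [js [ujs sjs jsb']] := window_count (f 0 (ic e) + bc) a0 A12.
have jsb j : j \in js -> 7 / 10 * (eps' * X) <= f 0 (ic e) + (1 + P%:R * j%:~R) * bc <= 3 / 4 * (eps' * X).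
  move=> /jsb'; rewrite (_ : f 0 (ic e) + bc + _ = f 0 (ic e) + (1 + P%:R * j%:~R) * bc) //; ring.
pose L := Num.trunc (X / k1).
have Xk1 : 1 <= X / k1 by rewrite ler_pdivlMr // mul1r (le_trans Ht1).
have LE : L%:R * A <= X / (30 * e%:R).
  by rewrite -ler_pdivlMr // -mulrA -invfM -/k1 truncn_le (le_trans ler01).
have bcle : `|bc| <= eps by have [_ _ Gb _] := GS; have /andP[] := Gb ord_max.
have bcp : 0 < `|bc| by rewrite normr_gt0.
have js_ge : X / k2 <= (size js)%:R.
  apply: le_trans sjs; have Xk2 : 1 <= X / k2 by rewrite ler_pdivlMr // mul1r (le_trans Ht2).
  have -> : (3 / 4 * (eps' * X) - 7 / 10 * (eps' * X)) / `|P%:R * bc| = 2 * (X / (40 * P%:R * `|bc| / eps')).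
    by rewrite normrM ger0_norm //; field; rewrite !gt_eqF.
  have : X / k2 <= X / (40 * P%:R * `|bc| / eps').
    rewrite ler_wpM2l ?(ltW X0) // lef_pV2 ?posrE // ?divr_gt0 ?mulr_gt0 //.
    by rewrite ler_wpM2r ?invr_ge0 ?(ltW eps'0) // ler_wpM2l // mulr_ge0.
  by lra.
have L_ge : X / (2 * k1) <= L%:R.
  have /andP[_] := truncn_itv (le_trans ler01 Xk1); rewrite -/L -natr1.
  have : 1 <= L%:R :> R by rewrite ler1n truncn_gt0.
  have -> : X / (2 * k1) = X / k1 / 2 by field; rewrite gt_eqF.
  by move: (X / k1) => z; lra.
clearbody k1 k2.
pose xf (p : {ffun 'I_e -> 'I_L} * int) := mkx w e0 eps' A sigma t P G y f p.1 p.2.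
exists [seq xf (l, j) | l <- enum {: {ffun 'I_e -> 'I_L}}, j <- js].
have xsep p p' : p.2 \in js -> p'.2 \in js -> p != p' -> sep_at w A T (xf p) (xf p').
  move: p p' => [l j] [l' j'] jj jj' pp.
  exact: (mkx_sep e0 w_sum1 w_noninc y eps0 eps'0 A0 t0 sigma0 GS Fnear PE LE jsb jj jj' pp).
split.
- rewrite allpairs_uniq ?enum_uniq // => p p' /allpairsP[[l j] /= [_ jj ->]] /allpairsP[[l' j'] /= [_ jj' ->]] /= xx.
  apply/eqP; apply: contrapT => /negP pp; have [i] := xsep (l, j) (l', j') jj jj' pp.
  by rewrite xx subrr normr0 leNgt mulr_gt0 ?expR_gt0.
- rewrite size_allpairs -cardE card_ffun !card_ord natrM natrX.
  have -> : (2 * k1)^-1 ^+ e * k2^-1 * expR (e.+1%:R * wd * t) = (expR (wd * t) / (2 * k1)) ^+ e * (expR (wd * t) / k2).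
    rewrite exprMn -[e.+1%:R * wd * t]mulrA expRM_natl exprSr; ring.
  have k2k : 0 < 2 * k1 by rewrite mulr_gt0.
  rewrite ler_pM ?exprn_ge0 ?divr_ge0 ?expR_ge0 ?(ltW k2k) ?(ltW k20) //.
    rewrite lerXn2r ?nnegrE ?divr_ge0 ?expR_ge0 ?(ltW k2k) //; apply: le_trans L_ge.
    by rewrite ler_wpM2r ?invr_ge0 ?(ltW k2k).
  by apply: le_trans js_ge; rewrite ler_wpM2r ?invr_ge0 ?(ltW k20).
- move=> x x' /allpairsP[[l j] /= [_ jj ->]] /allpairsP[[l' j'] /= [_ jj' ->]] xx.
  by apply: xsep => //; apply: contraNneq xx => ->.
move=> x /allpairsP[[l j] /= [_ jj ->]]; split.
  move=> k; exact: (mkx_near e0 w_gt0 w_sum1 w_noninc P eps0 eps'0 A0 t0 sigma0 GS sigmaC sigma1 Fnear r0_le LE).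
split.
- move=> i; exact: (mkx_le e0 w_gt0 w_sum1 w_noninc eps0 eps'0 A0 t0 sigma0 GS sigmaC sigma1 y01 Fnear r0_le LE jsb).
- exact: (mkx_dot e0 w_sum1 w_noninc y eps0 eps'0 A0 t0 sigma0 GS Fnear LE jsb l jj).
exact: (mkx_state e0 w_gt0 w_sum1 w_noninc eps0 eps'0 A0 t0 sigma0 GS sigmaC sigma1 Fnear r0_le LE jsb theta0 theta_bd ciu (erefl f) Pm l jj).
Qed.

End ChildPoints.

Section KeyTheorem.
Variables (R : realType) (e : nat) (w : 'I_e.+1 -> R).
Hypothesis e0 : (0 < e)%N.
Hypothesis w_gt0 : forall i, 0 < w i.
Hypothesis w_sum1 : \sum_i w i = 1.
Hypothesis w_noninc : forall i j : 'I_e.+1, (i <= j)%N -> w j <= w i.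

Local Notation n := e.+2.
Local Notation v := (fun k : 'I_e => w (lift ord_max k)).
Local Notation wd := (w ord_max).
Local Notation S := (\sum_(k < e) w (lift ord_max k)).
Local Notation qlam := (clam v S).
Local Notation state := (@state R e).

(** Words contribute (e + 1) S t to the exponent and their children (e + 1) wd t, and S + wd = 1.
    The output quality [delta'] is chosen before the input quality [delta], which only affects [T];
    this makes unlimited iteration possible. *)
Theorem key_lemma (eta A eps eps' : R) : 0 < eta -> 0 < A -> 0 < eps -> 0 < eps' ->
  exists2 delta', 0 < delta' & forall delta Tmin, 0 < delta -> exists2 T, Tmin <= T &
  forall G : 'M[R]_n, state eps delta G -> exists xs : seq 'cV[R]_e.+1,
  [/\ uniq xs, expR ((e.+1%:R - eta) * T) <= (size xs)%:R,
    forall x x', x \in xs -> x' \in xs -> x != x' -> sep_at w A T x x' &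
    forall x, x \in xs -> child w eps eps' delta' T G x].
Proof.
move=> eta0 A0 eps0 eps'0; have S0 := S_pos e0 w_gt0.
have v0 k : 0 < v k by [].
have eta20 : 0 < eta / 2 by rewrite divr_gt0.
have [tau [delta1 [tau0 d10 gen]]] := generic_words e0 v0 S0 (erefl S) eta20.
have [sigma [c [delta' [t0 [s0 c0 d'0 t00 wc]]]]] := word_children e0 w_gt0 w_sum1 w_noninc eps0 eps'0 d10 A0.
exists delta' => // delta Tmin d0.
have [l l0 lP] := quot_lattice_ge e eps0 d0.
have [M0 M0P] := gen l l0.
have q0 : 0 < 8^-1 :> R by lra.
have [t1 t10 Ht1] := exp_decay (w_gt0 ord_max) (ltW A0) q0.
have K0 : 0 <= expR (e.+1%:R * sigma) / c by rewrite divr_ge0 ?expR_ge0 // ltW.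
have [t2 t20 Ht2] := exp_decay eta20 K0 ltr01.
pose M := (M0 + (Num.trunc ((t0 + t1 + t2 + `|Tmin|) / tau)).+1)%N.
pose t := M%:R * tau.
have tge : t0 + t1 + t2 + `|Tmin| <= t.
  rewrite -ler_pdivrMr //; apply: le_trans (truncn_succ_ge _) _.
    by rewrite divr_ge0 ?(ltW tau0) // !addr_ge0.
  by rewrite ler_nat leq_addl.
have Tn := normr_ge0 Tmin; have Tn' := ler_norm Tmin.
have t_0 : 0 <= t by lra.
have tt0 : t0 <= t by lra.
have tt1 : t1 <= t by lra.
have tt2 : t2 <= t by lra.
exists (t + sigma) => [|G GS]; first by lra.
have [ys [uys sys ys01 ysep yslat]] := M0P M (leq_addr _ _) _ (det_qscale eps0 GS) (lP G GS).
have /choice[F FP] : forall y : 'cV[R]_e, exists xs : seq 'cV[R]_e.+1, y \in ys ->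
    [/\ uniq xs, c * expR (e.+1%:R * wd * t) <= (size xs)%:R,
    forall x x', x \in xs -> x' \in xs -> x != x' -> sep_at w A (t + sigma) x x' &
    forall x, x \in xs -> (forall k, `|x (lift ord_max k) 0 - y k 0| <= 3 / 8 * expR (- ((v k + S) * t))) /\
      child w eps eps' delta' (t + sigma) G x].
  move=> y; have [yy|yy] := boolP (y \in ys); last by exists [::].
  by have [xs xsP] := wc t delta G y tt0 GS (ys01 y yy) (yslat y yy); exists xs.
(* Children stay within 3/8 of the mesh from their word, so those of different words are at least a
   quarter of the mesh apart; the separation required at the final time is smaller than the mesh by
   a factor of order e^(- wd t). *)
have far y y' x x' : y \in ys -> y' \in ys -> y != y' -> x \in F y -> x' \in F y' -> sep_at w A (t + sigma) x x'.
  move=> yy y'y yy' xF x'F; have [k yk] := ysep y y' yy y'y yy'; exists (lift ord_max k).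
  have [_ _ _ /(_ x xF)[/(_ k) xk _]] := FP y yy; have [_ _ _ /(_ x' x'F)[/(_ k) x'k _]] := FP y' y'y.
  have h : A * expR (- ((1 + v k) * (t + sigma))) <= expR (- ((v k + S) * t)) / 8.
    apply: le_trans (_ : A * expR (- (wd * t)) * expR (- ((v k + S) * t)) <= _); last first.
      by rewrite mulrC ler_wpM2l ?expR_ge0 // Ht1.
    rewrite -mulrA ler_wpM2l ?(ltW A0) // -expRD ler_expR.
    have -> : S = 1 - wd by rewrite -(S_wd w_sum1) addrK.
    have : 0 <= (1 + v k) * sigma by rewrite mulr_ge0 // addr_ge0 // ltW.
    rewrite mulrDr; move: (w (lift _ _)) => a; lra.
  apply: le_trans h _; move: yk; rewrite /wsize -/t => yk.
  have -> : x (lift ord_max k) 0 - x' (lift ord_max k) 0 =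
    (y k 0 - y' k 0) + ((x (lift ord_max k) 0 - y k 0) - (x' (lift ord_max k) 0 - y' k 0)) by ring.
  have := lerB_normD (y k 0 - y' k 0) ((x (lift ord_max k) 0 - y k 0) - (x' (lift ord_max k) 0 - y' k 0)).
  have := ler_normB (x (lift ord_max k) 0 - y k 0) (x' (lift ord_max k) 0 - y' k 0).
  move: yk xk x'k (expR_gt0 (- ((v k + S) * t))); lra.
have sepN x x' : sep_at w A (t + sigma) x x' -> x != x'.
  by move=> [i h]; apply: contraTneq h => ->; rewrite subrr normr0 -ltNge mulr_gt0 ?expR_gt0.
exists (flatten [seq F y | y <- ys]); split.
- apply: uniq_flatten_map => // [y yy|y y' x x' yy y'y yy' xF x'F]; first by have [] := FP y yy.
  by apply: sepN; exact: far _ _ _ _ yy y'y yy' xF x'F.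
- rewrite size_flatten /shape -map_comp sumnE big_map natr_sum.
  apply: le_trans (_ : \sum_(y <- ys) c * expR (e.+1%:R * wd * t) <= _); last first.
    by rewrite big_seq [leRHS]big_seq; apply: ler_sum => y yy /=; have [] := FP y yy.
  rewrite big_const_seq count_predT iter_addr_0 -[leRHS]mulr_natl.
  apply: le_trans (_ : expR ((e.+1%:R * S - eta / 2) * t) * (c * expR (e.+1%:R * wd * t)) <= _); last first.
    by rewrite ler_wpM2r // mulr_ge0 ?expR_ge0 // ltW.
  have := Ht2 t tt2; rewrite mulrAC ler_pdivrMr // mul1r => h.
  rewrite mulrCA -expRD; have -> : (e.+1%:R * S - eta / 2) * t + e.+1%:R * wd * t = (e.+1%:R - eta / 2) * t.
    by have -> : S = 1 - wd by [rewrite -(S_wd w_sum1) addrK]; ring.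
  apply: le_trans (ler_wpM2r (expR_ge0 _) h); rewrite -!expRD ler_expR.
  have : 0 <= eta * sigma by rewrite mulr_ge0 // ltW.
  move: (e.+1%:R : R) => d; lra.
- move=> x x' /flattenP[_ /mapP[y yy ->] xF] /flattenP[_ /mapP[y' y'y ->] x'F] xx.
  have [yE|yy'] := eqVneq y y'; last exact: far _ _ _ _ yy y'y yy' xF x'F.
  by move: x'F; rewrite -yE => x'F; have [_ _ + _] := FP y yy; apply.
move=> x /flattenP[_ /mapP[y yy ->] xF].
by have [_ _ _ /(_ x xF)[]] := FP y yy.
Qed.

End KeyTheorem.

(** Points are labelled by mesh cells of [y], which need not be their coordinates; [hit_kids_slab]
    uses a sheared coordinate. *)
Lemma floor_count (R : realType) (T : eqType) d (xs : seq T) (y : T -> 'I_d -> R) (h c r : 'I_d -> R) :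
  uniq xs -> (forall i, 0 < h i) -> (forall i, 0 <= r i) ->
  (forall x, x \in xs -> forall i, `|y x i - c i| <= r i) ->
  (forall x x', x \in xs -> x' \in xs ->
     (forall i, Num.floor (y x i / h i) = Num.floor (y x' i / h i)) -> x = x') ->
  (size xs)%:R <= \prod_i (2 * r i / h i + 2).
Proof.
move=> uxs h0 r0 yr inj.
pose lo i := Num.floor ((c i - r i) / h i).
pose U i := (Num.trunc (2 * r i / h i)).+1.
pose M := (\sum_i U i)%N.
have UM i : (U i <= M)%N by rewrite /M (bigD1 i) //= leq_addr.
have K x i : x \in xs -> exists2 k : nat, (k <= U i)%N & Num.floor (y x i / h i) = lo i + k%:Z.
  move=> xxs; have := yr x xxs i; rewrite ler_norml => /andP[y1 y2].
  have l1 : lo i <= Num.floor (y x i / h i).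
    by apply: le_floor; rewrite ler_wpM2r ?invr_ge0 ?(ltW (h0 i)) //; lra.
  exists `|(Num.floor (y x i / h i) - lo i)%R|%N; last first.
    by rewrite abszE ger0_norm ?subr_ge0 // addrC subrK.
  have kd : `|(Num.floor (y x i / h i) - lo i)%R|%N%:R < (U i).+1%:R :> R.
    rewrite pmulrn abszE ger0_norm ?subr_ge0 // intrB.
    have /andP[f1 _] := floor_itv (y x i / h i).
    have /andP[_ f2] := floor_itv ((c i - r i) / h i).
    rewrite -/(lo i) intrD in f2.
    have f3 : y x i / h i <= (c i - r i) / h i + 2 * r i / h i.
      by rewrite -mulrDl ler_wpM2r ?invr_ge0 ?(ltW (h0 i)) //; lra.
    have f4 : 2 * r i / h i <= (U i)%:R.
      by apply: truncn_succ_ge; rewrite divr_ge0 ?(ltW (h0 i)) // mulr_ge0.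
    by rewrite -[(U i).+1%:R]natr1; move: f1 f2 f3 f4; lra.
  by rewrite ltr_nat in kd.
pose lab x : {ffun 'I_d -> 'I_M.+1} := [ffun i => inord `|(Num.floor (y x i / h i) - lo i)%R|%N].
pose Q i : pred 'I_M.+1 := fun k => (k <= U i)%N.
have labE x i : x \in xs -> ((lab x i : nat)%:Z = Num.floor (y x i / h i) - lo i) /\ (lab x i <= U i)%N.
  move=> xxs; have [k kU kE] := K x i xxs; rewrite ffunE kE addrAC subrr add0r absz_nat inordK //.
  by rewrite ltnS (leq_trans kU).
have s1 : (size xs <= #|family Q|)%N.
  rewrite -(size_map lab) -(card_uniqP _).
    apply: subset_leq_card; apply/fintype.subsetP => m /mapP[x xxs ->].
    by apply/familyP => i; have [] := labE x i xxs.
  rewrite map_inj_in_uniq // => x x' xxs x'xs labxx; apply: inj => // i.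
  have [h1 _] := labE x i xxs; have [h2 _] := labE x' i x'xs.
  by move: h2; rewrite -labxx h1 => /addIr.
apply: le_trans (_ : (#|family Q|)%:R <= _); first by rewrite ler_nat.
rewrite card_family foldrE big_map big_enum /= natr_prod; apply: ler_prod => i _.
rewrite ler0n (card_ord_le (UM i)) -[(U i).+1%:R]natr1 /U -natr1.
have : (Num.trunc (2 * r i / h i))%:R <= 2 * r i / h i.
  by rewrite truncn_le divr_ge0 ?(ltW (h0 i)) // mulr_ge0.
lra.
Qed.

Lemma primitive_part n (m : 'cV[int]_n.+1) : m != 0 -> exists k z, [/\ k != 0, m = k *: z &
  forall k' (z' : 'cV[int]_n.+1), z = k' *: z' -> k' \is a GRing.unit].
Proof.
have [N] := ubnP (\sum_i `|(m i 0%R)|)%N; elim: N m => // N IH m mN m0.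
have [prim|] := pselect (forall k' (z' : 'cV[int]_n.+1), m = k' *: z' -> k' \is a GRing.unit).
  by exists 1, m; rewrite scale1r.
move=> /existsNP[k /existsNP[z /not_implyP[mE /negP kN]]].
have z0 : z != 0 by apply: contra_neq m0 => z0; rewrite mE z0 scaler0.
have k0 : k != 0 by apply: contra_neq m0 => k0; rewrite mE k0 scale0r.
have k2 : (1 < `|k|)%N.
  rewrite ltn_neqAle eq_sym absz_gt0 k0 andbT; apply: contra kN => /eqP k1.
  have [->|->] : k = 1 \/ k = -1 by clear - k1; lia.
    exact: unitr1.
  exact: unitrN1.
have sE : (\sum_i `|(m i 0%R)| = `|k| * \sum_i `|(z i 0%R)|)%N.
  by rewrite big_distrr /=; apply: eq_bigr => i _; rewrite mE mxE abszM.
have zs : (0 < \sum_i `|(z i 0%R)|)%N.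
  rewrite lt0n; apply: contra_neqN z0; rewrite sum_nat_eq0 => /forallP h.
  by apply/colP => i; rewrite mxE; apply/eqP; rewrite -absz_eq0; exact: (implyP (h i)).
have [|k' [z' [k'0 zE zp]]] := IH z _ z0.
  by apply: leq_trans (_ : _ < \sum_i `|(m i 0%R)|)%N _; rewrite ?sE ?ltn_Pmull // -sE -ltnS.
exists (k * k'), z'; rewrite mulf_neq0 // -scalerA -zE; split=> //.
Qed.

(** * Lengths of the time steps and the first state *)

Section Schedule.
Variables (R : realType) (e : nat) (w : 'I_e.+1 -> R).
Hypothesis e0 : (0 < e)%N.
Hypothesis w_gt0 : forall i, 0 < w i.
Hypothesis w_sum1 : \sum_i w i = 1.
Hypothesis w_noninc : forall i j : 'I_e.+1, (i <= j)%N -> w j <= w i.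

Local Notation n := e.+2.
Local Notation state := (@state R e).

Lemma state_mono eps delta delta' (G : 'M[R]_n) : delta' <= delta -> state eps delta G -> state eps delta' G.
Proof. by move=> dd [h1 h2 h3 h4]; split=> // z z0; apply: le_trans dd _; exact: h4. Qed.

Lemma child_mono eps eps' delta delta' T (G : 'M[R]_n) x : delta' <= delta ->
  child w eps eps' delta T G x -> child w eps eps' delta' T G x.
Proof. by move=> dd [h1 h2 [c cu h3]]; split=> //; exists c => //; exact: state_mono h3. Qed.

Definition branches eta A T eps eps' delta delta' := forall G : 'M[R]_n, state eps delta G ->
  exists xs : seq 'cV[R]_e.+1,
  [/\ uniq xs, expR ((e.+1%:R - eta) * T) <= (size xs)%:R,
    forall x x', x \in xs -> x' \in xs -> x != x' -> sep_at w A T x x' &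
    forall x, x \in xs -> child w eps eps' delta' T G x].

(* The next value of [eps] is used only once the elapsed time dominates the time
   its construction takes, so steps stay short compared with the elapsed time. *)
Lemma schedule (eta A eps0 delta0 Tlow : R) : 0 < eta -> 0 < A -> 0 < eps0 -> 0 < delta0 -> 0 < Tlow ->
  exists (eps delta T : nat -> R) (B : R), [/\ eps 0%N = eps0, delta 0%N <= delta0,
    forall l, [/\ 0 < eps l, Tlow <= T l & T l <= B + eta * \sum_(i < l) T i],
    forall r, 0 < r -> exists l0, forall l, (l0 <= l)%N -> eps l <= r &
    forall l, branches eta A (T l) (eps l) (eps l.+1) (delta l) (delta l.+1)].
Proof.
move=> eta0 A0 eps00 delta00 Tl0.
pose es j : R := eps0 * 2^-1 ^+ j.
have es0 j : 0 < es j by rewrite mulr_gt0 // exprn_gt0 // invr_gt0.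
have kl := key_lemma e0 w_gt0 w_sum1 w_noninc eta0 A0.
have /choice[ds dsP] : forall j, exists d', 0 < d' /\ forall delta Tmin, 0 < delta -> exists2 T, Tmin <= T &
    branches eta A T (es j) (es j) delta d'.
  by move=> j; have [d' d'0 h] := kl _ _ (es0 j) (es0 j); exists d'.
have /choice[dn dnP] : forall j, exists d', 0 < d' /\ forall delta Tmin, 0 < delta -> exists2 T, Tmin <= T &
    branches eta A T (es j) (es j.+1) delta d'.
  by move=> j; have [d' d'0 h] := kl _ _ (es0 j) (es0 j.+1); exists d'.
(* Below the quality obtained by either way of arriving at size [es j]: remaining at it, or coming
   from the previous size. *)
pose D j := Num.min (ds j) (if j is j'.+1 then dn j' else delta0).
have D0 j : 0 < D j by rewrite lt_min (dsP j).1 /=; case: j => [//|j]; exact: (dnP j).1.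
have bmono T ep ep' dd dd1 dd2 : dd2 <= dd1 -> branches eta A T ep ep' dd dd1 -> branches eta A T ep ep' dd dd2.
  move=> h b G /b[xs [h1 h2 h3 h4]]; exists xs; split=> // x /h4; exact: child_mono.
have /choice[Ts TsP] : forall j, exists T, Tlow <= T /\ branches eta A T (es j) (es j) (D j) (D j).
  move=> j; have [T TT bT] := (dsP j).2 _ Tlow (D0 j); exists T; split=> //.
  by apply: bmono bT; rewrite ge_min lexx.
have /choice[Tn TnP] : forall j, exists T, Tlow <= T /\ branches eta A T (es j) (es j.+1) (D j) (D j.+1).
  move=> j; have [T TT bT] := (dnP j).2 _ Tlow (D0 j); exists T; split=> //.
  by apply: bmono bT; rewrite /D ge_min lexx orbT.
pose Bj j := Num.max (Ts j) (Tn j).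
(* The state consists of the index of the current size and the elapsed time. The index advances only
   when both step lengths available at the next index are at most [eta] times the elapsed time. *)
pose step (p : nat * R) := if Bj p.1.+1 <= eta * p.2 then (p.1.+1, p.2 + Tn p.1) else (p.1, p.2 + Ts p.1).
pose st l := iter l step (0%N, 0).
have stS l : st l.+1 = step (st l) by [].
have st0 : st 0%N = (0%N, 0) by [].
clearbody st.
pose J l := (st l).1; pose tt l := (st l).2.
pose up l := Bj (J l).+1 <= eta * tt l.
pose T l := if up l then Tn (J l) else Ts (J l).
have JS l : J l.+1 = if up l then (J l).+1 else J l.
  by rewrite /J /up /tt stS /step; case: ifP.
have tS l : tt l.+1 = tt l + T l.
  by rewrite /T /up /tt /J stS /step; case: ifP.
have ttE l : tt l = \sum_(i < l) T i.
  by elim: l => [|l IH]; [rewrite big_ord0 /tt st0 | rewrite big_ord_recr tS IH].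
have Tge l : Tlow <= T l by rewrite /T; case: ifP => _; [exact: (TnP _).1 | exact: (TsP _).1].
have tt0 l : 0 <= tt l by rewrite ttE; apply: sumr_ge0 => i _; rewrite (le_trans (ltW Tl0)).
have ttge l : l%:R * Tlow <= tt l.
  elim: l => [|l IH]; first by rewrite mul0r /tt st0.
  by rewrite tS -natr1 mulrDl mul1r lerD.
have inv l : Bj (J l) <= Bj 0%N + eta * tt l.
  elim: l => [|l IH]; first by rewrite /J /tt st0 mulr0 addr0.
  rewrite JS tS; have T0 : 0 <= eta * T l by rewrite mulr_ge0 ?(ltW eta0) // (le_trans (ltW Tl0)).
  have B00 : 0 <= Bj 0%N by rewrite le_max (le_trans (ltW Tl0)) ?(TsP 0%N).1.
  rewrite mulrDr; case: ifP => [h|_]; last lra.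
  by move: h; rewrite /up; lra.
have Jmono l k : (J l <= J (l + k))%N.
  elim: k => [|k IH]; first by rewrite addn0.
  by rewrite addnS JS; case: ifP => _; rewrite ?(leqW IH).
have Jinf j : exists l, (j <= J l)%N.
  elim: j => [|j [l jl]]; first by exists 0%N.
  have [//|no] := pselect (exists l', (j < J l')%N).
  have Jj k : J (l + k)%N = j.
    apply/eqP; rewrite eqn_leq (leq_trans jl (Jmono _ _)) andbT leqNgt; apply/negP => h.
    by apply: no; exists (l + k)%N.
  exfalso; pose k := (Num.trunc (`|Bj j.+1| / (eta * Tlow))).+1.
  have h : up (l + k)%N.
    rewrite /up Jj; apply: le_trans (ler_norm _) _.
    apply: le_trans (_ : eta * (k%:R * Tlow) <= _).
      rewrite mulrCA -ler_pdivrMr ?mulr_gt0 // truncn_succ_ge // divr_ge0 // mulr_ge0 // ltW //.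
    rewrite ler_wpM2l ?(ltW eta0) // (le_trans _ (ttge _)) // ler_wpM2r ?(ltW Tl0) //.
    by rewrite ler_nat leq_addl.
  by apply: no; exists (l + k).+1; rewrite JS h Jj.
exists (fun l => es (J l)), (fun l => D (J l)), T, (Bj 0%N); split.
- by rewrite /J st0 /es expr0 mulr1.
- by rewrite /J st0 /D ge_min lexx orbT.
- move=> l; split=> //; rewrite -ttE; apply: le_trans (inv l).
  by rewrite /T; case: ifP => _; rewrite le_max lexx ?orbT.
- move=> r r0; have [j0 hj0] := halving_decay eps0 r0; have [l0 l0P] := Jinf j0; exists l0 => l ll.
  by apply: hj0; rewrite (leq_trans l0P) // -(subnKC ll) Jmono.
move=> l; rewrite JS /T; case: ifP => _; [exact: (TnP _).2 | exact: (TsP _).2].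
Qed.

Lemma dual_ge_unit m (G : 'M[R]_m) : G \in unitmx -> exists2 delta, 0 < delta & dual_ge G delta.
Proof.
move=> Gu; have K0 : 0 < m%:R * mnorm (invmx G) + 1 by rewrite ltr_wpDl ?mulr_ge0 ?mnorm_ge0.
exists (m%:R * mnorm (invmx G) + 1)^-1 => [|z z0]; first by rewrite invr_gt0.
rewrite -[_^-1]mulr1 ler_pdivrMl //; apply: le_trans (int_row_ge1 R z0) _.
rewrite -{1}(mulmxK Gu (intmx z)); apply: le_trans (mnormM _ _) _.
by rewrite [mnorm (_ *m G) * _]mulrC mulrA ler_wpM2r ?mnorm_ge0 // lerDl.
Qed.

(** A dual vector close to a large multiple of (1, ..., 1, 0) has comparable first coordinates, and
    so has its primitive part; the shift [x] then cancels the last coordinate. *)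
Lemma initial_state (D : 'M[R]_n) : `|\det D| = 1 -> exists (x : 'cV[R]_e.+1) (c : 'M[int]_n) (eps delta : R),
  [/\ c \in unitmx, 0 < eps, 0 < delta & state eps delta (intmx c *m D *m ux (- x))].
Proof.
move=> D1; have Du := unit_of_det1 D1.
pose C := mnorm D + mnorm (invmx D).
have C0 : 0 <= C by rewrite addr_ge0 ?mnorm_ge0.
pose E := n%:R * C; have E0 : 0 <= E by rewrite mulr_ge0.
pose tau : 'rV[R]_n := \row_j oapp (fun=> 4 * E + 1) 0 (unlift ord_max j).
have [||m [ma _]] := @near_lattice_point R _ D C tau Du; rewrite ?lerDl ?lerDr ?mnorm_ge0 //.
have mD i : 3 * E + 1 <= `|(intmx m *m D) 0 (lift ord_max i)| <= 5 * E + 1.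
  have := ma (lift ord_max i); rewrite [tau _ _]mxE liftK /= -/E ler_norml => /andP[h1 h2].
  by rewrite ger0_norm; [apply/andP; split | ]; lra.
have mT0 : m^T != 0.
  apply/eqP => h; have m0 : m = 0 by rewrite -[m]trmxK h trmx0.
  by have := mD 0; rewrite m0 intmx0 mul0mx mxE normr0 => /andP[+ _]; lra.
have [k [z [k0 mE zp]]] := primitive_part mT0.
have [g gu gz] := unimodular_completion zp.
have kR0 : 0 < `|k%:~R| :> R by rewrite normr_gt0 intr_eq0.
pose b : 'rV[R]_n := intmx z^T *m D.
have bE i : `|b 0 i| = `|(intmx m *m D) 0 i| / `|k%:~R|.
  have -> : intmx m *m D = k%:~R *: b.
    rewrite /b scalemxAl; congr (_ *m _); apply/rowP => j.
    by have := congr1 (fun u : 'cV_ _ => u j 0) mE; rewrite !mxE => ->; rewrite intrM.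
  by rewrite [in RHS]mxE normrM mulrC mulKf // gt_eqF.
have bb i : (5 * E + 1) / `|k%:~R| / 2 <= `|b 0 (lift ord_max i)| <= (5 * E + 1) / `|k%:~R|.
  have /andP[h1 h2] := mD i; rewrite bE mulrAC !ler_pM2r ?invr_gt0 // h2 andbT.
  by apply: le_trans h1; lra.
have b00 : b 0 (lift ord_max 0) != 0.
  rewrite -normr_gt0; have /andP[h _] := bb 0; apply: lt_le_trans h.
  by rewrite !divr_gt0 //; lra.
pose x : 'cV[R]_e.+1 := \col_i if i == 0 then b 0 ord_max / b 0 (lift ord_max 0) else 0.
pose G := intmx g^T *m D *m ux (- x).
have r0 : row 0 (intmx g^T *m D) = b.
  rewrite row_mul; congr (_ *m _); apply/rowP => j; rewrite !mxE; congr (_%:~R).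
  by have := congr1 (fun u : 'cV_ _ => u j 0) gz; rewrite mxE.
have r0E j : (intmx g^T *m D) 0 j = b 0 j by rewrite -r0 [RHS]mxE.
have gTu : g^T \in unitmx by rewrite unitmx_tr.
have G1 : `|\det G| = 1.
  by rewrite /G det_mulmx det_ux mulr1 det_mulmx normrM D1 mulr1; have [] := unit_intmx R gTu.
have [delta d0 dP] := dual_ge_unit (unit_of_det1 G1).
exists x, g^T, ((5 * E + 1) / `|k%:~R|), delta; split=> //.
  by rewrite divr_gt0 //; lra.
split=> //.
  rewrite ux_mul_max r0E (bigD1 0) //= r0E big1 ?addr0.
    by rewrite [(- x) 0 0]mxE [x 0 0]mxE eqxx mulrN mulrC divfK // subrr.
  by move=> i i0; rewrite [(- x) i 0]mxE [x i 0]mxE (negbTE i0) oppr0 mulr0.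
by move=> i; rewrite ux_mul_lift r0E.
Qed.

End Schedule.

Lemma floor_eq_lt (R : realType) (a b h : R) : 0 < h -> Num.floor (a / h) = Num.floor (b / h) -> `|a - b| < h.
Proof.
move=> h0 ab; have /andP[a1 a2] := floor_itv (a / h); have /andP[b1 b2] := floor_itv (b / h).
rewrite ab in a1 a2; move: a1 a2 b1 b2; rewrite intrD.
rewrite !ler_pdivlMr // !ltr_pdivrMr // => a1 a2 b1 b2.
by rewrite ltr_norml; apply/andP; split; lra.
Qed.

Lemma num_hit (R : realType) (r u u' u'' s s' Y : R) : 1 <= Y -> 2 * s' <= s -> u <= u' + u'' ->
  u' <= r + 2 * Y * s' -> u'' <= s * Y -> u <= r + 2 * Y * s.
Proof. nra. Qed.

(** * A tree of divergent points *)

Section Tree.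
Variables (R : realType) (e : nat) (w : 'I_e.+1 -> R).
Hypothesis e0 : (0 < e)%N.
Hypothesis w_gt0 : forall i, 0 < w i.
Hypothesis w_sum1 : \sum_i w i = 1.
Hypothesis w_noninc : forall i j : 'I_e.+1, (i <= j)%N -> w j <= w i.

Local Notation n := e.+2.
Local Notation lam := (wlam w).
Local Notation state := (@state R e).
Definition reach : R := 4 * e.+1%:R.
Local Notation X := reach.
Local Notation A := (2 * X).

Lemma reach_ge1 : 1 <= X. Proof. by rewrite /X -natrM ler1n. Qed.

Variables (eta Tlow B : R) (D : 'M[R]_n) (p0 : 'cV[R]_e.+1) (c0 : 'M[int]_n).
Variables (eps delta T : nat -> R).
Hypothesis eps_gt0 : forall l, 0 < eps l.
Hypothesis T_ge : forall l, Tlow <= T l.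
Hypothesis Tlow1 : 1 <= Tlow.
Hypothesis br : forall l, branches w eta A (T l) (eps l) (eps l.+1) (delta l) (delta l.+1).
Hypothesis c0u : c0 \in unitmx.
Hypothesis start : state (eps 0%N) (delta 0%N) (intmx c0 *m D *m ux (- p0)).

Definition time l := \sum_(i < l) T i.
Local Notation tt := time.
Definition rho l (i : 'I_e.+1) := expR (- ((1 + w i) * tt l)).

Lemma timeS l : tt l.+1 = tt l + T l. Proof. by rewrite /time big_ord_recr. Qed.
Lemma time0 : tt 0 = 0. Proof. by rewrite /time big_ord0. Qed.
Lemma T_ge1 l : 1 <= T l. Proof. exact: le_trans (T_ge l). Qed.
Lemma T_gt0 l : 0 < T l. Proof. exact: lt_le_trans (T_ge1 l). Qed.

Lemma time_ge0 l : 0 <= tt l.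
Proof. by apply: sumr_ge0 => i _; exact: ltW (T_gt0 i). Qed.

Definition child_seq l (G : 'M[R]_n) : seq 'cV[R]_e.+1 :=
  xget [::] [set xs : seq 'cV[R]_e.+1 | [/\ uniq xs, expR ((e.+1%:R - eta) * T l) <= (size xs)%:R,
    forall x x', x \in xs -> x' \in xs -> x != x' -> sep_at w A (T l) x x' &
    forall x, x \in xs -> child w (eps l) (eps l.+1) (delta l.+1) (T l) G x]].

(** Truncating to a common number of children makes the counting of nodes a uniform measure on the
    tree. *)
Definition deg l : nat := Num.trunc (expR ((e.+1%:R - eta) * T l)).
Definition kid_seq l G := take (deg l) (child_seq l G).

Definition move_mx l (G : 'M[R]_n) (x : 'cV[R]_e.+1) : 'M[int]_n :=
  xget 1%:M [set c : 'M[int]_n | c \in unitmx /\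
    state (eps l.+1) (delta l.+1) (intmx c *m G *m dflow w x (T l))].

Definition place l (p : 'cV[R]_e.+1 * 'M[R]_n) x := p.1 + stretch lam (- tt l) x.
(* A node of level [l] is a point of the column space with the dual basis reached
   there at time [time l]. *)
Definition kids l (p : 'cV[R]_e.+1 * 'M[R]_n) :=
  [seq (place l p x, intmx (move_mx l p.2 x) *m p.2 *m dflow w x (T l)) | x <- kid_seq l p.2].

Fixpoint nodes l : seq ('cV[R]_e.+1 * 'M[R]_n) :=
  if l is l'.+1 then flatten [seq kids l' p | p <- nodes l'] else [:: (p0, intmx c0 *m D *m ux (- p0))].

Lemma kid_seqP l G : state (eps l) (delta l) G -> [/\ uniq (kid_seq l G), size (kid_seq l G) = deg l,
    forall x x', x \in kid_seq l G -> x' \in kid_seq l G -> x != x' -> sep_at w A (T l) x x' &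
    forall x, x \in kid_seq l G -> child w (eps l) (eps l.+1) (delta l.+1) (T l) G x].
Proof.
move=> GS; have [xs xsP] := br GS.
have [u sz sp ch] : [/\ uniq (child_seq l G), expR ((e.+1%:R - eta) * T l) <= (size (child_seq l G))%:R,
    forall x x', x \in child_seq l G -> x' \in child_seq l G -> x != x' -> sep_at w A (T l) x x' &
    forall x, x \in child_seq l G -> child w (eps l) (eps l.+1) (delta l.+1) (T l) G x].
  by rewrite /child_seq; case: xgetP => [xs' _|/(_ xs)]; [apply | case].
split.
- exact: take_uniq.
- rewrite size_take_min; apply/minn_idPl; rewrite -(ler_nat R); apply: le_trans sz.
  by rewrite truncn_le expR_ge0.
- by move=> x x' /mem_take xs1 /mem_take xs2; exact: sp.
by move=> x /mem_take; exact: ch.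
Qed.

Lemma move_mxP l G x : child w (eps l) (eps l.+1) (delta l.+1) (T l) G x ->
  move_mx l G x \in unitmx /\ state (eps l.+1) (delta l.+1) (intmx (move_mx l G x) *m G *m dflow w x (T l)).
Proof. by move=> [_ _ [c cu cS]]; rewrite /move_mx; case: xgetP => [c' _|/(_ c)]; [apply | case]. Qed.

Lemma dflow_dflow (p x : 'cV[R]_e.+1) t t' :
  dflow w p t *m dflow w x t' = dflow w (p + stretch lam (- t) x) (t + t').
Proof.
rewrite /dflow !mulmxA -[ux (- p) *m _ *m ux (- x)]mulmxA dmx_ux !mulmxA -uxD.
rewrite -[_ *m dmx lam (- t) *m _]mulmxA -dmxD -opprD; congr (ux _ *m _).
rewrite opprD; congr (_ + _); by apply/matrixP => i j; rewrite !mxE mulrN.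
Qed.

Definition node_inv l (p : 'cV[R]_e.+1 * 'M[R]_n) := state (eps l) (delta l) p.2 /\
  exists2 c : 'M[int]_n, c \in unitmx & p.2 = intmx c *m D *m dflow w p.1 (tt l).

Lemma kids_inv l p x : node_inv l p -> x \in kid_seq l p.2 ->
  node_inv l.+1 (place l p x, intmx (move_mx l p.2 x) *m p.2 *m dflow w x (T l)).
Proof.
move=> [pS [c cu pE]] xk; have [_ _ _ /(_ x xk) xc] := kid_seqP pS.
have [mu mS] := move_mxP xc; split=> //=.
exists (move_mx l p.2 x *m c); first by rewrite unitmx_mul mu.
by rewrite /place timeS -dflow_dflow map_mxM pE !mulmxA.
Qed.

Lemma nodes_inv l p : p \in nodes l -> node_inv l p.
Proof.
elim: l p => [|l IH] p.
  rewrite inE => /eqP ->; split=> //; exists c0 => //=.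
  by rewrite time0 /dflow oppr0 dmx0 mulmx1.
move=> /flattenP[_ /mapP[q qn ->] /mapP[x xk ->]]; apply: kids_inv => //; exact: IH.
Qed.

Lemma size_nodes l : size (nodes l) = (\prod_(k < l) deg k)%N.
Proof.
elim: l => [|l IH]; first by rewrite big_ord0.
rewrite big_ord_recr /= -IH size_flatten /shape -map_comp.
have /eq_in_map -> : {in nodes l, size \o kids l =1 fun=> deg l}.
  by move=> p /nodes_inv[pS _] /=; rewrite size_map; have [] := kid_seqP pS.
by rewrite sumnE big_map big_const_seq count_predT iter_addn_0 mulnC.
Qed.

Lemma place_E l p x i : place l p x i 0 = p.1 i 0 + rho l i * x i 0.
Proof.
rewrite /place [LHS]mxE; congr (_ + _); rewrite mxE wlam_lift wlam_max; congr (expR _ * _); ring.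
Qed.

Lemma rho_gt0 l i : 0 < rho l i. Proof. exact: expR_gt0. Qed.

Lemma rhoS l i : rho l.+1 i = rho l i * expR (- ((1 + w i) * T l)).
Proof. by rewrite /rho timeS -expRD; congr expR; ring. Qed.

Lemma rho_half l i : 2 * rho l.+1 i <= rho l i.
Proof.
rewrite rhoS mulrCA ler_piMr ?expR_ge0 // expRN ler_pdivrMr ?expR_gt0 // mul1r.
apply: le_trans (expR_ge1Dx _); have := T_ge1 l; have := w_gt0 i; move: (T l) (w i) => t a; nra.
Qed.

Lemma rho_anti l i : rho l.+1 i <= rho l i.
Proof. by have := rho_half l i; have := rho_gt0 l.+1 i; lra. Qed.

Section Hits.
Variables (r : R) (a : 'cV[R]_e.+1).
Hypothesis r0 : 0 < r.

(** Radius [2 * X * rho] encloses all descendants, since a child moves by at most [X * rho] and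
    [rho] at least halves; so a node can be hit only if its parent is. *)
Definition hit l (p : 'cV[R]_e.+1 * 'M[R]_n) := [forall i, `|p.1 i 0 - a i 0| <= r + 2 * X * rho l i].

Lemma hit_parent l p x G : node_inv l p -> x \in kid_seq l p.2 -> hit l.+1 (place l p x, G) -> hit l p.
Proof.
move=> [pS _] xk /forallP h; apply/forallP => i; have := h i; rewrite /= place_E.
have [_ _ _ /(_ x xk)[/(_ i) xX _ _]] := kid_seqP pS.
have x1 : `|rho l i * x i 0| <= rho l i * X by rewrite normrM (gtr0_norm (rho_gt0 _ _)) ler_wpM2l // ltW // rho_gt0.
have := rho_half l i; have X1 := reach_ge1; have := ler_normB (p.1 i 0 + rho l i * x i 0 - a i 0) (rho l i * x i 0).
have -> : p.1 i 0 + rho l i * x i 0 - a i 0 - rho l i * x i 0 = p.1 i 0 - a i 0 by ring.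
by move=> h1 h2 h3; exact: num_hit X1 h2 h1 h3 x1.
Qed.

(** Scale in direction [i] of the part of a cell inside the ball; ratios of these scales count the
    hit children. *)
Definition psi l i := Num.min r (rho l i).

Lemma psi_gt0 l i : 0 < psi l i. Proof. by rewrite lt_min r0 rho_gt0. Qed.

Lemma psi_anti l i : psi l.+1 i <= psi l i.
Proof. by rewrite le_min !ge_min lexx rho_anti orbT. Qed.

(** The constant lost per axis and level. Steps of length at least [Tlow] make it negligible, by the
    later hypothesis [Tlow_big]. *)
Definition branching : R := 4 * e.+1%:R + 6.
Local Notation C := branching.

Let hh l i := A * expR (- ((1 + w i) * T l)).
(** Window for the children in rescaled coordinates: if the cell is smaller than the ball, all
    children, within [X] of 0; otherwise those that the ball allows. *)
Let cc l (p : 'cV[R]_e.+1 * 'M[R]_n) i := if rho l i <= r then 0 else (a i 0 - p.1 i 0) / rho l i.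
Let rr l i := if rho l i <= r then X else (r + 2 * X * rho l.+1 i) / rho l i.

Let hh_gt0 l i : 0 < hh l i.
Proof. by rewrite !mulr_gt0 ?expR_gt0. Qed.

Let rr_ge0 l i : 0 <= rr l i.
Proof.
rewrite /rr; case: ifP => _; first by rewrite (le_trans _ reach_ge1).
by rewrite divr_ge0 ?(ltW (rho_gt0 _ _)) // addr_ge0 ?(ltW r0) // !mulr_ge0 // ltW // rho_gt0.
Qed.

Let slots_le l i : 2 * rr l i / hh l i + 2 <= C * (psi l i / psi l.+1 i).
Proof.
have X1 := reach_ge1; have X0 := lt_le_trans ltr01 X1.
have s0 : 0 < expR (- ((1 + w i) * T l)) by exact: expR_gt0.
have C5 : 5 <= C by rewrite /branching; have : 0 <= e.+1%:R :> R by []; lra.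
have p1 : 1 <= psi l i / psi l.+1 i by rewrite ler_pdivlMr ?psi_gt0 // mul1r psi_anti.
apply: le_trans (_ : 5 * (psi l i / psi l.+1 i) <= _); last by rewrite ler_wpM2r // (le_trans ler01).
rewrite /rr /hh; case: ifPn => h.
  have -> : psi l i = rho l i by rewrite /psi min_r.
  have -> : psi l.+1 i = rho l.+1 i by rewrite /psi min_r // (le_trans (rho_anti _ _)).
  have -> : rho l i / rho l.+1 i = (expR (- ((1 + w i) * T l)))^-1.
    by rewrite rhoS; field; rewrite !gt_eqF // rho_gt0.
  have -> : 2 * X / (2 * X * expR (- ((1 + w i) * T l))) = (expR (- ((1 + w i) * T l)))^-1.
    by field; rewrite !gt_eqF.
  have : 1 <= (expR (- ((1 + w i) * T l)))^-1.
    by rewrite invf_ge1 // -[leRHS]expR0 ler_expR oppr_le0 mulr_ge0 ?(ltW (T_gt0 _)) // addr_ge0 // ltW.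
  by lra.
rewrite -ltNge in h; have pE : psi l i = r by rewrite /psi min_l // ltW.
rewrite pE in p1 *.
have s' := rho_gt0 l.+1 i.
have -> : 2 * ((r + 2 * X * rho l.+1 i) / rho l i) / (2 * X * expR (- ((1 + w i) * T l))) = r / (X * rho l.+1 i) + 2.
  by rewrite rhoS; field; rewrite !gt_eqF // rho_gt0.
have : r / (X * rho l.+1 i) <= r / psi l.+1 i.
  rewrite ler_wpM2l ?(ltW r0) // lef_pV2 ?posrE ?mulr_gt0 ?psi_gt0 //.
  by rewrite ge_min ler_peMl ?orbT // ltW.
by lra.
Qed.

Let hit_window l p x G i : node_inv l p -> x \in kid_seq l p.2 -> hit l.+1 (place l p x, G) ->
  `|x i 0 - cc l p i| <= rr l i.
Proof.
move=> [pS _] xk /forallP/(_ i); rewrite /cc /rr; case: ifP => _; rewrite /= place_E => h.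
  by have [_ _ _ /(_ x xk)[/(_ i) + _ _]] := kid_seqP pS; rewrite subr0.
have s0 := rho_gt0 l i.
have -> : x i 0 - (a i 0 - p.1 i 0) / rho l i = (p.1 i 0 + rho l i * x i 0 - a i 0) / rho l i.
  by field; rewrite gt_eqF.
by rewrite normrM normfV (gtr0_norm s0) ler_wpM2r // invr_ge0 ltW.
Qed.

Definition hit_kids l p := [seq x <- kid_seq l p.2 | hit l.+1 (place l p x, intmx (move_mx l p.2 x) *m p.2 *m dflow w x (T l))].

Let same_close l p x x' : node_inv l p -> x \in kid_seq l p.2 -> x' \in kid_seq l p.2 ->
  (forall i, `|x i 0 - x' i 0| < hh l i) -> x = x'.
Proof.
move=> [pS _] xk x'k cl; apply/eqP; apply: contrapT => /negP xx.
have [_ _ /(_ x x' xk x'k xx)[i] + _] := kid_seqP pS.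
by rewrite leNgt => /negP; apply; exact: cl.
Qed.

Lemma hit_kids_fine l p : node_inv l p ->
  (size (hit_kids l p))%:R <= \prod_i (C * (psi l i / psi l.+1 i)).
Proof.
move=> pI; have [pS _] := pI; have [u _ _ _] := kid_seqP pS.
apply: le_trans (@floor_count _ _ _ (hit_kids l p) (fun x i => x i 0) (hh l) (cc l p) (rr l) _ _ _ _ _) _ => //.
- exact: filter_uniq.
- by move=> x; rewrite mem_filter => /andP[xh xk] i; exact: hit_window xh.
- by move=> x x'; rewrite !mem_filter => /andP[_ xk] /andP[_ x'k] fl; apply: same_close pI xk x'k _ => i; exact: floor_eq_lt (fl i).
apply: ler_prod => i _; rewrite slots_le andbT addr_ge0 // divr_ge0 ?(ltW (hh_gt0 _ _)) // mulr_ge0 //.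
Qed.

(** All children satisfy |b . x| <= eps e^(-T) with the |b_i| comparable to eps. In direction 0 this
    leaves an interval of length O(e^(-T)), so about e^(w_0 T) cells instead of the e^((1 + w_0) T)
    of a full side. *)
Lemma hit_kids_slab l p : node_inv l p ->
  (size (hit_kids l p))%:R <= C * expR (w 0 * T l) * \prod_(i | i != 0) (C * (psi l i / psi l.+1 i)).
Proof.
move=> pI; have [pS _] := pI; have [u _ _ chP] := kid_seqP pS.
have [_ _ Gb _] := pS; set G := p.2 in Gb chP.
have b0 : G 0 (lift ord_max 0) != 0 by exact: (state_neq0 (eps_gt0 l) pS).
have bratio i : `|G 0 (lift ord_max i) / G 0 (lift ord_max 0)| <= 2.
  have /andP[_ h1] := Gb i; have /andP[h2 _] := Gb 0.
  rewrite normrM normfV ler_pdivrMr ?normr_gt0 //; apply: le_trans h1 _.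
  by rewrite mulrC -ler_pdivrMr.
(* Coordinate 0 becomes b . x / b_0 with the other coordinates rounded to the mesh. When the other
   labels agree the added sums agree, so equal labels still force x_0 and x'_0 to be close. *)
pose y (x : 'cV[R]_e.+1) (i : 'I_e.+1) := if i == 0 then x 0 0 + \sum_(j | j != 0)
   G 0 (lift ord_max j) / G 0 (lift ord_max 0) * (hh l j * (Num.floor (x j 0 / hh l j))%:~R) else x i 0.
pose c' i := if i == 0 then 0 else cc l p i.
pose r' i := if i == 0 then (2 + 2 * e.+1%:R * A) * expR (- T l) else rr l i.
have X1 := reach_ge1; have X0 := lt_le_trans ltr01 X1.
have E0 := expR_gt0 (- T l).
have hle i : hh l i <= A * expR (- T l).
  rewrite /hh ler_wpM2l ?mulr_ge0 ?(ltW X0) // ler_expR lerN2 ler_peMl ?(ltW (T_gt0 _)) //.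
  by rewrite lerDl ltW.
apply: le_trans (@floor_count _ _ _ (hit_kids l p) y (hh l) c' r' _ _ _ _ _) _ => //.
- exact: filter_uniq.
- move=> i; rewrite /r'; case: ifP => _ //; rewrite mulr_ge0 ?(ltW E0) // addr_ge0 // !mulr_ge0 // ltW //.
- move=> x; rewrite mem_filter => /andP[xh xk] i; rewrite /y /c' /r'; case: ifPn => [_|i0]; last exact: hit_window xh.
  have [_ xslab _] := chP x xk.
  rewrite subr0; have -> : x 0 0 + \sum_(j | j != 0) G 0 (lift ord_max j) / G 0 (lift ord_max 0) * (hh l j * (Num.floor (x j 0 / hh l j))%:~R) =
     (\sum_j G 0 (lift ord_max j) * x j 0) / G 0 (lift ord_max 0) -
     \sum_(j | j != 0) G 0 (lift ord_max j) / G 0 (lift ord_max 0) * (x j 0 - hh l j * (Num.floor (x j 0 / hh l j))%:~R).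
    rewrite [\sum_j G 0 (lift ord_max j) * x j 0](bigD1 0) //= mulrDl [G 0 _ * x 0 0]mulrC mulfK // -addrA; congr (_ + _).
    rewrite mulr_suml -sumrB; apply: eq_bigr => j _; ring.
  apply: le_trans (ler_normB _ _) _; rewrite [(2 + _) * _]mulrDl; apply: lerD.
    rewrite normrM normfV ler_pdivrMr ?normr_gt0 //; apply: le_trans xslab _.
    have /andP[h2 _] := Gb 0; rewrite mulrAC ler_wpM2r ?(ltW E0) //; by lra.
  apply: le_trans (ler_norm_sum _ _ _) _.
  apply: le_trans (_ : \sum_(j < e.+1) 2 * (A * expR (- T l)) <= _).
    rewrite [leRHS](bigID (fun j => j != 0)) /= ler_wpDr //.
      by apply: sumr_ge0 => j _; rewrite !mulr_ge0 ?(ltW E0) ?(ltW X0).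
    apply: ler_sum => j _; rewrite normrM ler_pM //; apply: le_trans (hle j).
    have /andP[f1 f2] := floor_itv (x j 0 / hh l j); have hj := hh_gt0 l j.
    rewrite ler_pdivlMr // in f1; rewrite ltr_pdivrMr // intrD in f2.
    by rewrite ler_norml; apply/andP; split; lra.
  by rewrite sumr_const card_ord -[leLHS]mulr_natl le_eqVlt; apply/orP; left; apply/eqP; ring.
- move=> x x'; rewrite !mem_filter => /andP[_ xk] /andP[_ x'k] fl; apply: same_close pI xk x'k _ => i.
  have [->|i0] := eqVneq i 0; last first.
    by have := fl i; rewrite /y (negbTE i0); exact: floor_eq_lt.
  have := floor_eq_lt (hh_gt0 l 0) (fl 0); rewrite /y eqxx.
  have -> : \sum_(j | j != 0) G 0 (lift ord_max j) / G 0 (lift ord_max 0) * (hh l j * (Num.floor (x j 0 / hh l j))%:~R) =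
     \sum_(j | j != 0) G 0 (lift ord_max j) / G 0 (lift ord_max 0) * (hh l j * (Num.floor (x' j 0 / hh l j))%:~R).
    by apply: eq_bigr => j j0; have := fl j; rewrite /y (negbTE j0) => ->.
  by rewrite opprD addrACA subrr addr0.
rewrite (bigD1 0) //=; apply: ler_pM.
- by rewrite addr_ge0 // divr_ge0 ?(ltW (hh_gt0 _ _)) // mulr_ge0 // /r' eqxx mulr_ge0 ?(ltW E0) // addr_ge0 // !mulr_ge0 // ltW.
- apply: prodr_ge0 => i i0; rewrite addr_ge0 // divr_ge0 ?(ltW (hh_gt0 _ _)) // mulr_ge0 //.
  by rewrite /r' (negbTE i0).
- rewrite /r' eqxx /hh.
  have -> : 2 * ((2 + 2 * e.+1%:R * (2 * X)) * expR (- T l)) / (2 * X * expR (- ((1 + w 0) * T l))) =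
     (2 / X + 4 * e.+1%:R) * expR (w 0 * T l).
    have -> : expR (- T l) = expR (w 0 * T l) * expR (- ((1 + w 0) * T l)) by rewrite -expRD; congr expR; ring.
    by field; rewrite !gt_eqF ?expR_gt0.
  have : 2 / X <= 2 by rewrite ler_pdivrMr // ler_peMr.
  have : 1 <= expR (w 0 * T l) by rewrite -[leLHS]expR0 ler_expR mulr_ge0 ?(ltW (T_gt0 _)) // ltW.
  have : 0 <= e.+1%:R :> R by [].
  by rewrite /branching; move: (expR _) (2 / X) (e.+1%:R : R) => E q f; nra.
apply: ler_prod => i i0; rewrite /r' (negbTE i0) slots_le andbT.
by rewrite addr_ge0 // divr_ge0 ?(ltW (hh_gt0 _ _)) // mulr_ge0.
Qed.

Definition nhits l := count (hit l) (nodes l).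

Lemma nhits_step l (M : R) : 0 <= M -> (forall p, node_inv l p -> (size (hit_kids l p))%:R <= M) ->
  (nhits l.+1)%:R <= M * (nhits l)%:R.
Proof.
move=> M0 HM; rewrite /nhits [nodes l.+1]/= count_flatten -map_comp sumnE big_map natr_sum.
rewrite -sum1_count natr_sum mulr_sumr [leRHS]big_mkcond [leLHS]big_seq [leRHS]big_seq.
apply: ler_sum => p pn /=; have pI := nodes_inv pn.
have sE : count (hit l.+1) (kids l p) = size (hit_kids l p) by rewrite count_map size_filter.
rewrite sE; case: ifPn => hp; first by rewrite mulr1 HM.
rewrite (_ : hit_kids l p = [::]) //; apply/eqP; rewrite -size_eq0 size_filter -leqn0 leqNgt -has_count.
by apply/negP => /hasP[x xk xh]; case/negP: hp; exact: hit_parent pI xk xh.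
Qed.

Lemma nhits_deg l : (nhits l.+1 <= deg l * nhits l)%N.
Proof.
rewrite -(ler_nat R) natrM; apply: nhits_step => // p [pS _]; rewrite ler_nat.
by have [_ <- _ _] := kid_seqP pS; rewrite size_filter count_size.
Qed.

Let C0 : 0 < C. Proof. by rewrite /branching; have : 0 <= e.+1%:R :> R by []; lra. Qed.

Lemma nhits_fine l : (nhits l)%:R <= \prod_i (C ^+ l * (psi 0 i / psi l i)).
Proof.
elim: l => [|l IH].
  rewrite big1 => [|i _]; last by rewrite expr0 mul1r divff // gt_eqF ?psi_gt0.
  by rewrite /nhits /= addn0 lern1; case: (hit _ _).
have P0 : 0 <= \prod_i (C * (psi l i / psi l.+1 i)).
  by apply: prodr_ge0 => i _; rewrite mulr_ge0 ?(ltW C0) // divr_ge0 ?(ltW (psi_gt0 _ _)).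
apply: le_trans (nhits_step P0 (hit_kids_fine (l := l))) _.
apply: le_trans (ler_wpM2l P0 IH) _; rewrite -big_split /= le_eqVlt; apply/orP; left; apply/eqP.
by apply: eq_bigr => i _; rewrite exprS; field; rewrite !gt_eqF ?psi_gt0.
Qed.

Lemma nhits_slab k j : (nhits (k + j))%:R <=
  C ^+ (k + j) * (psi 0 0 / psi k 0) * expR (w 0 * (tt (k + j) - tt k)) *
  \prod_(i | i != 0) (C ^+ (k + j) * (psi 0 i / psi (k + j) i)).
Proof.
elim: j => [|j IH].
  rewrite addn0 subrr mulr0 expR0 mulr1; apply: le_trans (nhits_fine k) _.
  by rewrite (bigD1 0).
have P0 : 0 <= C * expR (w 0 * T (k + j)) * \prod_(i | i != 0) (C * (psi (k + j) i / psi (k + j).+1 i)).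
  rewrite !mulr_ge0 ?expR_ge0 ?(ltW C0) //.
  by apply: prodr_ge0 => i _; rewrite mulr_ge0 ?(ltW C0) // divr_ge0 ?(ltW (psi_gt0 _ _)).
rewrite addnS; apply: le_trans (nhits_step P0 (hit_kids_slab (l := k + j))) _.
apply: le_trans (ler_wpM2l P0 IH) _; rewrite le_eqVlt; apply/orP; left; apply/eqP.
rewrite timeS mulrACA [X in _ * X](_ : _ = \prod_(i | i != 0) (C ^+ (k + j).+1 * (psi 0 i / psi (k + j).+1 i))); last first.
  by rewrite -big_split /=; apply: eq_bigr => i _; rewrite exprS; field; rewrite !gt_eqF ?psi_gt0.
congr (_ * _); rewrite exprS.
have -> : expR (w 0 * (tt (k + j) + T (k + j) - tt k)) = expR (w 0 * T (k + j)) * expR (w 0 * (tt (k + j) - tt k)).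
  by rewrite -expRD; congr expR; ring.
ring.
Qed.

(** Down to level [k] the cells are longer than the ball in direction 0 and no branching is seen
    there; from [k] on the slab allows e^(w_0 (tt L - tt k)). In the other directions the ball is
    compared with the cells of level [L], all smaller than it. *)
Lemma hits_bound k L : (k <= L)%N -> r <= 1 -> r <= rho k 0 -> expR (- tt L) <= r ->
  (nhits L)%:R <= (C ^+ e.+1) ^+ L * r ^+ e * expR (e.+1%:R * tt L - w 0 * tt k).
Proof.
move=> kL r1 rk rL; rewrite -(subnKC kL); set j := (L - k)%N.
apply: le_trans (nhits_slab k j) _; rewrite /j subnKC //.
have q0 i : psi 0 i = r by rewrite /psi /rho time0 mulr0 oppr0 expR0 min_l.
have pk : psi k 0 = r by rewrite /psi min_l.
have pL i : psi L i = rho L i.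
  rewrite /psi min_r //; apply: le_trans rL; rewrite ler_expR lerN2 ler_peMl ?time_ge0 //.
  by rewrite lerDl ltW.
rewrite q0 pk divff ?gt_eqF // mulr1.
have -> : \prod_(i | i != 0) (C ^+ L * (psi 0 i / psi L i)) =
    (C ^+ L * r) ^+ e * expR ((e%:R + 1 - w 0) * tt L).
  have -> : (e%:R + 1 - w 0) * tt L = \sum_(i | i != 0) (1 + w i) * tt L.
    rewrite -mulr_suml; congr (_ * _); rewrite big_split /= sumr_const.
    have -> : #|[pred i : 'I_e.+1 | i != 0]| = e by rewrite (cardC1 (0 : 'I_e.+1)) card_ord.
    by rewrite -w_sum1 (bigD1 0) //=; ring.
  have -> : (C ^+ L * r) ^+ e = \prod_(i : 'I_e.+1 | i != 0) (C ^+ L * r).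
    by rewrite prodr_const; congr (_ ^+ _); rewrite (cardC1 (0 : 'I_e.+1)) card_ord.
  rewrite expR_sum -big_split /=; apply: eq_bigr => i _; rewrite q0 pL /rho expRN invrK; ring.
rewrite le_eqVlt; apply/orP; left; apply/eqP.
have -> : expR (e.+1%:R * tt L - w 0 * tt k) = expR (w 0 * (tt L - tt k)) * expR ((e%:R + 1 - w 0) * tt L).
  by rewrite -expRD; congr expR; rewrite -[e.+1%:R]natr1; ring.
rewrite exprMn -!exprM [(e.+1 * L)%N]mulnC mulnS exprD; ring.
Qed.

End Hits.

Lemma deg_ge l : expR ((e.+1%:R - eta) * T l) / 2 <= (deg l)%:R \/ eta >= e.+1%:R.
Proof.
have [h|h] := leP e.+1%:R eta; [by right | left].
have E1 : 1 <= expR ((e.+1%:R - eta) * T l).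
  by rewrite -[leLHS]expR0 ler_expR mulr_ge0 ?(ltW (T_gt0 _)) // subr_ge0 ltW.
have /andP[_] := truncn_itv (le_trans ler01 E1); rewrite -/(deg l) -natr1.
have : 1 <= (deg l)%:R :> R by rewrite ler1n truncn_gt0.
lra.
Qed.

End Tree.

Lemma num_ratio (R : realType) (ell q B eta wt t s e : R) : ell * q - B - eta * ell <= wt ->
  eta * t <= eta * (2 * ell + B) -> ell * s <= ell * (e + q - 5 * eta) ->
  eta * t + (- ell * e + ((e + 1) * t - wt)) <= 2 * eta * B + B + - ell * s + (e + 1 - eta) * t.
Proof. by move=> *; lra. Qed.

(** * Distribution of mass on the tree and its limit set *)

Section Content.
Variables (R : realType) (e : nat) (w : 'I_e.+1 -> R).
Hypothesis e0 : (0 < e)%N.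
Hypothesis w_gt0 : forall i, 0 < w i.
Hypothesis w_sum1 : \sum_i w i = 1.
Hypothesis w_noninc : forall i j : 'I_e.+1, (i <= j)%N -> w j <= w i.

Local Notation n := e.+2.
Local Notation state := (@state R e).
Local Notation X := (reach R e).
Local Notation A := (2 * X).

Variables (eta Tlow B : R) (D : 'M[R]_n) (p0 : 'cV[R]_e.+1) (c0 : 'M[int]_n).
Variables (eps delta T : nat -> R).
Hypothesis eps_gt0 : forall l, 0 < eps l.
Hypothesis T_ge : forall l, Tlow <= T l.
Hypothesis Tlow1 : 1 <= Tlow.
Hypothesis br : forall l, branches w eta A (T l) (eps l) (eps l.+1) (delta l) (delta l.+1).
Hypothesis c0u : c0 \in unitmx.
Hypothesis start : state (eps 0%N) (delta 0%N) (intmx c0 *m D *m ux (- p0)).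
Hypothesis T_le : forall l, T l <= B + eta * \sum_(i < l) T i.
Hypothesis eta01 : 0 < eta < 1.
Hypothesis B0 : 0 <= B.
Hypothesis Tlow_big : 2 * branching R e ^+ e.+1 <= expR (eta * Tlow).

Local Notation tt := (time T).
Local Notation rho := (rho w T).
Local Notation nodes := (nodes w eta D p0 c0 eps delta T).
Local Notation kids := (kids w eta eps delta T).
Local Notation nhits := (nhits w eta D p0 c0 eps delta T).
Local Notation deg := (deg e eta T).
Local Notation node := ('cV[R]_e.+1 * 'M[R]_n)%type.
Local Notation node_inv := (node_inv w D eps delta T).

Let eta0 : 0 < eta. Proof. by case/andP: eta01. Qed.
Let d1 : 1 <= e.+1%:R :> R. Proof. by rewrite ler1n. Qed.

Lemma time_ge l : l%:R <= tt l.
Proof.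
elim: l => [|l IH]; first by rewrite time0.
by rewrite timeS -natr1 lerD // (T_ge1 T_ge Tlow1).
Qed.

Lemma time_mono k l : (k <= l)%N -> tt k <= tt l.
Proof.
elim: l => [|l IH]; first by rewrite leqn0 => /eqP->.
rewrite leq_eqVlt => /orP[/eqP->//|kl]; rewrite timeS; apply: le_trans (IH kl) _.
by rewrite lerDl ltW // (T_gt0 T_ge Tlow1).
Qed.

Lemma time_between (x : R) l0 : tt l0 <= x -> exists2 l, (l0 <= l)%N & tt l <= x < tt l.+1.
Proof.
move=> xl0; have [N] : exists N, x < tt (l0 + N)%N.
  exists (Num.trunc `|x|).+1; apply: le_lt_trans (ler_norm x) _.
  apply: lt_le_trans (time_ge _); apply: lt_le_trans (_ : (Num.trunc `|x|).+1%:R <= _); last by rewrite ler_nat leq_addl.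
  by have /andP[] := truncn_itv (normr_ge0 x).
elim: N => [|N IH]; first by rewrite addn0 ltNge xl0.
rewrite addnS => h; have [/IH //|h'] := ltP x (tt (l0 + N)%N).
by exists (l0 + N)%N; rewrite ?leq_addr // h' h.
Qed.

Lemma deg_lower l : expR ((e.+1%:R - eta) * T l) / 2 <= (deg l)%:R.
Proof.
have [//|] := deg_ge e eta T_ge Tlow1 l.
by case/andP: eta01 => _ h1 h2; have := d1; lra.
Qed.

Lemma size_nodes_ge L : expR ((e.+1%:R - eta) * tt L) / 2 ^+ L <= (size (nodes L))%:R.
Proof.
rewrite (size_nodes br c0u start) natr_prod; elim: L => [|L IH].
  by rewrite time0 mulr0 expR0 expr0 divr1 big_ord0.
rewrite big_ord_recr /= timeS mulrDr expRD exprSr invfM mulrACA.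
apply: ler_pM; [| | exact: IH | exact: deg_lower]; by rewrite divr_ge0 ?expR_ge0 ?exprn_ge0.
Qed.

Lemma size_nodesS L : size (nodes L.+1) = (size (nodes L) * deg L)%N.
Proof. by rewrite (size_nodes br c0u start L.+1) (size_nodes br c0u start L) big_ord_recr. Qed.

Lemma size_nodes_gt0 L : (0 < size (nodes L))%N.
Proof.
by rewrite -(ltr_nat R); apply: lt_le_trans (size_nodes_ge L); rewrite divr_gt0 ?expR_gt0 ?exprn_gt0.
Qed.

Lemma time_Tlow L : L%:R * Tlow <= tt L.
Proof.
elim: L => [|L IH]; first by rewrite mul0r time0.
by rewrite timeS -natr1 mulrDl mul1r lerD.
Qed.

(** With r = e^(-ell), level [k] is where e^(-(1 + w_0) t) passes r, and [L'] where e^(-t) does.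
    Steps have length at most B + eta t, so these times are met up to that error. Of the five [eta],
    four come from two terms eta * tt with tt <= 2 ell + B, and one from the error at [k]. At later
    levels the ratio cannot grow, all nodes having equally many children. *)
Lemma nhits_ratio (s : R) : s <= e%:R + w 0 / (1 + w 0) - 5 * eta -> exists2 C, 0 < C &
  forall r a, 0 < r <= 1 -> exists L0, forall L, (L0 <= L)%N ->
    (nhits r a L)%:R <= C * r `^ s * (size (nodes L))%:R.
Proof.
move=> hs; exists (expR (2 * eta * B + B)) => [|r a /andP[r0 r1]]; first exact: expR_gt0.
pose ell := - ln r; have ell0 : 0 <= ell by rewrite oppr_ge0 ln_le0.
have rE : r = expR (- ell) by rewrite opprK lnK // posrE.
have w0 := w_gt0 0; have w01 := w_le1 w_gt0 w_sum1 0.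
have w10 : 0 < 1 + w 0 by rewrite addr_gt0.
have x0 : 0 <= ell / (1 + w 0) by rewrite divr_ge0 // ltW.
have xl : ell / (1 + w 0) <= ell by rewrite ler_pdivrMr // ler_peMr // lerDl ltW.
have [|k _ /andP[k1 k2]] := @time_between (ell / (1 + w 0)) 0; first by rewrite time0.
have [|L' _ /andP[L1 L2]] := @time_between ell 0; first by rewrite time0.
have kL : (k <= L'.+1)%N.
  rewrite leqNgt; apply/negP => /ltnW /time_mono h.
  by have := le_lt_trans (le_trans h (le_trans k1 xl)) L2; rewrite ltxx.
exists L'.+1 => L LL; rewrite -(subnKC LL); elim: (L - L'.+1)%N => [|j IH]; last first.
  rewrite addnS; apply: le_trans (_ : (deg (L'.+1 + j))%:R * (nhits r a (L'.+1 + j))%:R <= _).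
    by rewrite -natrM ler_nat; exact: (nhits_deg w_gt0 T_ge Tlow1 br c0u start).
  apply: le_trans (ler_wpM2l _ IH) _ => //.
  rewrite size_nodesS natrM le_eqVlt; apply/orP; left; apply/eqP; ring.
rewrite addn0.
have h1 : (nhits r a L'.+1)%:R <= (branching R e ^+ e.+1) ^+ L'.+1 * r ^+ e * expR (e.+1%:R * tt L'.+1 - w 0 * tt k).
  apply: (hits_bound w_gt0 w_sum1 eps_gt0 T_ge Tlow1 br c0u start) => //.
    by rewrite rE /rho ler_expR lerN2 mulrC -ler_pdivlMr.
  by rewrite rE ler_expR lerN2 ltW.
apply: le_trans h1 _.
apply: le_trans (_ : expR (2 * eta * B + B) * r `^ s * (expR ((e.+1%:R - eta) * tt L'.+1) / 2 ^+ L'.+1) <= _); last first.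
  by rewrite ler_wpM2l ?size_nodes_ge // mulr_ge0 ?expR_ge0 ?powR_ge0.
rewrite mulrA ler_pdivlMr ?exprn_gt0 //.
have bb : (2 * branching R e ^+ e.+1) ^+ L'.+1 <= expR (eta * tt L'.+1).
  apply: le_trans (_ : expR (eta * Tlow) ^+ L'.+1 <= _).
    by rewrite lerXn2r ?nnegrE ?expR_ge0 // mulr_ge0 // exprn_ge0 // /branching addr_ge0 // mulr_ge0.
  by rewrite -expRM_natl ler_expR mulrCA ler_wpM2l ?(ltW eta0) // time_Tlow.
have -> : (branching R e ^+ e.+1) ^+ L'.+1 * r ^+ e * expR (e.+1%:R * tt L'.+1 - w 0 * tt k) * 2 ^+ L'.+1 =
   (2 * branching R e ^+ e.+1) ^+ L'.+1 * (r ^+ e * expR (e.+1%:R * tt L'.+1 - w 0 * tt k)).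
  by rewrite [RHS]mulrC exprMn; ring.
apply: le_trans (ler_wpM2r _ bb) _; first by rewrite mulr_ge0 ?expR_ge0 // exprn_ge0 // ltW.
have -> : r ^+ e = expR (- ell * e%:R) by rewrite rE -expRM_natr.
have -> : r `^ s = expR (- ell * s) by rewrite rE expRM.
rewrite -!expRD ler_expR.
have t1 : tt L'.+1 <= 2 * ell + B.
  rewrite timeS; have := T_le L'; rewrite -/(tt L') => h.
  have : eta * tt L' <= tt L' by rewrite ler_piMl ?(time_ge0 T_ge Tlow1) // ltW //; case/andP: eta01.
  by lra.
have t2 : ell / (1 + w 0) - B - eta * ell <= tt k.
  move: k2; rewrite timeS; have := T_le k; rewrite -/(tt k) => h.
  have : eta * tt k <= eta * ell by rewrite ler_wpM2l ?(ltW eta0) // (le_trans k1).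
  by lra.
have t3 : w 0 * (ell / (1 + w 0)) - B - eta * ell <= w 0 * tt k.
  have h := ler_wpM2l (ltW w0) t2; apply: le_trans h.
  have : w 0 * (B + eta * ell) <= B + eta * ell.
    by rewrite ler_piMl // addr_ge0 // mulr_ge0 // ltW.
  by rewrite !mulrBr mulrDr; move: (w 0 * (_ / _)) (w 0 * B) (w 0 * (eta * ell)) (eta * ell) => b0 b1 b2 b3; lra.
have t4 : eta * tt L'.+1 <= eta * (2 * ell + B) by rewrite ler_wpM2l // ltW.
have t5 := ler_wpM2l ell0 hs.
move: t3 t4 t5; rewrite -[e.+1%:R]natr1.
have -> : w 0 * (ell / (1 + w 0)) = ell * (w 0 / (1 + w 0)) by ring.
move: (tt L'.+1) (tt k) (w 0 / (1 + w 0)) => t t' q.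
exact: num_ratio.
Qed.

Definition inbox l (p : node) (x : 'cV[R]_e.+1) := forall i, `|x i 0 - p.1 i 0| <= 2 * X * rho l i.

Lemma kid_center l p q i : node_inv l p -> q \in kids l p -> `|q.1 i 0 - p.1 i 0| <= X * rho l i.
Proof.
move=> [pS _] /mapP[x xk ->]; rewrite /= place_E addrAC subrr add0r normrM (gtr0_norm (rho_gt0 _ _ _ _)).
have [_ _ _ /(_ x xk)[/(_ i) xX _ _]] := kid_seqP br pS.
by rewrite mulrC ler_wpM2r // ltW // rho_gt0.
Qed.

Lemma inbox_kid l p q x : node_inv l p -> q \in kids l p -> inbox l.+1 q x -> inbox l p x.
Proof.
move=> pI qk h i; have := h i; have := kid_center i pI qk; have := rho_half w_gt0 T_ge Tlow1 l i.
have := ler_normD (x i 0 - q.1 i 0) (q.1 i 0 - p.1 i 0).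
have -> : x i 0 - q.1 i 0 + (q.1 i 0 - p.1 i 0) = x i 0 - p.1 i 0 by ring.
have := reach_ge1 R e; move: `|_| `|_| `|_| (rho l i) (rho l.+1 i) (X) => a b c s s' Y; nra.
Qed.

Lemma kid_inv l p q : node_inv l p -> q \in kids l p -> node_inv l.+1 q.
Proof. by move=> pI /mapP[x xk ->]; exact: kids_inv. Qed.

Fixpoint below m l (p q : node) : Prop :=
  if m is m'.+1 then exists2 p', p' \in kids l p & below m' l.+1 p' q else p = q.

Lemma below_snoc m l p q q' : below m l p q -> q' \in kids (l + m) q -> below m.+1 l p q'.
Proof.
elim: m l p => [|m IH] l p; first by rewrite addn0 => /= -> h; exists q'.
by rewrite addnS -addSn => -[p' p'k h] qk; exists p' => //; exact: IH h qk.
Qed.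

Lemma below_split m k l p q : below (m + k) l p q -> exists2 q', below m l p q' & below k (l + m) q' q.
Proof.
elim: m l p => [|m IH] l p; first by rewrite addn0 => h; exists p.
by move=> -[p' p'k /IH[q' h1 h2]]; exists q'; [exists p' | rewrite addnS -addSn].
Qed.

Lemma below_inv m l p q : node_inv l p -> below m l p q -> node_inv (l + m) q.
Proof.
elim: m l p => [|m IH] l p pI; first by rewrite addn0 => <-.
by move=> [p' p'k h]; rewrite addnS -addSn; apply: IH h; exact: kid_inv pI p'k.
Qed.

Lemma below_inbox m l p q x : node_inv l p -> below m l p q -> inbox (l + m) q x -> inbox l p x.
Proof.
elim: m l p => [|m IH] l p pI; first by rewrite addn0 => ->.
move=> [p' p'k h] xb; apply: (inbox_kid pI p'k); apply: IH h _; first exact: kid_inv pI p'k.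
by rewrite addSn -addnS.
Qed.

Lemma nodes_below l m q : q \in nodes (l + m) -> exists2 p, p \in nodes l & below m l p q.
Proof.
elim: m q => [|m IH] q; first by rewrite addn0 => h; exists q.
rewrite addnS => /flattenP[_ /mapP[q' q'n ->] qk]; have [p pn pq'] := IH _ q'n.
by exists p => //; exact: below_snoc pq' qk.
Qed.

Lemma rho_small r : 0 < r -> exists l0, forall l i, (l0 <= l)%N -> rho l i <= r.
Proof.
move=> r0; have [t0 t00 Ht0] := exp_decay ltr01 ler01 r0.
exists (Num.trunc t0).+1 => l i ll; apply: le_trans (Ht0 (tt l) _); last first.
  apply: le_trans (truncn_succ_ge t00) _; apply: le_trans (time_ge l); by rewrite ler_nat.
rewrite !mul1r ler_expR lerN2 ler_peMl ?(time_ge0 T_ge Tlow1) // lerDl ltW //.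
Qed.

(** Nested intervals in each coordinate: the boxes of radius [2 * X * rho] decrease along a
    branch. *)
Lemma branch_point (f : nat -> node) : (forall j, node_inv j (f j)) -> (forall j, f j.+1 \in kids j (f j)) ->
  exists x, forall j, inbox j (f j) x.
Proof.
move=> fI fk.
pose lo i j := (f j).1 i 0 - 2 * X * rho j i; pose up i j := (f j).1 i 0 + 2 * X * rho j i.
have step i j : lo i j <= lo i j.+1 /\ up i j.+1 <= up i j.
  have := kid_center i (fI j) (fk j); have := rho_half w_gt0 T_ge Tlow1 j i; have := reach_ge1 R e.
  rewrite ler_norml /lo /up => Y h /andP[h1 h2].
  by move: Y h h1 h2; move: ((f j).1 i 0) ((f j.+1).1 i 0) (rho j i) (rho j.+1 i) (X) => a b s s' Z *; split; nra.
have lo_mono i j k : lo i j <= lo i (j + k)%N.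
  by elim: k => [|k IH]; rewrite ?addn0 // addnS (le_trans IH) // (step _ _).1.
have up_mono i j k : up i (j + k)%N <= up i j.
  by elim: k => [|k IH]; rewrite ?addn0 // addnS (le_trans _ IH) // (step _ _).2.
have lu i j : lo i j <= up i j.
  by rewrite /lo /up lerD2l ge0_cp // !mulr_ge0 // ltW // rho_gt0.
have lu' i j k : lo i j <= up i k.
  apply: le_trans (lo_mono i j k) _; apply: le_trans (lu i _) _; rewrite addnC; exact: up_mono.
exists (\col_i sup [set lo i j | j in [set: nat]]) => j i; rewrite mxE.
have h1 : lo i j <= sup [set lo i j | j in [set: nat]].
  apply: ub_le_sup; last by exists j.
  by exists (up i 0%N) => _ [k _ <-].
have h2 : sup [set lo i j | j in [set: nat]] <= up i j.
  by apply: ge_sup; [exists (lo i 0%N), 0%N | move=> _ [k _ <-]].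
by move: h1 h2; rewrite /lo /up ler_norml => h1 h2; apply/andP; split; lra.
Qed.

(* A ball of radius [r] contains at most a proportion [C r^s] of the nodes of any
   late level, so a cover of the limit set has [s]-content bounded below. *)
Theorem tree_content (s : R) : 0 <= s -> s <= e%:R + w 0 / (1 + w 0) - 5 * eta -> exists2 c, 0 < c &
  forall (a : nat -> 'cV[R]_e.+1) (r : nat -> R), (forall k, 0 < r k <= 2^-1) ->
  (forall x, (forall l, exists2 p, p \in nodes l & inbox l p x) -> exists k, forall i, `|x i 0 - a k i 0| <= r k) ->
  exists m, c <= \sum_(k < m) r k `^ s.
Proof.
move=> s0 hs; have [C C0 HC] := nhits_ratio hs.
exists (C * 2 `^ s)^-1; first by rewrite invr_gt0 mulr_gt0 // powR_gt0.
move=> a r r01 cov.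
pose good l p := exists k, forall x, inbox l p x -> forall i, `|x i 0 - a k i 0| <= 2 * r k.
have good_below m l p q : node_inv l p -> below m l p q -> good l p -> good (l + m)%N q.
  by move=> pI pq [k kP]; exists k => x xq; apply: kP; exact: below_inbox pI pq xq.
(* Compactness by Koenig's argument: otherwise some infinite branch keeps bad descendants at all
   depths, but its limit point lies in one of the balls, which makes every late node of the branch
   good. *)
have [L LP] : exists L, forall p, p \in nodes L -> good L p.
  apply: contrapT => /forallNP none.
  pose persist l p := forall m, exists2 q, below m l p q & ~ good (l + m)%N q.
  have root_in : forall p, p \in nodes 0 -> persist 0%N p.
    move=> p; rewrite inE => /eqP pE m; have /existsNP[q /not_implyP[qn qg]] := none m.
    have [p' p'n p'q] := @nodes_below 0 m q qn; exists q => //.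
    by move: p'n; rewrite inE => /eqP p'E; rewrite pE -p'E.
  have step l p : node_inv l p -> persist l p -> exists q, q \in kids l p /\ persist l.+1 q.
    move=> pI pp; apply: contrapT => /forallNP no.
    have /choice[mf mfP] : forall q, exists m, q \in kids l p -> forall q', below m l.+1 q q' -> good (l.+1 + m)%N q'.
      move=> q; have [qk|qk] := boolP (q \in kids l p); last by exists 0%N.
      have /not_andP[//|/existsNP[m mP]] := no q; exists m => _ q' qq'.
      by apply: contrapT => ng; apply: mP; exists q'.
    pose M := (\sum_(q <- kids l p) mf q)%N.
    have [q [q1 q1k h] ng] := pp M.+1.
    have mM : (mf q1 <= M)%N by rewrite /M (big_rem q1) //= leq_addr.
    move: h; rewrite -(subnKC mM) => /below_split[q' h1 h2]; apply: ng.
    have := good_below _ _ _ _ (below_inv (kid_inv pI q1k) h1) h2 (mfP q1 q1k q' h1).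
    by rewrite -addnA subnKC // addSn -addnS.
  have /choice[nx nxP] : forall lp : nat * node, exists q, node_inv lp.1 lp.2 -> persist lp.1 lp.2 ->
      q \in kids lp.1 lp.2 /\ persist lp.1.+1 q.
    move=> [l p]; have [h|h] := pselect (node_inv l p /\ persist l p).
      by have [q qP] := step l p h.1 h.2; exists q.
    by exists p => h1 h2; case: h.
  pose f j := iter j (fun lp : nat * node => (lp.1.+1, nx lp)) (0%N, (p0, intmx c0 *m D *m ux (- p0))).
  have f1 j : (f j).1 = j by elim: j => //= j ->.
  have fP j : node_inv j (f j).2 /\ persist j (f j).2.
    elim: j => [|j [h1 h2]]; first by split; [apply: (nodes_inv br c0u start); exact: mem_head | apply: root_in; exact: mem_head].
    have := nxP (f j); rewrite f1 => /(_ h1 h2)[h3 h4]; split=> //; exact: kid_inv h1 h3.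
  have fk j : (f j.+1).2 \in kids j (f j).2.
    by have [h1 h2] := fP j; have := nxP (f j); rewrite f1 => /(_ h1 h2)[].
  have [x xP] := @branch_point (fun j => (f j).2) (fun j => (fP j).1) fk.
  have fn j : (f j).2 \in nodes j.
    elim: j => [|j IH]; first exact: mem_head.
    by apply/flattenP; exists (kids j (f j).2); [exact: map_f | exact: fk].
  have [l|k kP] := cov x; first by exists (f l).2.
  have X0 : 0 < X by rewrite (lt_le_trans ltr01) // reach_ge1.
  have /andP[rk0 _] := r01 k.
  have [l0 l0P] := rho_small (divr_gt0 rk0 (mulr_gt0 (ltr0Sn R 3) X0)).
  have [_ /(_ 0%N)[q <- ng]] := fP l0; apply: ng; rewrite addn0; exists k => y yb i.
  have := yb i; have := xP l0 i; have := kP i; have := l0P l0 i (leqnn _).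
  rewrite ler_pdivlMr ?mulr_gt0 // !ler_norml => h1 /andP[h2 h3] /andP[h4 h5] /andP[h6 h7].
  by apply/andP; split; lra.
have /choice[kf kfP] : forall p, exists k, p \in nodes L -> forall x, inbox L p x -> forall i, `|x i 0 - a k i 0| <= 2 * r k.
  move=> p; have [pn|pn] := boolP (p \in nodes L); last by exists 0%N.
  by have [k kP] := LP p pn; exists k.
pose m := (\sum_(p <- nodes L) kf p).+1.
have /choice[L0 L0P] : forall k, exists L0, forall L, (L0 <= L)%N ->
    (nhits (2 * r k) (a k) L)%:R <= C * (2 * r k) `^ s * (size (nodes L))%:R.
  by move=> k; apply: HC; have /andP[h1 h2] := r01 k; apply/andP; split; lra.
(* A level late enough for the proportion estimate of all the finitely many balls assigned to nodes
   of level [L]. *)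
pose L' := (L + \sum_(k < m) L0 k)%N.
have LL k : (k < m)%N -> (L0 k <= L')%N.
  by move=> km; rewrite /L' (bigD1 (Ordinal km)) //= addnCA leq_addr.
exists m; rewrite -[_^-1]mulr1 ler_pdivrMl ?mulr_gt0 ?powR_gt0 //.
have N0 : 0 < (size (nodes L'))%:R :> R by rewrite ltr0n size_nodes_gt0.
rewrite -(ler_pM2r N0) mul1r.
apply: le_trans (_ : (\sum_(k < m) nhits (2 * r k) (a k) L')%N%:R <= _).
  rewrite ler_nat -(count_predT (nodes L')) -sum1_count.
  under [X in (_ <= X)%N]eq_bigr do rewrite /nhits -sum1_count big_mkcond.
  rewrite exchange_big /= big_seq [leqRHS]big_seq; apply: leq_sum => q qn.
  have [p pn pq] := nodes_below qn.
  have km : (kf p < m)%N by rewrite ltnS (big_rem p) //= leq_addr.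
  rewrite (bigD1 (Ordinal km)) //= ifT ?leq_addr //.
  apply/forallP => i; have pI := nodes_inv br c0u start pn.
  apply: le_trans (_ : 2 * r (kf p) <= _); last first.
    by rewrite lerDl !mulr_ge0 ?(ltW (rho_gt0 _ _ _ _)) // (le_trans ler01) // reach_ge1.
  apply: (kfP p pn); apply: (below_inbox pI pq) => i'; rewrite subrr normr0 !mulr_ge0 ?(ltW (rho_gt0 _ _ _ _)) //.
rewrite natr_sum mulr_sumr mulr_suml; apply: ler_sum => k _.
have /andP[rk0 _] := r01 k; apply: le_trans (L0P k L' (LL _ (ltn_ord k))) _.
by rewrite powRM ?(ltW rk0) // mulrA.
Qed.

(** From time [tt l] to [tt l.+1] row 0 of the level-[l] basis is the short vector: its first
    coordinates shrink, and its last one is controlled by the slab condition at the child and by the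
    distance from [x] to the child, both of order e^(- T l). *)
Lemma tree_divergence x : (forall r, 0 < r -> exists l0, forall l, (l0 <= l)%N -> eps l <= r) ->
  (forall l, exists2 p, p \in nodes l & inbox l p x) ->
  forall r, 0 < r -> exists t0, forall t, t0 <= t -> exists2 z : 'rV[int]_n, z != 0 &
    mnorm (intmx z *m D *m dflow w x t) <= r.
Proof.
move=> eps_cvg xP r r0.
have K0 : 0 < 1 + 2 * X * e.+1%:R by rewrite addr_gt0 // !mulr_gt0.
have [l0 l0P] := eps_cvg _ (divr_gt0 r0 K0).
exists (tt l0) => t /time_between[l ll /andP[t1 t2]].
have [q qn qb] := xP l.+1; move: qn => /flattenP[_ /mapP[p pn ->] qk].
have [pS [c cu pE]] := nodes_inv br c0u start pn.
have [_ G0 Gb _] := pS.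
have z0 : row 0 c != 0.
  rewrite -(inj_eq (@trmx_inj _ _ _)) tr_row linear0; apply: unit_col_neq0; by rewrite unitmx_tr.
exists (row 0 c) => //.
move: qk => /mapP[x' x'k qE]; have [_ _ _ /(_ x' x'k)[_ slab _]] := kid_seqP br pS.
have epl : eps l * (1 + 2 * X * e.+1%:R) <= r by rewrite -ler_pdivlMr // l0P.
pose y := stretch (wlam w) (tt l) (x - p.1).
have xE : x = p.1 + stretch (wlam w) (- tt l) y by rewrite /y stretch_stretch addNr stretch0 addrC subrK.
have dE : intmx (row 0 c) *m D *m dflow w x t = row 0 p.2 *m dflow w y (t - tt l).
  have -> : dflow w x t = dflow w p.1 (tt l) *m dflow w y (t - tt l) by rewrite dflow_dflow -xE addrC subrK.
  have rc : row 0 (intmx c) = intmx (row 0 c) :> 'rV[R]_n by apply/rowP => j; rewrite !mxE.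
  by rewrite pE !row_mul rc !mulmxA.
have yx' i : `|y i 0 - x' i 0| <= 2 * X * expR (- ((1 + w i) * T l)).
  have := qb i; rewrite qE /= place_E {1}xE [(p.1 + _) i 0]mxE [stretch _ _ y i 0]mxE.
  have -> : expR ((wlam w (lift ord_max i) - wlam w ord_max) * - tt l) = rho l i.
    by rewrite wlam_lift wlam_max /rho; congr expR; ring.
  have -> : p.1 i 0 + rho l i * y i 0 - (p.1 i 0 + rho l i * x' i 0) = rho l i * (y i 0 - x' i 0) by ring.
  by rewrite normrM (gtr0_norm (rho_gt0 _ _ _ _)) rhoS mulrCA ler_pM2l // rho_gt0.
have t0 : 0 <= t - tt l by rewrite subr_ge0.
have tT : t - tt l <= T l by rewrite lerBlDl -timeS ltW.
rewrite dE; apply: mnorm_le => [|i j]; first exact: ltW.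
have el0 := eps_gt0 l.
rewrite (ord1 i); case: (unliftP ord_max j) => [j'|] ->.
  rewrite dflow_lift [row _ _ _ _]mxE normrM (gtr0_norm (expR_gt0 _)); apply: le_trans epl.
  have /andP[_ g2] := Gb j'; apply: ler_pM => //.
  apply: le_trans (_ : 1 <= _); last by rewrite lerDl !mulr_ge0 // (le_trans ler01) // reach_ge1.
  by rewrite -[leRHS]expR0 ler_expR oppr_le0 mulr_ge0 // ltW.
rewrite dflow_max [row _ _ _ _]mxE G0 sub0r normrM normrN (gtr0_norm (expR_gt0 _)).
apply: le_trans epl.
have -> : \sum_j row 0 p.2 0 (lift ord_max j) * y j 0 =
   \sum_j p.2 0 (lift ord_max j) * x' j 0 + \sum_j p.2 0 (lift ord_max j) * (y j 0 - x' j 0).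
  by rewrite -big_split; apply: eq_bigr => k _; rewrite [row _ _ _ _]mxE /=; ring.
apply: le_trans (_ : (eps l * expR (- T l) + \sum_(j < e.+1) eps l * (2 * X * expR (- T l))) * expR (T l) <= _).
  apply: ler_pM; rewrite ?expR_ge0 ?ler_expR //; apply: le_trans (ler_normD _ _) _; apply: lerD => //.
  apply: le_trans (ler_norm_sum _ _ _) _; apply: ler_sum => k _; rewrite normrM.
  have /andP[_ g2] := Gb k; apply: ler_pM => //; apply: le_trans (yx' k) _.
  have X0 : 0 <= 2 * X by rewrite mulr_ge0 // (le_trans ler01) // reach_ge1.
  by rewrite ler_wpM2l // ler_expR lerN2 ler_peMl ?lerDl ?(ltW (w_gt0 _)) // ltW // (T_gt0 T_ge Tlow1).
rewrite sumr_const card_ord -[_ *+ e.+1]mulr_natl le_eqVlt; apply/orP; left; apply/eqP.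
have E : expR (- T l) * expR (T l) = 1 by rewrite -expRD addNr expR0.
have -> : (eps l * expR (- T l) + e.+1%:R * (eps l * (2 * X * expR (- T l)))) * expR (T l) =
   eps l * (1 + 2 * X * e.+1%:R) * (expR (- T l) * expR (T l)) by ring.
by rewrite E mulr1.
Qed.

End Content.

Definition escapes (R : realType) d (w : 'I_d -> R) (g h : 'M[R]_d.+1) :=
  forall r, 0 < r -> \forall t \near +oo, has_short (dmx (wlam w) t *m h *m g) r.

Section SliceContent.
Variables (R : realType) (e : nat) (w : 'I_e.+1 -> R).
Hypothesis e0 : (0 < e)%N.
Hypothesis w_gt0 : forall i, 0 < w i.
Hypothesis w_sum1 : \sum_i w i = 1.
Hypothesis w_noninc : forall i j : 'I_e.+1, (i <= j)%N -> w j <= w i.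

(** The inverse of the flowed basis is the dual flow, and transference turns a dual vector of norm
    [r ^+ e.+1 / K] into a primal one of norm [r]. *)
Lemma dual_escapes (g : 'M[R]_e.+2) (x : 'cV[R]_e.+1) : `|\det g| = 1 ->
  (forall r, 0 < r -> exists t0, forall t, t0 <= t -> exists2 z : 'rV[int]_e.+2, z != 0 &
    mnorm (intmx z *m invmx g *m dflow w x t) <= r) -> escapes w g (ux x).
Proof.
move=> g1 dual r r0.
pose K : R := 2 ^+ (e.+2 * e.+2) * e.+2%:R.
have K0 : 0 < K by rewrite mulr_gt0 // exprn_gt0.
have [t0 t0P] := dual _ (divr_gt0 (exprn_gt0 e.+1 r0) K0).
exists t0; split=> [|t /ltW /t0P[z z0 zr]]; first exact: num_real.
have gu : g \in unitmx by rewrite unitmxE unitfE -normr_gt0 g1.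
set M := dmx _ _ *m _ *m _.
have M1 : `|\det M| = 1 by rewrite !det_mulmx (det_dmx w_sum1) det_ux !mul1r.
have Mu : M \in unitmx by rewrite unitmxE unitfE -normr_gt0 M1.
have ME : invmx M = invmx g *m dflow w x t.
  have E1 : dmx (wlam w) (- t) *m dmx (wlam w) t = 1%:M by rewrite -dmxD addNr dmx0.
  have E2 : ux (- x) *m ux x = 1%:M by rewrite -uxD addNr ux0.
  apply: (can_inj (mulmxK Mu)); rewrite mulVmx // /M /dflow -!mulmxA.
  by rewrite (mulmxA (dmx (wlam w) (- t))) E1 mul1mx (mulmxA (ux (- x))) E2 mul1mx mulVmx.
rewrite -mulmxA -ME in zr; have [y y0 yr] := dual_short_vector Mu z0 zr.
exists y => //; rewrite M1 mulr1 mulrA mulrCA divff ?gt_eqF // mulr1 in yr.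
by move: yr; rewrite ler_pXn2r ?nnegrE ?mnorm_ge0 ?(ltW r0).
Qed.

Lemma slice_content (g : 'M[R]_e.+2) (s : R) : `|\det g| = 1 -> 0 <= s -> s < e%:R + w 0 / (1 + w 0) ->
  exists2 c, 0 < c & forall (a : nat -> 'cV[R]_e.+1) (r : nat -> R), (forall k, 0 < r k <= 2^-1) ->
  (forall x, escapes w g (ux x) -> exists k, forall i, `|x i 0 - a k i 0| <= r k) ->
  exists m, c <= \sum_(k < m) r k `^ s.
Proof.
move=> g1 s0 hs; set lim := e%:R + _ in hs.
have D1 : `|\det (invmx g)| = 1 by rewrite det_inv normfV g1 invr1.
have [x0 [c0 [eps0 [delta0 [c0u eps00 delta00 start0]]]]] := initial_state D1.
(* A fifth of the gap, as [tree_content] loses [5 * eta]. *)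
pose eta := Num.min ((lim - s) / 5) 2^-1.
have eta0 : 0 < eta by rewrite lt_min divr_gt0 ?subr_gt0 //= invr_gt0.
have eta1 : 0 < eta < 1.
  by rewrite eta0 /= gt_min; apply/orP; right; rewrite invf_lt1 // ltr1n.
have heta : s <= lim - 5 * eta.
  have : eta <= (lim - s) / 5 by rewrite ge_min lexx.
  rewrite ler_pdivlMr // mulrC; lra.
pose Tlow := Num.max 1 (ln (2 * branching R e ^+ e.+1) / eta).
have Tlow1 : 1 <= Tlow by rewrite le_max lexx.
have C0 : 0 < branching R e by rewrite /branching addr_gt0 // mulr_gt0.
have Tbig : 2 * branching R e ^+ e.+1 <= expR (eta * Tlow).
  rewrite -[leLHS]lnK ?posrE ?mulr_gt0 ?exprn_gt0 // ler_expR -ler_pdivrMl // mulrC.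
  by rewrite le_max lexx orbT.
have A0 : 0 < 2 * reach R e by rewrite mulr_gt0 // (lt_le_trans ltr01) // reach_ge1.
have [eps [delta [T [B [eE dE ETB ecvg br]]]]] :=
  schedule e0 w_gt0 w_sum1 w_noninc eta0 A0 eps00 delta00 (lt_le_trans ltr01 Tlow1).
have eps_gt0 l : 0 < eps l by have [] := ETB l.
have T_ge l : Tlow <= T l by have [] := ETB l.
have T_le l : T l <= Num.max 0 B + eta * \sum_(i < l) T i.
  by have [_ _ h] := ETB l; apply: le_trans h _; rewrite lerD2r le_max lexx orbT.
have B0 : 0 <= Num.max 0 B by rewrite le_max lexx.
have start : state (eps 0%N) (delta 0%N) (intmx c0 *m invmx g *m ux (- x0)).
  by rewrite eE; apply: state_mono start0.
have [c c_gt0 cP] := tree_content w_gt0 w_sum1 eps_gt0 T_ge Tlow1 br c0u start T_le eta1 B0 Tbig s0 heta.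
exists c => // a r r01 cov; apply: cP => // x xlim; apply: cov.
by apply: dual_escapes => // r' r'0; exact: (tree_divergence w_gt0 eps_gt0 T_ge Tlow1 br c0u start ecvg xlim r'0).
Qed.

End SliceContent.

(** * Slicing and the lower bound *)

(** Tonelli: the sum of the [c k] over the sets containing u has finite integral over [D], a set of
    measure 1, so it is finite at some point. *)
Lemma summable_at (R : realType) dp (T : measurableType dp) (mu : {measure set T -> \bar R}) (D : set T)
    (I : nat -> set T) (c : nat -> R) (S : R) : measurable D -> mu D = 1%E -> (forall k, measurable (I k)) ->
  (forall k, 0 <= c k) -> (forall n, (\sum_(k < n) (c k)%:E * mu (I k) <= S%:E)%E) ->
  exists u S', forall n, \sum_(k < n) (if u \in I k then c k else 0) <= S'.
Proof.
move=> mD D1 mI c0 cS.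
pose f k (u : T) : \bar R := ((c k)%:E * (\1_(I k) u)%:E)%E.
have f0 k u : (0 <= f k u)%E by rewrite mule_ge0 // lee_fin ?c0.
have mind k : measurable_fun D (fun u : T => (\1_(I k) u : R)%:E).
  by apply/measurable_EFinP; apply: measurable_funTS; exact: measurable_indic.
have mf k : measurable_fun D (f k) by apply: measurable_funeM.
have intF : (\int[mu]_(u in D) (\sum_(k <oo) f k u) <= S%:E)%E.
  rewrite integral_nneseries //.
  apply: lime_le; first by apply: is_cvg_nneseries => k _ _; exact: integral_ge0.
  apply: nearW => n; apply: le_trans (cS n); rewrite big_mkord.
  apply: lee_sum => k _; rewrite ge0_integralZl_EFin // integral_indic //.
  rewrite lee_wpmul2l ?lee_fin //; by apply: le_measure; [apply/mem_set; exact: measurableI | exact: mem_set | exact: subIsetl].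
have [u uD uf] : exists2 u, D u & (\sum_(k <oo) f k u)%E != +oo%E.
  apply: contrapT => none.
  have : (\int[mu]_(u in D) (\sum_(k <oo) f k u) = +oo)%E.
    rewrite (eq_integral (cst +oo%E)) => [|u uD]; last first.
      by apply: contrapT => /eqP h; apply: none; exists u => //; exact: set_mem.
    by rewrite integral_cst // D1 mule1.
  by move=> h; rewrite h in intF; rewrite leNgt ltry in intF.
exists u, (fine (\sum_(k <oo) f k u)%E) => n.
have F0 : (0 <= \sum_(k <oo) f k u)%E by apply: nneseries_ge0 => k _ _; exact: f0.
rewrite -lee_fin fineK; last first.
  by move: F0 uf; case: (\sum_(k <oo) f k u)%E.
apply: le_trans (nneseries_lim_ge n _) => //.
rewrite -sumEFin big_mkord; apply: lee_sum => k _; rewrite /f indicE.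
by case: (u \in I k); rewrite ?mule1 ?mule0.
Qed.

Lemma itv_slice (R : realType) (c d a : nat -> R) (S : R) : (forall k, 0 <= c k) -> (forall k, 0 <= d k) ->
  (forall n, \sum_(k < n) c k * d k <= S) ->
  exists u S', forall n, \sum_(k < n) (if `|u - a k| <= d k then c k else 0) <= S'.
Proof.
move=> c0 d0 cS.
pose I k : set (measurableTypeR R) := [set` `[a k - d k, a k + d k]].
have D1 : lebesgue_measure ([set` `[(0 : R), 1]] : set (measurableTypeR R)) = 1%E.
  by rewrite lebesgue_measure_itv /= lte_fin ltr01 -EFinD subr0.
have I1 k : (lebesgue_measure (I k) <= (2 * d k)%:E)%E.
  rewrite /I lebesgue_measure_itv /= lte_fin; case: ifP => _; last by rewrite lee_fin mulr_ge0.
  by rewrite -EFinB lee_fin; lra.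
have [||k|n|u [S' S'P]] := @summable_at R _ _ lebesgue_measure [set` `[(0 : R), 1]] I c (2 * S) _ _ _ c0 _.
- exact: measurable_itv.
- exact: D1.
- exact: measurable_itv.
- apply: le_trans (_ : \sum_(k < n) (2 * (c k * d k))%:E <= _)%E; last first.
    by rewrite sumEFin lee_fin -mulr_sumr ler_wpM2l.
  apply: lee_sum => k _; rewrite [(2 * _)%R]mulrCA EFinM lee_wpmul2l ?lee_fin //.
  exact: I1.
exists u, S' => n; apply: le_trans (S'P n); apply: ler_sum => k _.
case: ifPn => h; last by case: ifP.
have -> // : (u \in I k) = true.
by apply/mem_set; rewrite /I /= in_itv /=; move: h; rewrite ler_norml => /andP[h1 h2]; apply/andP; split; lra.
Qed.

(** Each coordinate fixed trades one power of [rho k] for a condition on that coordinate, so measure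
    on the line suffices. *)
Lemma box_slice (R : realType) (T : eqType) (ps : seq T) (rho : nat -> R) (a : nat -> T -> R) : uniq ps ->
  (forall k, 0 <= rho k) -> forall (c : nat -> R) (S : R), (forall k, 0 <= c k) ->
  (forall n, \sum_(k < n) c k * rho k ^+ size ps <= S) ->
  exists (u : T -> R) S', forall n, \sum_(k < n) (if all (fun p => `|u p - a k p| <= rho k) ps then c k else 0) <= S'.
Proof.
move=> + rho0; elim: ps => [|p ps IH] /= ups c S c0 cS.
  by exists (fun=> 0), S => n; have := cS n; under eq_bigr do rewrite expr0 mulr1.
have /andP[pps {}ups] := ups.
have [|k|n|up [S1 S1P]] := @itv_slice R (fun k => c k * rho k ^+ size ps) rho (fun k => a k p) S => //.
- by move=> k; rewrite mulr_ge0 // exprn_ge0.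
- by have := cS n; under eq_bigr do rewrite exprSr mulrA.
pose c' k := if `|up - a k p| <= rho k then c k else 0.
have [k|n|u [S2 S2P]] := IH ups c' S1.
- by rewrite /c'; case: ifP.
- apply: le_trans (S1P n); apply: ler_sum => k _; rewrite /c'; case: ifP => // _; by rewrite mul0r.
exists (fun q => if q == p then up else u q), S2 => n.
apply: le_trans (S2P n); apply: ler_sum => k _; rewrite eqxx /c'.
have -> : all (fun q => `|(if q == p then up else u q) - a k q| <= rho k) ps = all (fun q => `|u q - a k q| <= rho k) ps.
  by apply: eq_in_all => q qps; case: eqP => // qp; rewrite -qp qps in pps.
by case: (`|up - _| <= _); case: all.
Qed.

Section NullCover.
Variables (R : realType) (V : normedModType R).
Implicit Types (A : set V) (s : R).

Lemma measure0_thin s A : hausdorff_measure s A = 0%E -> thin s A.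
Proof.
move=> A0 delta e d0 e0.
have : (hausdorff_premeasure s delta A < e%:E)%E.
  apply: le_lt_trans (_ : (0 < e%:E)%E); last by rewrite lte_fin.
  by rewrite -A0; apply: ereal_sup_ubound; exists delta.
move=> /ereal_inf_lt[_ [U [Ud AU] <-] Ue]; exists U; split=> //; exact: ltW.
Qed.

(** The slicing argument works with balls of positive radius, whereas a covering set may be empty or
    a single point; [eta] pads these cases. *)
Lemma diam_ball s s' U (delta eta : R) : 0 <= s < s' -> 0 < eta <= delta -> delta <= 1 ->
  (diam U <= delta%:E)%E -> exists (x : V) (r : R), [/\ 0 < r <= delta,
    forall y, U y -> `|y - x| <= r & ((r `^ s')%:E <= diam_pow s U + (eta `^ s')%:E)%E].
Proof.
move=> /andP[s0 ss] /andP[eta0 etad] d1 Ud; have s'0 := le_lt_trans s0 ss.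
have [->|U0] := eqVneq U set0.
  by exists 0, eta; split=> //; rewrite ?eta0 //; rewrite leeDr // diam_pow_ge0.
have /set0P[x Ux] := U0.
have dU0 := diam_ge0 (ex_intro _ x Ux).
have [d dE] : exists d, diam U = d%:E.
  by move: Ud dU0; case: (diam U) => // d _ _; exists d.
rewrite dE !lee_fin in Ud dU0.
have dist y : U y -> `|y - x| <= d.
  move=> Uy; rewrite -lee_fin -dE; apply: ereal_sup_ubound; exists y => //; by exists x.
exists x, (Num.max d eta); split.
- by rewrite lt_max eta0 orbT ge_max Ud.
- by move=> y /dist yd; rewrite le_max yd.
rewrite /diam_pow (negbTE U0) dE poweR_EFin -EFinD lee_fin.
have ds : d `^ s' <= d `^ s.
  have [->|dn0] := eqVneq d 0; first by rewrite powR0 ?powR_ge0 // gt_eqF.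
  by apply: ger_powR (ltW ss); rewrite lt0r dn0 dU0 (le_trans Ud).
have [h|h] := leP d eta; first by rewrite lerDr powR_ge0.
by rewrite ler_wpDr // powR_ge0.
Qed.

(** Superposing covers of totals 2^-1, 2^-2, ... covers each point infinitely often at finite cost.
    Slicing preserves only finiteness of the sum, and smallness is recovered by passing to a tail,
    which still covers. *)
Lemma recurrent_cover s s' A (delta : R) : hausdorff_measure s A = 0%E -> 0 <= s < s' -> 0 < delta <= 1 ->
  exists (a : nat -> V) (r : nat -> R), [/\ forall n, 0 < r n <= delta, forall n, \sum_(k < n) r k `^ s' <= 3 &
    forall x N, A x -> exists2 n, (N <= n)%N & `|x - a n| <= r n].
Proof.
move=> /measure0_thin thA ss /andP[d0 d1].
have s'0 : 0 < s' by case/andP: ss => h1 h2; exact: le_lt_trans h2.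
have ek k : 0 < 1 / (2 ^ k.+1)%:R :> R by rewrite divr_gt0 // ltr0n expn_gt0.
have /choice[U UP] := fun k => thA delta _ d0 (ek k).
have [W [Wd WU We]] := @interleave _ _ s U delta 1 ltr01 (fun k => let: And3 h _ _ := UP k in h) (fun k => let: And3 _ _ h := UP k in h).
pose eta n := Num.min delta ((2^-1 ^+ n) `^ s'^-1).
have eta0 n : 0 < eta n <= delta by rewrite lt_min d0 powR_gt0 ?exprn_gt0 ?invr_gt0 // ge_min lexx.
have eta_pow n : eta n `^ s' <= 2^-1 ^+ n.
  apply: le_trans (_ : ((2^-1 ^+ n) `^ s'^-1) `^ s' <= _).
    apply: ge0_ler_powR; rewrite ?nnegrE ?powR_ge0 ?(ltW s'0) // ?ge_min ?lexx ?orbT //.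
    by case/andP: (eta0 n) => /ltW.
  by rewrite -powRrM mulVf ?gt_eqF // powRr1 // exprn_ge0 // invr_ge0.
have /choice[a /choice[r arP]] := fun n => diam_ball ss (eta0 n) d1 (Wd n).
exists a, r; split=> [n|n|x N Ax]; first by have [] := arP n.
  have -> : (3 : R) = 1 + 2 by ring.
  rewrite -lee_fin -sumEFin; apply: le_trans (_ : \sum_(k < n) (diam_pow s (W k) + (2^-1 ^+ k)%:E) <= _)%E.
    apply: lee_sum => k _; have [_ _ h] := arP k; apply: le_trans h _; rewrite leeD2l // lee_fin //.
  rewrite big_split /= EFinD; apply: leeD.
    apply: le_trans We; rewrite -(big_mkord xpredT (fun k => diam_pow s (W k))).
    by apply: nneseries_lim_ge => k _ _; exact: diam_pow_ge0.
  rewrite sumEFin lee_fin.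
  have -> : \sum_(k < n) 2^-1 ^+ k = 2 - 2 * 2^-1 ^+ n :> R.
    elim: n => [|n IH]; first by rewrite big_ord0 expr0; ring.
    by rewrite big_ord_recr /= IH exprS; field.
  by rewrite gerBl mulr_ge0 // exprn_ge0 // invr_ge0.
have /choice[j jP] : forall k, exists j, U k j x.
  by move=> k; have [_ /(_ x Ax)[j _ Ux] _] := UP k; exists j.
(* Pigeonhole: the infinitely many sets found around [x] cannot all have index below [N]. *)
have [k kN] : exists k, (N <= pickle (k, j k))%N.
  apply: contrapT => /forallNP none.
  have lt k : (pickle (k, j k) < N)%N by rewrite ltnNge; apply/negP; exact: none.
  have inj : injective (fun k : 'I_N.+1 => Ordinal (lt k)).
    by move=> k k' /(congr1 val) /= /(pcan_inj pickleK)[kk _]; exact: val_inj.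
  by have := leq_card _ inj; rewrite !card_ord ltnn.
exists (pickle (k, j k)) => //; have [_ h _] := arP (pickle (k, j k)); apply: h.
by rewrite WU.
Qed.

End NullCover.

Lemma small_tail (R : realType) (x : nat -> R) (S e : R) : (forall k, 0 <= x k) ->
  (forall n, \sum_(k < n) x k <= S) -> 0 < e -> exists N, forall n, \sum_(k < n) x (N + k)%N <= e.
Proof.
move=> x0 xS e0.
have sE : has_sup [set \sum_(k < n) x k | n in [set: nat]].
  by split; [exists 0, 0%N; rewrite ?big_ord0 | exists S => _ [n _ <-]; exact: xS].
have [_ [N _ <-] hN] := sup_adherent e0 sE; exists N => n.
have : \sum_(k < N + n) x k <= sup [set \sum_(k < n) x k | n in [set: nat]].
  by apply: (ub_le_sup sE.2); exists (N + n)%N.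
by rewrite big_split_ord /=; lra.
Qed.

Lemma geometric_half (R : realType) n : \sum_(k < n) 2^-1 ^+ k.+1 <= 1 :> R.
Proof.
have -> : \sum_(k < n) 2^-1 ^+ k.+1 = 1 - 2^-1 ^+ n :> R.
  elim: n => [|n IH]; first by rewrite big_ord0 expr0 subrr.
  by rewrite big_ord_recr /= IH exprS; field.
by rewrite gerBl exprn_ge0 // invr_ge0.
Qed.

Section LowerBound.
Variables (R : realType) (e : nat) (w : 'I_e.+1 -> R).
Hypothesis e0 : (0 < e)%N.
Hypothesis w_gt0 : forall i, 0 < w i.
Hypothesis w_sum1 : \sum_i w i = 1.
Hypothesis w_noninc : forall i j : 'I_e.+1, (i <= j)%N -> w j <= w i.
Local Notation lam := (wlam w).

Lemma expands_max_row j : expands lam ord_max j = false.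
Proof.
change ((lam j < lam ord_max) = false); rewrite wlam_max; case: (unliftP ord_max j) => [k|] ->; rewrite ?wlam_lift ?wlam_max ?ltxx //.
by rewrite ltNge (ltW (lt_trans (ltrN10 _) (w_gt0 _))).
Qed.

Lemma expands_max_col k : expands lam (lift ord_max k) ord_max.
Proof.
by change (is_true (lam ord_max < lam (lift ord_max k))); rewrite wlam_lift wlam_max (lt_trans (ltrN10 _)).
Qed.

Definition inner_pairs := [seq p : 'I_e.+2 * 'I_e.+2 <- enum {: 'I_e.+2 * 'I_e.+2} |
  expands lam p.1 p.2 && (p.2 != ord_max)].

Lemma npairs_inner : npairs w = (size inner_pairs + e.+1)%N.
Proof.
rewrite /npairs -(cardID [pred p | p.2 == ord_max]) addnC; congr (_ + _)%N.
  rewrite /inner_pairs cardE enumT size_filter size_filter -?enumT.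
  by apply: eq_count => p /=; rewrite !inE andbC.
rewrite -[RHS](card_ord e.+1) -(card_imset (f := fun i : 'I_e.+1 => (lift ord_max i, ord_max) : 'I_e.+2 * 'I_e.+2)).
  apply: eq_card => -[i j]; rewrite !inE /=; apply/andP/imsetP.
    move=> [h /eqP jE]; move: h; rewrite jE; case: (unliftP ord_max i) => [k ->|->]; last by rewrite expands_max_row.
    by exists k.
  by move=> [k _ [-> ->]]; rewrite eqxx expands_max_col.
by move=> k k' /(congr1 fst); exact: lift_inj.
Qed.

Definition slice_mx (u : 'I_e.+2 * 'I_e.+2 -> R) : 'M[R]_e.+2 :=
  \matrix_(i, j) if expands lam i j && (j != ord_max) then u (i, j) else (i == j)%:R.

Lemma ux_slice u x i j : (ux x *m slice_mx u) i j =
  if expands lam i j then if j == ord_max then oapp (fun k => x k 0) 0 (unlift ord_max i) else u (i, j) else (i == j)%:R.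
Proof.
have max_row j' : slice_mx u ord_max j' = (ord_max == j')%:R.
  by rewrite mxE expands_max_row.
case: (unliftP ord_max i) => [k|] ->; last first.
  by rewrite mul_ux_max max_row expands_max_row.
rewrite mul_ux_lift max_row [slice_mx _ _ _]mxE [ord_max == j]eq_sym.
have [->|jm] := eqVneq j ord_max.
  by rewrite andbF mulr1 expands_max_col [lift _ _ == _]eq_sym (negbTE (neq_lift _ _)) add0r.
by rewrite andbT mulr0 addr0.
Qed.

(* Almost every slice [h = ux x *m slice_mx u], [u] fixed, meets a null cover in a
   family of finite sum, which contradicts [slice_content]. *)
Lemma lower_bound (g : 'M[R]_e.+2) (s : R) : `|\det g| = 1 -> 0 <= s ->
  hausdorff_measure s [set h : 'M[R]_e.+2 | unip lam h /\ escapes w g h] = 0%E ->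
  (npairs w)%:R - (1 + w 0)^-1 <= s.
Proof.
move=> g1 s0 null; rewrite leNgt; apply/negP => hs.
have w10 : 0 < 1 + w 0 by rewrite addr_gt0.
pose q := e%:R + w 0 / (1 + w 0).
pose m := size inner_pairs.
(* As w_0 / (1 + w_0) = 1 - 1 / (1 + w_0), the critical exponent of the whole group exceeds that of
   a slice by exactly the number [m] of fixed entries. *)
have hq : s - m%:R < q.
  have wq : w 0 / (1 + w 0) = 1 - (1 + w 0)^-1 by field; rewrite gt_eqF.
  by move: hs; rewrite npairs_inner -/m natrD -[e.+1%:R]natr1 /q wq; lra.
have q0 : 0 < q by rewrite ltr_wpDl // divr_gt0.
pose s' := (Num.max 0 (s - m%:R) + q) / 2.
have mx1 : 0 <= Num.max 0 (s - m%:R) by rewrite le_max lexx.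
have mx2 : s - m%:R <= Num.max 0 (s - m%:R) by rewrite le_max lexx orbT.
have mx3 : Num.max 0 (s - m%:R) < q by rewrite gt_max q0.
have [s'0 s'q ss'] : [/\ 0 < s', s' < q & s < m%:R + s'].
  by rewrite /s'; move: (Num.max _ _) mx1 mx2 mx3 => z *; split; lra.
have half1 : 0 < (2^-1 : R) <= 1 by rewrite invr_gt0 ltr0Sn /= invf_le1 // ler1n.
have ssq : 0 <= s < m%:R + s' by rewrite s0 ss'.
have [a [r [r01 rsum cov]]] := recurrent_cover null ssq half1.
have r0 k : 0 < r k by case/andP: (r01 k).
pose hit (u : 'I_e.+2 * 'I_e.+2 -> R) k := all (fun p : 'I_e.+2 * 'I_e.+2 => `|u p - a k p.1 p.2| <= r k) inner_pairs.
have [||k|n|u [S' S'P]] := @box_slice R _ inner_pairs r (fun k p => a k p.1 p.2) _ _ (fun k => r k `^ s') 3.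
- by rewrite filter_uniq // enum_uniq.
- by move=> k; exact: ltW.
- exact: powR_ge0.
- apply: le_trans (rsum n); apply: ler_sum => k _.
  rewrite -powR_mulrn ?(ltW (r0 k)) // -/m mulrC -powRD //.
  by apply/implyP => _; rewrite gt_eqF.
set h0 := slice_mx u.
have h0u x : unip lam (ux x *m h0) by move=> i j ij; rewrite ux_slice (negbTE ij).
have mono := wlam_mono w_gt0 w_noninc.
have h01 : `|\det (h0 *m g)| = 1.
  have := unip_det mono (h0u 0); rewrite ux0 mul1mx => h0d.
  by rewrite det_mulmx h0d mul1r.
have [c c0 cP] := slice_content e0 w_gt0 w_sum1 w_noninc h01 (ltW s'0) s'q.
pose x k := if hit u k then r k `^ s' else 0.
have x0 k : 0 <= x k by rewrite /x; case: ifP => // _; exact: powR_ge0.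
have c4 : 0 < c / 4 by rewrite divr_gt0.
have [N NP] := small_tail x0 S'P c4.
(* [slice_content] wants positive radii, so a ball that misses the slice is replaced by a tiny one;
   these cost at most c / 4 in total. *)
pose pad k := Num.min 2^-1 ((c / 4 * 2^-1 ^+ k.+1) `^ s'^-1).
have pad0 k : 0 < c / 4 * 2^-1 ^+ k.+1 by rewrite mulr_gt0 // exprn_gt0 // invr_gt0.
have pad01 k : 0 < pad k <= 2^-1.
  by rewrite lt_min powR_gt0 // invr_gt0 ltr0Sn ge_min lexx.
have pad_pow k : pad k `^ s' <= c / 4 * 2^-1 ^+ k.+1.
  apply: le_trans (_ : ((c / 4 * 2^-1 ^+ k.+1) `^ s'^-1) `^ s' <= _).
    apply: ge0_ler_powR; rewrite ?nnegrE ?powR_ge0 ?(ltW s'0) // ?ge_min ?lexx ?orbT //.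
    by case/andP: (pad01 k) => /ltW.
  by rewrite -powRrM mulVf ?gt_eqF // powRr1 // ltW.
have [k|y yesc|M] := cP (fun k => \col_i a (N + k)%N (lift ord_max i) ord_max)
   (fun k => if hit u (N + k)%N then r (N + k)%N else pad k).
- by case: ifP.
- have [|n Nn hn] := cov (ux y *m h0) N.
    split=> // t t0; apply: filterS (yesc t t0) => tau.
    by rewrite !mulmxA.
  have ent i j : `|(ux y *m h0) i j - a n i j| <= r n.
    have := mnorm_entry (ux y *m h0 - a n) i j; rewrite -normE => /le_trans/(_ hn).
    have -> // : (ux y *m h0 - a n) i j = (ux y *m h0) i j - a n i j.
    by move: (ux y *m h0) => A; rewrite !mxE.
  exists (n - N)%N => i; rewrite subnKC //.
  have -> : hit u n.
    apply/allP => -[i' j']; rewrite mem_filter => /andP[/andP[/= h1 h2] _].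
    by have := ent i' j'; rewrite ux_slice /= h1 (negbTE h2).
  have := ent (lift ord_max i) ord_max.
  rewrite ux_slice expands_max_col eqxx liftK /= mxE.
  by [].
apply/negP; rewrite -ltNge.
apply: le_lt_trans (_ : c / 4 + c / 4 < _); last by lra.
apply: le_trans (_ : \sum_(k < M) (x (N + k)%N + c / 4 * 2^-1 ^+ k.+1) <= _).
  apply: ler_sum => k _; rewrite /x; case: ifP => _; first by rewrite lerDl ltW.
  by rewrite add0r.
rewrite big_split; apply: lerD; first exact: NP.
rewrite -mulr_sumr -[leRHS]mulr1; apply: ler_wpM2l; first exact: ltW.
exact: geometric_half.
Qed.

End LowerBound.

Local Open Scope quotient_scope.

(** * Divergence in the space of lattices *)

Section FiniteLimits.
Variables (R : realType) (T : Type) (F : set_system T) (I : Type) (r : seq I).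
Variables (f : I -> T -> R) (a : I -> R).
Hypotheses (FF : Filter F) (fa : forall i, f i @ F --> a i).

Lemma cvg_sum_fun : (fun x => \sum_(i <- r) f i x) @ F --> \sum_(i <- r) a i.
Proof.
elim: r => [|i r' IH].
  by rewrite big_nil; under eq_fun do rewrite big_nil; exact: cvg_cst.
by rewrite big_cons; under eq_fun do rewrite big_cons; exact: cvgD.
Qed.

Lemma cvg_prod_fun : (fun x => \prod_(i <- r) f i x) @ F --> \prod_(i <- r) a i.
Proof.
elim: r => [|i r' IH].
  by rewrite big_nil; under eq_fun do rewrite big_nil; exact: cvg_cst.
by rewrite big_cons; under eq_fun do rewrite big_cons; exact: cvgM.
Qed.

End FiniteLimits.

Section LatticeTopology.
Variables (R : realType) (n : nat).
Local Notation SL := (SL R n.+1).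

Lemma nbhs_SL (a : SL) (A : set SL) : nbhs a A <-> exists2 r, 0 < r & forall b : SL, mnorm (val b - val a) < r -> A b.
Proof.
split=> [[_ [[B Bop <-] Ba BA]]|[r r0 rA]].
  have /nbhs_ballP[r r0 rB] : nbhs (val a) B by exact: open_nbhs_nbhs.
  exists r => // b ba; apply: BA; apply: rB; rewrite -ball_normE /= distrC normE.
  exact: ba.
have : nbhs a (val @^-1` (ball (val a) r)) by apply: (@initial_continuous _ _ (val : SL -> 'M[R]_n.+1) a); exact: nbhsx_ballx.
apply: filterS => b; rewrite -ball_normE /= distrC normE; exact: rA.
Qed.

Lemma continuous_det_vec : continuous (fun v : 'rV[R]_(n.+1 * n.+1) => \det (vec_mx v)).
Proof.
move=> v; rewrite /determinant; apply: (@cvg_sum_fun R _ _ _ _ _ _ (nbhs_filter v)) => s; apply: cvgM; first exact: cvg_cst.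
apply: (@cvg_prod_fun R _ _ _ _ _ _ (nbhs_filter v)) => i.
have -> : (fun v : 'rV[R]_(n.+1 * n.+1) => vec_mx v i (s i)) = (fun v => v 0 (mxvec_index i (s i))).
  by apply/funext => u; rewrite mxE.
rewrite [vec_mx v i (s i)]mxE; exact: coord_continuous.
Qed.

(** Flattened to row vectors, bounded matrices fill a compact box; a cluster point there has
    determinant 1 by continuity, so it lies in SL. *)
Lemma compact_SL (C : R) : compact [set a : SL | mnorm (val a) <= C].
Proof.
move=> F PF FC; pose phi (a : SL) := mxvec (val a).
pose K := [set v : 'rV[R]_(n.+1 * n.+1) | forall i, `[- C, C]%classic (v ord0 i)].
have Kc : compact K by apply: (@rV_compact _ _ (fun=> `[- C, C]%classic)) => _; exact: segment_compact.
have phiK : (phi @ F) K.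
  suff : F [set a | K (phi a)] by [].
  apply: filterS FC => a /= aC; rewrite /K /= => k; rewrite in_itv /= -ler_norml.
  by case/mxvec_indexP: k => i j; rewrite mxvecE; apply: le_trans aC; exact: mnorm_entry.
have [v [vK vF]] := Kc _ _ phiK.
have vdet : \det (vec_mx v) = 1.
  apply: contrapT => /eqP d1.
  have d0 : 0 < `|\det (vec_mx v) - 1| by rewrite normr_gt0 subr_eq0.
  have N1 := continuous_det_vec (nbhsx_ballx (\det (vec_mx v)) _ d0).
  have [_ [[a _ <-]]] := vF (phi @` setT) _ (filterS (fun a _ => ex_intro2 _ _ a I erefl) FC) N1.
  by rewrite /= /phi mxvecK -ball_normE /= det_SL ltxx.
exists (mkSL vdet); split.
  apply: mnorm_le => [|i j].
    by have := vK (mxvec_index ord0 ord0); rewrite /= in_itv /= => /andP[h1 h2]; rewrite -[C]addr0; lra.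
  by have := vK (mxvec_index i j); rewrite /= in_itv /= -ler_norml mxE.
move=> A B FA /nbhs_SL[r r0 rB].
have N1 : nbhs v (ball v r) by exact: nbhsx_ballx.
have [_ [[a Aa <-]]] := vF (phi @` A) _ (filterS (fun a Aa => ex_intro2 _ _ a Aa erefl) FA) N1.
rewrite -ball_normE /= => var; exists a; split=> //; apply: rB => /=.
apply: le_lt_trans var; have -> : `|v - phi a| = mnorm (v - phi a) by exact: mx_normrE.
apply: mnorm_le => [|i j]; first exact: mnorm_ge0.
have := mnorm_entry (v - phi a) 0 (mxvec_index i j).
by rewrite /phi !mxE mxvecE -/(mxvec_index i j) distrC.
Qed.

Lemma lattice_of_continuous : continuous (@lattice_of R n.+1).
Proof. exact: pi_continuous. Qed.

Lemma bounded_lattice_compact (C : R) : compact ((@lattice_of R n.+1) @` [set a : SL | mnorm (val a) <= C]).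
Proof.
apply: continuous_compact; last exact: compact_SL.
exact/continuous_subspaceT/lattice_of_continuous.
Qed.

Lemma has_short_lattice (a b : SL) r : lattice_of a = lattice_of b -> has_short (val a) r -> has_short (val b) r.
Proof.
move=> /esym/lattice_ofP/asboolP[c [dc ->]] [z z0]; rewrite -mulmxA -map_mxM => h.
exists (c *m z) => //; apply: contraNneq z0 => cz.
have cK : \adj c *m c = 1%:M by rewrite mul_adj_mx dc.
by rewrite -[z]mul1mx -cK -mulmxA cz mulmx0.
Qed.

(** Mahler's criterion: without short vectors a reduced basis is bounded. *)
Lemma mahler (r : R) : 0 < r -> exists C, forall a : SL, ~ has_short (val a) r ->
  ((@lattice_of R n.+1) @` [set b : SL | mnorm (val b) <= C]) (lattice_of a).
Proof.
move=> r0; exists (2 ^+ (n.+1 * n.+1) / r ^+ n) => a ash.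
have au : val a \in unitmx by rewrite unitmxE det_SL unitr1.
have ar : lattice_ge (val a) r.
  by move=> z z0; rewrite leNgt; apply/negP => /ltW h; apply: ash; exists z.
have [c cu cb] := bounded_basis au r0 ar.
(* Reduction gives a base change of determinant 1 or -1; a sign on one column makes it 1 without
   changing norms. *)
pose dg : 'M[int]_n.+1 := diag_mx (\row_i if i == 0 then \det c else 1).
have dcu : \det c \is a GRing.unit by rewrite -unitmxE.
have dc1 : `|\det c| = 1 by move: dcu; rewrite qualifE /= => /orP[] /eqP ->.
have ddg : \det dg = \det c.
  by rewrite det_diag big_ord_recl mxE eqxx big1 ?mulr1 // => i _; rewrite mxE.
have dcd : \det (c *m dg) = 1.
  rewrite det_mulmx ddg; move: dc1; case: (\det c) => m /=; lia.
have dbc : \det (val a *m intmx (c *m dg)) = 1 by rewrite det_mulmx det_SL mul1r det_map_mx dcd.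
exists (mkSL dbc); last first.
  by apply/esym/lattice_ofP/asboolP; exists (c *m dg).
have C0 : 0 <= 2 ^+ (n.+1 * n.+1) / r ^+ n by rewrite divr_ge0 // exprn_ge0 // ltW.
apply: mnorm_le => // i j; rewrite /= map_mxM mulmxA map_diag_mx mul_mx_diag [(\matrix_(_, _) _) _ _]mxE.
apply: le_trans (_ : `|(val a *m intmx c) i j| * 1 <= _).
  rewrite normrM ler_wpM2l //; apply: le_trans (_ : `|(if j == 0 then \det c else 1)%:~R : R| <= _).
    by rewrite [X in `|X|]mxE mxE.
  by rewrite -intr_norm; case: ifP => _; rewrite ?dc1 ?normr1.
rewrite mulr1.
apply: le_trans (_ : mnorm (col j (val a *m intmx c)) <= _).
  by have := mnorm_entry (col j (val a *m intmx c)) i 0; rewrite mxE.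
by apply: le_trans (cb j) _; rewrite det_SL normr1 mulr1.
Qed.

(* The margin [r < r'] makes this an open condition. *)
Definition spaced (r : R) (L : lattice_space R n.+1) : Prop := exists2 r', r < r' &
  forall a : SL, lattice_of a = L -> ~ has_short (val a) r'.

(** Replacing [a] by a nearby [b] moves each lattice vector by a small fraction of its length, so a
    vector of norm at most [q] for [b] has norm at most [r'] for [a]. *)
Lemma open_spaced r : 0 < r -> open (spaced r).
Proof.
move=> r0; apply: (_ : open ((@lattice_of R n.+1) @^-1` spaced r)).
rewrite openE => a [r' rr ar']; have {}ar' := ar' a erefl.
have r'0 : 0 < r' by exact: lt_trans rr.
pose q := (r + r') / 2; have [rq qr'] : r < q /\ q < r' by rewrite /q; split; lra.
have I0 := mnorm_ge0 (invmx (val a)).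
have au : val a \in unitmx by rewrite unitmxE det_SL unitr1.
pose E := (r' - q) / (r' * (n.+1%:R * (n.+1%:R * (mnorm (invmx (val a)) + 1)))).
have den0 : 0 < r' * (n.+1%:R * (n.+1%:R * (mnorm (invmx (val a)) + 1))).
  rewrite mulr_gt0 // mulr_gt0 ?ltr0Sn // mulr_gt0 ?ltr0Sn // ltr_wpDl //.
apply/nbhs_SL; exists E; first by rewrite divr_gt0 // subr_gt0.
move=> b ba; exists q => // c cb; apply: contra_not ar' => /(has_short_lattice cb)[z z0 zq].
exists z => //.
have h1 : mnorm (val a *m intmx z) <= mnorm (val b *m intmx z) + mnorm ((val b - val a) *m invmx (val a) *m (val a *m intmx z)).
  rewrite -mulmxA mulKmx // mulmxBl -[mnorm (_ - _)]mnormN opprB.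
  by apply: le_trans (mnormD _ _); rewrite addrC subrK.
have h2 : mnorm ((val b - val a) *m invmx (val a) *m (val a *m intmx z)) <= (r' - q) / r' * mnorm (val a *m intmx z).
  apply: le_trans (mnormM _ _) _; rewrite mulrA ler_wpM2r ?mnorm_ge0 //.
  apply: le_trans (_ : n.+1%:R * (n.+1%:R * (E * (mnorm (invmx (val a)) + 1))) <= _).
    rewrite ler_wpM2l //; apply: le_trans (mnormM _ _) _; rewrite ler_wpM2l //.
    by apply: ler_pM; rewrite ?mnorm_ge0 ?(ltW ba) // lerDl.
  rewrite /E le_eqVlt; apply/orP; left; apply/eqP; field.
  by rewrite nat1r pnatr_eq0 !gt_eqF // ltr_wpDl.
move: h1 h2; set x := mnorm (val a *m intmx z) => h1 h2.
have h3 : x <= q + (r' - q) / r' * x by lra.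
have : x * q <= q * r'.
  have : r' * x <= r' * (q + (r' - q) / r' * x) by rewrite ler_wpM2l // ltW.
  have -> : r' * (q + (r' - q) / r' * x) = q * r' + (r' - q) * x by field; rewrite gt_eqF.
  by lra.
by rewrite mulrC ler_pM2l // (lt_trans r0).
Qed.

Lemma spaced_ex (L : lattice_space R n.+1) : exists2 r, 0 < r & spaced r L.
Proof.
pose a : SL := generic_quotient.repr (L : quotient_topology {eq_quot (same_lattice_equiv R n.+1)}).
have aL : lattice_of a = L by exact: reprK.
have au : val a \in unitmx by rewrite unitmxE det_SL unitr1.
have [z z0 zmin] := shortest_vector au.
have s0 : 0 < mnorm (val a *m intmx z) by apply: mnorm_gt0; exact: gz_neq0.
exists (mnorm (val a *m intmx z) / 4); first by rewrite divr_gt0.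
exists (mnorm (val a *m intmx z) / 2); first by lra.
move=> b bL /(has_short_lattice (etrans bL (esym aL)))[z' z'0 h].
by have := zmin z' z'0; lra.
Qed.

End LatticeTopology.

Section Divergence.
Variables (R : realType) (d : nat) (w : 'I_d -> R).
Hypothesis w_sum1 : \sum_(i < d) w i = 1.
Local Notation SL := (SL R d.+1).
Local Notation lam := (wlam w).

Definition frame (L : lattice_space R d.+1) : SL :=
  generic_quotient.repr (L : quotient_topology {eq_quot (same_lattice_equiv R d.+1)}).

(** Lattices without short vectors lie in a compact set by [mahler], which a divergent trajectory
    leaves. Conversely a trajectory that keeps returning to [K] has a cluster point, near which
    lattices have no short vectors, against [escapes]. *)
Lemma divergentP (h : SL) (L : lattice_space R d.+1) :
  divergent (fun t => lattice_act (SLmul (flow w_sum1 t) h) L) <-> escapes w (val (frame L)) (val h).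
Proof.
pose y t := SLmul (SLmul (flow w_sum1 t) h) (frame L).
have yE t : val (y t) = dmx lam t *m val h *m val (frame L) by [].
split=> [dv r r0|esc K Kc].
  have [C CP] := @mahler R d r r0.
  have := dv _ (@bounded_lattice_compact R d C); apply: filterS => t nK.
  by rewrite -yE; apply: contrapT => ns; apply: nK; exact: CP.
apply: contrapT => stay.
(* Late times restricted to those spent in [K]; the filter is proper because the trajectory returns
   to [K] arbitrarily late. *)
pose F : set_system (lattice_space R d.+1) :=
  [set A | \forall t \near +oo, K (lattice_of (y t)) -> A (lattice_of (y t))].
have PF : ProperFilter F.
  apply: Build_ProperFilter; first by move=> h0; apply: stay; exact: h0.
  split; first by apply: nearW.
  - move=> A B FA FB.
    have FA' : \forall t \near +oo, K (lattice_of (y t)) -> A (lattice_of (y t)) := FA.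
    have FB' : \forall t \near +oo, K (lattice_of (y t)) -> B (lattice_of (y t)) := FB.
    suff : \forall t \near +oo, K (lattice_of (y t)) -> A (lattice_of (y t)) /\ B (lattice_of (y t)) by [].
    by apply: filterS2 FA' FB' => t h1 h2 Kt; split; [exact: h1 | exact: h2].
  - move=> A B AB FA.
    have FA' : \forall t \near +oo, K (lattice_of (y t)) -> A (lattice_of (y t)) := FA.
    suff : \forall t \near +oo, K (lattice_of (y t)) -> B (lattice_of (y t)) by [].
    by apply: filterS FA' => t h1 /h1; exact: AB.
have FK : F K by apply: nearW.
have [L0 [_ cl]] := Kc F PF FK.
have [r r0 spL0] := spaced_ex L0.
have nb : nbhs L0 (spaced r) by apply: open_nbhs_nbhs; split=> //; exact: open_spaced.
have Fshort : F [set M | exists2 a : SL, lattice_of a = M & has_short (val a) r].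
  by apply: filterS (esc r r0) => t hs _; exists (y t).
have [M [[a aM ha] [r' rr' sp]]] := cl _ _ Fshort nb.
by apply: (sp a aM); case: ha => z z0 zr; exists z => //; apply: le_trans zr (ltW rr').
Qed.

(** Conjugation multiplies entry (i, j) by e^((lam j - lam i) t). This tends to 0 when lam i > lam
    j; otherwise it is at least 1 for t >= 0, and an off-diagonal entry can only converge to 0 by
    being 0. *)
Lemma horosphericalP (h : SL) : horospherical w_sum1 h <-> unip lam (val h).
Proof.
have conj i j t : val (SLmul (SLmul (flow w_sum1 (- t)) h) (flow w_sum1 t)) i j = expR ((lam j - lam i) * t) * val h i j.
  rewrite /= /flow_mx mul_mx_diag mxE mul_diag_mx !mxE mulrAC -expRD; congr (expR _ * _); rewrite /wlam; ring.
split=> [hh i j|hu].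
  rewrite /= -leNgt => ij.
  have close (r : R) : 0 < r -> \forall t \near +oo, `|expR ((lam j - lam i) * t) * val h i j - (i == j)%:R| < r.
    move=> r0; have : nbhs (SLone R d.+1) [set b : SL | mnorm (val b - 1%:M) < r].
      by apply/nbhs_SL; exists r.
    move=> /hh hr; suff : \forall t \near +oo, mnorm (val (SLmul (SLmul (flow w_sum1 (- t)) h) (flow w_sum1 t)) - 1%:M) < r.
      apply: filterS => t; rewrite -conj; apply: le_lt_trans.
      have -> : (i == j)%:R = (1%:M : 'M[R]_d.+1) i j by rewrite mxE.
      set A := val _; have -> : A i j - 1%:M i j = (A - 1%:M) i j by rewrite !mxE.
      exact: mnorm_entry.
    exact: hr.
  apply/eqP; rewrite -subr_eq0 -normr_eq0 eq_le normr_ge0 andbT; apply/ler_addgt0Pr => r r0; rewrite add0r.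
  have [t [tr t0]] : exists t, `|expR ((lam j - lam i) * t) * val h i j - (i == j)%:R| < r /\ 0 <= t.
    near (+oo : set_system R) => t; exists t; split; near: t; first exact: close.
    exact: nbhs_pinfty_ge.
  apply: le_trans (ltW tr).
  have [/eqP ->|ij'] := boolP (i == j); first by rewrite subrr mul0r expR0 mul1r.
  rewrite !subr0 normrM ler_peMl // ger0_norm ?expR_ge0 // -[leLHS]expR0 ler_expR mulr_ge0 // subr_ge0 //.
move=> A /nbhs_SL[r r0 rA].
have [q q0 gap] := expands_gap lam.
have r20 : 0 < r / 2 by rewrite divr_gt0.
have [t0 t00 Ht0] := exp_decay q0 (mnorm_ge0 (val h)) r20.
exists t0; split=> [|t tt0]; first exact: num_real.
apply: rA; apply: (@le_lt_trans _ _ (r / 2)); last by lra.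
set B := val _; apply: mnorm_le => [|i j]; first exact: ltW.
have -> : (B - val (SLone R d.+1)) i j = B i j - (i == j)%:R by rewrite !mxE.
rewrite /B conj; have [ij|ij] := boolP (expands lam i j).
  have -> : (i == j) = false by apply: contraTF ij => /eqP ->; rewrite expands_irr.
  rewrite subr0 normrM (gtr0_norm (expR_gt0 _)) mulrC; apply: le_trans (Ht0 t (ltW tt0)).
  apply: ler_pM; rewrite ?expR_ge0 ?mnorm_entry // ler_expR.
  by rewrite -mulNr ler_wpM2r ?(le_trans t00 (ltW tt0)) // lerNr opprB gap.
rewrite (hu i j ij); have [/eqP ->|_] := boolP (i == j); last by rewrite mulr0 subrr normr0 ltW.
by rewrite subrr mul0r expR0 mul1r subrr normr0 ltW.
Unshelve. all: by end_near.
Qed.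

End Divergence.

(** * The Lie algebra of the horospherical group *)

Lemma cvg_mx (R : realType) (T : Type) (F : set_system T) (FF : Filter F) m n
    (f : T -> 'M[R]_(m.+1, n.+1)) (l : 'M[R]_(m.+1, n.+1)) :
  (forall i j, (fun x => f x i j) @ F --> l i j) -> f @ F --> l.
Proof.
move=> fl; apply/cvgrPdist_le => r r0.
have : \forall x \near F, forall p : 'I_m.+1 * 'I_n.+1, `|l p.1 p.2 - f x p.1 p.2| <= r.
  by apply: filter_forall => p; have /cvgrPdist_le := fl p.1 p.2; apply.
apply: filterS => x h; rewrite normE; apply: mnorm_le => [|i j]; first exact: ltW.
by have := h (i, j); rewrite !mxE.
Qed.

Section Exponential.
Variables (R : realType) (n : nat).
Implicit Types X : 'M[R]_n.+1.
Local Notation coef X i j := (fun k => ((k`!%:R)^-1 *: X ^+ k) i j).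

Lemma mnorm_exp X k : mnorm (X ^+ k) <= (n.+1%:R * mnorm X) ^+ k.
Proof.
elim: k => [|k IH].
  by rewrite !expr0; apply: mnorm_le => // i j; rewrite mxE; case: (i == j); rewrite ?normr1 ?normr0.
rewrite !exprS; apply: le_trans (mnormM _ _) _.
by rewrite -mulrA ler_wpM2l // ler_wpM2l ?mnorm_ge0.
Qed.

Lemma coef_bound X i j k : `|coef X i j k| <= exp_coeff (n.+1%:R * mnorm X) k.
Proof.
rewrite /= mxE normrM /exp_coeff /= [leRHS]mulrC normfV (ger0_norm (ler0n _ _)) ler_wpM2l ?invr_ge0 //.
by apply: le_trans (mnorm_entry _ _ _) _; exact: mnorm_exp.
Qed.

Lemma expmx_cvg X i j : series (coef X i j) @ \oo --> expmx X i j.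
Proof.
have a0 : 0 <= n.+1%:R * mnorm X by rewrite mulr_ge0 ?mnorm_ge0.
have cv i' j' : cvgn (series (coef X i' j')).
  apply: normed_cvg; apply: (series_le_cvg _ _ (coef_bound X i' j')) => // [k|].
    by rewrite /exp_coeff /= divr_ge0 // exprn_ge0.
  exact: is_cvg_series_exp_coeff.
pose L : 'M[R]_n.+1 := \matrix_(i', j') lim (series (coef X i' j') @ \oo).
have sL : series (fun k => (k`!%:R)^-1 *: X ^+ k) @ \oo --> L.
  apply: cvg_mx => i' j'; rewrite mxE.
  have -> : (fun N => series (fun k => (k`!%:R)^-1 *: X ^+ k) N i' j') = series (coef X i' j').
    by apply/funext => N; rewrite /series /= summxE.
  exact: cv.
have -> : expmx X = L by exact: (cvg_lim (@norm_hausdorff _ _) sL).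
by rewrite mxE; exact: cv.
Qed.

(** A remainder quadratic in [s] lets the linear term of the exponential be read off in
    [lie_algebra_unip]. *)
Lemma expmx_taylor X (s : R) i j : 0 <= s <= 1 ->
  `|expmx (s *: X) i j - (i == j)%:R - s * X i j| <= s ^+ 2 * expR (n.+1%:R * mnorm X).
Proof.
move=> /andP[s0 s1]; set a := n.+1%:R * mnorm X.
have a0 : 0 <= a by rewrite mulr_ge0 ?mnorm_ge0.
apply/ler_addgt0Pr => r r0.
have /cvgrPdist_le/(_ r r0) cv := @expmx_cvg (s *: X) i j.
have [N [N2 hN]] : exists N, (2 <= N)%N /\ `|expmx (s *: X) i j - series (coef (s *: X) i j) N| <= r.
  near \oo => N; exists N; split; near: N; [exact: nbhs_infty_ge | exact: cv].
have e0 k : 0 <= exp_coeff a k by rewrite /exp_coeff /= divr_ge0 // exprn_ge0.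
have partial : `|series (coef (s *: X) i j) N - (i == j)%:R - s * X i j| <= s ^+ 2 * expR a.
  have -> : series (coef (s *: X) i j) N = (i == j)%:R + s * X i j + \sum_(k < N - 2) coef (s *: X) i j (2 + k)%N.
    rewrite /series /= -{1}(subnKC N2) big_mkord big_split_ord /= !big_ord_recl big_ord0 addr0.
    congr (_ + _ + _); first by rewrite fact0 expr0 invr1 scale1r mxE.
    by rewrite -[lift ord0 ord0 : nat]/1%N invr1 expr1 scale1r mxE.
  set S := \sum_(_ < _) _; have -> : (i == j)%:R + s * X i j + S - (i == j)%:R - s * X i j = S by ring.
  apply: le_trans (ler_norm_sum _ _ _) _.
  apply: le_trans (_ : \sum_(k < N - 2) s ^+ 2 * exp_coeff a (2 + k)%N <= _).
    apply: ler_sum => k _; rewrite exprZn scalerA mxE mulrAC normrM mulrC [`|s ^+ _|]ger0_norm ?exprn_ge0 //.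
    apply: ler_pM; rewrite ?exprn_ge0 //.
      by rewrite exprD ler_piMr ?exprn_ge0 // exprn_ile1.
    by have := coef_bound X i j (2 + k)%N; rewrite mxE.
  rewrite -mulr_sumr ler_wpM2l ?exprn_ge0 //.
  apply: le_trans (_ : series (exp_coeff a) N <= _).
    by rewrite /series /= -[N in leRHS](subnKC N2) big_mkord big_split_ord /= ler_wpDl // sumr_ge0.
  have -> : expR a = limn (series (exp_coeff a)) by [].
  apply: nondecreasing_cvgn_le; last exact: is_cvg_series_exp_coeff.
  by apply/nondecreasing_seqP => m; rewrite /series /= big_nat_recr //= lerDl.
have -> : expmx (s *: X) i j - (i == j)%:R - s * X i j =
  (series (coef (s *: X) i j) N - (i == j)%:R - s * X i j) + (expmx (s *: X) i j - series (coef (s *: X) i j) N) by ring.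
by apply: le_trans (ler_normD _ _) _; exact: lerD.
Unshelve. all: by end_near.
Qed.

End Exponential.

Section UnipotentAlgebra.
Variables (R : realType) (n : nat) (lam : 'I_n.+1 -> R).
Implicit Types X : 'M[R]_n.+1.

Definition patterned X := forall i j, ~~ expands lam i j -> X i j = 0.

Lemma patternedM X Y : patterned X -> patterned Y -> patterned (X *m Y).
Proof.
move=> Xp Yp i j ij; rewrite mxE big1 // => l _.
have [il|il] := boolP (expands lam i l); last by rewrite Xp ?mul0r.
have [lj|lj] := boolP (expands lam l j); last by rewrite Yp ?mulr0.
by rewrite (expands_trans il lj) in ij.
Qed.

Lemma patterned_exp X k : patterned X -> patterned (X ^+ k.+1).
Proof. by move=> Xp; elim: k => [|k IH]; rewrite ?expr1 // exprS; exact: patternedM. Qed.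

(** Off the pattern exp(s X) equals the identity, so s X_ij is a remainder of order s^2 for all
    small s and X_ij = 0. Conversely all positive powers of a patterned matrix are patterned. *)
Lemma lie_algebra_unip X : lie_algebra (unip lam) X <-> patterned X.
Proof.
split=> [lX i j ij|Xp s i j ij].
  apply: contrapT => /eqP x0; have x1 : 0 < `|X i j| by rewrite normr_gt0.
  set E := expR (n.+1%:R * mnorm X); have E0 : 0 < E by exact: expR_gt0.
  pose s := Num.min 1 (`|X i j| / (2 * E)).
  have s0 : 0 < s by rewrite lt_min ltr01 divr_gt0 // mulr_gt0.
  have s1 : 0 <= s <= 1 by rewrite (ltW s0) ge_min lexx.
  have := expmx_taylor X i j s1; rewrite (lX s i j ij) subrr sub0r normrN normrM (gtr0_norm s0) -/E expr2 -mulrA ler_pM2l //.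
  have : s * (2 * E) <= `|X i j| by rewrite -ler_pdivlMr ?mulr_gt0 // ge_min lexx orbT.
  by lra.
have -> // : expmx (s *: X) i j = (i == j)%:R.
have sXp : patterned (s *: X) by move=> i' j' h; rewrite mxE Xp ?mulr0.
apply: (cvg_unique (@Rhausdorff R) (@expmx_cvg R n (s *: X) i j)).
apply: cvg_near_cst; exists 1%N => // N /= N1.
rewrite /series /= -(subnKC N1) big_mkord big_split_ord /= big_ord_recl big_ord0 addr0 big1 ?addr0 => [|k _].
  by rewrite fact0 expr0 invr1 scale1r mxE.
by rewrite mxE [X in _ * X](@patterned_exp _ k sXp i j ij) mulr0.
Qed.

(** The elementary matrices of the pattern span a space with the property that [xget] looks for, and
    a subspace is determined by its elements. *)
Lemma lie_dim_unip : lie_dim (unip lam) = #|[pred p | expands lam p.1 p.2]|.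
Proof.
set A := [pred p | expands lam p.1 p.2].
pose b := [tuple of [seq delta_mx p.1 p.2 : 'M[R]_n.+1 | p <- enum_tuple A]].
have bE (k : 'I_#|A|) : b`_k = delta_mx (enum_val k).1 (enum_val k).2.
  by rewrite /= (nth_map (enum_val k)) -?cardE // -enum_val_nth.
have entry (c : 'I_#|A| -> R) (k : 'I_#|A|) : (\sum_k c k *: b`_k) (enum_val k).1 (enum_val k).2 = c k.
  rewrite summxE (bigD1 k) // big1 => [|k' k'k].
    by rewrite Monoid.mulm1 bE [(_ *: delta_mx _ _) _ _]mxE [delta_mx _ _ _ _]mxE !eqxx mulr1.
  rewrite bE [(_ *: delta_mx _ _) _ _]mxE [delta_mx _ _ _ _]mxE -xpair_eqE -!surjective_pairing.
  by rewrite (inj_eq enum_val_inj) eq_sym (negbTE k'k) mulr0.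
have bfree : free b.
  by apply/freeP => c c0 k; rewrite -(entry c k) c0 mxE.
have bspan X : X \in <<b>>%VS <-> patterned X.
  split=> [/coord_span -> i j ij|Xp].
    rewrite summxE big1 // => k _; rewrite bE [(_ *: delta_mx _ _) _ _]mxE [delta_mx _ _ _ _]mxE.
    have kA : expands lam (enum_val k).1 (enum_val k).2 := enum_valP k.
    case: eqP => [ik|_]; last by rewrite mulr0.
    case: eqP => [jk|_]; last by rewrite mulr0.
    by rewrite -ik -jk in kA; rewrite kA in ij.
  rewrite [X]matrix_sum_delta; apply: memv_suml => i _; apply: memv_suml => j _.
  have [ij|ij] := boolP (expands lam i j); last by rewrite Xp // scale0r mem0v.
  apply/memvZ/memv_span/mapP; exists (i, j) => //.
  by rewrite mem_enum.
rewrite /lie_dim; case: xgetP => [E _ EP|/(_ <<b>>%VS)[]]; last first.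
  by move=> X; rewrite bspan lie_algebra_unip.
have -> : E = <<b>>%VS by apply/vspaceP => X; apply/idP/idP; rewrite bspan EP lie_algebra_unip.
by move: bfree; rewrite /free => /eqP ->; rewrite size_tuple.
Qed.

End UnipotentAlgebra.

(** * Conclusion *)

Lemma image_Sing (R : realType) (d : nat) (w : 'I_d -> R) (w_gt0 : forall i, 0 < w i)
    (w_sum1 : \sum_(i < d) w i = 1) (w_noninc : forall i j : 'I_d, (i <= j)%N -> w j <= w i)
    (L : lattice_space R d.+1) :
  set_val @` Sing w_sum1 (horospherical w_sum1) L =
  [set h | unip (wlam w) h /\ escapes w (val (frame L)) h].
Proof.
apply/seteqP; split=> [_ [h [/horosphericalP hu /divergentP he] <-]|h [hu he]]; first by split.
have h1 := unip_det (wlam_mono w_gt0 w_noninc) hu.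
by exists (mkSL h1) => //; split; [exact/horosphericalP | exact/divergentP].
Qed.

Lemma image_horospherical (R : realType) (d : nat) (w : 'I_d -> R) (w_gt0 : forall i, 0 < w i)
    (w_sum1 : \sum_(i < d) w i = 1) (w_noninc : forall i j : 'I_d, (i <= j)%N -> w j <= w i) :
  set_val @` horospherical w_sum1 = unip (wlam w).
Proof.
apply/seteqP; split=> [_ [h /horosphericalP hu <-]|h hu] //.
have h1 := unip_det (wlam_mono w_gt0 w_noninc) hu.
by exists (mkSL h1) => //; exact/horosphericalP.
Qed.

Theorem corollary1p4 (R : realType) (d : nat) (hd : (1 < d)%N)
    (w : 'I_d -> R) (w_gt0 : forall i, 0 < w i)
    (w_sum1 : \sum_(i < d) w i = 1)
    (w_noninc : forall i j : 'I_d, (i <= j)%N -> w j <= w i)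
    (L : lattice_space R d.+1) :
  let H := horospherical w_sum1 in
  hausdorff_dim (set_val @` Sing w_sum1 H L) =
    ((lie_dim (set_val @` H))%:R - (1 + w (Ordinal (ltnW hd)))^-1)%:E.
Proof.
move=> H; rewrite /H image_Sing // image_horospherical // lie_dim_unip -/(npairs w).
have g1 : `|\det (val (frame L))| = 1 by rewrite det_SL normr1.
case: d hd w w_gt0 w_sum1 w_noninc L H g1 => [|e] // hd w w_gt0 w_sum1 w_noninc L H g1.
have -> : Ordinal (ltnW hd) = 0 by exact: val_inj.
set A := [set h | _ /\ _]; set q := _ - _.
apply/eqP; rewrite eq_le; apply/andP; split.
  apply/lee_addgt0Pr => r r0; rewrite -EFinD; apply: ereal_inf_lbound.
  (* [hausdorff_dim] tests nonnegative exponents only, so the candidate must be one; H has dimension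
     at least 1 and 1 / (1 + w_0) is at most 1. *)
  have q0 : 0 <= q.
    rewrite /q subr_ge0; apply: (@le_trans _ _ 1).
      by rewrite invf_le1 ?addr_gt0 // lerDl ltW.
    by rewrite (npairs_inner w_gt0) natrD -natr1 addrA lerDr addr_ge0.
  have qr0 : 0 <= q + r by rewrite addr_ge0 // ltW.
  exists (q + r) => //; split=> //; apply: thin_measure0.
  have qlt : (npairs w)%:R - (1 + w 0)^-1 < q + r by rewrite ltrDl.
  exact: (escaping_thin _ w_gt0 w_sum1 w_noninc (fun i => w_noninc 0 i (leq0n i)) qr0 qlt g1).
apply: le_ereal_inf_tmp => _ [s [s0 sA] <-]; rewrite lee_fin.
exact: (lower_bound _ w_gt0 w_sum1 w_noninc g1 s0 sA).
Qed.
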